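(* Let $\Gamma\subset\mathsf{PGL}(d,\mathbb{R})$ be a projective non-folding Anosov subgroup. Then $$\dim_H\big(\Lambda^1(\Gamma)\big)=\delta^{\alpha_1}(\Gamma),$$ where $\delta^{\alpha_1}(\Gamma)$ is the critical exponent (abscissa of convergence, $\inf\{s\ge0: \mathcal{Q}^{\alpha_1}_\Gamma(s)<\infty\}$) of the Poincaré series $$\mathcal{Q}^{\alpha_1}_\Gamma(s)=\sum_{\gamma\in\Gamma}\left(\frac{\sigma_2}{\sigma_1}(\gamma)\right)^{s}.$$
   Context: Fix the standard Euclidean inner product on $\mathbb{R}^d$ (and one on each auxiliary real vector space $V$). For $g\in\mathsf{PGL}(d,\mathbb{R})$ let $\sigma_1(g)\ge\dots\ge\sigma_d(g)$ be the singular values of a representative with $|\det|=1$, and write $\alpha_1(\kappa(g))=\log\frac{\sigma_1(g)}{\sigma_2(g)}$. On $\mathbb{RP}^{d-1}$ use the angular metric $d_\angle([v],[w])=\arccos\frac{|\langle v,w\rangle|}{\|v\|\|w\|}$; $B_{d_\angle}(p,r)$ is the ball of radius $r$, and $\dim_H$ is Hausdorff dimension for $d_\angle$. Projective Anosov subgroup: a finitely generated subgroup $\Gamma\subset\mathsf{PGL}(d,\mathbb{R})$ such that, for a word metric $d_{word}$ of a finite generating set, there are $a>1,A>0$ with $\frac1a d_{word}(\mathrm{id},\gamma)-A\le\log\frac{\sigma_1}{\sigma_2}(\gamma)\le a\,d_{word}(\mathrm{id},\gamma)+A$ for all $\gamma\in\Gamma$. Limit sets: for $g=u(g)a(g)v(g)$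 a singular value decomposition, $U_1(g)=u(g)[e_1]$ (defined when $\sigma_1(g)>\sigma_2(g)$) and $U_{d-1}(g)=u(g)\,\mathrm{Span}(e_1,\dots,e_{d-1})$ (defined when $\sigma_{d-1}(g)>\sigma_d(g)$). $\Lambda^1(\Gamma)\subset\mathbb{RP}^{d-1}$ is the set of accumulation points of $U_1(\gamma_n)$, and $\Lambda^{1,d-1}(\Gamma)$ is the set of accumulation points of the flags $(U_1(\gamma_n),U_{d-1}(\gamma_n))$, over sequences $(\gamma_n)$ in $\Gamma$ leaving every finite set. The same definitions are used for subgroups of $\mathsf{PGL}(V)$. Regular convex cocompact: let $V$ be a real vector space and $\Omega\subset\mathbb{P}(V)$ a proper convex domain (open, convex, bounded in some affine chart), with automorphism group $\mathrm{Aut}(\Omega)\subset\mathsf{PGL}(V)$. A point of $\partial\Omega$ is $C^1$ if $\Omega$ has a unique supporting hyperplane there, and extreme if it lies in no nontrivial open segment contained in $\partial\Omega$. A discrete subgroup $\Gamma_0\subset\mathrm{Aut}(\Omega)$ is regular convex cocompact with respect to $(V,\Omega,\mathcal{C})$ if $\mathcal{C}\subset\Omega$ is a non-empty closed (in $\Omega$) convex $\Gamma_0$-invariant subset, $\mathcal{C}/\Gamma_0$ is compact, and every point of $\overline{\mathcal{C}}\cap\partial\Omega$ is a $C^1$ extreme point of $\partial\Omega$. Let $d_\Omega$ be the Hilbert metric, $d_\Omega(x,y)=\frac12\log\frac{|y-a||b-x|}{|x-a||b-y|}$, with $a,b\in\partial\Omega$ the endpoints of the line through $x,y$ in the order $a,x,y,b$.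 For $b,z\in\Omega$, $R>0$, the shadow is $\hat{\mathcal{O}}_R(b,z)=\{x\in\Lambda^1(\Gamma_0): [b,x)\cap\overline{B}_{d_\Omega}(z,R)\ne\emptyset\}$, where $[b,x)$ is the straight half-open segment. Projective Anosov representation: a faithful representation $\rho:\Gamma_0\to\mathsf{PGL}(d,\mathbb{R})$ of a regular convex cocompact group such that $\rho(\Gamma_0)$ is projective Anosov and there is a $\rho$-equivariant homeomorphism $\xi:\Lambda^{1,\dim V-1}(\Gamma_0)\to\Lambda^{1,d-1}(\rho(\Gamma_0))$ (the limit map), with induced map $\xi^1:\Lambda^1(\Gamma_0)\to\Lambda^1(\rho(\Gamma_0))$. Non-folding property: fix $b_0\in\mathcal{C}$. The representation $\rho$ has the non-folding property if for all $R>0$, $r\ge0$ there is $C>1$ such that for all $x\in\Lambda^1(\Gamma_0)$, $z\in\mathcal{C}$ with $z\in[b_0,x)$, and $\gamma\in\Gamma_0$ with $d_\Omega(z,\gamma b_0)\le r$, $$B_{d_\angle}\!\left(\xi^1(x),\tfrac1C e^{-\alpha_1(\kappa(\rho(\gamma)))}\right)\cap\xi^1(\Lambda^1(\Gamma_0))\subset\xi^1(\hat{\mathcal{O}}_R(b_0,z))\subset B_{d_\angle}\!\left(\xi^1(x),C e^{-\alpha_1(\kappa(\rho(\gamma)))}\right).$$ A subgroup $\Gamma\subset\mathsf{PGL}(d,\mathbb{R})$ is a projective non-folding Anosov subgroup if $\Gamma=\rho(\Gamma_0)$ for some regular convex cocompact $\Gamma_0$ and some projective Anosov representation $\rho$ of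 $\Gamma_0$ with the non-folding property. *)

(* Defs.v *)
From HB Require Import structures.
From mathcomp Require Import all_boot all_order all_algebra.
From mathcomp Require Import all_classical all_reals all_analysis.
From mathcomp Require Import ring lra zify.

Set Implicit Arguments.
Unset Strict Implicit.
Unset Printing Implicit Defensive.

Import Order.TTheory GRing.Theory Num.Theory.

Local Open Scope classical_set_scope.
Local Open Scope ring_scope.

HB.mixin Record Vector_isEuclidean (R : realType) V & Vector R V := {
  dotp_subdef : {dot V for @idfun R}
}.

#[short(type="euclidType")]
HB.structure Definition Euclidean (R : realType) :=
  { V of Vector R V & Vector_isEuclidean R V }.

Definition dotp {R : realType} {V : euclidType R} : {dot V for @idfun R} :=
  @dotp_subdef R V.

Section StandardInnerProduct.
Variables (R : realType) (d : nat).
Implicit Types u v : 'cV[R]_d.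

Definition cvdot u v : R := \sum_i u i 0 * v i 0.

Fact cvdot_bilinear : bilinear_for *%R (idfun \; *%R) cvdot.
Proof.
split=> [w a u v|w a u v]; rewrite /cvdot /= mulr_sumr -big_split /=.
  by apply: eq_bigr => i _; rewrite !mxE mulrDl mulrA.
by apply: eq_bigr => i _; rewrite !mxE mulrDr mulrCA.
Qed.

HB.instance Definition _ := @bilinear_isBilinear.Build R 'cV[R]_d 'cV[R]_d R
  *%R (idfun \; *%R) cvdot cvdot_bilinear.

Fact cvdotC u v : cvdot u v = (-1) ^+ false * idfun (cvdot v u).
Proof. by rewrite mul1r; apply: eq_bigr => i _; rewrite mulrC. Qed.

HB.instance Definition _ :=
  @isHermitianSesquilinear.Build R 'cV[R]_d false idfun cvdot cvdotC.

Fact cvdot_gt0 u : u != 0 -> 0 < cvdot u u.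
Proof.
move=> u0; have [i ui] : exists i, u i 0 != 0.
  apply/existsP; apply: contraNT u0; rewrite negb_exists => /forallP u0.
  by apply/eqP/colP => i; rewrite mxE; apply/eqP; have := u0 i; rewrite negbK.
rewrite /cvdot (bigD1 i)//= ltr_pwDl//.
  by rewrite lt_def mulf_neq0//= -expr2 sqr_ge0.
by apply: sumr_ge0 => j _; rewrite -expr2 sqr_ge0.
Qed.

HB.instance Definition _ := isDotProduct.Build R 'cV[R]_d cvdot cvdot_gt0.

HB.instance Definition _ := Vector_isEuclidean.Build R 'cV[R]_d cvdot.

End StandardInnerProduct.

Definition enorm (R : realType) (V : euclidType R) (v : V) : R :=
  Num.sqrt (dotp v v).

Section EuclideanTheory.
Context {R : realType} {V : euclidType R}.
Implicit Types u v w : V.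

Lemma dotpC u v : dotp u v = dotp v u.
Proof. by rewrite [LHS]hermC mul1r. Qed.

Lemma dotp0r u : dotp u 0 = 0.
Proof. exact: linear0r. Qed.

Lemma dotp_ge0 u : 0 <= dotp u u.
Proof.
have [->|/neq0_dnorm_gt0 /ltW//] := eqVneq u 0.
by rewrite dotp0r.
Qed.

Lemma dotp_eq0 u : (dotp u u == 0) = (u == 0).
Proof.
have [->|u0] := eqVneq u 0; first by rewrite dotp0r eqxx.
by rewrite gt_eqF// neq0_dnorm_gt0.
Qed.

Lemma enorm_gt0 u : (0 < enorm u) = (u != 0).
Proof. by rewrite sqrtr_gt0 lt_def dotp_eq0 dotp_ge0 andbT. Qed.

Lemma sqr_enorm u : enorm u ^+ 2 = dotp u u.
Proof. by rewrite sqr_sqrtr// dotp_ge0. Qed.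

Lemma dotpZl a u v : dotp (a *: u) v = a * dotp u v.
Proof. by rewrite linearZl_LR. Qed.

Lemma dotpZr a u v : dotp u (a *: v) = a * dotp u v.
Proof. by rewrite dotpC dotpZl dotpC. Qed.

Lemma dotpBl u v w : dotp (u - v) w = dotp u w - dotp v w.
Proof. by rewrite linearBl. Qed.

Lemma dotpBr u v w : dotp u (v - w) = dotp u v - dotp u w.
Proof. by rewrite dotpC dotpBl ![dotp _ u]dotpC. Qed.

Lemma dotp_CS u v : dotp u v ^+ 2 <= dotp u u * dotp v v.
Proof.
have [->|v0] := eqVneq v 0; first by rewrite !dotp0r mulr0 expr0n.
have vv : 0 < dotp v v by rewrite neq0_dnorm_gt0.
have := dotp_ge0 (dotp v v *: u - dotp u v *: v).
rewrite dotpBl !dotpBr !dotpZl !dotpZr [dotp v u]dotpC.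
set a := dotp u u; set b := dotp u v; set c := dotp v v => H.
have : 0 <= c * (a * c - b ^+ 2).
  by apply: le_trans H _; rewrite le_eqVlt; apply/orP; left; apply/eqP; ring.
by rewrite pmulr_rge0// subr_ge0.
Qed.

Lemma dotp_unit_eq u v : dotp u u = 1 -> dotp v v = 1 -> dotp u v ^+ 2 = 1 ->
  u = dotp u v *: v.
Proof.
move=> u1 v1 uv; apply/eqP; rewrite -subr_eq0 -dotp_eq0.
rewrite dotpBl !dotpBr !dotpZl !dotpZr u1 v1 [dotp v u]dotpC.
by move: uv; set k := dotp u v => uv; apply/eqP; ring: uv.
Qed.

Lemma dotp_unit_gram u v w :
    dotp u u = 1 -> dotp v v = 1 -> dotp w w = 1 ->
  (dotp u w - dotp u v * dotp v w) ^+ 2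
  <= (1 - dotp u v ^+ 2) * (1 - dotp v w ^+ 2).
Proof.
move=> u1 v1 w1.
have := dotp_CS (u - dotp u v *: v) (w - dotp v w *: v).
rewrite !(dotpBl, dotpBr, dotpZl, dotpZr) u1 v1 w1.
rewrite [dotp v u]dotpC [dotp w v]dotpC.
set a := dotp u v; set b := dotp v w; set c := dotp u w => H.
by move: H; congr (_ <= _); ring.
Qed.

End EuclideanTheory.

Section Projective.
Context {R : realType}.
Variable V : euclidType R.

Record pspace := PSpace { pline :> {vspace V}; _ : \dim pline == 1%N }.
HB.instance Definition _ := [isSub for pline].
HB.instance Definition _ := [Choice of pspace by <:].

Definition pvec (p : pspace) : V := vpick p.

Record hyperplane := Hyperplane { hspace :> {vspace V};
                        _ : (\dim hspace).+1 == \dim {:V} }.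
HB.instance Definition _ := [isSub for hspace].
HB.instance Definition _ := [Choice of hyperplane by <:].

Definition flag : Type := (pspace * hyperplane)%type.

Definition cosangle (p q : pspace) : R :=
  `|dotp (pvec p) (pvec q)| / (enorm (pvec p) * enorm (pvec q)).

Definition angle (p q : pspace) : R := acos (cosangle p q).

Lemma dim_proj (p : pspace) : \dim p = 1%N.
Proof. exact/eqP/(valP p). Qed.

Lemma pvec_neq0 (p : pspace) : pvec p != 0.
Proof. by rewrite vpick0 -dimv_eq0 dim_proj. Qed.

Lemma proj_pvec (p : pspace) : p = <[pvec p]>%VS :> {vspace V}.
Proof.
apply/esym/eqP; rewrite eqEdim -memvE memv_pick /=.
by rewrite dim_vline pvec_neq0 dim_proj.
Qed.

Let uvec (p : pspace) : V := (enorm (pvec p))^-1 *: pvec p.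

Let uvec1 p : dotp (uvec p) (uvec p) = 1.
Proof.
have /lt0r_neq0 p0 : 0 < enorm (pvec p) by rewrite enorm_gt0 pvec_neq0.
by rewrite /uvec dotpZl dotpZr -sqr_enorm; field.
Qed.

Let cosangleE p q : cosangle p q = `|dotp (uvec p) (uvec q)|.
Proof.
have nn u : `|(enorm u)^-1| = (enorm u)^-1 :> R.
  by rewrite ger0_norm// invr_ge0 sqrtr_ge0.
rewrite /cosangle /uvec dotpZl dotpZr !normrM !nn invfM.
by rewrite mulrC -mulrA.
Qed.

Let cosangle_01 p q : 0 <= cosangle p q <= 1.
Proof.
rewrite cosangleE normr_ge0 /= -(@expr_le1 _ 2)// real_normK ?num_real//.
by have := dotp_CS (uvec p) (uvec q); rewrite !uvec1 mulr1.
Qed.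

Let cosangle_N11 p q : -1 <= cosangle p q <= 1.
Proof.
have /andP[c0 ->] := cosangle_01 p q.
by rewrite andbT (le_trans _ c0)// lerN10.
Qed.

Let cos_angle p q : cos (angle p q) = cosangle p q.
Proof. by rewrite acosK// in_itv /=. Qed.

Fact anglexx p : angle p p = 0.
Proof. by rewrite /angle cosangleE uvec1 normr1 acos1. Qed.

Fact angle_sym p q : angle p q = angle q p.
Proof. by rewrite /angle /cosangle dotpC [enorm _ * _]mulrC. Qed.

Fact angle_positivity p q : angle p q = 0 -> p = q.
Proof.
move=> /(congr1 cos); rewrite cos_angle cos0 cosangleE => c1.
have {}c1 : dotp (uvec p) (uvec q) ^+ 2 = 1.
  by rewrite -real_normK ?num_real// c1 expr1n.
have pq := dotp_unit_eq (uvec1 p) (uvec1 q) c1.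
have sub : (p <= q)%VS.
  have /lt0r_neq0 p0 : 0 < enorm (pvec p) by rewrite enorm_gt0 pvec_neq0.
  rewrite (proj_pvec p) -memvE.
  have -> : pvec p = enorm (pvec p) *: uvec p by rewrite scalerA divff// scale1r.
  by rewrite pq /uvec !memvZ// memv_pick.
by apply/val_inj/eqP; rewrite /= eqEdim sub /= !dim_proj.
Qed.

Let angle_0pihalf p q : 0 <= angle p q <= pi / 2.
Proof.
have /andP[c0 c1] := cosangle_01 p q.
have a0 : 0 <= angle p q by apply: acos_ge0.
have api : angle p q <= pi by apply: acos_lepi.
rewrite a0 /= leNgt; apply/negP => lt; move: c0; rewrite -cos_angle.
apply/negP; rewrite -ltNge -cos_pihalf ltr_cos// in_itv /= ?a0//.
by rewrite divr_ge0 ?pi_ge0//= ler_pdivrMr// ler_peMr ?pi_ge0// ler1n.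
Qed.

Fact angle_triangle q p r : angle p r <= angle p q + angle q r.
Proof.
have /andP[a0 a2] := angle_0pihalf p q; have /andP[b0 b2] := angle_0pihalf q r.
have /andP[c0 c2] := angle_0pihalf p r.
have pi0 : 0 <= pi :> R := pi_ge0 R.
have ab0 : 0 <= angle p q + angle q r by rewrite addr_ge0.
have abpi : angle p q + angle q r <= pi.
  by rewrite [leRHS]splitr lerD.
have cpi : angle p r <= pi.
  by rewrite (le_trans c2)// [leRHS]splitr lerDl divr_ge0.
have ci : angle p r \in `[0, pi] by rewrite in_itv /= c0.
have abi : angle p q + angle q r \in `[0, pi] by rewrite in_itv /= ab0.
rewrite leNgt -(ltr_cos abi ci) -leNgt.
rewrite cosD !cos_angle !sin_acos//.
have /andP[x0 x1] := cosangle_01 p q; have /andP[y0 y1] := cosangle_01 q r.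
rewrite -sqrtrM; last by rewrite subr_ge0 expr_le1.
have CS := dotp_unit_gram (uvec1 p) (uvec1 q) (uvec1 r).
rewrite !cosangleE !real_normK ?num_real// -normrM -subr_ge0.
have /le_trans : `|dotp (uvec p) (uvec q) * dotp (uvec q) (uvec r)| -
    `|dotp (uvec p) (uvec r)| <= Num.sqrt ((1 - dotp (uvec p) (uvec q) ^+ 2)
      * (1 - dotp (uvec q) (uvec r) ^+ 2)).
  apply: (le_trans (lerB_dist _ _)).
  by rewrite distrC -sqrtr_sqr ler_wsqrtr.
move=> /(_ _ (lexx _)); rewrite -subr_ge0; congr (_ <= _); ring.
Qed.

HB.instance Definition _ := isMetric.Build R pspace
  anglexx angle_positivity angle_sym angle_triangle.

Fact dim_orthov_hyper (H : hyperplane) : \dim (orthov dotp H) == 1%N.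
Proof.
have dimH : (\dim H).+1 = \dim {:V} by apply/eqP/(valP H).
rewrite eqn_leq; apply/andP; split.
  have HH0 : (H :&: orthov dotp H = 0)%VS.
    apply/eqP; rewrite -subv0; apply/subvP => v /memv_capP[vH /mem_orthovP vo].
    by rewrite memv0 -dotp_eq0 vo.
  have := dimvS (subvf (H + orthov dotp H)).
  by rewrite dimv_disjoint_sum// -dimH -addn1 leq_add2l.
have codim (s : seq V) : (\dim {:V} <= \dim (orthov dotp (span s)) + size s)%N.
  elim: s => [|x s IH].
    by rewrite span_nil orthov0 leq_addr.
  have -> : orthov dotp (span (x :: s)) =
      (orthov dotp (span s) :&: orthov dotp <[x]>)%VS.
    apply/eqP; rewrite eqEsubv subv_cap; apply/andP; split.
      by rewrite andbC -orthovD -span_cons.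
    by rewrite span_cons orthovD capvSr capvSl.
  apply: leq_trans IH _; rewrite /= addnS -addSn leq_add2r.
  by have := leq_dim_orthov1 dotp x (orthov dotp (span s)); lia.
have := codim (vbasis H); rewrite (span_basis (vbasisP H)) size_tuple -dimH.
by rewrite -addn1 addnC leq_add2r.
Qed.

(* Hyperplanes are topologized through their orthogonal lines. *)
Definition hnormal (H : hyperplane) : pspace := PSpace (dim_orthov_hyper H).
HB.instance Definition _ := Topological.copy hyperplane (initial_topology hnormal).

End Projective.

Section PGL.
Context {R : realType}.
Variable V : euclidType R.
Implicit Types g h : 'End(V).

Definition is_pgl (L : {vspace 'End(V)}) : bool :=
  (lker (vpick L) == 0%VS) && (L == <[vpick L]>%VS).

(* An element of PGL(V) is the line spanned in End(V) by an invertible map. *)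
Record PGL := MkPGL { pgl_line :> {vspace 'End(V)}; _ : is_pgl pgl_line }.
HB.instance Definition _ := [isSub for pgl_line].
HB.instance Definition _ := [Choice of PGL by <:].

Definition rep (x : PGL) : 'End(V) := vpick x.

Lemma lker_rep (x : PGL) : lker (rep x) = 0%VS.
Proof. by have /andP[/eqP] := valP x. Qed.

Lemma pgl_rep (x : PGL) : <[rep x]>%VS = x.
Proof. by have /andP[_ /eqP <-] := valP x. Qed.

Let vlineZ (k : R) g : k != 0 -> <[k *: g]>%VS = <[g]>%VS.
Proof.
move=> k0; apply/eqP; rewrite eqEsubv -!memvE memvZ ?memv_line//=.
by rewrite -[X in X \in _](scalerK k0) memvZ// memv_line.
Qed.

Let vpick_line g : exists2 k : R, k != 0 & vpick <[g]>%VS = k *: g.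
Proof.
have [->|g0] := eqVneq g 0.
  exists 1; rewrite ?oner_eq0// scaler0.
  by apply/eqP; rewrite vpick0 -subv0 -memvE memv0.
have [k kE] := vlineP _ _ (memv_pick <[g]>%VS).
exists k => //; apply: contraNneq g0 => k0.
have /eqP : vpick <[g]>%VS = 0 by rewrite kE k0 scale0r.
by rewrite vpick0 => /eqP g0; rewrite -memv0 -g0 memv_line.
Qed.

Fact is_pgl_line g : lker g = 0%VS -> is_pgl <[g]>%VS.
Proof.
move=> g0; have [k k0 kE] := vpick_line g.
rewrite /is_pgl kE vlineZ// eqxx andbT -subv0; apply/subvP => v.
by rewrite memv_ker scale_lfunE scaler_eq0 (negbTE k0) /= -memv_ker g0.
Qed.

Definition pgl_class g (g0 : lker g = 0%VS) : PGL := MkPGL (is_pgl_line g0).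

Let rep_class g (g0 : lker g = 0%VS) :
  exists2 k : R, k != 0 & rep (pgl_class g0) = k *: g.
Proof. exact: vpick_line. Qed.

Fact lker_comp0 g h : lker g = 0%VS -> lker h = 0%VS -> lker (g \o h)%VF = 0%VS.
Proof.
move=> g0 h0; apply/eqP; rewrite -subv0; apply/subvP => v.
by rewrite memv_ker comp_lfunE -memv_ker g0 memv0 -memv_ker h0.
Qed.

Fact lker_id0 : lker (\1%VF : 'End(V)) = 0%VS.
Proof.
by apply/eqP; rewrite -subv0; apply/subvP => v; rewrite memv_ker id_lfunE memv0.
Qed.

Let limg_full g : lker g = 0%VS -> limg g = fullv.
Proof.
move=> g0; apply/eqP; rewrite eqEdim subvf /=.
by rewrite limg_dim_eq// g0 capv0.
Qed.

Let inv_rightK g : lker g = 0%VS -> (g \o g^-1)%VF = \1%VF.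
Proof.
move=> g0; apply/lfunP => v; rewrite comp_lfunE id_lfunE.
by rewrite limg_lfunVK// limg_full// memvf.
Qed.

Fact lker_inv0 g : lker g = 0%VS -> lker (g^-1)%VF = 0%VS.
Proof.
move=> g0; apply/eqP; rewrite -subv0; apply/subvP => v.
rewrite memv_ker memv0 => /eqP v0.
have := congr1 (fun f : 'End(V) => f v) (inv_rightK g0).
by rewrite comp_lfunE v0 linear0 id_lfunE => <-.
Qed.

Definition pgl_one : PGL := pgl_class lker_id0.
Definition pgl_mul (x y : PGL) : PGL :=
  pgl_class (lker_comp0 (lker_rep x) (lker_rep y)).
Definition pgl_inv (x : PGL) : PGL := pgl_class (lker_inv0 (lker_rep x)).

Let pgl_eq (x y : PGL) (k : R) g h : k != 0 -> k *: g = h ->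
  <[g]>%VS = x -> <[h]>%VS = y -> x = y.
Proof. by move=> k0 <- gx; rewrite vlineZ// gx => /val_inj. Qed.

Fact pgl_mulA : associative pgl_mul.
Proof.
move=> x y z; apply: val_inj => /=.
have [k k0 ->] := rep_class (lker_comp0 (lker_rep y) (lker_rep z)).
have [l l0 ->] := rep_class (lker_comp0 (lker_rep x) (lker_rep y)).
by rewrite -comp_lfunZl -comp_lfunZr !vlineZ// comp_lfunA.
Qed.

Fact pgl_mul1 : left_id pgl_one pgl_mul.
Proof.
move=> x; apply: val_inj => /=; have [k k0 ->] := rep_class lker_id0.
by rewrite -comp_lfunZl vlineZ// comp_lfun1l pgl_rep.
Qed.

Fact pgl_mul1r : right_id pgl_one pgl_mul.
Proof.
move=> x; apply: val_inj => /=; have [k k0 ->] := rep_class lker_id0.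
by rewrite -comp_lfunZr vlineZ// comp_lfun1r pgl_rep.
Qed.

Fact pgl_mulV : left_inverse pgl_one pgl_inv pgl_mul.
Proof.
move=> x; apply: val_inj => /=.
have [k k0 ->] := rep_class (lker_inv0 (lker_rep x)).
by rewrite -comp_lfunZl vlineZ// lker0_compVf// lker_rep.
Qed.

Fact pgl_mulrV : right_inverse pgl_one pgl_inv pgl_mul.
Proof.
move=> x; apply: val_inj => /=.
have [k k0 ->] := rep_class (lker_inv0 (lker_rep x)).
by rewrite -comp_lfunZr vlineZ// inv_rightK// lker_rep.
Qed.

HB.instance Definition _ :=
  isGroup.Build PGL pgl_mulA pgl_mul1 pgl_mul1r pgl_mulV pgl_mulrV.

(* The quotient topology of GL(V), which carries the operator norm topology. *)
Definition pgl_open (U : set PGL) : Prop :=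
  forall (x : PGL) (g : 'End(V)), U x -> <[g]>%VS = x ->
  exists2 e : R, 0 < e & forall (y : PGL) (h : 'End(V)), <[h]>%VS = y ->
    (forall v : V, enorm (h v - g v) <= e * enorm v) -> U y.

Fact pgl_openT : pgl_open setT.
Proof. by move=> x g _ _; exists 1. Qed.

Fact pgl_openI : setI_closed pgl_open.
Proof.
move=> A B Ao Bo x g [Ax Bx] gx.
have [e e0 eA] := Ao x g Ax gx; have [f f0 fB] := Bo x g Bx gx.
exists (Num.min e f) => [|y h hy hg]; first by rewrite lt_min e0.
split; [apply: (eA y h hy)|apply: (fB y h hy)] => v; apply: (le_trans (hg v));
  by rewrite ler_wpM2r ?sqrtr_ge0// ge_min lexx ?orbT.
Qed.

Fact pgl_open_bigU (I : Type) (f : I -> set PGL) :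
  (forall i, pgl_open (f i)) -> pgl_open (\bigcup_i f i).
Proof.
move=> fo x g [i _ fx] gx; have [e e0 ef] := fo i x g fx gx.
by exists e => // y h hy hg; exists i => //; exact: ef hg.
Qed.

HB.instance Definition _ :=
  isOpenTopological.Build PGL pgl_openT pgl_openI pgl_open_bigU.

Fact dim_act (x : PGL) (U : {vspace V}) : \dim (rep x @: U) = \dim U.
Proof. by rewrite limg_dim_eq// lker_rep capv0. Qed.

Fact act_point_subproof (x : PGL) (p : pspace V) : \dim (rep x @: p) == 1%N.
Proof. by rewrite dim_act; exact: valP p. Qed.

Definition act_point (x : PGL) (p : pspace V) : pspace V := PSpace (act_point_subproof x p).

Fact act_hyper_subproof (x : PGL) (H : hyperplane V) :
  (\dim (rep x @: H)).+1 == \dim {:V}.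
Proof. by rewrite dim_act; exact: valP H. Qed.

Definition act_hyper (x : PGL) (H : hyperplane V) : hyperplane V :=
  Hyperplane (act_hyper_subproof x H).

Definition act_flag (x : PGL) (F : flag V) : flag V :=
  (act_point x F.1, act_hyper x F.2).

End PGL.

Section LimitSets.
Context {R : realType} {V : euclidType R}.
Local Notation n := (\dim {:V}).

Definition orthonormal_basis (u : seq V) : bool :=
  basis_of fullv u && orthonormal dotp u.

Definition is_svd (g : 'End(V)) (u : seq V) (a : seq R) (v : seq V) : Prop :=
  [/\ orthonormal_basis u, orthonormal_basis v, size a = n,
      sorted >=%R a /\ all (fun s => 0 <= s) a &
      forall i, (i < n)%N -> g v`_i = a`_i *: u`_i].

Definition lfun_det (g : 'End(V)) : R :=
  \det (passmx.mxof (vbasis {:V}) (vbasis {:V}) g).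

Definition pgl_svd (x : PGL V) (u : seq V) (a : seq R) (v : seq V) : Prop :=
  exists g : 'End(V),
    [/\ <[g]>%VS = x, `|lfun_det g| = 1 & is_svd g u a v].

(* Singular values are numbered from 1, list entries from 0. *)
Definition sigma (k : nat) (x : PGL V) : R :=
  (xget [::] [set a | exists u v, pgl_svd x u a v])`_k.-1.

Definition alpha1 (x : PGL V) : R := ln (sigma 1 x / sigma 2 x).

Definition is_U1 (x : PGL V) (p : pspace V) : Prop :=
  exists u a v, [/\ pgl_svd x u a v, a`_1 < a`_0 &
                    p = <[u`_0]>%VS :> {vspace V}].

Definition is_U1flag (x : PGL V) (F : flag V) : Prop :=
  exists u a v, [/\ pgl_svd x u a v, a`_1 < a`_0, a`_n.-1 < a`_n.-2,
      F.1 = <[u`_0]>%VS :> {vspace V} &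
      F.2 = <<take n.-1 u>>%VS :> {vspace V}].

Definition escapes (T : Type) (x : nat -> T) : Prop :=
  forall A : set T, finite_set A -> \forall k \near \oo, ~ A (x k).

Definition limit_set (Gamma : set (PGL V)) : set (pspace V) :=
  [set p | exists (x : nat -> PGL V) (q : nat -> pspace V),
    [/\ forall k, Gamma (x k), escapes x, forall k, is_U1 (x k) (q k) &
        cluster (q @ \oo) p]].

Definition flag_limit_set (Gamma : set (PGL V)) : set (flag V) :=
  [set F | exists (x : nat -> PGL V) (G : nat -> flag V),
    [/\ forall k, Gamma (x k), escapes x, forall k, is_U1flag (x k) (G k) &
        cluster (G @ \oo) F]].

End LimitSets.

Section WordLength.
Variable G : groupType.
Implicit Types (S : seq G) (Gamma : set G).

Definition subgroup Gamma : Prop :=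
  [/\ Gamma 1%g, forall x y, Gamma x -> Gamma y -> Gamma (x * y)%g &
      forall x, Gamma x -> Gamma x^-1%g].

Definition is_word S (k : nat) (x : G) : Prop :=
  exists w : seq G, [/\ size w = k,
    {subset w <= S ++ [seq s^-1%g | s <- S]} & x = (\prod_(s <- w) s)%g].

Definition word_length S (x : G) (k : nat) : Prop :=
  is_word S k x /\ forall l, is_word S l x -> (k <= l)%N.

Definition generates S Gamma : Prop :=
  (forall s, s \in S -> Gamma s) /\
  (forall x, Gamma x -> exists k, is_word S k x).

End WordLength.

Definition projective_anosov (R : realType) (V : euclidType R)
    (Gamma : set (PGL V)) : Prop :=
  subgroup Gamma /\
  exists S : seq (PGL V), generates S Gamma /\
  exists a A : R, [/\ 1 < a, 0 < A & forall x k, Gamma x -> word_length S x k ->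
    a^-1 * k%:R - A <= alpha1 x <= a * k%:R + A].

Section Convex.
Context {R : realType} {V : euclidType R}.
Implicit Types (f : {scalar V}) (Omega C : set (pspace V)) (Gamma : set (PGL V)).

(* The choice of a chart containing the closure of a proper convex domain does *)
(* not change segments between points of that closure.                         *)
Definition chart f : set (pspace V) := [set p | f (pvec p) != 0].

(* The representative of p in the affine hyperplane f = 1. *)
Definition aff f (p : pspace V) : V := (f (pvec p))^-1 *: pvec p.

(* Points (1 - t) x + t y for t in i, where x and y lie in the chart. *)
Definition segment f (i : interval R) (x y : pspace V) : set (pspace V) :=
  [set p | chart f p /\
    exists2 t, t \in i & aff f p = (1 - t) *: aff f x + t *: aff f y].

Definition pconvex f Omega : Prop :=
  forall x y, Omega x -> Omega y -> segment f `[0, 1] x y `<=` Omega.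

Definition proper_convex_domain f Omega : Prop :=
  [/\ open Omega, Omega !=set0, Omega `<=` chart f, pconvex f Omega &
      exists M : R, forall p, Omega p -> enorm (aff f p) <= M].

Definition frontier Omega : set (pspace V) := closure Omega `\` interior Omega.

Definition supporting Omega (p : pspace V) (H : hyperplane V) : Prop :=
  (p <= H)%VS /\ forall q, Omega q -> ~~ (q <= H)%VS.

Definition C1_point Omega (p : pspace V) : Prop :=
  exists! H : hyperplane V, supporting Omega p H.

Definition extreme_point f Omega (p : pspace V) : Prop :=
  forall x y, chart f x -> chart f y -> x <> y ->
    segment f `]0, 1[ x y `<=` frontier Omega -> ~ segment f `]0, 1[ x y p.

Definition automorphism Omega (g : PGL V) : Prop := act_point g @` Omega = Omega.

Definition invariant_set Gamma C : Prop :=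
  forall g, Gamma g -> act_point g @` C = C.

Definition discrete_subgroup Gamma : Prop :=
  subgroup Gamma /\ forall g, Gamma g -> isolated Gamma g.

Definition open_in C (W : set (pspace V)) : Prop :=
  exists2 U, open U & W = C `&` U.

(* Open sets of C / Gamma are the Gamma-invariant relatively open sets of C. *)
Definition compact_quotient Gamma C : Prop :=
  forall F : set (set (pspace V)),
    (forall W, F W -> open_in C W /\ invariant_set Gamma W) ->
    C `<=` \bigcup_(W in F) W ->
    exists F' : set (set (pspace V)),
      [/\ F' `<=` F, finite_set F' & C `<=` \bigcup_(W in F') W].

Definition regular_convex_cocompact f Omega C Gamma : Prop :=
  [/\ proper_convex_domain f Omega,
      discrete_subgroup Gamma /\ (forall g, Gamma g -> automorphism Omega g),
      [/\ C `<=` Omega, C !=set0, closure C `&` Omega `<=` C, pconvex f C &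
          invariant_set Gamma C],
      compact_quotient Gamma C &
      forall p, closure C p -> frontier Omega p ->
        C1_point Omega p /\ extreme_point f Omega p].

(* The points (a, b) of the frontier such that a, x, y, b lie in this order on *)
(* the line through x and y.                                                   *)
Definition line_ends f Omega (x y : pspace V) : set (pspace V * pspace V) :=
  [set ab | [/\ frontier Omega ab.1, frontier Omega ab.2,
    exists2 s : R, s < 0 & aff f ab.1 = (1 - s) *: aff f x + s *: aff f y &
    exists2 t : R, 1 < t & aff f ab.2 = (1 - t) *: aff f x + t *: aff f y]].

Definition hilbert f Omega (x y : pspace V) : R :=
  if x == y then 0 else
  let ab := xget (x, y) (line_ends f Omega x y) in
  let dist p q := enorm (aff f p - aff f q) in
  2^-1 * ln ((dist y ab.1 * dist ab.2 x) / (dist x ab.1 * dist ab.2 y)).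

Definition shadow f Omega Gamma (r : R) (b z : pspace V) : set (pspace V) :=
  [set x | limit_set Gamma x /\
    exists y, [/\ segment f `[0, 1[ b x y, Omega y & hilbert f Omega z y <= r]].

End Convex.

Section Representations.
Context {R : realType} {V W : euclidType R}.
Implicit Type rho : PGL V -> PGL W.

Definition faithful_rep (Gamma0 : set (PGL V)) rho : Prop :=
  (forall x y, Gamma0 x -> Gamma0 y -> rho (x * y)%g = (rho x * rho y)%g) /\
  (forall x y, Gamma0 x -> Gamma0 y -> rho x = rho y -> x = y).

Definition limit_map (Gamma0 : set (PGL V)) rho (xi : flag V -> flag W) : Prop :=
  let L0 := flag_limit_set Gamma0 in
  let L := flag_limit_set (rho @` Gamma0) in
  [/\ set_bij L0 L xi,
      {within L0, continuous xi},
      exists2 eta : flag W -> flag V,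
        {within L, continuous eta} & forall F, L0 F -> eta (xi F) = F &
      forall g F, Gamma0 g -> L0 F ->
        xi (act_flag g F) = act_flag (rho g) (xi F)].

(* On limit_set Gamma0 this determines xi1, as every point of limit_set Gamma0 *)
(* is the first component of a flag in flag_limit_set Gamma0.                  *)
Definition induced_map (Gamma0 : set (PGL V)) (xi : flag V -> flag W)
    (xi1 : pspace V -> pspace W) : Prop :=
  forall F, flag_limit_set Gamma0 F -> xi1 F.1 = (xi F).1.

Definition anosov_rep (Gamma0 : set (PGL V)) rho
    (xi : flag V -> flag W) (xi1 : pspace V -> pspace W) : Prop :=
  [/\ faithful_rep Gamma0 rho, projective_anosov (rho @` Gamma0),
      limit_map Gamma0 rho xi & induced_map Gamma0 xi xi1].

Definition non_folding (f : {scalar V}) (Omega C : set (pspace V))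
    (Gamma0 : set (PGL V)) rho (xi1 : pspace V -> pspace W) (b0 : pspace V) : Prop :=
  forall r0 r : R, 0 < r0 -> 0 <= r -> exists2 K : R, 1 < K &
  forall (x z : pspace V) (g : PGL V),
    limit_set Gamma0 x -> C z -> segment f `[0, 1[ b0 x z ->
    Gamma0 g -> hilbert f Omega z (act_point g b0) <= r ->
    ball (xi1 x) (K^-1 * expR (- alpha1 (rho g))) `&` xi1 @` limit_set Gamma0
      `<=` xi1 @` shadow f Omega Gamma0 r0 b0 z /\
    xi1 @` shadow f Omega Gamma0 r0 b0 z
      `<=` ball (xi1 x) (K * expR (- alpha1 (rho g))).

End Representations.

Definition non_folding_anosov (R : realType) (W : euclidType R)
    (Gamma : set (PGL W)) : Prop :=
  exists (V : euclidType R) (f : {scalar V}) (Omega C : set (pspace V))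
         (Gamma0 : set (PGL V)) (b0 : pspace V) (rho : PGL V -> PGL W)
         (xi : flag V -> flag W) (xi1 : pspace V -> pspace W),
    [/\ regular_convex_cocompact f Omega C Gamma0, C b0,
        anosov_rep Gamma0 rho xi xi1,
        non_folding f Omega C Gamma0 rho xi1 b0 &
        Gamma = rho @` Gamma0].

Section Dimension.
Local Open Scope ereal_scope.
Context {R : realType}.

Definition poincare_series (V : euclidType R) (Gamma : set (PGL V)) (s : R)
    : \bar R :=
  \esum_(g in Gamma) ((sigma 2 g / sigma 1 g) `^ s)%:E.

Definition critical_exponent (V : euclidType R) (Gamma : set (PGL V)) : \bar R :=
  ereal_inf [set s%:E | s in [set s | (0 <= s)%R /\
                                      poincare_series Gamma s < +oo]].

Variable T : metricType R.
Implicit Types A B : set T.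

Definition diam B : \bar R := ereal_sup [set (mdist x y)%:E | x in B & y in B].

(* The empty set has weight 0, also when s = 0. *)
Definition diam_pow (s : R) B : \bar R :=
  if B == set0 then 0 else (diam B) `^ s.

Definition hausdorff_pre (s e : R) A : \bar R :=
  ereal_inf [set \sum_(0 <= i <oo) diam_pow s (B i) |
    B in [set B : nat -> set T | A `<=` \bigcup_i B i /\
                                 forall i, diam (B i) <= e%:E]].

Definition hausdorff_measure (s : R) A : \bar R :=
  ereal_sup [set hausdorff_pre s e A | e in [set e | (0 < e)%R]].

Definition hausdorff_dim A : \bar R :=
  ereal_inf [set s%:E | s in [set s | (0 <= s)%R /\
                                      hausdorff_measure s A = 0]].

End Dimension.

(* Main.v *)
Require Import Defs.
From mathcomp Require Import all_boot all_order all_algebra.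
From mathcomp Require Import all_classical all_reals all_analysis.
From mathcomp Require Import ring lra zify.

Set Implicit Arguments.
Unset Strict Implicit.
Unset Printing Implicit Defensive.

Import Order.TTheory GRing.Theory Num.Theory.
Import numFieldNormedType.Exports.

Local Open Scope classical_set_scope.
Local Open Scope ring_scope.

(** Why the dimension of the limit set is the critical exponent.

    Write a(g) for the logarithmic singular gap of rho(g), and D(g) for the Hilbert
    distance from the base point b0 to g b0.  The theorem holds in the strong form
    that, for every s >= 0, the limit set has zero s-dimensional Hausdorff measure
    if and only if the Poincare series converges at s.  No measure has to be
    constructed on the limit set.

    Convergence gives measure zero by covering.  A boundary point x is the end of a
    ray of C issued from b0, which by cocompactness passes at bounded distance from
    infinitely many orbit points g b0; by the non-folding property the boundary
    points whose rays pass near g b0 have image of diameter O(exp(- a(g))).  These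
    images, for g outside of a finite set, form arbitrarily fine covers, and the sum
    of their diameters to the power s is a tail of the Poincare series
    ([hausdorff_upper]).

    Conversely, measure zero provides a cover of the limit set by balls of small
    radii t_i with a small sum of t_i^s, finitely many by compactness.  The lower
    inclusion of the non-folding property places the i-th ball inside the image of
    the shadow of some g_i with exp(- a(g_i)) of the order of t_i ([ball_prefix]).
    A far element h is seen from b0 near some ray, whose end lies in one of the
    balls; hence g_i b0 is near a geodesic from b0 to h b0 and h = g_i h' with
    D(g_i) + D(h') <= D(h) + O(1).  For such aligned pairs a is superadditive up to a
    constant, so the Poincare sum Q over the ball of radius t of the group satisfies
    Q(t) <= Q(M) + Q(t) / 2, the small sum absorbing all the constants; thus
    Q(t) <= 2 Q(M) for every t ([counting_bound]).

    Superadditivity along aligned pairs ([alpha1_aligned]) rests on [domination]: if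
    all the subproducts of a product of uniformly bounded matrices have a singular
    gap exponentially large in their length, then cutting the product somewhere loses
    at most a bounded factor of its norm.  Indeed a large loss at some cut persists
    at all the nearby cuts, the angle between the singular directions of the two
    sides being almost constant; then the norm over a window of length 2^J would, by
    dyadic induction, decay faster than any exponential, which bounded matrices
    forbid.

    The second ingredient is that the boundary map is injective on the limit set and
    onto the limit set of the image, which turns statements on shadows into
    statements on balls ([limit_set_rho], [xi1_inj]).  It follows from the bijection
    between flags once the point of a limit flag determines the flag
    ([limit_flag_inj]): two flags over distinct boundary points come from sequences
    whose quotients are aligned, and are therefore transverse; two flags over the same
    boundary point have the same hyperplane because the hyperplane is already
    determined, up to an exponentially small error, by a long common prefix.

    On the side of the convex domain everything is done in the cone over it, where
    the Hilbert metric is read on order relations ([hilbert_le]).  Extremity of the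
    ideal boundary closure(C) minus Omega makes sequences at bounded distance have the
    same limit ([bd_face]), whence visibility ([orbit_visible]), the degeneration of
    the group to rank one maps ([rank_one]), and the fact that the limit set is the
    ideal boundary ([limit_setE]).  Discreteness gives finiteness of the balls
    ([finite_balls]), and the compact quotient gives coboundedness ([cobounded]). *)

(** * Euclidean vectors *)

Lemma le_eps (R : realType) (a b : R) : (forall e : R, 0 < e -> a <= b + e) -> a <= b.
Proof. by move=> H; apply/ler_addgt0Pr => e /H. Qed.

Section EuclideanVectors.
Context {R : realType} {V : euclidType R}.
Implicit Types (u v w : V) (s : seq V).

Lemma dotp0l u : dotp 0 u = 0.
Proof. by rewrite dotpC dotp0r. Qed.

Lemma dotpDl u v w : dotp (u + v) w = dotp u w + dotp v w.
Proof. by rewrite linearDl. Qed.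

Lemma dotpDr u v w : dotp u (v + w) = dotp u v + dotp u w.
Proof. by rewrite dotpC dotpDl ![dotp _ u]dotpC. Qed.

Lemma dotpNl u v : dotp (- u) v = - dotp u v.
Proof. by rewrite -scaleN1r dotpZl mulN1r. Qed.

Lemma dotpNr u v : dotp u (- v) = - dotp u v.
Proof. by rewrite dotpC dotpNl dotpC. Qed.

Definition dotpE := (dotpDl, dotpDr, @dotpBl R V, @dotpBr R V, @dotpZl R V,
  @dotpZr R V, dotpNl, dotpNr, dotp0l, @dotp0r R V).

Lemma dotp_suml (I : Type) (r : seq I) (P : pred I) (F : I -> V) w :
  dotp (\sum_(i <- r | P i) F i) w = \sum_(i <- r | P i) dotp (F i) w.
Proof. by apply: (big_morph (fun x => dotp x w)) => [x y|]; rewrite dotpE. Qed.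

Lemma dotp_sumr (I : Type) (r : seq I) (P : pred I) (F : I -> V) w :
  dotp w (\sum_(i <- r | P i) F i) = \sum_(i <- r | P i) dotp w (F i).
Proof. by rewrite dotpC dotp_suml; apply: eq_bigr => i _; rewrite dotpC. Qed.

Lemma enorm_ge0 u : 0 <= enorm u. Proof. exact: sqrtr_ge0. Qed.

Lemma enorm0 : enorm (0 : V) = 0.
Proof. by rewrite /enorm dotp0r sqrtr0. Qed.

Lemma enorm_eq0 u : (enorm u == 0) = (u == 0).
Proof. by rewrite -[RHS]negbK -enorm_gt0 lt_def enorm_ge0 andbT negbK. Qed.

Lemma enormZ a u : enorm (a *: u) = `|a| * enorm u.
Proof. by rewrite /enorm !dotpE mulrA -expr2 sqrtrM ?sqr_ge0// sqrtr_sqr. Qed.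

Lemma enormN u : enorm (- u) = enorm u.
Proof. by rewrite -scaleN1r enormZ normrN1 mul1r. Qed.

Lemma enorm_dist u v : enorm (u - v) = enorm (v - u).
Proof. by rewrite -enormN opprB. Qed.

Lemma enorm1P u : enorm u = 1 <-> dotp u u = 1.
Proof.
rewrite -sqr_enorm; split=> [->|/eqP]; first by rewrite expr1n.
rewrite sqrf_eq1 => /orP[/eqP//|/eqP uN].
by have := enorm_ge0 u; rewrite uN ler0N1.
Qed.

Lemma dotp_le u v : `|dotp u v| <= enorm u * enorm v.
Proof.
rewrite -(@ler_pXn2r _ 2)// ?nnegrE ?mulr_ge0 ?enorm_ge0//.
by rewrite real_normK ?num_real// exprMn !sqr_enorm dotp_CS.
Qed.

Lemma enormD u v : enorm (u + v) <= enorm u + enorm v.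
Proof.
rewrite -(@ler_pXn2r _ 2)// ?nnegrE ?addr_ge0 ?enorm_ge0//.
rewrite sqrrD !sqr_enorm !dotpE [dotp v u]dotpC.
have := ler_norm (dotp u v); have := dotp_le u v; lra.
Qed.

Lemma enormB u v : enorm (u - v) <= enorm u + enorm v.
Proof. by rewrite -(enormN v) enormD. Qed.

Lemma enorm_triangle v u w : enorm (u - w) <= enorm (u - v) + enorm (v - w).
Proof. by rewrite -[u - w](subrKA v) enormD. Qed.

Lemma enorm_sum (I : Type) (r : seq I) (P : pred I) (F : I -> V) :
  enorm (\sum_(i <- r | P i) F i) <= \sum_(i <- r | P i) enorm (F i).
Proof.
elim/big_ind2: _ => [|x a y b xa yb|//]; first by rewrite enorm0.
by rewrite (le_trans (enormD _ _))// lerD.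
Qed.

Lemma enorm_pyth u v : dotp u v = 0 -> enorm (u + v) ^+ 2 = enorm u ^+ 2 + enorm v ^+ 2.
Proof. by move=> uv; rewrite !sqr_enorm !dotpE [dotp v u]dotpC uv; ring. Qed.

Definition unitize v := (enorm v)^-1 *: v.

Lemma enorm_unitize v : v != 0 -> enorm (unitize v) = 1.
Proof.
rewrite -enorm_gt0 => v0; rewrite enormZ ger0_norm ?invr_ge0 ?ltW//.
by rewrite mulVf// gt_eqF.
Qed.

Definition orthoseq s := forall i j, (i < size s)%N -> (j < size s)%N ->
  dotp s`_i s`_j = (i == j)%:R.

Lemma orthoseq_free s : orthoseq s -> free s.
Proof.
move=> os; rewrite -[s]/(val (in_tuple s)); apply/freeP => k k0 i.
have := congr1 (fun x => dotp x s`_i) k0; rewrite dotp_suml dotp0l.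
rewrite (bigD1 i)//= big1 ?addr0 => [|j ji].
  by rewrite dotpZl os// eqxx mulr1.
by rewrite dotpZl os// (negbTE ji : (j == i :> nat) = false) mulr0.
Qed.

Lemma orthoseq_basis s : orthoseq s -> size s = \dim {:V} -> basis_of fullv s.
Proof. by move=> os ss; rewrite basisEfree orthoseq_free//= subvf ss leqnn. Qed.

Lemma pair_orthoP s : reflect (forall i j, (i < j < size s)%N -> dotp s`_i s`_j = 0)
  (pair_ortho_rec dotp s).
Proof.
elim: s => [|x s IH] /=; first by apply: ReflectT => i j; rewrite ltn0 andbF.
rewrite andbT; apply: (iffP andP) => [[/allP xs /IH ss] [|i] [|j]//=|H].
- by rewrite ltnS => js; apply/eqP/xs/mem_nth.
- by rewrite !ltnS; exact: ss.
- split; last by apply/IH => i j ij; exact: (H i.+1 j.+1).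
  apply/allP => y ys /=; have := H 0%N (index y s).+1; rewrite /= nth_index// => ->//.
  by rewrite ltnS index_mem.
Qed.

Lemma orthoseqP s : orthonormal dotp s <-> orthoseq s.
Proof.
split=> [/andP[/allP s1 /pair_orthoP sO] i j si sj|os].
  case: (ltngtP i j) => [ij|ji|->]; first by rewrite sO ?ij.
    by rewrite dotpC sO ?ji.
  by apply/eqP/s1/mem_nth.
apply/andP; split; last first.
  apply/pair_orthoP => i j /andP[ij js]; rewrite os// ?(ltn_trans ij)//.
  by rewrite ltn_eqF.
apply/(all_nthP 0) => i si /=; by rewrite os// eqxx.
Qed.

Lemma orthonormal_basisP s :
  orthonormal_basis s <-> orthoseq s /\ size s = \dim {:V}.
Proof.
split=> [/andP[sb /orthoseqP os]|[os ss]]; last first.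
  by apply/andP; split; [exact: orthoseq_basis | apply/orthoseqP].
by split; [exact: os|exact/esym/(@size_basis _ _ _ (size s) (in_tuple s) sb)].
Qed.

Lemma codim_orthov s : (\dim {:V} <= \dim (orthov dotp (span s)) + size s)%N.
Proof.
elim: s => [|x s IH]; first by rewrite span_nil orthov0 leq_addr.
have -> : orthov dotp (span (x :: s)) =
    (orthov dotp (span s) :&: orthov dotp <[x]>)%VS.
  apply/eqP; rewrite eqEsubv subv_cap; apply/andP; split.
    by rewrite andbC -orthovD -span_cons.
  by rewrite span_cons orthovD capvSr capvSl.
apply: leq_trans IH _; rewrite /= addnS -addSn leq_add2r.
by have := leq_dim_orthov1 dotp x (orthov dotp (span s)); lia.
Qed.

Lemma orthogonal_unit s : (size s < \dim {:V})%N ->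
  exists2 v, enorm v = 1 & forall x, x \in s -> dotp x v = 0.
Proof.
move=> sn; have := codim_orthov s; set U := orthov _ _ => nU.
have v0 : vpick U != 0 by rewrite vpick0 -dimv_eq0; apply/eqP; lia.
exists (unitize (vpick U)); first exact: enorm_unitize.
move=> x xs; rewrite dotpZr; have /mem_orthovP Uv := memv_pick U.
by rewrite dotpC Uv ?mulr0// memv_span.
Qed.

Lemma orthoseq_rcons s v : orthoseq s -> enorm v = 1 ->
  (forall x, x \in s -> dotp x v = 0) -> orthoseq (rcons s v).
Proof.
move=> os /enorm1P v1 sv i j; rewrite size_rcons !nth_rcons !ltnS.
rewrite leq_eqVlt => /predU1P[->|si]; rewrite leq_eqVlt => /predU1P[->|sj].
- by rewrite ltnn !eqxx.
- by rewrite ltnn eqxx sj dotpC sv ?mem_nth// gtn_eqF.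
- by rewrite ltnn eqxx si sv ?mem_nth// ltn_eqF.
- by rewrite si sj os.
Qed.

End EuclideanVectors.

(** * Limits in Euclidean spaces *)

Lemma bolzano_weierstrass_rV (R : realType) (n : nat) (x : nat -> 'rV[R]_n) (B : R) :
  (forall k i, `|x k 0 i| <= B) ->
  exists l : 'rV[R]_n, forall e : R, 0 < e -> forall m, exists2 k, (m <= k)%N &
    forall i, `|x k 0 i - l 0 i| < e.
Proof.
move=> xB.
have cK := @rV_compact _ n (fun=> `[- B, B]%classic) (fun=> @segment_compact R _ _).
have [|l [_ lc]] := cK (x @ \oo) _.
  by exists 0%N => //= k _ i /=; rewrite in_itv /= -ler_norml.
exists l => e e0 m.
have [] := lc [set y | exists2 k, (m <= k)%N & y = x k] (ball l e).
- by exists m => //= k mk; exists k.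
- exact: nbhsx_ballx.
by move=> y [[k mk ->] [_ lxe]]; exists k => // i; rewrite distrC; exact: lxe.
Qed.

Section Limits.
Context {R : realType} {V : euclidType R}.
Implicit Types (u v w : V) (x y : nat -> V).

Lemma exists_orthoseq : exists2 e : seq V, orthoseq e & size e = \dim {:V}.
Proof.
suff H k : (k <= \dim {:V})%N -> exists2 e : seq V, orthoseq e & size e = k.
  exact: H (leqnn _).
elim: k => [_|k IH kn]; first by exists [::].
have [e eo ek] := IH (ltnW kn).
have [|v v1 ve] := @orthogonal_unit R V e; first by rewrite ek.
by exists (rcons e v); [exact: orthoseq_rcons|rewrite size_rcons ek].
Qed.

Lemma orthoseq_expand (e : seq V) v : orthoseq e -> size e = \dim {:V} ->
  v = \sum_(i < size e) dotp v e`_i *: e`_i.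
Proof.
move=> eo en; apply/eqP; rewrite -subr_eq0 -dotp_eq0; apply/eqP.
set r := v - _.
have re i : (i < size e)%N -> dotp r e`_i = 0.
  move=> ie; rewrite dotpBl dotp_suml (bigD1 (Ordinal ie))//= big1 ?addr0.
    by rewrite dotpZl eo// eqxx mulr1 subrr.
  move=> j ji; rewrite dotpZl eo// (_ : (j == i :> nat) = false) ?mulr0//.
  exact/negbTE.
have : r \in <<in_tuple e>>%VS.
  by rewrite (span_basis (orthoseq_basis eo en)) memvf.
move=> /coord_span {2}->; rewrite dotp_sumr big1// => i _.
by rewrite dotpZr re ?mulr0.
Qed.

Lemma orthoseq_parseval (e : seq V) v : orthoseq e -> size e = \dim {:V} ->
  enorm v ^+ 2 = \sum_(i < size e) dotp v e`_i ^+ 2.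
Proof.
move=> eo en; rewrite sqr_enorm {2}(orthoseq_expand v eo en) dotp_sumr.
by apply: eq_bigr => i _; rewrite dotpZr expr2.
Qed.

(** A seminorm is controlled by its values on an orthonormal basis. *)
Lemma seminorm_bounded (N : V -> R) :
    (forall u v, N (u + v) <= N u + N v) -> (forall a u, N (a *: u) <= `|a| * N u) ->
  exists2 B, 0 < B & forall v, N v <= B * enorm v.
Proof.
move=> ND NZ; have [e eo en] := exists_orthoseq.
have N0 : N 0 <= 0 by rewrite -(scale0r (0 : V)) (le_trans (NZ _ _))// normr0 mul0r.
have Nge u : 0 <= N u.
  have := ND u (- u); rewrite subrr -scaleN1r; have := NZ (-1) u.
  have := ND 0 0; rewrite addr0 normrN1 mul1r; lra.
have NS (I : Type) (r : seq I) (P : pred I) (F : I -> V) :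
    N (\sum_(i <- r | P i) F i) <= \sum_(i <- r | P i) N (F i).
  elim/big_ind2: _ => [|x a y b xa yb|//]; first exact: N0.
  by rewrite (le_trans (ND _ _))// lerD.
exists (1 + \sum_(i < size e) N e`_i) => [|v].
  by rewrite ltr_pwDl// sumr_ge0.
rewrite {1}(orthoseq_expand v eo en) (le_trans (NS _ _ _ _))//.
rewrite mulrDl mul1r ler_wpDl ?enorm_ge0//.
rewrite mulr_suml; apply: ler_sum => i _.
rewrite (le_trans (NZ _ _))// mulrC ler_wpM2l//.
by rewrite (le_trans (dotp_le _ _))// [enorm e`_i](_ : _ = 1) ?mulr1//;
   apply/enorm1P; rewrite eo// eqxx.
Qed.

Lemma functional_bounded (f : {scalar V}) :
  exists2 B, 0 < B & forall v, `|f v| <= B * enorm v.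
Proof.
apply: seminorm_bounded => [u v|a u]; first by rewrite linearD ler_normD.
by rewrite linearZ normrM.
Qed.

(** Convergence in a Euclidean space, which carries no topology of its own. *)
Definition vcvg x v := forall e : R, 0 < e -> \forall k \near \oo, enorm (x k - v) < e.

Lemma vcvg_cst v : vcvg (fun=> v) v.
Proof. by move=> e e0; apply: nearW => k; rewrite subrr enorm0. Qed.

Lemma vcvg_sub x v (phi : nat -> nat) : (forall k, (k <= phi k)%N) ->
  vcvg x v -> vcvg (x \o phi) v.
Proof.
move=> kphi xv e e0; have [N _ HN] := xv e e0; exists N => // k /= Nk.
by apply: HN => /=; exact: leq_trans Nk (kphi k).
Qed.

Lemma vcvgD x y u v : vcvg x u -> vcvg y v -> vcvg (fun k => x k + y k) (u + v).
Proof.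
move=> xu yv e e0; have e2 : 0 < e / 2 by rewrite divr_gt0.
near=> k; rewrite opprD addrACA (le_lt_trans (enormD _ _))//.
by rewrite [ltRHS]splitr ltrD//; near: k; [exact: xu|exact: yv].
Unshelve. all: by end_near. Qed.

Lemma vcvgZ a x u : vcvg x u -> vcvg (fun k => a *: x k) (a *: u).
Proof.
move=> xu e e0; have a1 : 0 < `|a| + 1 by rewrite ltr_pwDr.
have e1 : 0 < e / (`|a| + 1) by rewrite divr_gt0.
near=> k; rewrite -scalerBr enormZ.
have : enorm (x k - u) < e / (`|a| + 1) by near: k; exact: xu.
rewrite ltr_pdivlMr// mulrC => /(le_lt_trans _); apply.
by rewrite ler_wpM2r ?enorm_ge0// lerDl.
Unshelve. all: by end_near. Qed.

Lemma vcvgB x y u v : vcvg x u -> vcvg y v -> vcvg (fun k => x k - y k) (u - v).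
Proof.
by move=> xu /(vcvgZ (-1)); rewrite scaleN1r => /(vcvgD xu); congr vcvg;
  apply/funext => k; rewrite scaleN1r.
Qed.

Lemma vcvg_unique x u v : vcvg x u -> vcvg x v -> u = v.
Proof.
move=> xu xv; apply/eqP; rewrite -subr_eq0 -enorm_eq0; apply/eqP.
apply/le_anti/andP; split; last exact: enorm_ge0.
apply/ler_addgt0Pl => e e0; rewrite addr0; have e2 : 0 < e / 2 by rewrite divr_gt0.
near \oo => k.
rewrite (le_trans (enorm_triangle (x k) _ _))// [leRHS]splitr lerD//.
  by rewrite enorm_dist ltW//; near: k; exact: xu.
by rewrite ltW//; near: k; exact: xv.
Unshelve. all: by end_near. Qed.

Lemma vcvg_le (N : V -> R) x u (a : R) : (exists2 B, 0 < B &
    forall v w, N v <= N w + B * enorm (v - w)) ->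
  vcvg x u -> (forall k, N (x k) <= a) -> N u <= a.
Proof.
move=> [B B0 NB] xu xa; apply/ler_addgt0Pr => e e0.
have e1 : 0 < e / B by rewrite divr_gt0.
near \oo => k; rewrite (le_trans (NB _ (x k)))// lerD// mulrC.
rewrite -ler_pdivlMr// enorm_dist ltW//; near: k; exact: xu.
Unshelve. all: by end_near. Qed.

Lemma vcvg_dotp x u w : vcvg x u -> (fun k => dotp (x k) w) @ \oo --> dotp u w.
Proof.
move=> xu; apply/cvgrPdist_lt => e e0.
have w1 : 0 < enorm w + 1 by rewrite ltr_pwDr// enorm_ge0.
have e1 : 0 < e / (enorm w + 1) by rewrite divr_gt0.
near=> k; rewrite -dotpBl (le_lt_trans (dotp_le _ _))// enorm_dist.
have : enorm (x k - u) < e / (enorm w + 1) by near: k; exact: xu.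
rewrite ltr_pdivlMr// => /(le_lt_trans _); apply.
by rewrite ler_wpM2l ?enorm_ge0// lerDl.
Unshelve. all: by end_near. Qed.

Lemma vcvg_enorm x u : vcvg x u -> (fun k => enorm (x k)) @ \oo --> enorm u.
Proof.
move=> xu; apply/cvgrPdist_lt => e e0; near=> k.
have : enorm (x k - u) < e by near: k; exact: xu.
apply: le_lt_trans; rewrite ler_norml lerBlDr lerNl opprB.
have := enorm_triangle (x k) u 0; have := enorm_triangle u (x k) 0.
rewrite !subr0 [enorm (u - x k)]enorm_dist; lra.
Unshelve. all: by end_near. Qed.

(** A subsequence is only required to satisfy [k <= phi k]: this is enough to
    preserve limits.  A family of [m] vectors is treated at once in order to extract
    convergent sequences of linear maps, given by their values on a basis. *)
Lemma bolzano_weierstrass m (x : nat -> 'I_m -> V) (B : R) :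
  (forall k i, enorm (x k i) <= B) ->
  exists2 phi : nat -> nat, forall k, (k <= phi k)%N &
    exists l : 'I_m -> V, forall i, vcvg (fun k => x (phi k) i) (l i).
Proof.
move=> xB; have [e eo en] := exists_orthoseq; set n := size e.
pose r k : 'rV[R]_(m * n) := mxvec (\matrix_(i, j) dotp (x k i) e`_j).
have [|l lP] := @bolzano_weierstrass_rV _ _ r B.
  move=> k ij; case/mxvec_indexP: ij => i j; rewrite mxvecE mxE.
  apply: le_trans (dotp_le _ _) _; rewrite [enorm e`_j](_ : _ = 1) ?mulr1//.
  by apply/enorm1P; rewrite eo// eqxx.
pose L : 'M[R]_(m, n) := vec_mx l.
have {}lP k : exists j, (k <= j)%N /\
    forall i (i' : 'I_n), `|dotp (x j i) e`_i' - L i i'| < k.+1%:R^-1.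
  have [|j kj jP] := lP k.+1%:R^-1 _ k; first by rewrite invr_gt0.
  exists j; split=> // i i'; have := jP (mxvec_index i i').
  by rewrite mxvecE mxE /L mxE.
have [phi phiP] := choice lP; exists phi => [k|]; first by have [] := phiP k.
exists (fun i => \sum_(j < n) L i j *: e`_j) => i d d0.
have d1 : 0 < d / n.+1%:R by rewrite divr_gt0.
near=> k; rewrite [x (phi k) i](orthoseq_expand _ eo en) -sumrB.
apply: (le_lt_trans (enorm_sum _ _ _)).
apply: (@le_lt_trans _ _ (\sum_(j < n) d / n.+1%:R)); last first.
  rewrite sumr_const card_ord -[ltLHS]mulr_natr -mulrA gtr_pMr//.
  by rewrite ltr_pdivrMl// mulr1 ltr_nat.
apply: ler_sum => j _; rewrite -scalerBl enormZ [enorm _](_ : _ = 1) ?mulr1; last first.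
  by apply/enorm1P; rewrite eo// eqxx.
have [_ /(_ i j)/ltW/le_trans] := phiP k; apply.
by apply: ltW; near: k; exact: near_infty_natSinv_lt (PosNum d1).
Unshelve. all: by end_near. Qed.

Lemma bolzano_weierstrass1 x (B : R) : (forall k, enorm (x k) <= B) ->
  exists2 phi : nat -> nat, forall k, (k <= phi k)%N &
    exists l, vcvg (fun k => x (phi k)) l.
Proof.
move=> xB; have [|phi kphi [l xl]] := @bolzano_weierstrass 1 (fun k _ => x k) B.
  by move=> k _; exact: xB.
by exists phi => //; exists (l 0); exact: xl.
Qed.

End Limits.

(** * Singular value decompositions *)

Section SingularValues.
Context {R : realType} {V : euclidType R}.
Implicit Types (g h : 'End(V)) (u v w : V) (s : seq V).

Lemma operator_bounded g : exists2 B, 0 < B & forall v, enorm (g v) <= B * enorm v.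
Proof.
apply: seminorm_bounded => [u v|a u]; first by rewrite linearD enormD.
by rewrite linearZ /= enormZ.
Qed.

(** The unit sphere of the orthogonal of [s] is compact. *)
Lemma norm_maximizer g s : (size s < \dim {:V})%N ->
  exists2 v, enorm v = 1 /\ (forall x, x \in s -> dotp x v = 0) &
    forall w, (forall x, x \in s -> dotp x w = 0) ->
      enorm (g w) <= enorm (g v) * enorm w.
Proof.
move=> sn; have [B B0 gB] := operator_bounded g.
pose A : set V := [set w | enorm w = 1 /\ forall x, x \in s -> dotp x w = 0].
pose E := [set enorm (g w) | w in A].
have hE : has_sup E.
  split; last by exists B => _ [w [w1 _] <-]; rewrite (le_trans (gB w))// w1 mulr1.
  by have [w w1 ws] := orthogonal_unit sn; exists (enorm (g w)); exists w.
have xE k : exists w, A w /\ sup E - k.+1%:R^-1 <= enorm (g w).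
  have k0 : 0 < k.+1%:R^-1 :> R by rewrite invr_gt0.
  by have [_ [w Aw <-] /ltW wE] := sup_adherent k0 hE; exists w.
have [x xP] := choice xE.
have [|phi kphi [v xv]] := @bolzano_weierstrass1 R V x 1.
  by move=> k; have [[-> _] _] := xP k.
have v1 : enorm v = 1.
  have := vcvg_enorm xv; rewrite (_ : (fun _ => _) = fun=> 1); last first.
    by apply/funext => k; have [[-> _] _] := xP (phi k).
  by move=> /(cvg_unique _ (@cvg_cst _ _ _ _ _))->.
have vs y : y \in s -> dotp y v = 0.
  move=> ys; have := @vcvg_dotp _ _ _ _ y xv; rewrite (_ : (fun _ => _) = fun=> 0); last first.
    by apply/funext => k; have [[_ xs] _] := xP (phi k); rewrite dotpC xs.
  by move=> /(cvg_unique _ (@cvg_cst _ _ _ _ _)); rewrite dotpC => <-.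
have supE : sup E <= enorm (g v).
  apply: le_eps => e e0; have e2 : 0 < e / 2 by rewrite divr_gt0.
  have e3 : 0 < e / 2 / B by rewrite divr_gt0.
  near \oo => k.
  have [_] := xP (phi k); rewrite lerBlDr => /le_trans; apply.
  have gk : enorm (g (x (phi k))) <= enorm (g v) + e / 2.
    have := enorm_triangle (g v) (g (x (phi k))) 0; rewrite !subr0 addrC.
    move=> /le_trans; apply; rewrite lerD2l -linearB (le_trans (gB _))// mulrC.
    by rewrite -ler_pdivlMr// ltW//; near: k; exact: xv.
  have : (phi k).+1%:R^-1 <= e / 2.
    rewrite (@le_trans _ _ k.+1%:R^-1)//.
      by rewrite lef_pV2 ?posrE// ler_nat ltnS.
    by rewrite ltW//; near: k; exact: near_infty_natSinv_lt (PosNum e2).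
  by move: ((phi k).+1%:R^-1) gk => t; lra.
exists v => // w ws; have [->|w0] := eqVneq w 0.
  by rewrite linear0 enorm0 mulr0.
have wn : 0 < enorm w by rewrite enorm_gt0.
have : enorm (g (unitize w)) <= sup E.
  apply: (ub_le_sup (proj2 hE)); exists (unitize w) => //; split.
    exact: enorm_unitize.
  by move=> y ys; rewrite dotpZr ws// mulr0.
rewrite linearZ /= enormZ ger0_norm ?invr_ge0 ?enorm_ge0//.
by rewrite ler_pdivrMl// mulrC => /le_trans; apply; rewrite ler_wpM2r// ltW.
Unshelve. all: by end_near. Qed.

(** First variation: at a maximizer [v] of the norm, moving along [w] shows that
    the images of [v] and [w] are orthogonal. *)
Lemma norm_maximizer_orth g s v : enorm v = 1 -> (forall x, x \in s -> dotp x v = 0) ->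
  (forall w, (forall x, x \in s -> dotp x w = 0) ->
    enorm (g w) <= enorm (g v) * enorm w) ->
  forall w, (forall x, x \in s -> dotp x w = 0) -> dotp v w = 0 ->
    dotp (g v) (g w) = 0.
Proof.
move=> /enorm1P v1 vs vM w ws vw.
set c := dotp (g v) (g w); pose B := enorm (g v) ^+ 2 * enorm w ^+ 2.
have B0 : 0 <= B by rewrite mulr_ge0 ?sqr_ge0.
have H t : 2 * t * c <= t ^+ 2 * B.
  have /vM K : forall x, x \in s -> dotp x (v + t *: w) = 0.
    by move=> x xs; rewrite dotpDr dotpZr vs// ws// mulr0 addr0.
  rewrite -(@ler_pXn2r _ 2) ?nnegrE ?mulr_ge0 ?enorm_ge0// exprMn in K.
  move: K; rewrite linearD linearZ /= (@sqr_enorm _ _ (v + _)) !sqr_enorm !dotpE.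
  rewrite v1 vw [dotp w v]dotpC vw [dotp (g w) (g v)]dotpC -/c.
  have := dotp_ge0 (g w); rewrite -!sqr_enorm /B.
  have := mulr_ge0 (sqr_ge0 t) (sqr_ge0 (enorm (g w))).
  by move=> *; lra.
have B1 : 0 < B + 1 by rewrite ltr_pwDr.
have := H (c / (B + 1)); rewrite exprMn exprVn.
have -> : 2 * (c / (B + 1)) * c = 2 * c ^+ 2 * (B + 1) / (B + 1) ^+ 2.
  by field; rewrite gt_eqF.
have -> : c ^+ 2 / (B + 1) ^+ 2 * B = c ^+ 2 * B / (B + 1) ^+ 2.
  by field; rewrite gt_eqF.
rewrite ler_pM2r ?invr_gt0 ?exprn_gt0// => cB.
by apply/eqP; rewrite -sqrf_eq0; apply/eqP; have := sqr_ge0 c;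
  have := mulr_ge0 (sqr_ge0 c) B0; nra.
Qed.

Lemma lker0_neq0 g v : lker g = 0%VS -> v != 0 -> g v != 0.
Proof. by move=> g0; apply: contra; rewrite -memv_ker g0 memv0. Qed.

(** Right singular vectors are built greedily: each one maximizes the norm of
    its image among unit vectors orthogonal to the preceding ones. *)
Lemma svd_exists g : lker g = 0%VS ->
  exists (u : seq V) (a : seq R) (v : seq V), is_svd g u a v /\ (forall i, (i < \dim {:V})%N -> 0 < a`_i).
Proof.
move=> g0; set n := \dim {:V}.
pose P (v : seq V) := forall i w, (i < size v)%N ->
  (forall j, (j < i)%N -> dotp v`_j w = 0) ->
  enorm (g w) <= enorm (g v`_i) * enorm w /\
  (dotp v`_i w = 0 -> dotp (g v`_i) (g w) = 0).
have [v vo [vn vP]] : exists2 v, orthoseq v & size v = n /\ P v.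
  suff H k : (k <= n)%N -> exists2 v, orthoseq v & size v = k /\ P v by exact: H.
  elim: k => [_|k IH kn]; first by exists [::].
  have [v vo [vk vP]] := IH (ltnW kn).
  have [|x [x1 xv] xM] := @norm_maximizer g v; first by rewrite vk.
  exists (rcons v x); first exact: orthoseq_rcons.
  split=> [|i w]; first by rewrite size_rcons vk.
  rewrite size_rcons ltnS leq_eqVlt nth_rcons => /predU1P[->|iv].
    rewrite ltnn eqxx => vw; have {}vw y : y \in v -> dotp y w = 0.
      move=> yv; rewrite -(nth_index 0 yv); have iv : (index y v < size v)%N.
        by rewrite index_mem.
      by have := vw _ iv; rewrite nth_rcons iv.
    by split; [exact: xM|exact: norm_maximizer_orth xM _ vw].
  rewrite iv => vw; apply: vP => // j ji; have := vw j ji.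
  by rewrite nth_rcons (ltn_trans ji).
have v0 i : (i < n)%N -> enorm v`_i = 1 by move=> ni; apply/enorm1P; rewrite vo ?vn// eqxx.
have gv i : (i < n)%N -> 0 < enorm (g v`_i).
  by move=> ni; rewrite enorm_gt0 lker0_neq0// -enorm_eq0 v0// oner_eq0.
pose a := mkseq (fun i => enorm (g v`_i)) n.
pose u := mkseq (fun i => unitize (g v`_i)) n.
have aE i : (i < n)%N -> a`_i = enorm (g v`_i) by move=> ni; rewrite nth_mkseq.
exists u, a, v; split=> [|i ni]; last by rewrite aE// gv.
have dec i j : (i < j < n)%N -> dotp v`_i v`_j = 0.
  move=> /andP[ij jn]; rewrite vo ?vn// ?(ltn_trans ij)//.
  by rewrite ltn_eqF.
split.
- apply/orthonormal_basisP; rewrite size_mkseq; split=> // i j.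
  rewrite size_mkseq => ni nj; rewrite !nth_mkseq//.
  have [->|ij] := eqVneq i j.
    by apply/enorm1P/enorm_unitize; rewrite -enorm_gt0 gv.
  have O k l : (k < l < n)%N -> dotp (g v`_k) (g v`_l) = 0.
    move=> /andP[kl ln]; have kn := ltn_trans kl ln.
    have [||_] := vP k v`_l; rewrite ?vn//.
      by move=> m mk; rewrite dec// (ltn_trans mk kl).
    by apply; rewrite dec// kl.
  rewrite dotpZl dotpZr; case: (ltngtP i j) ij => // ij _.
    by rewrite O ?ij// !mulr0.
  by rewrite dotpC O ?ij// !mulr0.
- exact/orthonormal_basisP.
- by rewrite size_mkseq.
- split; last by apply/(all_nthP 0) => i; rewrite size_mkseq => ni; rewrite aE// ltW// gv.
  apply/(sortedP 0) => i; rewrite size_mkseq => ni; rewrite !aE ?(ltnW ni)//.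
  have [||+ _] := vP i v`_i.+1; rewrite ?vn ?(ltnW ni)//.
    by move=> j ji; rewrite dec// (ltn_trans ji) /=.
  by rewrite v0// mulr1.
- move=> i ni; rewrite aE// nth_mkseq// scalerA mulfV ?scale1r//.
  by rewrite gt_eqF// gv.
Qed.

End SingularValues.

(** * The leading pair of singular values *)

Section TopSingularData.
Context {R : realType} {V : euclidType R}.
Implicit Types (g h : 'End(V)) (u v w x y : V).
Lemma lfD g u v : g (u + v) = g u + g v. Proof. exact: linearD. Qed.
Lemma lfB g u v : g (u - v) = g u - g v. Proof. exact: linearB. Qed.
Lemma lfZ g a u : g (a *: u) = a *: g u. Proof. exact: linearZ. Qed.

(** The leading part of a singular value decomposition, in a form that can be
    checked on an arbitrary pair of unit vectors and is stable under scaling. *)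
Definition svtop g (s1 s2 : R) u v :=
  [/\ 0 <= s2 <= s1, enorm u = 1 /\ enorm v = 1, g v = s1 *: u,
      forall w, dotp v w = 0 -> dotp u (g w) = 0 /\ enorm (g w) <= s2 * enorm w &
      exists w, [/\ enorm w = 1, dotp v w = 0 & enorm (g w) = s2]].

Lemma svtop_sqnorm g s1 s2 u v a w : svtop g s1 s2 u v -> dotp v w = 0 ->
  enorm (g (a *: v + w)) ^+ 2 = (a * s1) ^+ 2 + enorm (g w) ^+ 2.
Proof.
move=> [/andP[s0 s12] [u1 v1] gv gw _] vw; rewrite lfD lfZ gv scalerA.
rewrite enorm_pyth; last by rewrite dotpZl (proj1 (gw _ vw)) mulr0.
by rewrite enormZ u1 mulr1 real_normK ?num_real.
Qed.

Lemma unit_decomp v w : enorm v = 1 ->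
  exists2 w', w = dotp v w *: v + w' & dotp v w' = 0.
Proof.
move=> /enorm1P v1; exists (w - dotp v w *: v); first by rewrite addrC subrK.
by rewrite !dotpE v1 mulr1 subrr.
Qed.

Lemma svtop_norm g s1 s2 u v w : svtop g s1 s2 u v -> enorm (g w) <= s1 * enorm w.
Proof.
move=> gs; have [/andP[s0 s12] [u1 v1] gv gw _] := gs.
have [w' wE vw'] := unit_decomp w v1; have s10 := le_trans s0 s12.
rewrite -(@ler_pXn2r _ 2) ?nnegrE ?mulr_ge0 ?enorm_ge0// exprMn wE.
rewrite (svtop_sqnorm _ gs)// enorm_pyth ?dotpZl ?vw' ?mulr0// enormZ v1 mulr1.
rewrite real_normK ?num_real// mulrDr -exprMn mulrC lerD2l -exprMn.
rewrite ler_pXn2r ?nnegrE ?mulr_ge0 ?enorm_ge0//.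
by rewrite (le_trans (proj2 (gw _ vw')))// ler_wpM2r ?enorm_ge0.
Qed.

(** Every plane meets the hyperplane [p = 0], in particular the plane spanned by the
    two most expanded directions: the easy half of the min-max principle. *)
Lemma svtop_minmax g s1 s2 u v (p : V -> R) (c : R) : svtop g s1 s2 u v -> 0 <= c ->
  (forall a b x y, p (a *: x + b *: y) = a * p x + b * p y) ->
  (forall w, p w = 0 -> enorm (g w) <= c * enorm w) -> s2 <= c.
Proof.
move=> gs c0 plin gc; have [/andP[s0 s12] [u1 v1] gv gw [w [w1 vw gws]]] := gs.
have [pw|pw] := eqVneq (p w) 0; first by have := gc w pw; rewrite gws w1 mulr1.
pose a := p w; pose b := p v.
have := gc (a *: v + (- b *: w)); rewrite plin -/a -/b => /(_ _)H.
have {H}: enorm (g (a *: v - b *: w)) <= c * enorm (a *: v - b *: w).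
  by rewrite -scaleNr; apply: H; ring.
rewrite -(@ler_pXn2r _ 2) ?nnegrE ?mulr_ge0 ?enorm_ge0// exprMn -scaleNr.
rewrite (svtop_sqnorm _ gs) ?dotpZr ?vw ?mulr0//.
rewrite enorm_pyth ?dotpZl ?dotpZr ?vw ?mulr0// linearZ /= !enormZ gws v1 w1 !mulr1.
rewrite exprMn !real_normK ?num_real// => H.
rewrite -(@ler_pXn2r _ 2) ?nnegrE// -subr_ge0.
have D : 0 < a ^+ 2 + (- b) ^+ 2.
  by rewrite ltr_pwDl ?sqr_ge0// exprn_even_gt0.
have s2s1 : s2 ^+ 2 <= s1 ^+ 2 by rewrite ler_pXn2r ?nnegrE ?(le_trans s0).
rewrite -(pmulr_rge0 _ D).
have := ler_wpM2l (sqr_ge0 a) s2s1; rewrite -exprMn.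
have : (`|- b| * s2) ^+ 2 = (- b) ^+ 2 * s2 ^+ 2.
  by rewrite exprMn real_normK ?num_real.
by move: H => /[swap] ->; lra.
Qed.

Lemma svtop_unique g s1 s2 u v t1 t2 u' v' :
  svtop g s1 s2 u v -> svtop g t1 t2 u' v' -> s1 = t1 /\ s2 = t2.
Proof.
have le s s' t t' a b c d : svtop g s s' a b -> svtop g t t' c d -> s <= t /\ s' <= t'.
  move=> gs gt; have [/andP[s0 ss] [a1 b1] gb gw _] := gs.
  have [/andP[t0 tt] [c1 d1] gd gw' _] := gt; split.
    have := svtop_norm b gt; rewrite gb enormZ a1 b1 !mulr1 ger0_norm//.
    exact: le_trans s0 ss.
  apply: (svtop_minmax gs t0 (p := dotp d)) => [x y p q|w /gw'[]//].
  by rewrite !dotpE.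
move=> A B; have [h1 h2] := le _ _ _ _ _ _ _ _ A B.
by have [h3 h4] := le _ _ _ _ _ _ _ _ B A; split; apply/le_anti/andP.
Qed.

Lemma svtop_scale g s1 s2 u v (k : R) : k != 0 -> svtop g s1 s2 u v ->
  svtop (k *: g) (`|k| * s1) (`|k| * s2) (Num.sg k *: u) v.
Proof.
move=> k0 [/andP[s0 s12] [u1 v1] gv gw [w [w1 vw gws]]]; split.
- by rewrite mulr_ge0//= ler_wpM2l.
- by rewrite enormZ normr_sg k0 mul1r.
- by rewrite lfunE /= gv !scalerA {1}[k]numEsg; congr (_ *: _); ring.
- move=> x /gw[ux gx]; rewrite lfunE /= dotpZr dotpZl ux !mulr0; split=> //.
  by rewrite enormZ -mulrA ler_wpM2l.
- by exists w; split=> //; rewrite lfunE /= enormZ gws.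
Qed.

(** The area of the parallelogram spanned by [x] and [y], squared. *)
Let area2 (x y : V) := dotp x x * dotp y y - dotp x y ^+ 2.

Let area2_le x y t : area2 x y <= dotp x x * dotp (y - t *: x) (y - t *: x).
Proof.
rewrite /area2 !dotpE [dotp y x]dotpC.
set a := dotp x x; set b := dotp x y; set c := dotp y y.
by have := sqr_ge0 (b - t * a); lra.
Qed.

(** The exterior square of [g] has norm [s1 * s2]; this is the source of the
    submultiplicativity of [s1 * s2], without constructing exterior powers. *)
Lemma svtop_area g s1 s2 u v x y : svtop g s1 s2 u v ->
  area2 (g x) (g y) <= (s1 * s2) ^+ 2 * area2 x y.
Proof.
move=> gs; have [/andP[s0 s12] [u1 v1] gv gw _] := gs.
have [x' xE vx] := unit_decomp x v1; have [y' yE vy] := unit_decomp y v1.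
set a := dotp v x in xE; set b := dotp v y in yE.
have split2 (e p q : V) (c d : R) : enorm e = 1 -> dotp e p = 0 -> dotp e q = 0 ->
    area2 (c *: e + p) (d *: e + q) = dotp (c *: q - d *: p) (c *: q - d *: p) + area2 p q.
  move=> /enorm1P e1 ep eq; rewrite /area2 !dotpE ![dotp p e]dotpC ![dotp q e]dotpC.
  by rewrite ep eq e1 [dotp q p]dotpC; ring.
have [ux gx'] := gw _ vx; have [uy gy'] := gw _ vy.
rewrite xE yE !lfD !lfZ gv !scalerA !split2//.
have sq w : dotp v w = 0 -> dotp (g w) (g w) <= s2 ^+ 2 * dotp w w.
  move=> /gw[_]; rewrite -!sqr_enorm -exprMn => H.
  by rewrite ler_pXn2r ?nnegrE ?mulr_ge0 ?enorm_ge0.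
have s22 : s2 ^+ 2 <= s1 ^+ 2 by rewrite ler_pXn2r ?nnegrE ?(le_trans s0).
rewrite mulrDr lerD//.
  have -> : (a * s1) *: g y' - (b * s1) *: g x' = s1 *: g (a *: y' - b *: x').
    have -> : g (a *: y' - b *: x') = a *: g y' - b *: g x' by rewrite lfB !lfZ.
    by rewrite scalerBr !scalerA ![_ * s1]mulrC.
  have : dotp v (a *: y' - b *: x') = 0 by rewrite dotpBr !dotpZr vx vy !mulr0 subrr.
  move: (_ - _) => z vz.
  by rewrite dotpZl dotpZr mulrA -expr2 exprMn -[leRHS]mulrA ler_wpM2l ?sqr_ge0// sq.
have [->|x0] := eqVneq x' 0; first by rewrite /area2 linear0 !dotp0l; lra.
have xx : 0 < dotp x' x' by rewrite lt_def dotp_eq0 x0 dotp_ge0.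
pose t := dotp x' y' / dotp x' x'.
have A : area2 x' y' = dotp x' x' * dotp (y' - t *: x') (y' - t *: x').
  by rewrite /area2 !dotpE [dotp y' x']dotpC /t; field; rewrite gt_eqF.
apply: (le_trans (area2_le _ _ t)).
have -> : g y' - t *: g x' = g (y' - t *: x') by rewrite lfB lfZ.
rewrite A; have : dotp v (y' - t *: x') = 0 by rewrite dotpBr dotpZr vx vy mulr0 subrr.
move: (y' - _) => z vz.
have -> : (s1 * s2) ^+ 2 * (dotp x' x' * dotp z z) =
  (s1 ^+ 2 * dotp x' x') * (s2 ^+ 2 * dotp z z) by ring.
apply: ler_pM; rewrite ?dotp_ge0// ?sq//.
by rewrite (le_trans (sq _ vx))// ler_wpM2r ?dotp_ge0.
Qed.

Lemma svtop_mul g h s1 s2 u v t1 t2 u' v' r1 r2 u'' v'' :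
  svtop g s1 s2 u v -> svtop h t1 t2 u' v' -> svtop (g \o h)%VF r1 r2 u'' v'' ->
  r1 * r2 <= (s1 * s2) * (t1 * t2).
Proof.
move=> gs hs ghs; have [/andP[r0 r12] [u1 v1] gv gw [w [w1 vw ghw]]] := ghs.
have [/andP[s0 s12] _ _ _ _] := gs; have [/andP[t0 t12] _ _ _ _] := hs.
have ge0 := (le_trans s0 s12, le_trans t0 t12, le_trans r0 r12).
rewrite -(@ler_pXn2r _ 2) ?nnegrE ?mulr_ge0 ?ge0//.
have := svtop_area (h v'') (h w) gs; rewrite -!comp_lfunE => H.
have {H} : area2 ((g \o h)%VF v'') ((g \o h)%VF w) <=
    (s1 * s2) ^+ 2 * ((t1 * t2) ^+ 2 * area2 v'' w).
  by rewrite (le_trans H)// ler_wpM2l ?sqr_ge0// (svtop_area _ _ hs).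
rewrite /area2 vw (proj1 (enorm1P v'') v1) (proj1 (enorm1P w) w1) expr0n /= subr0.
have /enorm1P u11 := u1.
rewrite !mulr1 gv !dotpZl !dotpZr (proj1 (gw _ vw)) mulr0 expr0n /= subr0.
rewrite u11 mulr1 -expr2 -(sqr_enorm ((g \o h)%VF w)) ghw -exprMn.
by rewrite [X in _ <= X -> _](_ : _ = (s1 * s2 * (t1 * t2)) ^+ 2)//; ring.
Qed.

(** The direction of the top left singular vector barely changes under
    multiplication on the right, as soon as [g] has a large gap. *)
Lemma svtop_left g h s1 s2 u v r1 r2 u' v' (H : R) :
  svtop g s1 s2 u v -> svtop (g \o h)%VF r1 r2 u' v' ->
  (forall w, enorm (h w) <= H * enorm w) ->
  r1 * enorm (u' - dotp u u' *: u) <= s2 * H.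
Proof.
move=> gs ghs hH; have [/andP[r0 r12] [u1' v1'] gv' _ _] := ghs.
have [/andP[s0 s12] [u1 v1] gv gw _] := gs.
have [w hE vw] := unit_decomp (h v') v1; have [uw gsw] := gw _ vw.
have E : r1 *: u' = (dotp v (h v') * s1) *: u + g w.
  by rewrite -gv' comp_lfunE hE lfD lfZ gv scalerA !dotpE
    (proj1 (enorm1P v) v1) vw addr0 mulr1.
have -> : r1 * enorm (u' - dotp u u' *: u) = enorm (g w).
  rewrite -[r1]ger0_norm ?(le_trans r0)// -enormZ scalerBr scalerA -dotpZr E.
  by rewrite !dotpE (proj1 (enorm1P u) u1) uw addr0 mulr1 addrAC subrr add0r.
rewrite (le_trans gsw)// ler_wpM2l//.
have := hH v'; rewrite v1' mulr1; apply: le_trans.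
rewrite hE -(@ler_pXn2r _ 2) ?nnegrE ?enorm_ge0// enorm_pyth ?lerDr ?sqr_ge0//.
by rewrite dotpZl vw mulr0.
Qed.

(** The counterpart of [svtop_left] on the side of the source. *)
Lemma svtop_right g h s1 s2 u v r1 r2 u' v' (G : R) :
  svtop h s1 s2 u v -> svtop (g \o h)%VF r1 r2 u' v' ->
  (forall w, enorm (g w) <= G * enorm w) -> 0 <= G ->
  r1 * enorm (v' - dotp v v' *: v) <= G * s2.
Proof.
move=> hs ghs gG G0; have [/andP[r0 r12] [u1' v1'] gv' ghw _] := ghs.
have [/andP[s0 s12] [u1 v1] hv hw _] := hs.
have [w vE vw] := unit_decomp v' v1.
have -> : v' - dotp v v' *: v = w by rewrite {1}vE addrAC subrr add0r.
(* the component of [w] along [v'] alone is stretched by [r1] *)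
have [w' wE v'w'] := unit_decomp w v1'.
have ww : dotp v' w = enorm w ^+ 2.
  by rewrite {1}vE !dotpE vw mulr0 add0r sqr_enorm.
have [->|w0] := eqVneq (enorm w) 0; first by rewrite mulr0 mulr_ge0.
have wp : 0 < enorm w by rewrite lt_def w0 enorm_ge0.
have A : r1 * enorm w ^+ 2 <= enorm ((g \o h)%VF w).
  rewrite -(@ler_pXn2r _ 2) ?nnegrE ?mulr_ge0 ?exprn_ge0 ?enorm_ge0 ?(le_trans r0)//.
  by rewrite {2}wE (svtop_sqnorm _ ghs)// ww [r1 * _]mulrC lerDl sqr_ge0.
rewrite -(ler_pM2r wp) -[in leLHS]mulrA -expr2 (le_trans A)// comp_lfunE.
by rewrite (le_trans (gG _))// -mulrA ler_wpM2l// (proj2 (hw _ vw)).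
Qed.

(** The expansion of a product is controlled by the angle between the most
    expanded direction of the left factor and the image direction of the right
    factor. *)
Lemma svtop_mul_angle g h s1 s2 u v t1 t2 u' v' r1 r2 u'' v'' :
  svtop g s1 s2 u v -> svtop h t1 t2 u' v' -> svtop (g \o h)%VF r1 r2 u'' v'' ->
  r1 <= s1 * t1 * `|dotp v u'| + s2 * t1 + s1 * t2.
Proof.
move=> gs hs ghs; have [/andP[r0 r12] [u1'' w1] gv'' _ _] := ghs.
have [/andP[s0 s12] [u1 v1] gv gw _] := gs; have s10 := le_trans s0 s12.
have [/andP[t0 t12] [u1' v1'] hv' hw' _] := hs; have t10 := le_trans t0 t12.
have -> : r1 = enorm ((g \o h)%VF v'').
  by rewrite gv'' enormZ u1'' mulr1 ger0_norm// (le_trans r0).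
have [w' wE vw'] := unit_decomp v'' v1'; set a := dotp _ v'' in wE.
have le1 (x y z : V) (k : R) : enorm x = 1 -> x = k *: y + z -> dotp y z = 0 -> enorm z <= 1.
  move=> x1 xE yz; rewrite -(@ler_pXn2r _ 2) ?nnegrE ?enorm_ge0// -[in leRHS]x1 [in leRHS]xE.
  by rewrite enorm_pyth ?lerDr ?sqr_ge0// dotpZl yz mulr0.
have w'1 := le1 _ _ _ _ w1 wE vw'.
have a1 : `|a| <= 1 by rewrite (le_trans (dotp_le _ _))// v1' w1 mulr1.
have gu' : enorm (g u') <= s1 * `|dotp v u'| + s2.
  have [z uE vz] := unit_decomp u' v1; rewrite [in leLHS]uE lfD lfZ gv.
  rewrite (le_trans (enormD _ _))// lerD//.
    by rewrite !enormZ u1 mulr1 (ger0_norm s10) mulrC.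
  by rewrite (le_trans (proj2 (gw _ vz)))// ler_piMr// (le1 _ _ _ _ u1' uE vz).
rewrite comp_lfunE [in leLHS]wE !lfD !lfZ hv' lfZ scalerA.
rewrite (le_trans (enormD _ _))// enormZ normrM (ger0_norm t10) lerD//.
  rewrite (_ : _ + _ = t1 * (s1 * `|dotp v u'| + s2)); last by ring.
  apply: ler_pM; rewrite ?mulr_ge0 ?enorm_ge0//.
  by rewrite ler_piMl.
rewrite (le_trans (svtop_norm _ gs))// ler_wpM2l//.
by rewrite (le_trans (proj2 (hw' _ vw')))// ler_piMr.
Qed.

Lemma dotp_near u u' w : enorm u = 1 -> enorm u' = 1 -> enorm w = 1 ->
  `|dotp w u'| <= `|dotp w u| + enorm (u' - dotp u u' *: u).
Proof.
move=> u1 u1' w1.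
have {1}-> : u' = dotp u u' *: u + (u' - dotp u u' *: u) by rewrite addrC subrK.
rewrite dotpDr dotpZr (le_trans (ler_normD _ _))// lerD//.
  rewrite normrM ler_piMl// (le_trans (dotp_le _ _))// u1 u1' mulr1//.
by rewrite (le_trans (dotp_le _ _))// w1 mul1r.
Qed.

Lemma sin_sym u v : enorm u = 1 -> enorm v = 1 ->
  enorm (u - dotp v u *: v) = enorm (v - dotp u v *: u).
Proof.
move=> /enorm1P u1 /enorm1P v1; rewrite /enorm; congr Num.sqrt.
by rewrite !dotpE [dotp v u]dotpC u1 v1; ring.
Qed.

End TopSingularData.

(** * Projective classes and their singular gap *)

Section ProjectiveClasses.
Context {R : realType} {V : euclidType R}.
Implicit Types (g h : 'End(V)) (u v w : V) (x y : PGL V).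
Local Notation n := (\dim {:V}).

Lemma pgl_line_eq g h x : <[g]>%VS = x -> <[h]>%VS = x ->
  exists2 k : R, k != 0 & g = k *: h.
Proof.
move=> gx hx; have /vlineP[k gE] : g \in <[h]>%VS by rewrite hx -gx memv_line.
have [k0|k0] := eqVneq k 0; last by exists k.
have : rep x \in <[g]>%VS by rewrite gx -(pgl_rep x) memv_line.
rewrite gE k0 scale0r => /vlineP[l]; rewrite scaler0 => r0.
have h0 : h = 0.
  have : h \in <[rep x]>%VS by rewrite pgl_rep -hx memv_line.
  by rewrite r0 => /vlineP[m ->]; rewrite scaler0.
by exists 1; rewrite ?oner_eq0// h0 scaler0.
Qed.

Lemma pgl_lineZ (k : R) g x : k != 0 -> <[g]>%VS = x -> <[k *: g]>%VS = x.
Proof.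
move=> k0 <-; apply/eqP; rewrite eqEsubv -!memvE memvZ ?memv_line//=.
by rewrite -[X in X \in _](scalerK k0) memvZ// memv_line.
Qed.

Lemma pgl_line_rep g x : <[g]>%VS = x -> exists2 k : R, k != 0 & g = k *: rep x.
Proof. by move=> gx; apply: pgl_line_eq gx (pgl_rep x). Qed.

Lemma pgl_line_lker g x : <[g]>%VS = x -> lker g = 0%VS.
Proof.
move=> /pgl_line_rep[k k0 ->]; apply/eqP; rewrite -subv0; apply/subvP => v.
by rewrite memv_ker scale_lfunE scaler_eq0 (negbTE k0) /= -memv_ker lker_rep.
Qed.

Lemma pgl_line_inj x y g : <[g]>%VS = x -> <[g]>%VS = y -> x = y.
Proof. by move=> gx gy; apply: val_inj; rewrite /= -gx -gy. Qed.

Lemma pgl_classE g (g0 : lker g = 0%VS) : <[g]>%VS = pgl_class g0.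
Proof. by []. Qed.

Lemma lker_neq0 g v : lker g = 0%VS -> (g v == 0) = (v == 0).
Proof. by move=> g0; rewrite -memv_ker g0 memv0. Qed.

Lemma comp_lfunZZ (k l : R) g h : ((k *: g) \o (l *: h))%VF = (k * l) *: (g \o h)%VF.
Proof. by apply/lfunP => v; rewrite comp_lfunE !lfunE /= comp_lfunE lfZ scalerA. Qed.

Lemma pgl_line_mul g h x y : <[g]>%VS = x -> <[h]>%VS = y ->
  <[(g \o h)%VF]>%VS = (x * y)%g.
Proof.
move=> /pgl_line_rep[k k0 ->] /pgl_line_rep[l l0 ->].
by rewrite comp_lfunZZ; apply: pgl_lineZ; rewrite ?mulf_neq0.
Qed.

Lemma lfun_invK g v : lker g = 0%VS -> g ((g^-1)%VF v) = v.
Proof.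
move=> g0; have /eqP gf : limg g == fullv.
  by rewrite eqEdim subvf /= limg_dim_eq// g0 capv0.
by rewrite limg_lfunVK// gf memvf.
Qed.

Lemma lfun_Kinv g v : lker g = 0%VS -> (g^-1)%VF (g v) = v.
Proof. by move=> g0; rewrite -comp_lfunE lker0_compVf ?id_lfunE// g0. Qed.

Lemma pgl_line_inv g x : <[g]>%VS = x -> <[(g^-1)%VF]>%VS = (x^-1)%g.
Proof.
move=> gx; have g0 := pgl_line_lker gx.
have -> : (x^-1)%g = pgl_class (lker_inv0 g0); last by [].
apply: (@mulIg _ x); rewrite mulVg.
have := pgl_line_mul (pgl_classE (lker_inv0 g0)) gx.
rewrite (_ : (g^-1 \o g)%VF = \1%VF); last by rewrite lker0_compVf// g0.
by move=> /(pgl_line_inj (pgl_classE (@lker_id0 R V))) <-; apply: val_inj.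
Qed.

Lemma act_pointE g x (p : pspace V) : <[g]>%VS = x -> act_point x p = (g @: p)%VS :> {vspace V}.
Proof.
move=> /pgl_line_rep[k k0 ->] /=; rewrite proj_pvec !limg_line lfunE /=.
apply/eqP; rewrite eqEsubv -!memvE memvZ ?memv_line// andbT.
by rewrite -[X in X \in _](scalerK k0) memvZ// memv_line.
Qed.

Lemma lfun_detM g h : lfun_det (g \o h)%VF = lfun_det g * lfun_det h.
Proof.
by rewrite /lfun_det (passmx.mxof_comp _ _ (vbasisP _)) det_mulmx mulrC.
Qed.

Lemma lfun_detZ (k : R) g : lfun_det (k *: g) = k ^+ n * lfun_det g.
Proof.
rewrite /lfun_det -[k *: g]addr0 passmx.mxof_linear.
have /eqP -> : passmx.mxof (vbasis {:V}) (vbasis {:V}) 0 == 0.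
  by rewrite passmx.mxof_eq0 ?vbasisP.
by rewrite addr0 detZ.
Qed.

Lemma lfun_det1 : lfun_det (\1%VF : 'End(V)) = 1.
Proof. by rewrite /lfun_det passmx.mxof1 ?det1// (basis_free (vbasisP _)). Qed.

Lemma lfun_det_neq0 g : lker g = 0%VS -> lfun_det g != 0.
Proof.
move=> g0; apply/eqP => d0; have := lfun_detM (g^-1)%VF g.
by rewrite lker0_compVf ?g0// lfun_det1 d0 mulr0; apply/eqP; rewrite oner_eq0.
Qed.

Lemma is_svdZ (k : R) g (u : seq V) a (v : seq V) : 0 < k -> is_svd g u a v ->
  is_svd (k *: g) u [seq k * t | t <- a] v.
Proof.
move=> k0 [uo vo an [/(sortedP 0) sa /allP a0] gv]; split=> //.
- by rewrite size_map.
- split; last by apply/allP => _ /mapP[t /a0/= t0 ->]; rewrite /= mulr_ge0// ltW.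
  apply/(sortedP 0) => i; rewrite size_map => ia; rewrite !(nth_map 0)// ?(ltnW ia)//.
  by rewrite /= ler_wpM2l ?(ltW k0)//; exact: sa.
- by move=> i ni; rewrite lfunE /= gv// (nth_map 0) ?an// scalerA.
Qed.

Lemma pgl_svd_exists x : exists (u : seq V) (a : seq R) (v : seq V), pgl_svd x u a v.
Proof.
have [u [a [v [gs _]]]] := svd_exists (lker_rep x).
have d0 : 0 < `|lfun_det (rep x)| by rewrite normr_gt0 lfun_det_neq0// lker_rep.
have [c c0 cn] : exists2 c : R, 0 < c & c ^+ n * `|lfun_det (rep x)| = 1.
  have [n0|n0] := posnP n.
    exists 1; rewrite // expr1n mul1r /lfun_det.
    move: (passmx.mxof _ _ _); rewrite n0 => M.
    by rewrite det_mx00 normr1.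
  exists (`|lfun_det (rep x)|^-1 `^ n%:R^-1); first by rewrite powR_gt0 ?invr_gt0.
  rewrite -powR_mulrn ?powR_ge0// -powRrM mulVf ?pnatr_eq0 -?lt0n//.
  by rewrite powRr1 ?invr_ge0// mulVf// gt_eqF.
exists u, [seq c * t | t <- a], v, (c *: rep x); split.
- by apply: pgl_lineZ; rewrite ?gt_eqF// pgl_rep.
- by rewrite lfun_detZ normrM (ger0_norm (exprn_ge0 _ (ltW c0))).
- exact: is_svdZ.
Qed.

Lemma pgl_svd_gt0 x (u : seq V) a (v : seq V) i : pgl_svd x u a v -> (i < n)%N -> 0 < a`_i.
Proof.
move=> [g [gx _ [/orthonormal_basisP[uo un] /orthonormal_basisP[vo vn] an [_ /allP a0] gv]]] ni.
have ai : 0 <= a`_i by apply: a0; rewrite mem_nth// an.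
rewrite lt_def ai andbT; apply/eqP => a00.
have := gv i ni; rewrite a00 scale0r => /eqP; rewrite (lker_neq0 _ (pgl_line_lker gx)).
by rewrite -enorm_eq0 (_ : enorm _ = 1) ?oner_eq0//; apply/enorm1P; rewrite vo ?vn// eqxx.
Qed.

Lemma sigma_svd x : exists (u : seq V) (a : seq R) (v : seq V), [/\ pgl_svd x u a v, sigma 1 x = a`_0 & sigma 2 x = a`_1].
Proof.
rewrite /sigma /=; set A := [set a | _].
have [u [a [v xs]]] := pgl_svd_exists x.
have [|u' [v' H]] := @xgetPex _ [::] A; first by exists a, u, v.
by exists u', (xget [::] A), v'.
Qed.

Lemma svtop_of_svd g (u : seq V) a (v : seq V) : is_svd g u a v -> (1 < n)%N ->
  svtop g a`_0 a`_1 u`_0 v`_0.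
Proof.
move=> [/orthonormal_basisP[uo un] /orthonormal_basisP[vo vn] an [/(sortedP 0) sa /allP a0] gv] n1.
have n0 := ltnW n1.
have u1 i : (i < n)%N -> enorm u`_i = 1 by move=> ni; apply/enorm1P; rewrite uo ?un// eqxx.
have v1 i : (i < n)%N -> enorm v`_i = 1 by move=> ni; apply/enorm1P; rewrite vo ?vn// eqxx.
have ai i : (i < n)%N -> 0 <= a`_i by move=> ni; apply: a0; rewrite mem_nth// an.
have dec i : (0 < i < n)%N -> a`_i <= a`_1.
  elim: i => [//|[//|i] IH] /= ni; apply: le_trans (IH (ltnW ni)).
  by apply: sa; rewrite an.
split.
- by rewrite ai//=; apply: sa; rewrite an.
- by rewrite u1// v1.
- by rewrite gv.
- move=> w vw.
  have E : g w = \sum_(i < size v) (dotp w v`_i * a`_i) *: u`_i.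
    rewrite {1}(orthoseq_expand w vo vn) linear_sum; apply: eq_bigr => i _.
    by rewrite linearZ /= gv -?vn// scalerA.
  have gu i : (i < n)%N -> dotp (g w) u`_i = dotp w v`_i * a`_i.
    move=> ni; rewrite E dotp_suml; have iv : (i < size v)%N by rewrite vn.
    rewrite (bigD1 (Ordinal iv))//= big1 ?addr0.
      by rewrite dotpZl uo ?un// eqxx mulr1.
    move=> j ji; rewrite dotpZl uo ?un -?vn//.
    by rewrite (_ : (j == i :> nat) = false) ?mulr0//; apply/negbTE.
  split; first by rewrite dotpC gu// dotpC vw mul0r.
  rewrite -(@ler_pXn2r _ 2) ?nnegrE ?mulr_ge0 ?enorm_ge0 ?ai// exprMn.
  rewrite (orthoseq_parseval (g w) uo un) (orthoseq_parseval w vo vn) mulr_sumr un vn.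
  apply: ler_sum => i _; rewrite gu// exprMn mulrC.
  have [i0|i0] := posnP i; first by rewrite i0 dotpC vw expr0n /= !mulr0.
  rewrite ler_wpM2r ?sqr_ge0// ler_pXn2r ?nnegrE ?ai//.
  by apply: dec; rewrite i0 ltn_ord.
- exists v`_1; split; rewrite ?v1// ?vo ?vn//.
  by rewrite gv// enormZ u1// mulr1 ger0_norm// ai.
Qed.

(** Representatives of a class and choices of singular vectors differ by scalars,
    so that any of them computes the gap. *)
Lemma svtop_alpha x g s1 s2 u v : (1 < n)%N -> <[g]>%VS = x -> svtop g s1 s2 u v ->
  [/\ 0 < s1, 0 < s2 & s2 = s1 * expR (- alpha1 x)].
Proof.
move=> n1 gx gs; have [u' [a [v' [xs s1E s2E]]]] := sigma_svd x.
have a1 : 0 < a`_1 := pgl_svd_gt0 xs n1.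
have a0 : 0 < a`_0 := pgl_svd_gt0 xs (ltnW n1).
have [h [hx _ /svtop_of_svd/(_ n1) hs]] := xs.
have [k k0 gE] := pgl_line_eq gx hx.
have := svtop_scale k0 hs; rewrite -gE => /(svtop_unique gs)[-> ->].
rewrite !mulr_gt0 ?normr_gt0//; split=> //.
rewrite /alpha1 s1E s2E expRN lnK ?posrE ?divr_gt0// invf_div.
by rewrite -mulrA; congr (_ * _); field; rewrite gt_eqF.
Qed.

Lemma svtop_exists x g : (1 < n)%N -> <[g]>%VS = x -> exists s1 s2 u v, svtop g s1 s2 u v.
Proof.
move=> n1 gx; have [u [a [v [h [hx _ /svtop_of_svd/(_ n1) hs]]]]] := pgl_svd_exists x.
have [k k0 ->] := pgl_line_eq gx hx.
by do 4!eexists; exact: svtop_scale k0 hs.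
Qed.

(** A factor with norm and inverse norm at most [b] changes each of the two leading
    singular values at most by the factor [b]. *)
Lemma alpha1_mul_bound x y g h (b : R) : (1 < n)%N -> <[g]>%VS = x -> <[h]>%VS = y -> 0 < b ->
  (forall w, b^-1 * enorm w <= enorm (h w) <= b * enorm w) ->
  `|alpha1 (x * y)%g - alpha1 x| <= 2 * ln b.
Proof.
move=> n1 gx hy b0 hb; have ghx := pgl_line_mul gx hy.
have [s1 [s2 [u [v gs]]]] := svtop_exists n1 gx.
have [r1 [r2 [u' [v' ghs]]]] := svtop_exists n1 ghx.
have [s10 s20 s2E] := svtop_alpha n1 gx gs.
have [r10 r20 r2E] := svtop_alpha n1 ghx ghs.
have h0 := pgl_line_lker hy.
have hinv w : enorm ((h^-1)%VF w) <= b * enorm w.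
  by have /andP[+ _] := hb ((h^-1)%VF w); rewrite lfun_invK// ler_pdivrMl.
have gE w : g w = (g \o h)%VF ((h^-1)%VF w) by rewrite comp_lfunE lfun_invK.
have [/andP[_ _] [u1 v1] gv gw [w [w1 vw gws]]] := gs.
have [/andP[_ _] [u1' v1'] ghv ghw _] := ghs.
have r1s1 : r1 <= s1 * b.
  have : enorm ((g \o h)%VF v') = r1 by rewrite ghv enormZ u1' mulr1 ger0_norm// ltW.
  move=> <-; rewrite comp_lfunE (le_trans (svtop_norm _ gs))// ler_wpM2l ?(ltW s10)//.
  by have /andP[_] := hb v'; rewrite v1' mulr1.
have s1r1 : s1 <= r1 * b.
  have : enorm (g v) = s1 by rewrite gv enormZ u1 mulr1 ger0_norm// ltW.
  move=> <-; rewrite gE (le_trans (svtop_norm _ ghs))// ler_wpM2l ?(ltW r10)//.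
  by have := hinv v; rewrite v1 mulr1.
have r2s2 : r2 <= s2 * b.
  apply: (svtop_minmax ghs _ (p := fun w => dotp v (h w))) => [|a c x' y'|z vz].
  - by rewrite mulr_ge0// ltW.
  - by rewrite lfD !lfZ !dotpE.
  rewrite comp_lfunE (le_trans (proj2 (gw _ vz)))// -mulrA ler_wpM2l ?(ltW s20)//.
  by have /andP[] := hb z.
have s2r2 : s2 <= r2 * b.
  apply: (svtop_minmax gs _ (p := fun w => dotp v' ((h^-1)%VF w))) => [|a c x' y'|z vz].
  - by rewrite mulr_ge0// ltW.
  - by rewrite lfD !lfZ !dotpE.
  by rewrite gE (le_trans (proj2 (ghw _ vz)))// -mulrA ler_wpM2l ?(ltW r20).
move: (r2s2) (s2r2); rewrite r2E s2E.
set p := alpha1 x; set q := alpha1 _ => A B.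
have lnb t : t <= b * b -> 0 < t -> ln t <= 2 * ln b.
  by move=> tb t0; rewrite (le_trans (_ : _ <= ln (b * b))) ?ler_ln ?posrE ?mulr_gt0// lnM ?posrE//; lra.
have C : expR (q - p) <= b * b.
  rewrite expRD -(ler_pM2l s10) -(ler_pM2l (expR_gt0 (- q))).
  have -> : expR (- q) * (s1 * (expR q * expR (- p))) = s1 * expR (- p).
    by rewrite expRN; field; rewrite gt_eqF// expR_gt0.
  apply: (le_trans B).
  have -> : expR (- q) * (s1 * (b * b)) = s1 * b * expR (- q) * b by ring.
  by rewrite ler_pM2r// ler_pM2r ?expR_gt0.
have D : expR (p - q) <= b * b.
  rewrite expRD -(ler_pM2l r10) -(ler_pM2l (expR_gt0 (- p))).
  have -> : expR (- p) * (r1 * (expR p * expR (- q))) = r1 * expR (- q).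
    by rewrite expRN; field; rewrite gt_eqF// expR_gt0.
  apply: (le_trans A).
  have -> : expR (- p) * (r1 * (b * b)) = r1 * b * expR (- p) * b by ring.
  by rewrite ler_pM2r// ler_pM2r ?expR_gt0.
have := lnb _ C (expR_gt0 _); have := lnb _ D (expR_gt0 _).
by rewrite !expRK ler_norml; lra.
Qed.

End ProjectiveClasses.

(** * Products of matrices with exponential gaps *)

Section Domination.
Context {R : realType} {V : euclidType R}.
Implicit Types (g : 'End(V)) (w x y : V).

Fixpoint lprod (h : nat -> 'End(V)) (i m : nat) : 'End(V) :=
  if m is m'.+1 then (h i \o lprod h i.+1 m')%VF else \1%VF.

Lemma lprodD h i m l : lprod h i (m + l) = (lprod h i m \o lprod h (i + m) l)%VF.
Proof.
elim: m i => [|m IH] i; first by rewrite add0n addn0 comp_lfun1l.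
by rewrite addSn /= IH addSnnS comp_lfunA.
Qed.

Lemma lprodS h i m : lprod h i m.+1 = (lprod h i m \o h (i + m)%N)%VF.
Proof. by rewrite -addn1 lprodD /= comp_lfun1r. Qed.

Section Products.
Context (h : nat -> 'End(V)) (S T : nat -> nat -> R) (u v : nat -> nat -> V).
Context (b c q : R) (N : nat).
Context (b1 : 1 <= b) (c1 : 1 <= c) (q0 : 0 < q) (q1 : q < 1).
Context (hb : forall i w, (i < N)%N -> b^-1 * enorm w <= enorm (h i w) <= b * enorm w).
Context (svP : forall i m, (i + m <= N)%N ->
  svtop (lprod h i m) (S i m) (T i m) (u i m) (v i m)).
Context (gap : forall i m, (i + m <= N)%N -> T i m <= S i m * (c * q ^+ m)).
Local Notation P := (lprod h).

Let b0 : 0 < b. Proof. exact: lt_le_trans b1. Qed.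
Let c0 : 0 < c. Proof. exact: lt_le_trans c1. Qed.

Let P_norm i m w : (i + m <= N)%N ->
  b^-1 ^+ m * enorm w <= enorm (P i m w) <= b ^+ m * enorm w.
Proof.
elim: m i => [|m IH] i iN; first by rewrite /= id_lfunE !expr0 mul1r lexx.
have iN1 : (i.+1 + m <= N)%N by rewrite addSnnS.
have iN0 : (i < N)%N by apply: leq_trans iN; rewrite -addSnnS leq_addr.
rewrite /= comp_lfunE !exprS -!mulrA.
have /andP[A B] := IH _ iN1; have /andP[C D] := hb (P i.+1 m w) iN0.
apply/andP; split; [apply: le_trans C|apply: le_trans D _].
  by rewrite ler_pM2l ?invr_gt0.
by rewrite ler_pM2l.
Qed.

Let uv1 i m : (i + m <= N)%N -> enorm (u i m) = 1 /\ enorm (v i m) = 1.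
Proof. by move=> /svP[]. Qed.

Let Sv i m : (i + m <= N)%N -> enorm (P i m (v i m)) = S i m.
Proof.
move=> iN; have [/andP[t0 ts] [u1 v1] -> _ _] := svP iN.
by rewrite enormZ u1 mulr1 ger0_norm// (le_trans t0).
Qed.

Let S_le i m : (i + m <= N)%N -> S i m <= b ^+ m.
Proof.
move=> iN; rewrite -(Sv iN); have /andP[_] := P_norm (v i m) iN.
by have [_ ->] := uv1 iN; rewrite mulr1.
Qed.

Let S_ge i m : (i + m <= N)%N -> b^-1 ^+ m <= S i m.
Proof.
move=> iN; rewrite -(Sv iN); have /andP[+ _] := P_norm (v i m) iN.
by have [_ ->] := uv1 iN; rewrite mulr1.
Qed.

Let S_gt0 i m : (i + m <= N)%N -> 0 < S i m.
Proof. by move=> iN; apply: lt_le_trans (S_ge iN); rewrite exprn_gt0 ?invr_gt0. Qed.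

Let P_lker i m : (i + m <= N)%N -> lker (P i m) = 0%VS.
Proof.
move=> iN; apply/eqP; rewrite -subv0; apply/subvP => w; rewrite memv_ker memv0.
move=> /eqP w0; have /andP[+ _] := P_norm w iN; rewrite w0 enorm0.
rewrite -enorm_eq0 eq_le enorm_ge0 andbT.
by rewrite pmulr_rle0// exprn_gt0// invr_gt0.
Qed.

(** Composing on the right with the inverse of a bounded product. *)
Let S_ext i m p : (i + (m + p) <= N)%N -> S i m <= b ^+ p * S i (m + p).
Proof.
move=> iN; have iN1 : (i + m <= N)%N by rewrite (leq_trans _ iN)// addnA leq_addr.
have iN2 : ((i + m) + p <= N)%N by rewrite -addnA.
pose y := ((P (i + m) p)^-1)%VF (v i m).
have yE : P (i + m) p y = v i m by rewrite lfun_invK// P_lker.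
have : enorm y <= b ^+ p.
  have /andP[+ _] := P_norm y iN2; rewrite yE (proj2 (uv1 iN1)).
  by rewrite exprVn ler_pdivrMl ?exprn_gt0// mulr1.
rewrite -(Sv iN1) -yE -comp_lfunE -lprodD => yb.
rewrite (le_trans (svtop_norm _ (svP iN)))// mulrC ler_wpM2r//.
exact/ltW/S_gt0.
Qed.

Let S_cut i p m : (i + (p + m) <= N)%N -> S i (p + m) <= b ^+ p * S (i + p) m.
Proof.
move=> iN; have iN1 : (i + p <= N)%N by rewrite (leq_trans _ iN)// addnA leq_addr.
have iN2 : ((i + p) + m <= N)%N by rewrite -addnA.
rewrite -(Sv iN) lprodD comp_lfunE.
have /andP[_ /le_trans] := P_norm (P (i + p) m (v i (p + m))) iN1; apply.
rewrite ler_wpM2l ?exprn_ge0 ?(ltW b0)//.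
rewrite (le_trans (svtop_norm _ (svP iN2)))//.
by rewrite (proj2 (uv1 iN)) mulr1.
Qed.

(** The angle, seen through its cosine, between the most expanded direction of
    the left factor and the image of the most expanded direction of the right
    factor of [P i (m + l)]. *)
Let th i m l : R := `|dotp (v i m) (u (i + m) l)|.

Let th_le i m l : (i + (m + l) <= N)%N ->
  th i m l * (S i m * S (i + m) l) <= S i (m + l).
Proof.
move=> iN; have iN1 : (i + m <= N)%N by rewrite (leq_trans _ iN)// addnA leq_addr.
have iN2 : ((i + m) + l <= N)%N by rewrite -addnA.
have [_ [_ v1] gv _ _] := svP iN2.
have := svtop_norm (v (i + m) l) (svP iN); rewrite v1 mulr1; apply: le_trans.
rewrite lprodD comp_lfunE gv lfZ enormZ (ger0_norm (ltW (S_gt0 iN2))).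
rewrite mulrA [leRHS]mulrC ler_wpM2r ?(ltW (S_gt0 iN2))//.
have [w uE vw] := unit_decomp (u (i + m) l) (proj2 (uv1 iN1)).
rewrite -(@ler_pXn2r _ 2) ?nnegrE ?mulr_ge0 ?enorm_ge0 ?(ltW (S_gt0 iN1)) ?normr_ge0//.
rewrite [in leRHS]uE (svtop_sqnorm _ (svP iN1))// /th !exprMn real_normK ?num_real//.
by rewrite lerDl sqr_ge0.
Qed.

Let th_ge i m l : (i + (m + l) <= N)%N ->
  S i (m + l) <= S i m * S (i + m) l * (th i m l + c * q ^+ m + c * q ^+ l).
Proof.
move=> iN; have iN1 : (i + m <= N)%N by rewrite (leq_trans _ iN)// addnA leq_addr.
have iN2 : ((i + m) + l <= N)%N by rewrite -addnA.
have [s0 s0'] := (S_gt0 iN1, S_gt0 iN2).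
have := svP iN; rewrite lprodD => /(svtop_mul_angle (svP iN1) (svP iN2)) /le_trans; apply.
rewrite -/(th i m l) !mulrDr lerD//; last first.
  rewrite -mulrA ler_wpM2l ?(ltW s0)//; exact: gap.
by rewrite lerD2l mulrAC ler_wpM2r ?(ltW s0')//; exact: gap.
Qed.

Let E := b ^+ 2 * c / (1 - q).

Let E0 : 0 < E.
Proof. by rewrite divr_gt0 ?mulr_gt0 ?exprn_gt0// subr_gt0. Qed.

Let Eq m : b ^+ 2 * c * q ^+ m = E * (q ^+ m - q ^+ m.+1).
Proof.
have q10 : 1 - q != 0 by rewrite subr_eq0 gt_eqF.
have -> : q ^+ m - q ^+ m.+1 = (1 - q) * q ^+ m by rewrite exprS; ring.
by rewrite /E mulrA divfK.
Qed.

(** Lengthening the product on the right moves the image direction by no more than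
    the inverse of the gap reached so far; by geometric summation this direction is
    almost independent of the length. *)
Let sin_left i m : (i + m.+1 <= N)%N ->
  enorm (u i m - dotp (u i m.+1) (u i m) *: u i m.+1) <= b ^+ 2 * c * q ^+ m.
Proof.
move=> iN; have iN1 : (i + m <= N)%N by rewrite (leq_trans _ iN)// addnS.
have iN2 : (i + m < N)%N by rewrite -addnS.
rewrite sin_sym; try by [have [] := uv1 iN|have [] := uv1 iN1].
have hbw w : enorm (h (i + m)%N w) <= b * enorm w by have /andP[] := hb w iN2.
have := svP iN; rewrite lprodS => /(svtop_left (svP iN1))/(_ hbw) H.
rewrite -(ler_pM2l (S_gt0 iN)) (le_trans H)//.
rewrite (le_trans (ler_wpM2r (ltW b0) (gap iN1)))//.
have := S_ext (p := 1) (m := m); rewrite addn1 => /(_ _ iN).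
have cq : 0 <= c * q ^+ m by rewrite mulr_ge0 ?exprn_ge0 ?ltW.
move=> /(ler_wpM2r cq) /(ler_wpM2r (ltW b0)) /le_trans; apply.
by rewrite le_eqVlt; apply/orP; left; apply/eqP; ring.
Qed.

Let sin_right i m : (i + m.+1 <= N)%N ->
  enorm (v i.+1 m - dotp (v i m.+1) (v i.+1 m) *: v i m.+1) <= b ^+ 2 * c * q ^+ m.
Proof.
move=> iN; have iN1 : (i.+1 + m <= N)%N by rewrite addSnnS.
have iN2 : (i < N)%N by apply: leq_trans iN; rewrite -addSnnS leq_addr.
rewrite sin_sym; try by [have [] := uv1 iN|have [] := uv1 iN1].
have hbw w : enorm (h i w) <= b * enorm w by have /andP[] := hb w iN2.
have /(svtop_right (svP iN1))/(_ hbw (ltW b0)) H := svP iN.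
rewrite -(ler_pM2l (S_gt0 iN)) (le_trans H)//.
rewrite mulrC (le_trans (ler_wpM2r (ltW b0) (gap iN1)))//.
(* lengthening on the left also costs at most a factor [b] *)
have Sx : S i.+1 m <= b * S i m.+1.
  rewrite -(Sv iN1); have := hb (P i.+1 m (v i.+1 m)) iN2.
  rewrite ler_pdivrMl// => /andP[/le_trans + _]; apply.
  rewrite ler_pM2l// -comp_lfunE (le_trans (svtop_norm _ (svP iN)))//.
  by rewrite (proj2 (uv1 iN1)) mulr1.
have cq : 0 <= c * q ^+ m by rewrite mulr_ge0 ?exprn_ge0 ?ltW.
have := ler_wpM2r (ltW b0) (ler_wpM2r cq Sx) => /le_trans; apply.
by rewrite le_eqVlt; apply/orP; left; apply/eqP; ring.
Qed.

Let th_left i m l d : (i + (m + (l + d)) <= N)%N ->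
  th i m l <= th i m (l + d) + E * (q ^+ l - q ^+ (l + d)).
Proof.
elim: d => [|d IH] iN; first by rewrite addn0 subrr mulr0 addr0.
have iN1 : (i + (m + (l + d)) <= N)%N by apply: leq_trans iN; clear; lia.
apply: (le_trans (IH iN1)).
have jN : (i + m + (l + d).+1 <= N)%N by apply: leq_trans iN; clear; lia.
have jN1 : (i + m + (l + d) <= N)%N by apply: leq_trans iN; clear; lia.
have iN2 : (i + m <= N)%N by apply: leq_trans iN; clear; lia.
have := dotp_near (proj1 (uv1 jN)) (proj1 (uv1 jN1)) (proj2 (uv1 iN2)).
have := sin_left jN; rewrite Eq addnS /th; lra.
Qed.

Let th_right i m l d : (i + (d + m + l) <= N)%N ->
  th (i + d) m l <= th i (d + m) l + E * (q ^+ m - q ^+ (d + m)).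
Proof.
elim: d i => [|d IH] i iN; first by rewrite addn0 add0n subrr mulr0 addr0.
have iN1 : (i.+1 + (d + m + l) <= N)%N by apply: leq_trans iN; clear; lia.
have := IH _ iN1; rewrite addSnnS => /le_trans; apply.
have jN : (i + (d + m).+1 <= N)%N by apply: leq_trans iN; clear; lia.
have jN1 : (i.+1 + (d + m) <= N)%N by apply: leq_trans iN; clear; lia.
have jN2 : (i.+1 + (d + m) + l <= N)%N by apply: leq_trans iN; clear; lia.
have := dotp_near (proj2 (uv1 jN)) (proj2 (uv1 jN1)) (proj1 (uv1 jN2)).
have := sin_right jN; rewrite Eq /th addSn [(i + (d + m).+1)%N]addnS addSn.
rewrite ![dotp (v _ _) (u _ _)]dotpC; lra.
Qed.

Let G := 1 + 2 * (E + c).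

Let G1 : 1 <= G.
Proof. by rewrite lerDl mulr_ge0// addr_ge0// ltW. Qed.

(** A loss at the cut point [i + m] of [P i (m + l)] means a small angle there; the
    directions forming this angle are almost those of the shorter products cut at the
    same point, which therefore lose as much. *)
Let loss i m l m' : (i + (m + l) <= N)%N -> (m' <= m)%N -> (m' <= l)%N ->
  th i m l <= q ^+ m' ->
  S (i + m - m') (m' + m') <= S (i + m - m') m' * S (i + m) m' * (G * q ^+ m').
Proof.
move=> iN m'm m'l thq; set i' := (i + m - m')%N.
have jE : (i' + m' = i + m)%N by rewrite /i'; clear -m'm m'l; lia.
have i'N : (i' + (m' + m') <= N)%N by apply: leq_trans iN; rewrite /i'; clear -m'm m'l; lia.
have i'N1 : (i' + m' <= N)%N by apply: leq_trans iN; rewrite /i'; clear -m'm m'l; lia.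
have jN : (i + m + m' <= N)%N by apply: leq_trans iN; clear -m'm m'l; lia.
have := th_ge i'N; rewrite jE => /le_trans; apply.
rewrite ler_wpM2l ?mulr_ge0 ?(ltW (S_gt0 _))//.
have A : th i' m' m' <= th i m m' + E * q ^+ m'.
  have dE : (m - m' + m' = m)%N by clear -m'm m'l; lia.
  have := th_right (i := i) (m := m') (l := m') (d := (m - m')%N).
  rewrite (_ : (i + (m - m') = i')%N); last by rewrite /i'; clear -m'm m'l; lia.
  rewrite dE => /(_ _)/le_trans; apply; first by apply: leq_trans iN; clear -m'm m'l; lia.
  by rewrite lerD2l// ler_pM2l// lerBlDr lerDl exprn_ge0// ltW.
have B : th i m m' <= th i m l + E * q ^+ m'.
  have dE : (m' + (l - m') = l)%N by clear -m'm m'l; lia.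
  have := th_left (i := i) (m := m) (l := m') (d := (l - m')%N).
  rewrite dE => /(_ iN)/le_trans; apply.
  by rewrite lerD2l// ler_pM2l// lerBlDr lerDl exprn_ge0// ltW.
rewrite /G mulrDl mul1r; lra.
Qed.

Let e := fix e (J : nat) := if J is J'.+1 then (2 * e J' + 2 ^ J')%N else 0%N.

Let eE J : (2 * e J = J * 2 ^ J)%N.
Proof. by elim: J => [//|J IH]; rewrite /= expnS; nia. Qed.

(** A loss [G q ^+ m] at the middle of every window of length [2 m] accumulates
    over the [J] dyadic scales: the exponent [e J] is [J 2 ^ J / 2], which beats
    the lower bound [b ^- (2 ^ J)]. *)
Let dyadic j p J : (j + p <= N)%N ->
  (forall i m, (j <= i)%N -> (i + (m + m) <= j + p)%N ->
     S i (m + m) <= S i m * S (i + m) m * (G * q ^+ m)) ->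
  forall i, (j <= i)%N -> (i + 2 ^ J <= j + p)%N ->
  S i (2 ^ J) <= (b * G) ^+ (2 ^ J) / G * q ^+ e J.
Proof.
move=> jN H; have G0 : 0 < G := lt_le_trans ltr01 G1.
elim: J => [|J IH] i ji ip.
  rewrite expn0 !expr1 mulr1 mulfK ?gt_eqF// -[leRHS]expr1 S_le//.
  exact: leq_trans ip jN.
have pE : (2 ^ J.+1 = 2 ^ J + 2 ^ J)%N by rewrite expnS mul2n addnn.
rewrite pE in ip *; rewrite (le_trans (H _ _ ji ip))//.
have I1 : S i (2 ^ J) <= (b * G) ^+ (2 ^ J) / G * q ^+ e J.
  by apply: IH => //; clear -ip; lia.
have I2 : S (i + 2 ^ J) (2 ^ J) <= (b * G) ^+ (2 ^ J) / G * q ^+ e J.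
  by apply: IH; clear -ip ji; lia.
set X := (b * G) ^+ (2 ^ J) / G * q ^+ e J in I1 I2.
rewrite (@le_trans _ _ (X * X * (G * q ^+ (2 ^ J))))//.
  rewrite ler_wpM2r ?mulr_ge0 ?exprn_ge0 ?(ltW q0) ?(ltW G0)//.
  by apply: ler_pM => //; apply/ltW/S_gt0; apply: leq_trans jN; clear -ip ji; lia.
rewrite /X /= mul2n -addnn !exprD le_eqVlt; apply/orP; left; apply/eqP.
by field; rewrite gt_eqF.
Qed.

(** If this factor were not enough at some cut, the loss would persist at all the
    cuts at distance at most [2 ^ (2 J)], contradicting [dyadic] with the norm bound
    from below. *)
Lemma domination_aux J : b ^+ 2 * G * q ^+ J < 1 ->
  forall i m l, (i + (m + l) <= N)%N ->
    S i m * S (i + m) l <= (b ^+ 2 / q) ^+ (2 ^ (2 * J)) * S i (m + l).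
Proof.
move=> JP i m l iN; move pE : (2 ^ (2 * J))%N => p.
have iN1 : (i + m <= N)%N by apply: leq_trans iN; clear; lia.
have iN2 : (i + m + l <= N)%N by apply: leq_trans iN; clear; lia.
have iN3 : (i + (m + l) <= N)%N by [].
have b2q : b ^+ 2 <= b ^+ 2 / q by rewrite ler_peMr ?sqr_ge0// invf_ge1// ltW.
have [lp|pl] := ltnP l p.
  have A : S i m * S (i + m) l <= (b ^+ l * S i (m + l)) * b ^+ l.
    by apply: ler_pM; rewrite ?(ltW (S_gt0 _))// ?S_ext ?S_le.
  rewrite (le_trans A)// mulrAC ler_wpM2r ?(ltW (S_gt0 _))//.
  rewrite -exprD addnn -mul2n exprM.
  rewrite (@le_trans _ _ ((b ^+ 2) ^+ p))//.
    by rewrite ler_weXn2l ?exprn_ege1// ltnW.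
  by rewrite lerXn2r// ?nnegrE ?divr_ge0 ?sqr_ge0 ?(ltW q0).
rewrite leNgt; apply/negP => H.
(* the loss at the cut point [i + m] persists at the next [p] cut points *)
have th_small k : (k <= p)%N -> th i (m + k) (l - k) <= q ^+ p.
  move=> kp; have kN : (i + (m + k + (l - k)) <= N)%N by apply: leq_trans iN; clear -kp pl; lia.
  have := th_le kN; rewrite (_ : (m + k + (l - k) = m + l)%N); last by clear -kp pl; lia.
  have kN1 : (i + (m + k) <= N)%N by apply: leq_trans iN; clear -kp pl; lia.
  have kN2 : (i + (m + k) + (l - k) <= N)%N by apply: leq_trans iN; clear -kp pl; lia.
  have s1 := S_gt0 kN1; have s2 := S_gt0 kN2.
  rewrite -ler_pdivlMr ?mulr_gt0// => /le_trans; apply.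
  rewrite ler_pdivrMr ?mulr_gt0//.
  have E1 : S i m <= b ^+ k * S i (m + k) by apply: S_ext.
  have E2 : S (i + m) l <= b ^+ k * S (i + (m + k)) (l - k).
    have := S_cut (i := i + m) (p := k) (m := (l - k)%N).
    rewrite (_ : (k + (l - k) = l)%N); last by clear -kp pl; lia.
    by rewrite addnA; apply; apply: leq_trans iN; clear -kp pl; lia.
  have E3 := ler_pM (ltW (S_gt0 iN1)) (ltW (S_gt0 iN2)) E1 E2.
  have := lt_le_trans H E3; set s := S i (m + l); set t := S i (m + k).
  set t' := S (i + (m + k)) (l - k).
  have bk : b ^+ k * t * (b ^+ k * t') <= (b ^+ 2) ^+ p * (t * t').
    rewrite (_ : _ * _ = (b ^+ 2) ^+ k * (t * t')); last by rewrite -exprM mulnC exprM; ring.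
    by rewrite ler_pM2r ?mulr_gt0// ler_weXn2l// exprn_ege1.
  move=> /lt_le_trans/(_ bk); rewrite expr_div_n mulrAC -mulrA ltr_pM2l ?exprn_gt0//.
  by rewrite ltr_pdivrMr ?exprn_gt0// mulrC => /ltW.
have W : forall i' k, (i + m <= i')%N -> (i' + (k + k) <= i + m + p)%N ->
    S i' (k + k) <= S i' k * S (i' + k) k * (G * q ^+ k).
  move=> i' k ii' ik; pose d := (i' + k - (i + m))%N.
  have dp : (d <= p)%N by rewrite /d; clear -ii' ik pl; lia.
  have := @loss i (m + d)%N (l - d)%N k.
  rewrite (_ : (i + (m + d) - k = i')%N); last by rewrite /d; clear -ii' ik pl; lia.
  rewrite (_ : (i + (m + d) = i' + k)%N); last by rewrite /d; clear -ii' ik pl; lia.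
  apply; rewrite ?(leq_trans _ iN)//; try by rewrite /d; clear -ii' ik pl; lia.
  rewrite (le_trans (th_small _ dp))// ler_wiXn2l ?(ltW q0) ?(ltW q1)//.
  by clear -ii' ik pl; lia.
have jN : (i + m + p <= N)%N by apply: leq_trans iN; clear -pl; lia.
have := dyadic jN W (J := (2 * J)%N) (leqnn _); rewrite pE => /(_ (leqnn _)).
have eJ : (e (2 * J) = J * p)%N by have := eE (2 * J)%N; rewrite pE; clear; lia.
have G0 : 0 < G := lt_le_trans ltr01 G1.
rewrite eJ => U; have := le_trans (S_ge jN) U; rewrite leNgt => /negP; apply.
rewrite -(ltr_pM2l (exprn_gt0 p b0)) exprVn divff; last by rewrite gt_eqF// exprn_gt0.
rewrite exprM mulrCA mulrAC !mulrA -!exprMn.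
rewrite (_ : b * G * b * q ^+ J = b ^+ 2 * G * q ^+ J); last by ring.
rewrite ltr_pdivrMr// mul1r (lt_le_trans _ G1)//.
by rewrite exprn_ilt1 ?mulr_ge0 ?exprn_ge0 ?(ltW b0) ?(ltW q0) ?(ltW G0)// -pE expn_eq0.
Qed.

End Products.

(** The constant depends on the bounds only: it is fixed by the window on which
    an unbounded loss contradicts the lower bound on the norms. *)
Lemma domination (b c q : R) : 1 <= b -> 1 <= c -> 0 < q -> q < 1 ->
  exists2 K : R, 0 < K & forall (h : nat -> 'End(V)) (S T : nat -> nat -> R) (u v : nat -> nat -> V) N,
    (forall i w, (i < N)%N -> b^-1 * enorm w <= enorm (h i w) <= b * enorm w) ->
    (forall i m, (i + m <= N)%N ->
       svtop (lprod h i m) (S i m) (T i m) (u i m) (v i m)) ->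
    (forall i m, (i + m <= N)%N -> T i m <= S i m * (c * q ^+ m)) ->
    forall i m l, (i + (m + l) <= N)%N -> S i m * S (i + m)%N l <= K * S i (m + l)%N.
Proof.
move=> b1 c1 q0 q1; set G := 1 + 2 * (b ^+ 2 * c / (1 - q) + c).
have b0 : 0 < b by exact: lt_le_trans b1.
have G0 : 0 < G.
  have c0 : 0 <= c by rewrite (le_trans _ c1).
  have q10 : 0 <= 1 - q by rewrite subr_ge0 ltW.
  by rewrite /G ltr_wpDr// mulr_ge0// addr_ge0// divr_ge0// mulr_ge0// exprn_ge0// ltW.
have [J JP] : exists J, b ^+ 2 * G * q ^+ J < 1.
  have := @cvg_expr R q; rewrite ger0_norm ?(ltW q0)// => /(_ q1)/cvgrPdist_lt.
  have e0 : 0 < (b ^+ 2 * G)^-1 by rewrite invr_gt0 mulr_gt0 ?exprn_gt0.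
  move=> /(_ _ e0)[J _ /(_ J (leqnn _))] /=.
  rewrite sub0r normrN ger0_norm ?exprn_ge0 ?(ltW q0)//.
  rewrite -(ltr_pM2l (_ : 0 < b ^+ 2 * G)) ?mulr_gt0 ?exprn_gt0//.
  by rewrite mulfV ?gt_eqF ?mulr_gt0 ?exprn_gt0// => ?; exists J.
exists ((b ^+ 2 / q) ^+ (2 ^ (2 * J))).
  by rewrite exprn_gt0 ?divr_gt0 ?exprn_gt0.
by move=> h S T u v N hb svP gap; exact: (domination_aux b1 c1 q0 q1 hb svP gap).
Qed.
End Domination.

(** * Superadditivity of the gap along aligned pairs *)

Section QuasiAdditivity.
Context {R : realType} {G : groupType} {W : euclidType R}.
Context (Gam : set G) (D : G -> R) (rho : G -> PGL W) (c0 lam A : R).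
Implicit Types (x y z : G) (g h : 'End(W)) (u v w : W).

(** The properties of the displacement of a base point by a group acting properly
    by isometries; the matrix estimates below need nothing else of the geometry. *)
Definition length_function := [/\ forall x, Gam x -> 0 <= D x,
  forall x, Gam x -> D x^-1%g = D x,
  forall x y, Gam x -> Gam y -> D (x * y)%g <= D x + D y &
  forall r, finite_set [set x | Gam x /\ D x <= r]].

(** A quasi-geodesic with multiplicative constant one, as obtained by following a
    geodesic in unit steps. *)
Definition coarse_path (beta : nat -> G) (N : nat) := (forall i, Gam (beta i)) /\
  forall i j, (i <= j <= N)%N -> `|D ((beta i)^-1 * beta j)%g - (j - i)%:R| <= c0.

Context (Gsub : subgroup Gam) (Dlen : length_function).
Context (Gpath : forall x, Gam x -> exists beta N,
  [/\ beta 0%N = 1%g, beta N = x & coarse_path beta N]).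
Context (rhoM : forall x y, Gam x -> Gam y -> rho (x * y)%g = (rho x * rho y)%g).
Context (n1 : (1 < \dim {:W})%N) (lam0 : 0 < lam).
Context (rho_gap : forall x, Gam x -> lam * D x - A <= alpha1 (rho x)).

Let G1 : Gam 1%g. Proof. by have [] := Gsub. Qed.
Let GM x y : Gam x -> Gam y -> Gam (x * y)%g.
Proof. by have [_ H _] := Gsub; exact: H. Qed.
Let GV x : Gam x -> Gam x^-1%g. Proof. by have [_ _ H] := Gsub; exact: H. Qed.

Lemma rho1 : rho 1%g = 1%g.
Proof. by apply: (@mulgI _ (rho 1%g)); rewrite -rhoM// !mulg1. Qed.

Lemma rhoV x : Gam x -> rho x^-1%g = (rho x)^-1%g.
Proof.
by move=> Gx; apply: (@mulgI _ (rho x)); rewrite -rhoM ?mulgV ?rho1//; exact: GV.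
Qed.

Lemma lfun_bilip g : lker g = 0%VS -> exists2 b : R, 1 <= b &
  forall w, b^-1 * enorm w <= enorm (g w) <= b * enorm w.
Proof.
move=> g0; have [b b0 gb] := operator_bounded g.
have [b' b0' gb'] := operator_bounded (g^-1)%VF.
have bb : 0 < 1 + b + b' by rewrite !addr_gt0.
exists (1 + b + b') => [|w]; first by rewrite -addrA lerDl addr_ge0// ltW.
apply/andP; split.
  rewrite ler_pdivrMl// -{1}(lfun_Kinv w g0) (le_trans (gb' _))//.
  by rewrite ler_wpM2r ?enorm_ge0// lerDr addr_ge0// ltW.
by rewrite (le_trans (gb w))// ler_wpM2r ?enorm_ge0//; move: b0'; lra.
Qed.

(** Only finitely many elements have length at most [r]. *)
Lemma rep_bilip r : exists2 b : R, 1 <= b & forall x, Gam x -> D x <= r ->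
  forall w, b^-1 * enorm w <= enorm (rep (rho x) w) <= b * enorm w.
Proof.
have [_ _ _ /(_ r)/finite_seqP[s sE]] := Dlen.
suff [b b1 bP] : exists2 b : R, 1 <= b & forall x, x \in s ->
    forall w, b^-1 * enorm w <= enorm (rep (rho x) w) <= b * enorm w.
  by exists b => // x Gx xr; apply: bP; have : [set` s] x by rewrite -sE.
elim: {sE} s => [|x s [b b1 bP]]; first by exists 1.
have [b' b1' bP'] := lfun_bilip (lker_rep (rho x)).
have b0 := lt_le_trans ltr01 b1; have b0' := lt_le_trans ltr01 b1'.
exists (b * b') => [|y]; first by rewrite -[1]mulr1 ler_pM.
have w1 (t t' : R) w : 1 <= t -> 1 <= t' -> (t * t')^-1 * enorm w <= t^-1 * enorm w.
  move=> t1 t1'; rewrite ler_wpM2r ?enorm_ge0// lef_pV2 ?posrE ?mulr_gt0 ?(lt_le_trans ltr01)//.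
  by rewrite ler_peMr// (le_trans ler01).
have w2 (t t' : R) w : 1 <= t -> 1 <= t' -> t * enorm w <= (t * t') * enorm w.
  by move=> t1 t1'; rewrite ler_wpM2r ?enorm_ge0// ler_peMr// (le_trans ler01).
rewrite inE => /predU1P[-> w|/bP ys w].
  have /andP[p q] := bP' w; rewrite [b * b']mulrC.
  by rewrite (le_trans (w1 _ _ _ b1' b1) p)/= (le_trans q)// w2.
have /andP[p q] := ys w.
by rewrite (le_trans (w1 _ _ _ b1 b1') p)/= (le_trans q)// w2.
Qed.

Lemma alpha1_right r : exists2 C : R, 0 <= C & forall x y, Gam x -> Gam y -> D y <= r ->
  `|alpha1 (rho (x * y)%g) - alpha1 (rho x)| <= C.
Proof.
have [b b1 bP] := rep_bilip r; have b0 := lt_le_trans ltr01 b1.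
exists (2 * ln b) => [|x y Gx Gy yr]; first by rewrite mulr_ge0// ln_ge0.
rewrite rhoM//; apply: alpha1_mul_bound (pgl_rep _) (pgl_rep _) b0 _ => //.
exact: bP.
Qed.

Lemma svtop_line g h (p : PGL W) s1 s2 u v t1 t2 u' v' :
  <[g]>%VS = p -> <[h]>%VS = p -> svtop g s1 s2 u v -> svtop h t1 t2 u' v' ->
  exists2 k : R, k != 0 & [/\ g = k *: h, s1 = `|k| * t1 & s2 = `|k| * t2].
Proof.
move=> gp hp gs hs; have [k k0 gE] := pgl_line_eq gp hp.
have := svtop_scale k0 hs; rewrite -gE => /(svtop_unique gs)[-> ->].
by exists k.
Qed.

(** When the product is not much shorter than the sum of the lengths, concatenating
    the coarse paths of [x] and of [y] gives a path all of whose subpaths have a length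
    comparable to their number of steps; the gap is then exponentially large along
    all subpaths and [domination] applies at the junction. *)
Theorem aligned_expansion c : exists2 K : R, 0 < K & forall x y, Gam x -> Gam y ->
  D x + D y <= D (x * y)%g + c ->
  forall g h s1 s2 u v t1 t2 u' v' r1 r2 u'' v'',
  <[g]>%VS = rho x -> <[h]>%VS = rho y ->
  svtop g s1 s2 u v -> svtop h t1 t2 u' v' -> svtop (g \o h)%VF r1 r2 u'' v'' ->
  s1 * t1 <= K * r1.
Proof.
have [Dge DV DM Dfin] := Dlen.
have [b b1 bP] := rep_bilip (1 + c0).
pose C := expR (lam * (4 * `|c0| + `|c|) + `|A|).
have C1 : 1 <= C by rewrite -expR0 ler_expR addr_ge0// mulr_ge0 ?(ltW lam0)// addr_ge0// mulr_ge0.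
pose q := expR (- lam).
have q0 : 0 < q by exact: expR_gt0.
have q1 : q < 1 by rewrite -expR0 ltr_expR oppr_lt0.
have [K K0 KP] := @domination R W b C q b1 C1 q0 q1.
exists K => // x y Gx Gy xy.
have [be [N [be0 beN [beG beP]]]] := Gpath Gx.
have [be' [N' [be0' beN' [beG' beP']]]] := Gpath Gy.
pose ga i := if (i <= N)%N then be i else (x * be' (i - N)%N)%g.
have gaG i : Gam (ga i) by rewrite /ga; case: ifP => // _; exact: GM.
have gaN k : ga (N + k)%N = (x * be' k)%g.
  rewrite /ga; case: leqP => [|_]; last by rewrite addKn.
  by rewrite -[X in (_ <= X)%N]addn0 leq_add2l leqn0 => /eqP->; rewrite addn0 be0' mulg1.
have gaP i j : (i <= j <= N + N')%N ->
    (j - i)%:R - (4 * `|c0| + `|c|) <= D ((ga i)^-1 * ga j)%g.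
  move=> /andP[ij jN].
  have := ler_norm c0; have := normr_ge0 c; have := ler_norm c.
  have [jN1|Nj] := leqP j N.
    rewrite /ga jN1 (leq_trans ij jN1); have := beP i j; rewrite ij jN1 => /(_ isT).
    by rewrite ler_norml; have := normr_ge0 c0; lra.
  have [k jE] : exists k, j = (N + k)%N by exists (j - N)%N; rewrite subnKC// ltnW.
  have kN : (k <= N')%N by move: jN; rewrite jE leq_add2l.
  rewrite jE gaN; have [iN|Ni] := leqP i N; last first.
    have [l iE] : exists l, i = (N + l)%N by exists (i - N)%N; rewrite subnKC// ltnW.
    rewrite iE gaN subnDl invgM -mulgA mulKg.
    have := beP' l k; rewrite kN andbT => /(_ _)H.
    have {}H : `|D ((be' l)^-1 * be' k)%g - (k - l)%:R| <= c0.
      by apply: H; rewrite -(leq_add2l N) -iE -jE.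
    by move: H; rewrite ler_norml; have := normr_ge0 c0; lra.
  rewrite {1}/ga iN -addnBAC//.
  have P1 : D (be i) <= i%:R + c0.
    have := beP 0%N i; rewrite iN /= => /(_ isT); rewrite be0 invg1 mul1g subn0.
    by rewrite ler_norml; lra.
  have P2 : D ((be' k)^-1 * y)%g <= (N' - k)%:R + c0.
    have := beP' k N'; rewrite kN leqnn => /(_ isT); rewrite beN'.
    by rewrite ler_norml; lra.
  have P3 : N%:R - c0 <= D x.
    have := beP 0%N N; rewrite leqnn /= => /(_ isT); rewrite be0 beN invg1 mul1g subn0.
    by rewrite ler_norml; lra.
  have P4 : N'%:R - c0 <= D y.
    have := beP' 0%N N'; rewrite leqnn /= => /(_ isT); rewrite be0' beN' invg1 mul1g subn0.
    by rewrite ler_norml; lra.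
  have E : (x * y = be i * ((be i)^-1 * (x * be' k)) * ((be' k)^-1 * y))%g.
    by rewrite mulVKg -mulgA mulVKg.
  have := DM _ _ (GM (beG i) (GM (GV (beG i)) (GM Gx (beG' k)))) (GM (GV (beG' k)) Gy).
  have := DM _ _ (beG i) (GM (GV (beG i)) (GM Gx (beG' k))).
  rewrite -E natrD !natrB// in P2 *.
  by move: P1 P2 P3 P4 xy; have := ler_norm c0; have := normr_ge0 c0; lra.
pose st i := ((ga i)^-1 * ga i.+1)%g.
have stG i : Gam (st i) by apply: GM => //; exact: GV.
have stD i : (i < N + N')%N -> D (st i) <= 1 + c0.
  move=> iN; rewrite /st; have [iN1|Ni] := ltnP i N.
    rewrite /ga iN1 (ltnW iN1); have := beP i i.+1; rewrite leqnSn iN1 => /(_ isT).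
    by rewrite subSnn ler_norml; lra.
  have [k iE] : exists k, i = (N + k)%N by exists (i - N)%N; rewrite subnKC.
  have kN : (k < N')%N by move: iN; rewrite iE ltn_add2l.
  rewrite iE -addnS !gaN invgM -mulgA mulKg.
  have := beP' k k.+1; rewrite leqnSn kN => /(_ isT).
  by rewrite subSnn ler_norml; lra.
pose H i := rep (rho (st i)).
have HP i m : <[lprod H i m]>%VS = rho ((ga i)^-1 * ga (i + m)%N)%g.
  elim: m i => [|m IH] i.
    by rewrite addn0 mulVg rho1; exact: (pgl_classE (@lker_id0 R W)).
  rewrite /= (pgl_line_mul (pgl_rep _) (IH i.+1)) -rhoM//; last exact: GM (GV (gaG _)) (gaG _).
  by rewrite /st -mulgA mulVKg addSnnS.
have /choice[X XP] : forall im : nat * nat, exists X : R * R * W * W,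
    svtop (lprod H im.1 im.2) X.1.1.1 X.1.1.2 X.1.2 X.2.
  by move=> [i m]; have [s1 [s2 [u [v s]]]] := svtop_exists n1 (HP i m);
    exists (s1, s2, u, v).
have gap i m : (i + m <= N + N')%N ->
    (X (i, m)).1.1.2 <= (X (i, m)).1.1.1 * (C * q ^+ m).
  move=> iN; have [s10 s20 ->] := svtop_alpha n1 (HP i m) (XP (i, m)).
  rewrite ler_pM2l// /C /q -expRM_natl -expRD ler_expR.
  have := rho_gap (GM (GV (gaG i)) (gaG (i + m)%N)).
  have := gaP i (i + m)%N; rewrite leq_addr iN addKn => /(_ isT).
  rewrite -(ler_pM2l lam0); have := ler_norm A.
  by rewrite mulrBr mulrN -mulrC; lra.
have := KP H (fun i m => (X (i, m)).1.1.1) (fun i m => (X (i, m)).1.1.2)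
  (fun i m => (X (i, m)).1.2) (fun i m => (X (i, m)).2) (N + N')%N.
move=> /(_ (fun i w iN => bP _ (stG i) (stD i iN) w) (fun i m _ => XP (i, m)) gap 0%N N N').
rewrite !add0n leqnn => /(_ isT) main.
move=> g h s1 s2 u v t1 t2 u' v' r1 r2 u'' v'' gx hy gs hs ghs.
have ga0 : ga 0%N = 1%g by rewrite /ga leq0n.
have gaN0 : ga N = x by rewrite /ga leqnn.
have HN : <[lprod H 0 N]>%VS = rho x by rewrite HP add0n ga0 gaN0 invg1 mul1g.
have HN' : <[lprod H N N']>%VS = rho y by rewrite HP gaN gaN0 beN' mulKg.
have [k k0 [gE -> _]] := svtop_line gx HN gs (XP (0%N, N)).
have [l l0 [hE -> _]] := svtop_line hy HN' hs (XP (N, N')).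
have ghE : (g \o h)%VF = (k * l) *: lprod H 0 (N + N').
  by rewrite gE hE comp_lfunZZ lprodD add0n.
have := svtop_scale (mulf_neq0 k0 l0) (XP (0%N, (N + N')%N)); rewrite -ghE.
move=> /(svtop_unique ghs)[-> _]; rewrite normrM.
by rewrite mulrACA [leRHS]mulrCA ler_wpM2l// mulr_ge0.
Qed.

(** Combines the lower bound on the first singular value of the product with
    the submultiplicativity of the product of the first two. *)
Theorem alpha1_aligned c : exists C : R, forall x y, Gam x -> Gam y ->
  D x + D y <= D (x * y)%g + c ->
  alpha1 (rho x) + alpha1 (rho y) <= alpha1 (rho (x * y)%g) + C.
Proof.
have [K K0 KP] := aligned_expansion c.
exists (2 * ln K) => x y Gx Gy xy; rewrite rhoM//.
have gx := pgl_rep (rho x); have hy := pgl_rep (rho y).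
have ghxy := pgl_line_mul gx hy.
have [s1 [s2 [u [v gs]]]] := svtop_exists n1 gx.
have [t1 [t2 [u' [v' hs]]]] := svtop_exists n1 hy.
have [r1 [r2 [u'' [v'' ghs]]]] := svtop_exists n1 ghxy.
have H := KP x y Gx Gy xy _ _ _ _ _ _ _ _ _ _ _ _ _ _ gx hy gs hs ghs.
have [s10 s20 s2E] := svtop_alpha n1 gx gs.
have [t10 t20 t2E] := svtop_alpha n1 hy hs.
have [r10 r20 r2E] := svtop_alpha n1 ghxy ghs.
have := svtop_mul gs hs ghs; rewrite s2E t2E r2E.
set p := alpha1 (rho x); set p' := alpha1 (rho y); set p'' := alpha1 _ => M.
have {}M : expR (p + p' - p'') <= K * K.
  have st0 : 0 < s1 * t1 by rewrite mulr_gt0.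
  have HH : (s1 * t1) * (s1 * t1) <= (K * r1) * (K * r1) by rewrite ler_pM// ltW.
  have N : r1 * r1 * expR (- p'') <= (K * r1) * (K * r1) * expR (- p) * expR (- p').
    apply: (@le_trans _ _ ((s1 * t1) * (s1 * t1) * expR (- p) * expR (- p'))).
      by apply: (le_trans _ (le_trans M _)); rewrite le_eqVlt; apply/orP; left; apply/eqP; ring.
    by rewrite ler_pM2r ?expR_gt0// ler_pM2r ?expR_gt0.
  rewrite -(ler_pM2l (mulr_gt0 r10 r10)) -(ler_pM2r (expR_gt0 (- p - p'))).
  apply: (le_trans _ (le_trans N _)); rewrite le_eqVlt; apply/orP; left; apply/eqP.
    by rewrite -!mulrA -expRD; congr (_ * (_ * expR _)); ring.
  by rewrite expRD; ring.
have : ln (expR (p + p' - p'')) <= ln (K * K) by rewrite ler_ln ?posrE ?expR_gt0 ?mulr_gt0.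
by rewrite expRK lnM ?posrE//; lra.
Qed.

(** The first two estimates divide the bounds of [svtop_left] and [svtop_right] by
    the lower bound on the expansion of the product; the third one reads
    [svtop_mul_angle] backwards. *)
Theorem aligned_directions c : exists2 K : R, 0 < K & forall x y, Gam x -> Gam y ->
  D x + D y <= D (x * y)%g + c ->
  forall g h s1 s2 u v t1 t2 u' v' r1 r2 u'' v'',
  <[g]>%VS = rho x -> <[h]>%VS = rho y ->
  svtop g s1 s2 u v -> svtop h t1 t2 u' v' -> svtop (g \o h)%VF r1 r2 u'' v'' ->
  [/\ enorm (u'' - dotp u u'' *: u) <= K * expR (- alpha1 (rho x)),
      enorm (v'' - dotp v' v'' *: v') <= K * expR (- alpha1 (rho y)) &
      K^-1 <= `|dotp v u'| + expR (- alpha1 (rho x)) + expR (- alpha1 (rho y))].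
Proof.
have [K K0 KP] := aligned_expansion c.
exists K => // x y Gx Gy xy g h s1 s2 u v t1 t2 u' v' r1 r2 u'' v'' gx hy gs hs ghs.
have H := KP x y Gx Gy xy _ _ _ _ _ _ _ _ _ _ _ _ _ _ gx hy gs hs ghs.
have [s10 s20 s2E] := svtop_alpha n1 gx gs.
have [t10 t20 t2E] := svtop_alpha n1 hy hs.
have [r10 r20 r2E] := svtop_alpha n1 (pgl_line_mul gx hy) ghs.
split.
- rewrite -(ler_pM2l r10).
  rewrite (le_trans (svtop_left gs ghs (fun w => svtop_norm w hs)))// s2E.
  rewrite mulrAC mulrA [r1 * K]mulrC ler_wpM2r ?expR_ge0//.
- rewrite -(ler_pM2l r10).
  rewrite (le_trans (svtop_right hs ghs (fun w => svtop_norm w gs) (ltW s10)))// t2E.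
  by rewrite !mulrA [r1 * K]mulrC ler_wpM2r ?expR_ge0.
- have M := svtop_mul_angle gs hs ghs.
  have st0 : 0 < s1 * t1 by rewrite mulr_gt0.
  rewrite -(ler_pM2l st0); apply: (@le_trans _ _ r1).
    by rewrite ler_pdivrMr// [r1 * K]mulrC.
  by apply: (le_trans M); rewrite s2E t2E le_eqVlt; apply/orP; left; apply/eqP; ring.
Qed.

End QuasiAdditivity.

(** * Convergence in projective space *)

Section ProjectiveTopology.
Context {R : realType} {V : euclidType R}.
Implicit Types (u v w : V) (p q : pspace V) (H : hyperplane V).
Local Notation n := (\dim {:V}).

Fact pt_subproof v : v != 0 -> \dim <[v]> == 1%N.
Proof. by move=> v0; rewrite dim_vline v0. Qed.

Definition pt v (v0 : v != 0) : pspace V := PSpace (pt_subproof v0).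

Lemma mem_pt v (v0 : v != 0) : v \in (pt v0 : {vspace V}).
Proof. exact: memv_line. Qed.

Lemma pspaceP p v : v != 0 -> v \in (p : {vspace V}) -> p = <[v]>%VS :> {vspace V}.
Proof.
move=> v0; rewrite {1}(proj_pvec p) => /vlineP[k vE].
have k0 : k != 0 by apply: contraNneq v0 => k0; rewrite vE k0 scale0r.
rewrite (proj_pvec p) vE; apply/eqP; rewrite eqEsubv -!memvE memvZ ?memv_line// andbT.
by rewrite -[X in X \in _](scalerK k0) memvZ// memv_line.
Qed.

Lemma ptP p v (v0 : v != 0) : v \in (p : {vspace V}) -> p = pt v0.
Proof. by move=> vp; apply: val_inj; exact: pspaceP. Qed.

Lemma pspace_eqP p q v : v != 0 -> v \in (p : {vspace V}) -> v \in (q : {vspace V}) -> p = q.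
Proof. by move=> v0 vp vq; rewrite (ptP v0 vp) (ptP v0 vq). Qed.

Lemma pspace_unit p : exists2 v, enorm v = 1 & v \in (p : {vspace V}).
Proof.
exists (unitize (pvec p)); first by rewrite enorm_unitize// pvec_neq0.
by rewrite memvZ// memv_pick.
Qed.

Lemma unit_neq0 v : enorm v = 1 -> v != 0.
Proof. by move=> v1; rewrite -enorm_eq0 v1 oner_eq0. Qed.

Lemma pspace_line p v w : v != 0 -> v \in (p : {vspace V}) -> w \in (p : {vspace V}) ->
  exists k : R, w = k *: v.
Proof. by move=> v0 vp; rewrite (pspaceP v0 vp) => /vlineP. Qed.

Lemma cos_mdist p q v w : v \in (p : {vspace V}) -> w \in (q : {vspace V}) ->
  `|dotp v w| = cos (mdist p q) * (enorm v * enorm w).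
Proof.
have [pv qv] := (pvec_neq0 p, pvec_neq0 q).
move=> /(pspace_line pv (memv_pick _))[k ->] /(pspace_line qv (memv_pick _))[l ->].
have pn : 0 < enorm (pvec p) by rewrite enorm_gt0.
have qn : 0 < enorm (pvec q) by rewrite enorm_gt0.
have c01 : 0 <= cosangle p q <= 1.
  rewrite /cosangle divr_ge0 ?mulr_ge0 ?enorm_ge0//= ler_pdivrMr ?mulr_gt0//.
  by rewrite mul1r dotp_le.
rewrite (_ : mdist p q = angle p q)// /angle acosK; last first.
  by rewrite in_itv /=; move: c01 => /andP[c0 ->]; rewrite andbT (le_trans _ c0)// lerN10.
rewrite !enormZ dotpZl dotpZr !normrM /cosangle.
by field; rewrite !gt_eqF.
Qed.

Lemma mdist_pihalf p q : 0 <= mdist p q <= pi.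
Proof.
rewrite (_ : mdist p q = angle p q)// /angle.
have c01 : -1 <= cosangle p q <= 1.
  rewrite /cosangle (le_trans (lerN10 _)) ?divr_ge0 ?mulr_ge0 ?enorm_ge0//=.
  rewrite ler_pdivrMr ?mulr_gt0 ?enorm_gt0 ?pvec_neq0//.
  by rewrite mul1r dotp_le.
by rewrite acos_ge0// acos_lepi.
Qed.

Lemma near_cos (e : R) : 0 < e -> exists2 d, 0 < d & forall t : R, 0 <= t < d -> 1 - e < cos t.
Proof.
move=> e0; have : cos x @[x --> (0 : R)] --> cos 0 by exact: continuous_cos.
rewrite cos0 => /cvgrPdist_lt/(_ _ e0).
move=> [d /= d0 dP]; exists d => // t /andP[t0 td].
have := dP t; rewrite /= sub0r normrN ger0_norm// => /(_ td).
by move=> /ltr_normlW; lra.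
Qed.

(** Each point close to a line of projective space has a unit vector close to a
    given one: the passage from the angular metric to vectors. *)
Lemma near_unit (e : R) : 0 < e -> exists2 d, 0 < d & forall p q v,
  mdist q p < d -> enorm v = 1 -> v \in (p : {vspace V}) ->
  exists w, [/\ enorm w = 1, w \in (q : {vspace V}) & enorm (w - v) < e].
Proof.
move=> e0; have e1 : 0 < e ^+ 2 / 2 by rewrite divr_gt0// exprn_gt0.
have [d d0 dP] := near_cos e1; exists d => // p q v qp v1 vp.
have [w w1 wq] := pspace_unit q.
have := cos_mdist wq vp; rewrite w1 v1 !mulr1 => wv.
have /dP : 0 <= mdist q p < d by rewrite mdist_ge0.
rewrite -wv => cwv.
have lt_e (w' : V) : dotp w' v = `|dotp w v| -> enorm w' = 1 -> enorm (w' - v) < e.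
  move=> w'v w'1; rewrite -(@ltr_pXn2r _ 2) ?nnegrE ?enorm_ge0 ?(ltW e0)//.
  rewrite sqr_enorm !dotpE [dotp v w']dotpC w'v.
  by rewrite (proj1 (enorm1P w') w'1) (proj1 (enorm1P v) v1); lra.
have [wv0|wv0] := leP 0 (dotp w v).
  by exists w; split=> //; apply: lt_e => //; rewrite ger0_norm.
exists (- w); rewrite enormN; split=> //; first by rewrite memvN.
by apply: lt_e; rewrite ?enormN// dotpNl ltr0_norm.
Qed.

(** The converse passage, from vectors to the angular metric. *)
Lemma near_mdist v (e : R) : v != 0 -> 0 < e -> exists2 d, 0 < d &
  forall p q w, v \in (p : {vspace V}) -> w \in (q : {vspace V}) ->
    enorm (w - v) < d -> w != 0 /\ mdist q p < e.
Proof.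
move=> v0 e0; have vn : 0 < enorm v by rewrite enorm_gt0.
pose e' := Num.min e pi.
have e'0 : 0 < e' by rewrite lt_min e0 pi_gt0.
have c1 : cos e' < 1.
  rewrite -cos0 ltr_cos ?in_itv /= ?lexx ?pi_ge0 ?(ltW e'0)//.
  by rewrite /e' ge_min lexx orbT.
pose c := Num.max (cos e') 0.
have c01 : 0 <= c < 1 by rewrite le_max lexx orbT gt_max c1 ltr01.
pose d := enorm v * (1 - c) / 2.
have d0 : 0 < d by rewrite divr_gt0// mulr_gt0// subr_gt0; case/andP: c01.
exists d => // p q w vp wq wv.
have dv : d < enorm v.
  rewrite /d -mulrA gtr_pMr//; move: c01 => /andP[? ?]; lra.
have wv1 := enorm_triangle v w 0; have wv2 := enorm_triangle w v 0.
rewrite !subr0 in wv1 wv2; rewrite (enorm_dist v w) in wv2.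
have wn : 0 < enorm w by move: wv wv2 dv; lra.
split; first by rewrite -enorm_gt0.
have := cos_mdist wq vp => cE.
set t := enorm (w - v) in wv wv1 wv2.
have lb : enorm v * (enorm v - t) <= `|dotp w v|.
  apply: le_trans (ler_norm _); rewrite -[X in dotp X _](subrK v) dotpDl -sqr_enorm.
  have := dotp_le (w - v) v; rewrite -/t ler_norml expr2; lra.
rewrite cE in lb.
have cc : cos e' <= c by rewrite le_max lexx.
suff : mdist q p < e' by rewrite lt_min => /andP[].
have /andP[m0 mpi] := mdist_pihalf q p.
rewrite -ltr_cos ?in_itv /= ?m0 ?(ltW e'0)//; last by rewrite ge_min lexx orbT.
apply: (le_lt_trans cc); rewrite ltNge; apply/negP => cm.
have : enorm v * (enorm v - t) <= c * (enorm v + t) * enorm v.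
  apply: (le_trans lb); rewrite mulrA ler_wpM2r ?enorm_ge0//.
  apply: ler_pM => //; [|exact: enorm_ge0|by rewrite addrC].
  have := normr_ge0 (dotp w v); rewrite cE.
  by rewrite pmulr_lge0// mulr_gt0.
rewrite mulrC ler_pM2r// => H.
have {}wv : t < enorm v * (1 - c) / 2 by [].
move: c01 => /andP[c0 c11]; have t0 : 0 <= t by rewrite enorm_ge0.
have := mulr_ge0 c0 t0; have : c * t <= t by rewrite ler_piMl// ltW.
by move: H wv; lra.
Qed.

Lemma orthov_dotP (U : {vspace V}) v :
  v \in orthov dotp U <-> forall w, w \in U -> dotp v w = 0.
Proof. by split=> [/mem_orthovP H w /H//|H]; apply/mem_orthovP => w /H. Qed.

(** Sequential form of the topology of projective space. *)
Definition pcvg (q : nat -> pspace V) p :=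
  forall e : R, 0 < e -> \forall k \near \oo, mdist (q k) p < e.

Lemma pcvg_sub (q : nat -> pspace V) p phi : (forall k, (k <= phi k)%N) -> pcvg q p ->
  pcvg (q \o phi) p.
Proof.
move=> kphi xv e e0; have [N _ HN] := xv e e0; exists N => // k /= Nk.
by apply: HN => /=; exact: leq_trans Nk (kphi k).
Qed.

Lemma vcvg_pcvg (x : nat -> V) (q : nat -> pspace V) v p : v != 0 ->
  v \in (p : {vspace V}) -> (forall k, x k \in (q k : {vspace V})) -> vcvg x v ->
  pcvg q p.
Proof.
move=> v0 vp xq xv e e0; have [d d0 dP] := near_mdist v0 e0.
near=> k; have [|//] := dP p (q k) (x k) vp (xq k).
by near: k; exact: xv.
Unshelve. all: by end_near. Qed.

Lemma pcvg_unique (q : nat -> pspace V) p p' : pcvg q p -> pcvg q p' -> p = p'.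
Proof.
move=> qp qp'; apply: mdist_positivity; apply/le_anti; rewrite mdist_ge0 andbT.
apply: le_eps => e e0; rewrite add0r; have e2 : 0 < e / 2 by rewrite divr_gt0.
near \oo => k; rewrite (le_trans (metric_triangle _ (q k) _))// [leRHS]splitr lerD//.
  by rewrite metric_sym ltW//; near: k; exact: qp.
by rewrite ltW//; near: k; exact: qp'.
Unshelve. all: by end_near. Qed.

Definition hyper_of_subproof p : (\dim (orthov dotp p)).+1 == n.
Proof.
have := codim_orthov [:: pvec p]; rewrite span_seq1 -proj_pvec /= addn1 => H.
rewrite eqn_leq H andbT.
have D : (p :&: orthov dotp p = 0)%VS.
  apply/eqP; rewrite -subv0; apply/subvP => v /memv_capP[vp /mem_orthovP vo].
  by rewrite memv0 -dotp_eq0 vo.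
have := dimvS (subvf (p + orthov dotp p)).
by rewrite dimv_disjoint_sum// dim_proj add1n.
Qed.

Definition hyper_of p : hyperplane V := Hyperplane (hyper_of_subproof p).

Lemma hyper_ofK p : hnormal (hyper_of p) = p.
Proof.
apply: (pspace_eqP (pvec_neq0 p)); last exact: memv_pick.
by apply/orthov_dotP => w /orthov_dotP wp; rewrite dotpC wp// memv_pick.
Qed.

Lemma hnormalK H : hyper_of (hnormal H) = H.
Proof.
apply: val_inj; apply/esym/eqP; rewrite eqEdim.
have /eqP D1 := valP H; have /eqP D2 := valP (hyper_of (hnormal H)).
have -> : \dim (val (hyper_of (hnormal H))) = \dim (val H) by apply: succn_inj; rewrite D1.
rewrite leqnn andbT.
by apply/subvP => v vH; apply/orthov_dotP => w /orthov_dotP wH; rewrite dotpC wH.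
Qed.

Lemma pspace_bw (q : nat -> pspace V) : exists2 phi : nat -> nat,
  forall k, (k <= phi k)%N & exists p, pcvg (q \o phi) p.
Proof.
have /choice[u uP] : forall k, exists v, enorm v = 1 /\ v \in (q k : {vspace V}).
  by move=> k; have [v v1 vq] := pspace_unit (q k); exists v.
have [|phi kphi [v uv]] := @bolzano_weierstrass1 R V u 1.
  by move=> k; have [->] := uP k.
exists phi => //; have v1 : enorm v = 1.
  have := vcvg_enorm uv; rewrite (_ : (fun _ => _) = fun=> 1); last first.
    by apply/funext => k; have [] := uP (phi k).
  by move=> /(cvg_unique _ (@cvg_cst _ _ _ _ _))->.
exists (pt (unit_neq0 v1)); apply: vcvg_pcvg (mem_pt _) _ uv; first exact: unit_neq0.
by move=> k; have [] := uP (phi k).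
Qed.

Lemma pcluster (q : nat -> pspace V) p : cluster (q @ \oo) p <->
  forall e N, 0 < e -> exists2 k, (N <= k)%N & mdist (q k) p < e.
Proof.
split=> [qp e N e0|H A B].
  have [] := qp [set x | exists2 k, (N <= k)%N & q k = x] (ball p e).
  - by exists N => //= k Nk; exists k.
  - exact: nbhsx_ballx.
  by move=> x [[k Nk <-]]; rewrite ballEmdist /= metric_sym; exists k.
move=> [N _ NA] /nbhs_ballP[e /= e0 eB]; have [k Nk kp] := H e N e0.
by exists (q k); split; [exact: NA|apply: eB; rewrite ballEmdist /= metric_sym].
Qed.

(** Hyperplanes are compared through their normals, which is how they are
    topologized. *)
Lemma fcluster (G : nat -> flag V) (F : flag V) : cluster (G @ \oo) F <->
  forall e N, 0 < e -> exists2 k, (N <= k)%N &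
    mdist (G k).1 F.1 < e /\ mdist (hnormal (G k).2) (hnormal F.2) < e.
Proof.
split=> [GF e N e0|H A B].
  have [] := GF [set x | exists2 k, (N <= k)%N & G k = x]
    (ball F.1 e `*` (@hnormal R V @^-1` ball (hnormal F.2) e)).
  - by exists N => //= k Nk; exists k.
  - exists (ball F.1 e, @hnormal R V @^-1` ball (hnormal F.2) e) => //=.
    split; first exact: nbhsx_ballx.
    by apply: (@initial_continuous _ _ (@hnormal R V) F.2); exact: nbhsx_ballx.
  by move=> x [[k Nk <-]] []; rewrite /= !ballEmdist /= metric_sym [mdist (hnormal _) _]metric_sym; exists k.
move=> [N _ NA] [[B1 B2] /= [/nbhs_ballP[e /= e0 eB]]].
rewrite nbhsE => -[B3 [[B4 B4o B43] FB3] B32] B12.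
have /nbhs_ballP[e' /= e'0 eB'] : nbhs (hnormal F.2) B4.
  by apply: open_nbhs_nbhs; split=> //; rewrite -B43 in FB3.
have [|k Nk [k1 k2]] := H (Num.min e e') N; first by rewrite lt_min e0.
exists (G k); split; first exact: NA.
apply: B12; split => /=.
  by apply: eB; rewrite ballEmdist /= metric_sym (lt_le_trans k1)// ge_min lexx.
apply: B32; rewrite -B43; apply: eB'.
by rewrite ballEmdist /= metric_sym (lt_le_trans k2)// ge_min lexx orbT.
Qed.

End ProjectiveTopology.

Section SingularFlags.
Context {R : realType} {V : euclidType R}.
Implicit Types (u v w : V) (p q : pspace V) (x : PGL V) (F : flag V).
Local Notation n := (\dim {:V}).

(** The decomposition of the inverse is read backwards. *)
Lemma is_svd_inv (g : 'End(V)) (u : seq V) (a : seq R) (v : seq V) : lker g = 0%VS ->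
  is_svd g u a v -> (forall i, (i < n)%N -> 0 < a`_i) ->
  is_svd (g^-1)%VF (rev v) (rev [seq t^-1 | t <- a]) (rev u).
Proof.
move=> g0 [/orthonormal_basisP[uo un] /orthonormal_basisP[vo vn] an [/(sortedP 0) sa _] gv] a0.
have revo (s : seq V) : size s = n -> orthoseq s -> orthoseq (rev s).
  move=> sn so i j; rewrite size_rev => si sj; rewrite !nth_rev//.
  have -> : (i == j) = (size s - i.+1 == size s - j.+1)%N.
    by apply/eqP/eqP => [->//|]; clear -si sj; lia.
  by apply: so; rewrite ltn_subrL (leq_ltn_trans _ si).
have aE i : (i < n)%N -> (rev [seq t^-1 | t <- a])`_i = (a`_(n - i.+1)%N)^-1.
  move=> ni; rewrite nth_rev size_map an// (nth_map 0) ?an//; lia.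
split.
- by apply/orthonormal_basisP; rewrite size_rev; split=> //; exact: revo.
- by apply/orthonormal_basisP; rewrite size_rev; split=> //; exact: revo.
- by rewrite size_rev size_map.
- split.
    apply/(sortedP 0) => i; rewrite size_rev size_map an => ni.
    rewrite !aE ?(ltnW ni)//=.
    have E : (n - i.+1 = (n - i.+2).+1)%N by lia.
    rewrite lef_pV2 ?posrE ?a0//; [|lia|lia].
    by rewrite E; apply: sa; rewrite an; lia.
  apply/(all_nthP 0) => i; rewrite size_rev size_map an => ni.
  by rewrite aE//= invr_ge0 ltW// a0//; lia.
- move=> i ni; rewrite aE// !nth_rev ?un ?vn//.
  have ni' : (n - i.+1 < n)%N by lia.
  have ai := a0 _ ni'.
  have -> : u`_(n - i.+1)%N = (a`_(n - i.+1)%N)^-1 *: g v`_(n - i.+1)%N.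
    by rewrite gv// scalerA mulVf ?scale1r// gt_eqF.
  by rewrite lfZ lfun_Kinv.
Qed.

Lemma svtop_svd_inv x (u : seq V) (a : seq R) (v : seq V) (g : 'End(V)) : (1 < n)%N ->
  <[g]>%VS = x -> is_svd g u a v -> (forall i, (i < n)%N -> 0 < a`_i) ->
  svtop (g^-1)%VF (a`_n.-1)^-1 (a`_n.-2)^-1 v`_n.-1 u`_n.-1.
Proof.
move=> n1 gx gs a0; have g0 := pgl_line_lker gx.
have := svtop_of_svd (is_svd_inv g0 gs a0) n1.
have [/orthonormal_basisP[_ un] /orthonormal_basisP[_ vn] an _ _] := gs.
rewrite !nth_rev ?size_map ?un ?vn ?an ?(ltnW n1)// !subn1 subn2.
by rewrite !(nth_map 0) ?an ?ltn_predL ?(ltnW n1)// -subn2 ltn_subrL (ltnW n1).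
Qed.

Lemma pgl_svd_gaps x (u : seq V) (a : seq R) (v : seq V) : (1 < n)%N -> pgl_svd x u a v ->
  (0 < alpha1 x -> a`_1 < a`_0) /\ (0 < alpha1 x^-1%g -> a`_n.-1 < a`_n.-2).
Proof.
move=> n1 xs; have [g [gx _ gs]] := xs.
have a0 i : (i < n)%N -> 0 < a`_i := pgl_svd_gt0 xs.
split=> al.
  have [s1 _ ->] := svtop_alpha n1 gx (svtop_of_svd gs n1).
  by rewrite gtr_pMr// expR_lt1 oppr_lt0.
have [s1 s2] := svtop_alpha n1 (pgl_line_inv gx) (svtop_svd_inv n1 gx gs a0).
have lt1 : expR (- alpha1 x^-1%g) < 1 by rewrite expR_lt1 oppr_lt0.
move=> E; have : (a`_n.-2)^-1 < (a`_n.-1)^-1 by rewrite E gtr_pMr.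
by rewrite ltf_pV2 ?posrE -1?invr_gt0.
Qed.

Lemma flag_of_svd x (u : seq V) (a : seq R) (v : seq V) p : (1 < n)%N -> pgl_svd x u a v ->
  a`_1 < a`_0 -> a`_n.-1 < a`_n.-2 -> p = <[u`_0]>%VS :> {vspace V} ->
  exists2 F, is_U1flag x F & F.1 = p.
Proof.
move=> n1 xs a10 an pu; have [g [gx _ [/orthonormal_basisP[uo un] _ _ _ _]]] := xs.
have lt_n : (n.-1 < n)%N by rewrite ltn_predL (ltnW n1).
have un0 : u`_n.-1 != 0.
  by apply: unit_neq0; apply/enorm1P; rewrite uo ?un// eqxx.
exists (p, hyper_of (pt un0)) => //; exists u, a, v; split=> //=.
apply/esym/eqP; rewrite eqEdim; apply/andP; split.
  apply/span_subvP => w /(nthP 0)[i]; rewrite size_take un lt_n => ni <-.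
  rewrite nth_take//; apply/orthov_dotP => y /vlineP[k ->].
  by rewrite dotpZr uo ?un// ?(ltn_trans ni)// (ltn_eqF ni) mulr0.
have /eqP H := hyper_of_subproof (pt un0); rewrite -ltnS H.
have /eqnP -> : free (take n.-1 u).
  apply: orthoseq_free => i j; rewrite size_take un lt_n => ni nj.
  by rewrite !nth_take// uo ?un// (ltn_trans _ lt_n).
by rewrite size_take un lt_n prednK// ltnW.
Qed.

Lemma U1_flag x p : (1 < n)%N -> is_U1 x p -> 0 < alpha1 x^-1%g ->
  exists2 F, is_U1flag x F & F.1 = p.
Proof.
move=> n1 [u [a [v [xs a10 pu]]]] al.
exact: flag_of_svd n1 xs a10 (proj2 (pgl_svd_gaps n1 xs) al) pu.
Qed.

Lemma U1_exists x : (1 < n)%N -> 0 < alpha1 x -> exists p, is_U1 x p.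
Proof.
move=> n1 al; have [u [a [v xs]]] := pgl_svd_exists x.
have [g [gx _ [/orthonormal_basisP[uo un] _ _ _ _]]] := xs.
have u0 : u`_0 != 0.
  by apply: unit_neq0; apply/enorm1P; rewrite uo ?un ?(ltnW n1)// eqxx.
by exists (pt u0), u, a, v; split=> //; exact: (proj1 (pgl_svd_gaps n1 xs)).
Qed.

Lemma U1flag_U1 x F : is_U1flag x F -> is_U1 x F.1.
Proof. by move=> [u [a [v [? ? _ ? _]]]]; exists u, a, v. Qed.

Lemma U1_svtop x p : (1 < n)%N -> is_U1 x p -> exists g s1 s2 u v,
  [/\ <[g]>%VS = x, svtop g s1 s2 u v & u \in (p : {vspace V})].
Proof.
move=> n1 [u [a [v [[g [gx _ gs]] _ pu]]]].
exists g, a`_0, a`_1, u`_0, v`_0; split=> //; first exact: svtop_of_svd.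
by rewrite pu memv_line.
Qed.

(** The hyperplane of the flag is spanned by all the left singular vectors but the
    last one, and the last one is the most expanded direction of the inverse map. *)
Lemma U1flag_svtop x F : (1 < n)%N -> is_U1flag x F -> exists g s1 s2 u v t1 t2 u' v',
  [/\ <[g]>%VS = x, svtop g s1 s2 u v, svtop (g^-1)%VF t1 t2 u' v',
      u \in (F.1 : {vspace V}) /\ v' \in (hnormal F.2 : {vspace V}) & dotp u v' = 0].
Proof.
move=> n1 [u [a [v [xs _ _ F1 F2]]]]; have [g [gx _ gs]] := xs.
have a0 i : (i < n)%N -> 0 < a`_i := pgl_svd_gt0 xs.
exists g, a`_0, a`_1, u`_0, v`_0, (a`_n.-1)^-1, (a`_n.-2)^-1, v`_n.-1, u`_n.-1.
have [/orthonormal_basisP[uo un] _ _ _ _] := gs.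
have lt_n : (n.-1 < n)%N by rewrite ltn_predL (ltnW n1).
split=> //; first exact: svtop_of_svd.
- exact: svtop_svd_inv gx gs a0.
- rewrite F1 memv_line; split=> //; apply/orthov_dotP => w; rewrite F2.
  rewrite -[take _ _]/(val (in_tuple _)) => /coord_span ->.
  rewrite dotp_sumr big1// => i _; rewrite dotpZr.
  have := ltn_ord i; rewrite {2}size_take un lt_n => ni.
  by rewrite nth_take// uo ?un ?(ltn_trans ni)// (gtn_eqF ni) mulr0.
- by rewrite uo ?un// ?(ltnW n1)// (ltn_eqF (_ : 0 < n.-1)%N)// -ltnS prednK// ltnW.
Qed.

End SingularFlags.

(** * Limit sets of points and flags *)

Section FlagLimits.
Context {R : realType} {V : euclidType R}.
Implicit Types (p : pspace V) (F : flag V) (Gam : set (PGL V)).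

Lemma pcvg_pcluster (q : nat -> pspace V) p : pcvg q p -> cluster (q @ \oo) p.
Proof.
move=> qp; apply/pcluster => e N e0; have [M _ MP] := qp e e0.
by exists (maxn N M); [exact: leq_maxl|apply: MP; exact: leq_maxr].
Qed.

Lemma pcluster_sub (q : nat -> pspace V) p N : cluster (q @ \oo) p ->
  exists2 psi : nat -> nat, forall k, (k + N <= psi k)%N & pcvg (q \o psi) p.
Proof.
move=> /pcluster qp.
have /choice[psi psiP] k : exists j, (k + N <= j)%N /\ mdist (q j) p < k.+1%:R^-1.
  by have [|j] := qp k.+1%:R^-1 (k + N)%N; [rewrite invr_gt0|exists j].
exists psi => [k|e e0]; first by case: (psiP k).
exists (Num.truncn e^-1) => // k /= ek; apply: (lt_trans (proj2 (psiP k))).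
rewrite invf_plt ?posrE//; apply: (lt_le_trans (truncnS_gt _)).
by rewrite ler_nat.
Qed.

Lemma escapes_comp (x : nat -> PGL V) (phi : nat -> nat) : (forall k, (k <= phi k)%N) ->
  escapes x -> escapes (x \o phi).
Proof.
by move=> phik xe A /xe[N _ NP]; exists N => // k /= Nk; apply: NP => /=; exact: leq_trans (phik k).
Qed.

Lemma escapes_invg (x : nat -> PGL V) : escapes x -> escapes (fun k => (x k)^-1%g).
Proof.
move=> xe A finA; have := xe _ (finite_image (fun a : PGL V => a^-1%g) finA).
by apply: filterS => k H Ax; apply: H; exists (x k)^-1%g => //; rewrite invgK.
Qed.

(** Normals of hyperplanes lie in a compact projective space. *)
Lemma flag_bw (F : nat -> flag V) p : pcvg (fun k => (F k).1) p ->
  exists2 F', cluster (F @ \oo) F' & F'.1 = p.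
Proof.
move=> Fp; have [phi phik [p' Fp']] := pspace_bw (fun k => hnormal (F k).2).
exists (p, hyper_of p') => //; apply/fcluster => e N e0 /=; rewrite hyper_ofK.
have [M1 _ M1P] := Fp e e0; have [M2 _ M2P] := Fp' e e0.
pose k := maxn N (maxn M1 M2); have := phik k; rewrite {1}/k !geq_max => /andP[k1 /andP[k2 k3]].
exists (phi k) => //; split; first exact: M1P.
by apply: M2P; rewrite /= leq_max leq_max leqnn !orbT.
Qed.

Lemma flag_limit_point Gam F : flag_limit_set Gam F -> limit_set Gam F.1.
Proof.
move=> [x [G [Gx xe xG /fcluster GF]]]; exists x, (fun k => (G k).1); split=> //.
  by move=> k; exact: U1flag_U1.
by apply/pcluster => e N e0; have [k Nk [kF _]] := GF e N e0; exists k.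
Qed.

(** Flags are defined only where the gap of the inverse is positive, hence the shift
    of the sequence before extracting. *)
Lemma limit_flag Gam p : (1 < \dim {:V})%N -> (forall a : PGL V, Gam a -> Gam a^-1%g) ->
  (forall x : nat -> PGL V, (forall k, Gam (x k)) -> escapes x ->
     \forall k \near \oo, 0 < alpha1 (x k)) ->
  limit_set Gam p -> exists2 F, flag_limit_set Gam F & F.1 = p.
Proof.
move=> n1 GV alp [x [q [Gx xe xq qp]]].
have [N _ NP] := alp _ (fun k => GV _ (Gx k)) (escapes_invg xe).
have [psi psik qpsi] := pcluster_sub N qp.
have psik' k : (k <= psi k)%N by exact: leq_trans (leq_addr _ _) (psik k).
have /choice[F FP] k : exists F, is_U1flag (x (psi k)) F /\ F.1 = q (psi k).
  have [|F ? ?] := U1_flag n1 (xq (psi k)); last by exists F.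
  by apply: NP; exact: leq_trans (leq_addl _ _) (psik k).
have [|F' FF' F'p] := @flag_bw F p.
  by rewrite (_ : (fun k => _) = q \o psi)//; apply/funext => k /=; case: (FP k).
exists F' => //; exists (x \o psi), F; split=> //.
- by move=> k; exact: Gx.
- exact: escapes_comp.
- by move=> k; case: (FP k).
Qed.

(** This makes the escaping sequences those along which the gap diverges. *)
Definition alpha1_proper Gam := forall r : R, finite_set [set x | Gam x /\ alpha1 x <= r].

Lemma proper_escapes Gam (x : nat -> PGL V) (r : R) : alpha1_proper Gam ->
  (forall k, Gam (x k)) -> escapes x -> \forall k \near \oo, r < alpha1 (x k).
Proof.
move=> fin Gx xe; have := xe _ (fin r).
by apply: filterS => k H; rewrite ltNge; apply/negP => xr; apply: H.
Qed.

(** Diagonal extraction: properness allows choosing, along each of the sequences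
    defining the points [p k], an element with gap at least [k]. *)
Lemma limit_set_closed Gam (p : nat -> pspace V) q : alpha1_proper Gam ->
  (forall k, limit_set Gam (p k)) -> pcvg p q -> limit_set Gam q.
Proof.
move=> fin Lp pq.
have /choice[y yP] (k : nat) : exists y : PGL V * pspace V,
    [/\ Gam y.1, is_U1 y.1 y.2, mdist y.2 (p k) < k.+1%:R^-1 & k%:R < alpha1 y.1].
  have [x [r [Gx xe xr /pcluster rp]]] := Lp k.
  have [N _ NP] := proper_escapes k%:R fin Gx xe.
  have [|j Nj jp] := rp k.+1%:R^-1 N; first by rewrite invr_gt0.
  by exists (x j, r j); split=> //=; exact: NP.
exists (fun k => (y k).1), (fun k => (y k).2); split.
- by move=> k; case: (yP k).
- move=> A /finite_seqP[s ->]; elim: s => [|a s [N _ NP]]; first by exists 0%N.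
  exists (maxn N (Num.truncn (alpha1 a)).+1) => // k /=; rewrite geq_max => /andP[Nk ka].
  rewrite inE => /orP[/eqP ya|]; last exact: NP.
  have [_ _ _] := yP k; rewrite ya ltNge => /negP; apply.
  by apply/ltW/(lt_le_trans (truncnS_gt _)); rewrite ler_nat.
- by move=> k; case: (yP k).
apply: pcvg_pcluster => e e0; have e2 : 0 < e / 2 by rewrite divr_gt0.
have [N _ NP] := pq _ e2.
exists (maxn N (Num.truncn (e / 2)^-1)) => // k /=; rewrite geq_max => /andP[Nk ke].
have [_ _ yp _] := yP k; have tri := metric_triangle (y k).2 (p k) q; apply: (le_lt_trans tri).
rewrite [e]splitr ltrD//; last exact: NP.
apply: (lt_trans yp); rewrite invf_plt ?posrE//; apply: (lt_le_trans (truncnS_gt _)).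
by rewrite ler_nat.
Qed.

End FlagLimits.

(** * The cone over a proper convex domain *)

Section Cone.
Context {R : realType} {V : euclidType R} (f : {scalar V}) (Omega : set (pspace V)).
Context (Om : proper_convex_domain f Omega).
Implicit Types (u v w x y z : V) (p q : pspace V).

Lemma fD x y : f (x + y) = f x + f y. Proof. exact: linearD. Qed.
Lemma fB x y : f (x - y) = f x - f y. Proof. exact: linearB. Qed.
Lemma fZ (a : R) x : f (a *: x) = a * f x. Proof. exact: linearZ. Qed.
Lemma f0 : f 0 = 0. Proof. exact: linear0. Qed.

(** The domain is replaced by the open convex cone over it, on the positive side of
    the chart; linear algebra in the cone replaces projective geometry. *)
Definition cone : set V := [set v | 0 < f v /\ exists2 p, Omega p & v \in (p : {vspace V})].
Definition ccone : set V := [set v | forall e : R, 0 < e -> exists2 w, cone w & enorm (w - v) < e].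

Lemma aff_mem p : aff f p \in (p : {vspace V}).
Proof. by rewrite memvZ// memv_pick. Qed.

Lemma f_aff p : chart f p -> f (aff f p) = 1.
Proof. by move=> fp; rewrite fZ mulVf. Qed.

Lemma f_aff_chart p : f (aff f p) != 0 -> chart f p.
Proof. by apply: contraNN => /eqP fp; rewrite /aff fp invr0 scale0r f0. Qed.

Lemma aff_eq p v : v \in (p : {vspace V}) -> f v != 0 -> aff f p = (f v)^-1 *: v.
Proof.
move=> vp fv; have v0 : v != 0 by apply: contraNneq fv => ->; rewrite f0.
have [k pE] := pspace_line v0 vp (memv_pick p).
rewrite /aff /pvec pE fZ invfM scalerA; congr (_ *: _).
have k0 : k != 0.
  by apply: contra_neq (pvec_neq0 p) => k0; rewrite /pvec pE k0 scale0r.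
by rewrite mulrAC mulVf// mul1r.
Qed.

Lemma chartP p v : v \in (p : {vspace V}) -> f v != 0 -> chart f p.
Proof.
move=> vp fv; apply: f_aff_chart; rewrite (aff_eq vp fv) fZ mulVf ?oner_eq0//.
Qed.

Lemma aff_neq0 p : chart f p -> aff f p != 0.
Proof. by move=> /f_aff f1; apply/eqP => p0; move: f1; rewrite p0 f0 => /eqP; rewrite eq_sym oner_eq0. Qed.

Lemma aff_inj p q : chart f p -> aff f p = aff f q -> p = q.
Proof.
move=> cp E; apply: (pspace_eqP (aff_neq0 cp) (aff_mem p)).
by rewrite E aff_mem.
Qed.

Lemma Omega_chart p : Omega p -> chart f p.
Proof. by have [_ _ H _ _] := Om; exact: H. Qed.

Lemma cone_aff p : Omega p -> cone (aff f p).
Proof.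
move=> Op; split; first by rewrite (f_aff (Omega_chart Op)).
by exists p => //; exact: aff_mem.
Qed.

Lemma cone_neq0 v : cone v -> v != 0.
Proof. by move=> [fv _]; apply: contraTneq fv => ->; rewrite f0 ltxx. Qed.

Lemma cone_Omega v p : cone v -> v \in (p : {vspace V}) -> Omega p.
Proof. by move=> cv vp; have [_ [q Oq vq]] := cv; rewrite (pspace_eqP (cone_neq0 cv) vp vq). Qed.

Lemma Omega_cone p v : Omega p -> v \in (p : {vspace V}) -> 0 < f v -> cone v.
Proof. by move=> Op vp fv; split=> //; exists p. Qed.

Lemma OmegaE p : chart f p -> Omega p <-> cone (aff f p).
Proof. by move=> cp; split=> [/cone_aff//|/cone_Omega]; apply; exact: aff_mem. Qed.

Lemma coneZ (a : R) v : 0 < a -> cone v -> cone (a *: v).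
Proof. by move=> a0 [fv [p Op vp]]; split; [rewrite fZ mulr_gt0|exists p => //; exact: memvZ]. Qed.

Lemma coneD v w : cone v -> cone w -> cone (v + w).
Proof.
move=> [fv [p Op vp]] [fw [q Oq wq]]; have fvw : 0 < f (v + w) by rewrite fD addr_gt0.
have vw0 : v + w != 0 by apply: contraTneq fvw => ->; rewrite f0 ltxx.
split=> //; exists (pt vw0); last exact: mem_pt.
have [_ _ _ Oc _] := Om; apply: (Oc p q) => //; split.
  by apply: chartP (mem_pt _) _; rewrite gt_eqF.
exists (f w / f (v + w)).
  rewrite in_itv /= divr_ge0 ?(ltW fw) ?(ltW fvw)//= ler_pdivrMr// mul1r fD lerDr.
  exact: ltW.
rewrite (aff_eq (mem_pt vw0)) ?(aff_eq vp) ?(aff_eq wq) ?gt_eqF//.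
rewrite scalerDr !scalerA fD; move: (f v) (f w) fv fw => a b a0 b0.
have ab0 : a + b != 0 by rewrite gt_eqF// addr_gt0.
congr (_ *: _ + _ *: _); last by rewrite mulrAC mulfV ?mul1r ?gt_eqF.
have -> : 1 - b / (a + b) = a / (a + b) by rewrite -{1}(divff ab0) -mulrBl addrK.
by rewrite mulrAC mulfV ?mul1r ?gt_eqF.
Qed.

Lemma f_bounded : exists2 B : R, 0 < B & forall v, `|f v| <= B * enorm v.
Proof. exact: functional_bounded. Qed.

Lemma cone_open v : cone v -> exists2 d : R, 0 < d & forall w, enorm (w - v) < d -> cone w.
Proof.
move=> cv; have [fv [p Op vp]] := cv; have [Oo _ _ _ _] := Om.
have /nbhs_ballP[e /= e0 eO] : nbhs p Omega by apply: open_nbhs_nbhs.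
have [d d0 dP] := near_mdist (cone_neq0 cv) e0; have [B B0 fB'] := f_bounded.
exists (Num.min d (f v / B)); first by rewrite lt_min d0 divr_gt0.
move=> w; rewrite lt_min => /andP[wd wB].
have fw : 0 < f w.
  rewrite -[w](subrK v) fD; have := le_lt_trans (fB' (w - v)).
  move=> /(_ (f v)); rewrite mulrC -ltr_pdivlMr// => /(_ wB).
  by rewrite ltr_norml; lra.
have w0 : w != 0 by apply: contraTneq fw => ->; rewrite f0 ltxx.
split=> //; exists (pt w0); last exact: mem_pt.
apply: eO; rewrite ballEmdist /= metric_sym.
by have [] := dP p (pt w0) w vp (mem_pt _) wd.
Qed.

Lemma cone_bounded : exists2 M : R, 0 < M & forall v, cone v -> enorm v <= M * f v.
Proof.
have [_ _ _ _ [M MP]] := Om; exists (`|M| + 1); first by rewrite ltr_wpDl.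
move=> v [fv [p Op vp]]; have := MP p Op; rewrite (aff_eq vp) ?gt_eqF// enormZ.
rewrite ger0_norm ?invr_ge0 ?(ltW fv)// ler_pdivrMl// mulrC => /le_trans; apply.
by rewrite ler_wpM2r ?(ltW fv)//; have := ler_norm M; lra.
Qed.

Lemma cone_ccone v : cone v -> ccone v.
Proof. by move=> cv e e0; exists v => //; rewrite subrr enorm0. Qed.

Lemma cconeD v w : ccone v -> ccone w -> ccone (v + w).
Proof.
move=> cv cw e e0; have e2 : 0 < e / 2 by rewrite divr_gt0.
have [v' cv' vv'] := cv _ e2; have [w' cw' ww'] := cw _ e2.
exists (v' + w'); first exact: coneD.
by rewrite opprD addrACA (le_lt_trans (enormD _ _))// [ltRHS]splitr ltrD.
Qed.

Lemma ccone_lim v : (forall e : R, 0 < e -> exists2 w, ccone w & enorm (w - v) < e) -> ccone v.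
Proof.
move=> H e e0; have e2 : 0 < e / 2 by rewrite divr_gt0.
have [w cw wv] := H _ e2; have [x cx xw] := cw _ e2; exists x => //.
by rewrite (le_lt_trans (enorm_triangle w _ _))// [ltRHS]splitr ltrD.
Qed.

Lemma vcvg_ccone (x : nat -> V) v : vcvg x v -> (forall k, ccone (x k)) -> ccone v.
Proof.
move=> xv cx; apply: ccone_lim => e e0; near \oo => k; exists (x k) => //.
by near: k; exact: xv.
Unshelve. all: by end_near. Qed.

Lemma cone_nonempty : exists v, cone v /\ f v = 1.
Proof.
have [_ [p Op] _ _ _] := Om; exists (aff f p).
by split; [exact: cone_aff|exact/f_aff/Omega_chart].
Qed.

Lemma ccone0 : ccone 0.
Proof.
move=> e e0; have [v [cv _]] := cone_nonempty.
have vn : 0 < enorm v by rewrite enorm_gt0 cone_neq0.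
have d0 : 0 < e / 2 / enorm v by rewrite !divr_gt0.
exists ((e / 2 / enorm v) *: v); first exact: coneZ.
by rewrite subr0 enormZ ger0_norm ?(ltW d0)// divfK ?gt_eqF//; lra.
Qed.

Lemma cconeZ (a : R) v : 0 <= a -> ccone v -> ccone (a *: v).
Proof.
rewrite le_eqVlt => /predU1P[<- _|a0 cv e e0]; first by rewrite scale0r; exact: ccone0.
have [w cw wv] := cv (e / a) (divr_gt0 e0 a0); exists (a *: w); first exact: coneZ.
by rewrite -scalerBr enormZ gtr0_norm// mulrC -ltr_pdivlMr.
Qed.

Lemma cone_cconeD v w : cone v -> ccone w -> cone (v + w).
Proof.
move=> cv cw; have [d d0 dP] := cone_open cv; have [w' cw' ww'] := cw _ d0.
rewrite (_ : v + w = (v + (w - w')) + w'); last by rewrite addrA subrK.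
by apply: coneD => //; apply: dP; rewrite addrAC subrr add0r enorm_dist.
Qed.

Lemma ccone_bounded : exists2 M : R, 0 < M & forall v, ccone v -> enorm v <= M * f v.
Proof.
have [M M0 MP] := cone_bounded; have [B B0 fB'] := f_bounded.
exists M => // v cv; apply: le_eps => e e0.
have d0 : 0 < e / (1 + M * B) by rewrite divr_gt0// ltr_wpDr// mulr_ge0// ltW.
have [w cw wv] := cv _ d0; have := MP _ cw => wM.
have := enorm_triangle w v 0; rewrite !subr0 enorm_dist => T.
have := fB' (w - v); rewrite fB => F; have {F}F := le_trans (ler_norm _) F.
rewrite ltr_pdivlMr ?ltr_wpDr ?mulr_ge0 ?(ltW M0) ?(ltW B0)// in wv.
have F2 := ler_wpM2l (ltW M0) F.
have : M * f w <= M * f v + M * (B * enorm (w - v)) by move: F2; rewrite mulrBr; lra.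
by move: T wM wv; rewrite mulrA mulrDr mulr1 [enorm (w - v) * _]mulrC; lra.
Qed.

Lemma ccone_f v : ccone v -> 0 <= f v.
Proof.
by move=> cv; have [M M0 /(_ v cv)] := ccone_bounded; have := enorm_ge0 v => v0 vM;
  rewrite -(pmulr_rge0 _ M0) (le_trans v0).
Qed.

Lemma ccone_f0 v : ccone v -> f v = 0 -> v = 0.
Proof.
move=> cv fv; have [M M0 /(_ v cv)] := ccone_bounded; rewrite fv mulr0 => vM.
by apply/eqP; rewrite -enorm_eq0 eq_le vM enorm_ge0.
Qed.

(** A limit of lines of the cone could a priori have its cone vectors escape to the
    kernel of the chart functional; properness, that is [cone_bounded], forbids it. *)
Lemma closureP p : closure Omega p <-> chart f p /\ ccone (aff f p).
Proof.
split=> [cp|[cp ca]].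
  have [v v1 vp] := pspace_unit p; have v0 := unit_neq0 v1.
  have cv : ccone v \/ ccone (- v).
    apply: contrapT => /not_orP[n1 n2].
    have ex w : ~ ccone w -> exists2 e : R, 0 < e & forall z, cone z -> e <= enorm (z - w).
      move=> nw; apply: contrapT => H; apply: nw => e e0; apply: contrapT => H'.
      apply: H; exists e => // z cz; rewrite leNgt; apply/negP => zw.
      by apply: H'; exists z.
    have [e1 e10 H1] := ex _ n1; have [e2 e20 H2] := ex _ n2.
    have e0 : 0 < Num.min e1 e2 by rewrite lt_min e10.
    have [d d0 dP] := @near_unit R V _ e0.
    have [q [Oq]] := cp _ (nbhsx_ballx p d d0); rewrite ballEmdist /= metric_sym => qp.
    have [w [w1 wq]] := dP p q v qp v1 vp; rewrite lt_min => /andP[we1 we2].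
    have fw : f w != 0.
      have := Omega_chart Oq; apply: contraNN => /eqP fw.
      have [k pE] := pspace_line (unit_neq0 w1) wq (memv_pick q).
      by rewrite /pvec pE fZ fw mulr0.
    case: (ltrP 0 (f w)) => fw0.
      by have := H1 w (Omega_cone Oq wq fw0); rewrite leNgt we1.
    have cNw : cone (- w).
      apply: (Omega_cone Oq); first by rewrite memvN.
      by rewrite -scaleN1r fZ mulN1r oppr_gt0 lt_neqAle fw.
    by have := H2 _ cNw; rewrite -opprD enormN leNgt we2.
  have cc w : w != 0 -> ccone w -> w \in (p : {vspace V}) -> chart f p /\ ccone (aff f p).
    move=> w0 cw wp; have fw : 0 < f w.
      by rewrite lt_def ccone_f// andbT; apply: contra_neq w0; exact: ccone_f0.
    split; first by apply: chartP wp _; rewrite gt_eqF.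
    by rewrite (aff_eq wp) ?gt_eqF//; apply: cconeZ => //; rewrite invr_ge0 ltW.
  by case: cv => cv; [exact: (cc v)|apply: (cc (- v)); rewrite ?oppr_eq0 ?memvN].
move=> B /nbhs_ballP[e /= e0 eB]; have [d d0 dP] := near_mdist (aff_neq0 cp) e0.
have [w cw wd] := ca _ d0; have w0 := cone_neq0 cw.
exists (pt w0); split; first exact: cone_Omega cw (mem_pt _).
apply: eB; rewrite ballEmdist /= metric_sym.
by have [] := dP p (pt w0) w (aff_mem p) (mem_pt _) wd.
Qed.

Lemma frontierP p : frontier Omega p <->
  [/\ chart f p, ccone (aff f p) & ~ cone (aff f p)].
Proof.
have [Oo _ _ _ _] := Om; rewrite /frontier (proj1 (interior_id _) Oo).
split=> [[/closureP[cp ca] nO]|[cp ca nc]].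
  by split=> //; rewrite -OmegaE.
by split; [exact/closureP|rewrite /= OmegaE].
Qed.

(** The parameters at which the affine line through [x] and [y] enters and leaves the
    cone. *)
Definition chord x y (s t : R) := [/\ f x = 1, f y = 1, x <> y, s < t &
  forall r : R, (cone ((1 - r) *: x + r *: y) <-> s < r < t) /\
            (ccone ((1 - r) *: x + r *: y) <-> s <= r <= t)].

Let LB x y (r r' : R) :
  ((1 - r) *: x + r *: y) - ((1 - r') *: x + r' *: y) = (r - r') *: (y - x).
Proof.
rewrite opprD addrACA -!scalerBl (_ : 1 - r - (1 - r') = - (r - r')); last by ring.
by rewrite scaleNr scalerBr addrC.
Qed.

Let Lmid x y (r t : R) : t != 0 ->
  (1 - r) *: x + r *: y = (1 - r / t) *: x + (r / t) *: ((1 - t) *: x + t *: y).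
Proof.
move=> t0; rewrite scalerDr !scalerA divfK// addrA -scalerDl; congr (_ *: _ + _).
by rewrite mulrBr divfK//; ring.
Qed.

(** The exit parameter is the supremum of the parameters in the cone, finite because
    the cone is bounded in the chart. *)
Let ray x y : cone x -> f x = 1 -> f y = 1 -> x <> y -> exists2 t : R, 0 < t &
  forall r : R, 0 <= r -> (cone ((1 - r) *: x + r *: y) <-> r < t) /\
                      (ccone ((1 - r) *: x + r *: y) <-> r <= t).
Proof.
move=> cx fx fy xy; pose L r := (1 - r) *: x + r *: y.
have fL r : f (L r) = 1 by rewrite fD !fZ fx fy; ring.
have yx : 0 < enorm (y - x) by rewrite enorm_gt0 subr_eq0; apply/eqP => /esym.
have L0 : L 0 = x by rewrite /L subr0 scale1r scale0r addr0.
have K2 s t : 0 <= s -> s < t -> ccone (L t) -> cone (L s).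
  move=> s0 st ct; have t0 : 0 < t := le_lt_trans s0 st.
  rewrite /L (Lmid _ _ _ (lt0r_neq0 t0)); apply: cone_cconeD.
    by apply: coneZ => //; rewrite subr_gt0 ltr_pdivrMr// mul1r.
  by apply: cconeZ => //; rewrite divr_ge0// ltW.
have [M M0 MP] := ccone_bounded.
pose E := [set t | 0 <= t /\ ccone (L t)].
have ubE : ubound E ((M + enorm x) / enorm (y - x)).
  move=> t [t0 /MP]; rewrite fL mulr1 => Lt; rewrite ler_pdivlMr//.
  have := enorm_triangle (L 0) (L t) 0; have := enorm_triangle (L t) (L t) (L 0).
  rewrite subrr enorm0 add0r => _; have := enormB (L t) (L 0).
  by rewrite LB subr0 enormZ ger0_norm// L0; lra.
have hE : has_sup E.
  split; last by exists ((M + enorm x) / enorm (y - x)).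
  by exists 0; split=> //; rewrite L0; exact: cone_ccone.
set t1 := sup E.
have leE t : 0 <= t -> ccone (L t) -> t <= t1 by move=> t0 ct; apply: (ub_le_sup (proj2 hE)).
have gtE t : 0 <= t -> cone (L t) -> t < t1.
  move=> t0 ct; have [d d0 dP] := cone_open ct.
  have e0 : 0 < d / 2 / enorm (y - x) by rewrite !divr_gt0.
  rewrite (@lt_le_trans _ _ (t + d / 2 / enorm (y - x))) ?ltrDl//.
  apply: leE; first by rewrite addr_ge0// ltW.
  apply/cone_ccone/dP; rewrite LB addrAC subrr add0r enormZ (ger0_norm (ltW e0)).
  by rewrite divfK ?gt_eqF//; lra.
have t10 : 0 < t1 by apply: gtE; rewrite ?L0.
have ltE t : 0 <= t -> t < t1 -> cone (L t).
  move=> t0 tt1; have e0 : 0 < t1 - t by rewrite subr_gt0.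
  have [t' [t'0 ct']] := sup_adherent e0 hE; rewrite -/t1 => tt'.
  by apply: (K2 t t') => //; move: tt'; lra.
have ct1 : ccone (L t1).
  apply: ccone_lim => e e0; have e1 : 0 < e / enorm (y - x) by rewrite divr_gt0.
  have [t' [t'0 ct']] := sup_adherent e1 hE; rewrite -/t1 => tt'; exists (L t') => //.
  rewrite LB enormZ ler0_norm ?subr_le0 ?leE// -ltr_pdivlMr//; move: tt'; lra.
exists t1 => // r r0; split; split=> [|rt]; [exact: gtE|exact: ltE|exact: leE|].
have [->//|rt1] := eqVneq r t1; apply: cone_ccone; apply: ltE => //.
by rewrite lt_neqAle rt1.
Qed.

Lemma chord_exists x y : cone x -> f x = 1 -> f y = 1 -> x <> y ->
  exists s t : R, s < 0 < t /\ chord x y s t.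
Proof.
move=> cx fx fy xy; have [t t0 tP] := ray cx fx fy xy.
have f2 : f (2 *: x - y) = 1 by rewrite fB fZ fx fy; ring.
have xy2 : x <> 2 *: x - y.
  move=> E; apply: xy; have -> : y = 2 *: x - x by rewrite {2}E opprB addrC subrK.
  by rewrite scaler_nat mulr2n addrK.
have [s s0 sP] := ray cx fx f2 xy2.
exists (- s), t; rewrite oppr_lt0 s0 t0; split=> //; split=> //; first lra.
move=> r; have [r0|r0] := leP 0 r.
  have [H1 H2] := tP r r0; split; split.
  - by move=> /H1 ?; apply/andP; split; lra.
  - by move=> /andP[_ ?]; apply/H1.
  - by move=> /H2 ?; apply/andP; split; lra.
  - by move=> /andP[_ ?]; apply/H2.
have rN : 0 <= - r by lra.
have [] := sP _ rN.
have -> : (1 - - r) *: x + - r *: (2 *: x - y) = (1 - r) *: x + r *: y.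
  by rewrite scalerBr scalerA addrA -scalerDl -[- (- r *: y)]scaleNr opprK; congr (_ *: _ + _); ring.
move=> H1 H2; split; split.
- by move=> /H1 ?; apply/andP; split; lra.
- by move=> /andP[? _]; apply/H1; lra.
- by move=> /H2 ?; apply/andP; split; lra.
- by move=> /andP[? _]; apply/H2; lra.
Qed.

End Cone.

(** * The Hilbert metric as an order relation *)

Section HilbertMetric.
Context {R : realType} {V : euclidType R} (f : {scalar V}) (Omega : set (pspace V)).
Context (Om : proper_convex_domain f Omega).
Implicit Types (u v w x y z : V) (p q : pspace V).
Local Notation cone := (cone f Omega).
Local Notation ccone := (ccone f Omega).
Local Notation chord := (chord f Omega).
Local Notation hilb := (hilbert f Omega).

Lemma chordB x y (r r' : R) :
  ((1 - r) *: x + r *: y) - ((1 - r') *: x + r' *: y) = (r - r') *: (y - x).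
Proof.
rewrite opprD addrACA -!scalerBl (_ : 1 - r - (1 - r') = - (r - r')); last by ring.
by rewrite scaleNr scalerBr addrC.
Qed.

Lemma chord_comp x y (a b r : R) :
  (1 - r) *: ((1 - a) *: x + a *: y) + r *: ((1 - b) *: x + b *: y) =
  (1 - (a + r * (b - a))) *: x + (a + r * (b - a)) *: y.
Proof.
rewrite !scalerDr !scalerA addrACA -!scalerDl.
by congr (_ *: _ + _ *: _); ring.
Qed.

Lemma f_chord x y (r : R) : f x = 1 -> f y = 1 -> f ((1 - r) *: x + r *: y) = 1.
Proof. by move=> fx fy; rewrite fD !fZ fx fy; ring. Qed.

Lemma pt_aff v (v0 : v != 0) : f v = 1 -> aff f (pt v0) = v.
Proof. by move=> fv; rewrite (aff_eq (mem_pt v0)) fv ?oner_eq0// invr1 scale1r. Qed.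

Lemma f1_neq0 v : f v = 1 -> v != 0.
Proof. by move=> fv; apply/eqP => v0; move: fv; rewrite v0 f0 => /eqP; rewrite eq_sym oner_eq0. Qed.

(** Enters the cross-ratio with the end points of the chord. *)
Lemma hilbert_chord x y s t a b p q : chord x y s t -> s < a -> a < b -> b < t ->
  aff f p = (1 - a) *: x + a *: y -> aff f q = (1 - b) *: x + b *: y ->
  hilb p q = 2^-1 * ln ((b - s) * (t - a) / ((a - s) * (t - b))).
Proof.
move=> xyst; have [fx fy xy st cP] := xyst => sa ab bt pE qE.
pose L (r : R) := (1 - r) *: x + r *: y.
have yx : 0 < enorm (y - x) by rewrite enorm_gt0 subr_eq0; apply/eqP => /esym.
have [Ls Lt] : ccone (L s) /\ ccone (L t) by split; apply/(proj2 (cP _)); lra.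
have frE (c : pspace V) (r : R) : aff f c = L r -> frontier Omega c -> r = s \/ r = t.
  move=> cE /(frontierP Om)[_]; rewrite cE => /(proj2 (cP r))/andP[sr rt] nr.
  have [->|rs] := eqVneq r s; first by left.
  have [->|rt'] := eqVneq r t; first by right.
  by case: nr; apply/(proj1 (cP r)); rewrite !lt_neqAle sr rt eq_sym rs rt'.
have fr (r : R) (r0 : L r != 0) : (r = s \/ r = t) -> frontier Omega (pt r0).
  move=> rst; apply/(frontierP Om); rewrite pt_aff ?f_chord//; split.
  - by apply: (chartP (mem_pt _)); rewrite f_chord ?oner_eq0.
  - by case: rst => ->.
  - by move=> /(proj1 (cP r)); case: rst => ->; rewrite ltxx ?andbF.
have s0 : L s != 0 by apply: f1_neq0; exact: f_chord.
have t0 : L t != 0 by apply: f1_neq0; exact: f_chord.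
have pq : p != q.
  apply/eqP => E; move: pE; rewrite E qE => /eqP; rewrite -subr_eq0 chordB.
  by rewrite scaler_eq0 -enorm_eq0 (gt_eqF yx) orbF subr_eq0 (gt_eqF ab).
have ba : b - a != 0 by rewrite subr_eq0 gt_eqF.
rewrite /hilbert (negbTE pq); set ab' := xget _ _.
have [|f1 f2 [s' s'0 E1] [t' t'0 E2]] := @xgetPex _ (p, q) (line_ends f Omega p q).
  exists (pt s0, pt t0); split; [by apply: fr; left|by apply: fr; right|..].
    exists ((s - a) / (b - a)).
      by rewrite ltr_pdivrMr ?subr_gt0// mul0r subr_lt0.
    by rewrite /= pt_aff ?f_chord// pE qE chord_comp divfK// [a + _]addrC subrK.
  exists ((t - a) / (b - a)).
    by rewrite ltr_pdivlMr ?subr_gt0// mul1r ltrD2r.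
  by rewrite /= pt_aff ?f_chord// pE qE chord_comp divfK// [a + _]addrC subrK.
rewrite -/ab' in f1 f2 E1 E2 *.
have {}E1 : aff f ab'.1 = L s.
  move: E1; rewrite pE qE chord_comp => E; rewrite E.
  have [-> //|X] := frE _ _ E f1; exfalso; move: X.
  have : s' * (b - a) < 0 by rewrite pmulr_llt0// subr_gt0.
  by lra.
have {}E2 : aff f ab'.2 = L t.
  move: E2; rewrite pE qE chord_comp => E; rewrite E.
  have [X|-> //] := frE _ _ E f2; exfalso; move: X.
  have : 1 * (b - a) < t' * (b - a) by rewrite ltr_pM2r// subr_gt0.
  by lra.
rewrite E1 E2 pE qE !chordB !enormZ; congr (_ * ln _).
rewrite !ger0_norm ?subr_ge0 ?(ltW sa) ?(ltW bt)//; try lra.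
have [b1 b2] : a - s != 0 /\ t - b != 0 by split; lra.
by move: (enorm (y - x)) yx => e e0; field; rewrite (gt_eqF e0) b1 b2.
Qed.

(** The order-theoretic description of the Hilbert metric, which makes the
    triangle inequality and the invariance evident. *)
Definition hle x y (r : R) := exists l m : R,
  [/\ 0 < l, 0 < m, ccone (l *: y - x), ccone (m *: x - y) & l * m <= expR (2 * r)].

Lemma hleZ x y r (a b : R) : 0 < a -> 0 < b -> hle x y r -> hle (a *: x) (b *: y) r.
Proof.
move=> a0 b0 [l [m [l0 m0 cl cm lm]]]; exists (l * a / b), (m * b / a).
rewrite !divr_gt0 ?mulr_gt0//; split=> //.
- by rewrite scalerA divfK ?gt_eqF// mulrC -scalerA -scalerBr; apply: (cconeZ Om) => //; exact: ltW.
- by rewrite scalerA divfK ?gt_eqF// mulrC -scalerA -scalerBr; apply: (cconeZ Om) => //; exact: ltW.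
- by rewrite (_ : _ * _ = l * m)//; field; rewrite !gt_eqF.
Qed.

Lemma hleC x y r : hle x y r -> hle y x r.
Proof. by move=> [l [m [? ? ? ? ?]]]; exists m, l; split=> //; rewrite mulrC. Qed.

Lemma hle_trans y x z r r' : hle x y r -> hle y z r' -> hle x z (r + r').
Proof.
move=> [l [m [l0 m0 cl cm lm]]] [l' [m' [l0' m0' cl' cm' lm']]].
exists (l * l'), (m * m'); rewrite !mulr_gt0//; split=> //.
- have := cconeD Om (cconeZ Om (ltW l0) cl') cl.
  by rewrite scalerBr scalerA addrA subrK.
- have := cconeD Om (cconeZ Om (ltW m0') cm) cm'.
  by rewrite scalerBr scalerA addrA subrK mulrC.
- by rewrite mulrDr expRD mulrACA ler_pM// mulr_ge0// ltW.
Qed.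

Lemma hle_ge0 x y r : cone x -> hle x y r -> 0 <= r.
Proof.
move=> cx [l [m [l0 m0 cl cm lm]]].
have /(ccone_f Om) := cconeD Om (cconeZ Om (ltW l0) cm) cl.
rewrite scalerBr scalerA addrA subrK fB fZ subr_ge0.
have [fx _] := cx => H.
have lm1 : 1 <= l * m by rewrite -subr_ge0 -(pmulr_lge0 _ fx) mulrBl mul1r subr_ge0.
by have := le_trans lm1 lm; rewrite -expR0 ler_expR pmulr_rge0.
Qed.

(** On a chord the best constants [l] and [m] are attained when the differences reach
    the boundary of the cone, that is at the end points of the chord, and their product
    is the cross-ratio. *)
Lemma hilbert_le p q r : Omega p -> Omega q -> hilb p q <= r <-> hle (aff f p) (aff f q) r.
Proof.
move=> Op Oq; have [cp cq] := (cone_aff Om Op, cone_aff Om Oq).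
have [fp fq] := (f_aff (Omega_chart Om Op), f_aff (Omega_chart Om Oq)).
have [E|pq] := eqVneq p q.
  rewrite /hilbert E eqxx; split=> [r0|]; last by apply: hle_ge0; rewrite E in cp.
  exists 1, 1; rewrite scale1r subrr; split=> //; try exact: ccone0 Om.
  by rewrite mulr1 -expR0 ler_expR mulr_ge0.
have xy : aff f p <> aff f q by move=> /(aff_inj (Omega_chart Om Op))/eqP; rewrite (negbTE pq).
have [s [t [/andP[s0 t0] xyst]]] := chord_exists Om cp fp fq xy.
move: (xyst) => [_ _ _ _ cP].
have t1 : 1 < t.
  by have := proj1 (cP 1); rewrite subrr scale0r scale1r add0r => -[/(_ cq)/andP[]].
have L0 : aff f p = (1 - 0) *: aff f p + 0 *: aff f q by rewrite subr0 scale1r scale0r addr0.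
have L1 : aff f q = (1 - 1) *: aff f p + 1 *: aff f q by rewrite subrr scale1r scale0r add0r.
rewrite (hilbert_chord xyst s0 ltr01 t1 L0 L1) subr0 sub0r.
have t10 : 0 < t - 1 by rewrite subr_gt0.
have s00 : 0 < - s by rewrite oppr_gt0.
have s10 : 0 < 1 - s by lra.
set k := (1 - s) * t / _.
have k0 : 0 < k by rewrite divr_gt0 ?mulr_gt0.
have -> : 2^-1 * ln k <= r <-> k <= expR (2 * r).
  rewrite -{2}[k]lnK ?posrE// ler_expR mulrC ler_pdivrMr// mulrC; split=> //.
rewrite (_ : k = (t / (t - 1)) * ((1 - s) / - s)); last first.
  by rewrite mulrACA -invfM /k [t * _]mulrC [(t - 1) * _]mulrC.
have gt1 x y (l : R) : f x = 1 -> f y = 1 -> x <> y -> ccone (l *: y - x) -> 1 < l.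
  move=> fx fy xy' cl; have := ccone_f Om cl; rewrite fB fZ fx fy mulr1 subr_ge0.
  rewrite le_eqVlt => /predU1P[l1|//]; exfalso; apply: xy'.
  have := ccone_f0 Om cl; rewrite fB fZ fx fy mulr1 -l1 subrr scale1r => /(_ erefl)/eqP.
  by rewrite subr_eq0 => /eqP.
have ccl (l : R) : 1 < l -> ccone (l *: aff f q - aff f p) <-> t / (t - 1) <= l.
  move=> l1; have l10 : 0 < l - 1 by rewrite subr_gt0.
  have E : l *: aff f q - aff f p = (l - 1) *:
      ((1 - l / (l - 1)) *: aff f p + (l / (l - 1)) *: aff f q).
    have A : (l - 1) * (l / (l - 1)) = l by rewrite mulrC divfK ?gt_eqF.
    have B : (l - 1) * (1 - l / (l - 1)) = - 1 by rewrite mulrBr A; ring.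
    by move: (aff f p) (aff f q) => x y; rewrite scalerDr !scalerA A B scaleN1r addrC.
  have -> : t / (t - 1) <= l <-> s <= l / (l - 1) <= t.
    have ll : 0 <= l / (l - 1) by rewrite divr_ge0 ?(ltW l10) ?(ltW (lt_trans ltr01 l1)).
    rewrite ler_pdivrMr// ler_pdivrMr// (le_trans (ltW s0) ll) /=.
    by rewrite !mulrBr !mulr1 mulrC; split; lra.
  rewrite E -(proj2 (cP _)); split=> [H|]; last by apply: (cconeZ Om); exact: ltW.
  have := cconeZ Om (ltW (_ : 0 < (l - 1)^-1)) H; rewrite invr_gt0 => /(_ l10).
  by rewrite scalerA mulVf ?gt_eqF// scale1r.
have ccm (m : R) : 1 < m -> ccone (m *: aff f p - aff f q) <-> (1 - s) / - s <= m.
  move=> m1; have m10 : 0 < m - 1 by rewrite subr_gt0.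
  have E : m *: aff f p - aff f q = (m - 1) *:
      ((1 - - (m - 1)^-1) *: aff f p + (- (m - 1)^-1) *: aff f q).
    have A : (m - 1) * (- (m - 1)^-1) = - 1 by rewrite mulrN mulfV ?gt_eqF.
    have B : (m - 1) * (1 - - (m - 1)^-1) = m by rewrite mulrBr A; ring.
    by move: (aff f p) (aff f q) => x y; rewrite scalerDr !scalerA A B scaleN1r.
  have -> : (1 - s) / - s <= m <-> s <= - (m - 1)^-1 <= t.
    have ll : 0 <= (m - 1)^-1 by rewrite invr_ge0 ltW.
    have -> : (- (m - 1)^-1 <= t) = true by rewrite lerNl (le_trans _ ll)// oppr_le0 ltW.
    rewrite andbT lerNr -[X in _ <-> X <= _]mul1r ler_pdivrMr// ler_pdivrMr//.
    by split; lra.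
  rewrite E -(proj2 (cP _)); split=> [H|]; last by apply: (cconeZ Om); exact: ltW.
  have := cconeZ Om (ltW (_ : 0 < (m - 1)^-1)) H; rewrite invr_gt0 => /(_ m10).
  by rewrite scalerA mulVf ?gt_eqF// scale1r.
have tt : 1 < t / (t - 1) by rewrite ltr_pdivlMr//; lra.
have ss : 1 < (1 - s) / - s by rewrite ltr_pdivlMr//; lra.
split=> [kr|[l [m [l0 m0 cl cm lm]]]].
  exists (t / (t - 1)), ((1 - s) / - s); split=> //; rewrite ?(lt_trans ltr01)//.
    exact/ccl.
  exact/ccm.
have l1 := gt1 _ _ _ fp fq xy cl.
have m1 : 1 < m by apply: gt1 cm => // /esym.
apply: le_trans lm; apply: ler_pM; rewrite ?(ltW (lt_trans ltr01 _))//.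
  exact/ccl.
exact/ccm.
Qed.

End HilbertMetric.

(** * Hilbert geodesics *)

Section HilbertGeometry.
Context {R : realType} {V : euclidType R} (f : {scalar V}) (Omega : set (pspace V)).
Context (Om : proper_convex_domain f Omega).
Implicit Types (u v w x y z : V) (p q : pspace V).
Local Notation cone := (cone f Omega).
Local Notation ccone := (ccone f Omega).
Local Notation chord := (chord f Omega).
Local Notation hilb := (hilbert f Omega).
Local Notation hle := (hle f Omega).

Lemma hilb_ge0 p q : Omega p -> Omega q -> 0 <= hilb p q.
Proof.
move=> Op Oq; apply: (hle_ge0 Om (cone_aff Om Op)).
exact/(hilbert_le Om _ Op Oq).
Qed.

Lemma hilbxx p : hilb p p = 0.
Proof. by rewrite /hilbert eqxx. Qed.

Lemma hilb_sym p q : Omega p -> Omega q -> hilb p q = hilb q p.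
Proof.
move=> Op Oq; apply/le_anti/andP; split; apply/(hilbert_le Om) => //; apply: hleC;
  exact/(hilbert_le Om).
Qed.

Lemma hilb_triangle q p r : Omega p -> Omega q -> Omega r ->
  hilb p r <= hilb p q + hilb q r.
Proof.
move=> Op Oq Or; apply/(hilbert_le Om) => //.
by apply: (hle_trans Om (y := aff f q)); apply/(hilbert_le Om).
Qed.

Lemma aff_cont p (e : R) : chart f p -> 0 < e -> exists2 d : R, 0 < d &
  forall q, mdist q p < d -> chart f q /\ enorm (aff f q - aff f p) < e.
Proof.
move=> cp e0; have [v v1 vp] := pspace_unit p; have v0 := unit_neq0 v1.
have fv : f v != 0.
  apply: contraNN cp => /eqP fv; have [k pE] := pspace_line v0 vp (memv_pick p).
  by rewrite /pvec pE fZ fv mulr0.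
have [B B0 fB'] := functional_bounded f.
have nf : 0 < `|f v| by rewrite normr_gt0.
(* near [p] the functional stays at least half as large, whence the constants *)
pose e1 := Num.min (`|f v| / (2 * B)) (e * `|f v| ^+ 2 / (2 * (`|f v| + B + 1))).
have e10 : 0 < e1.
  rewrite lt_min !divr_gt0 ?mulr_gt0 ?exprn_gt0//.
  by rewrite -addrA addr_gt0// addr_gt0.
have [d d0 dP] := @near_unit R V _ e10; exists d => // q qp.
have [w [w1 wq]] := dP p q v qp v1 vp; rewrite lt_min => /andP[we1 we2].
have fwv : `|f w - f v| <= B * enorm (w - v) by rewrite -fB; exact: fB'.
have fw : `|f v| / 2 <= `|f w|.
  have : B * enorm (w - v) < `|f v| / 2.
    by rewrite mulrC -ltr_pdivlMr// -mulrA -invfM.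
  have := ler_distD (f w) (f v) 0; rewrite !subr0 distrC.
  by move: fwv; lra.
have fw0 : f w != 0 by rewrite -normr_gt0 (lt_le_trans _ fw)// divr_gt0.
split; first exact: chartP wq fw0.
rewrite (aff_eq wq fw0) (aff_eq vp fv).
have -> : (f w)^-1 *: w - (f v)^-1 *: v =
    ((f v) * (f w))^-1 *: (f v *: (w - v) - (f w - f v) *: v).
  rewrite [f v *: (w - v)]scalerBr scalerBl opprB addrA subrK scalerBr !scalerA.
  by rewrite invfM; congr (_ *: _ - _ *: _); [rewrite mulrAC mulVf// mul1r|rewrite divfK].
rewrite enormZ normfV normrM.
have nw : 0 < `|f w| by rewrite normr_gt0.
rewrite ltr_pdivrMl ?mulr_gt0//.
have D0 : 0 < `|f v| + B + 1 by rewrite -addrA addr_gt0// addr_gt0.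
have : enorm (f v *: (w - v) - (f w - f v) *: v) <= (`|f v| + B + 1) * enorm (w - v).
  apply: (le_trans (enormB _ _)); rewrite !enormZ v1 mulr1.
  by have := enorm_ge0 (w - v); move: fwv; lra.
move=> /le_lt_trans; apply; rewrite mulrC -ltr_pdivlMr//.
apply: (lt_le_trans we2); rewrite invfM mulrA ler_pM2r ?invr_gt0//.
have -> : e * `|f v| ^+ 2 / 2 = `|f v| * (`|f v| / 2) * e by ring.
by rewrite ler_pM2r// ler_pM2l.
Qed.

(** Arc length on a chord, up to a constant. *)
Definition hfun (s t r : R) : R := 2^-1 * (ln (r - s) - ln (t - r)).

Lemma hfun_mono s t a b : s < a -> a < b -> b < t -> hfun s t a < hfun s t b.
Proof.
move=> sa ab bt; rewrite /hfun ltr_pM2l ?invr_gt0// ltrD// ?ltrN2 ltr_ln ?posrE; lra.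
Qed.

Lemma hfun_surj s t c : s < t -> exists r, [/\ s < r, r < t & hfun s t r = c].
Proof.
move=> st; pose k := expR (2 * c); have k0 : 0 < k := expR_gt0 _.
have k1 : 0 < 1 + k by rewrite addr_gt0.
have ts : 0 < t - s by rewrite subr_gt0.
have E1 : (k * t + s) / (1 + k) - s = k * (t - s) / (1 + k).
  by field; rewrite gt_eqF.
have E2 : t - (k * t + s) / (1 + k) = (t - s) / (1 + k).
  by field; rewrite gt_eqF.
exists ((k * t + s) / (1 + k)); split.
- by rewrite -subr_gt0 E1 divr_gt0// mulr_gt0.
- by rewrite -subr_gt0 E2 divr_gt0.
rewrite /hfun E1 E2 -ln_div ?posrE ?divr_gt0 ?mulr_gt0//.
have -> : k * (t - s) / (1 + k) / ((t - s) / (1 + k)) = k.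
  by field; rewrite !gt_eqF.
by rewrite expRK mulKf.
Qed.

Lemma hilbert_hfun x y s t a b p q : chord x y s t -> s < a -> a <= b -> b < t ->
  aff f p = (1 - a) *: x + a *: y -> aff f q = (1 - b) *: x + b *: y ->
  hilb p q = hfun s t b - hfun s t a.
Proof.
move=> xyst sa; rewrite le_eqVlt => /predU1P[<-|ab] bt pE qE.
  have [fx fy _ _ _] := xyst.
  rewrite subrr (@aff_inj _ _ f p q) ?hilbxx// ?pE ?qE//.
  by apply: f_aff_chart; rewrite pE f_chord// oner_eq0.
rewrite (hilbert_chord Om xyst sa ab bt pE qE).
have sb := lt_trans sa ab; have at' := lt_trans ab bt.
rewrite /hfun -mulrBr; congr (_ * _).
have [s1 s2 s3 s4] : [/\ 0 < b - s, 0 < t - a, 0 < a - s & 0 < t - b] by split; lra.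
rewrite ln_div ?posrE ?mulr_gt0// !lnM ?posrE//; ring.
Qed.

(** [hfun] is an increasing bijection from the chord onto the line, whose inverse,
    normalized to start at [x], is the required parametrization. *)
Lemma geodesic x y s t : chord x y s t -> s < 0 -> 0 < t ->
  exists (z : R -> pspace V) (ze : R -> R), [/\
    forall c, s < ze c < t /\ aff f (z c) = (1 - ze c) *: x + ze c *: y,
    forall c c', c <= c' -> ze c <= ze c' /\ hilb (z c) (z c') = c' - c,
    ze 0 = 0 &
    forall p r, s < r < t -> aff f p = (1 - r) *: x + r *: y ->
      exists c, [/\ p = z c, ze c = r & (0 <= c) = (0 <= r)]].
Proof.
move=> xyst s0 t0; have [fx fy xy st cP] := xyst.
pose L r := (1 - r) *: x + r *: y; pose h0 := hfun s t 0.
have ex (c : R) : exists zr : pspace V * R, [/\ s < zr.2 < t,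
    aff f zr.1 = L zr.2 & hfun s t zr.2 = c + h0].
  have [r [sr rt rc]] := hfun_surj (c + h0) st.
  have L0 : L r != 0 by apply: (@f1_neq0 _ _ f); exact: f_chord.
  by exists (pt L0, r); split=> //=; [rewrite sr|rewrite pt_aff// f_chord].
have /choice[zr zrP] := ex.
have hinj a b : s < a < t -> s < b < t -> hfun s t a = hfun s t b -> a = b.
  move=> /andP[sa at'] /andP[sb bt] E; case: (ltgtP a b) => // ab; exfalso.
    by have := hfun_mono sa ab bt; rewrite E ltxx.
  by have := hfun_mono sb ab at'; rewrite E ltxx.
have hmono a b : s < a < t -> s < b < t -> hfun s t a <= hfun s t b -> a <= b.
  move=> /andP[sa at'] /andP[sb bt] E; rewrite leNgt; apply/negP => ab.
  by have := hfun_mono sb ab at'; rewrite ltNge E.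
have s0t : s < 0 < t by rewrite s0.
exists (fun c => (zr c).1), (fun c => (zr c).2); split.
- by move=> c; have [? ? _] := zrP c.
- move=> c c' cc; have [z1 z2 z3] := zrP c; have [w1 w2 w3] := zrP c'.
  have zw : (zr c).2 <= (zr c').2 by apply: hmono => //; rewrite z3 w3 lerD2r.
  split=> //; move: z1 w1 => /andP[z1 z1'] /andP[w1 w1'].
  by rewrite (hilbert_hfun xyst z1 zw w1' z2 w2) w3 z3; ring.
- have [z1 _ z3] := zrP 0; apply: hinj => //; by rewrite z3 add0r.
- move=> p r rst pE; pose c := hfun s t r - h0; exists c.
  have [z1 z2 z3] := zrP c; have rE : (zr c).2 = r.
    by apply: hinj => //; rewrite z3 /c subrK.
  split=> //.
    apply: (@aff_inj _ _ f); last by rewrite pE z2 rE.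
    by apply: f_aff_chart; rewrite pE f_chord// oner_eq0.
  apply/idP/idP => c0.
    by apply: hmono => //; rewrite -/h0 -subr_ge0.
  move: c0; rewrite le_eqVlt => /predU1P[E|r0]; first by rewrite /c /h0 -E subrr.
  by rewrite subr_ge0 ltW// /h0 hfun_mono//; case/andP: rst.
Qed.

(** Near a point of the open cone both differences with slightly enlarged constants
    stay in the cone. *)
Lemma hilb_near p : Omega p -> exists2 d : R, 0 < d & forall q, chart f q ->
  enorm (aff f q - aff f p) < d -> Omega q /\ hilb p q <= 1.
Proof.
move=> Op; have cp := cone_aff Om Op.
have c2 : cone (2^-1 *: aff f p) by apply: coneZ => //; rewrite invr_gt0.
have [d d0 dP] := cone_open Om cp; have [d' d'0 d'P] := cone_open Om c2.
exists (Num.min d (d' / 2)); first by rewrite lt_min d0 divr_gt0.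
move=> q cq; rewrite lt_min => /andP[qd qd'].
have Oq : Omega q by apply/(OmegaE Om cq)/dP.
split=> //; apply/(hilbert_le Om) => //; exists (3 / 2), (3 / 2); split=> //.
- apply/cone_ccone/d'P.
  rewrite (_ : _ - _ = (3 / 2) *: (aff f q - aff f p)).
    by rewrite enormZ ger0_norm//; lra.
  move: (aff f p) (aff f q) => x y; rewrite scalerBr -addrA -opprD -{1}(scale1r x) -scalerDl.
  by congr (_ - _ *: _); field.
- apply/cone_ccone/d'P.
  rewrite (_ : _ - _ = - (aff f q - aff f p)); first by rewrite enormN; lra.
  move: (aff f p) (aff f q) => x y; rewrite addrAC -scalerBl.
  by rewrite (_ : 3 / 2 - 2^-1 = 1 :> R) ?scale1r ?opprB//; field.
- by have := expR_ge1Dx (2 * 1 : R); lra.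
Qed.
End HilbertGeometry.

(** * Lifts of automorphisms to the cone *)

Section Lifts.
Context {R : realType} {V : euclidType R} (f : {scalar V}) (Omega : set (pspace V)).
Context (Om : proper_convex_domain f Omega).
Implicit Types (u v w x y z : V) (p q : pspace V) (g : 'End(V)) (a : PGL V).
Local Notation cone := (cone f Omega).
Local Notation ccone := (ccone f Omega).
Local Notation hilb := (hilbert f Omega).
Local Notation hle := (hle f Omega).

(** Projective maps preserving the domain only act on lines; the Hilbert metric needs
    representatives preserving the cone itself rather than its opposite. *)
Definition lifts a g := <[g]>%VS = a /\ forall v, cone v <-> cone (g v).

Lemma act_mem a g p v : <[g]>%VS = a -> v \in (p : {vspace V}) ->
  g v \in (act_point a p : {vspace V}).
Proof. by move=> ga vp; rewrite (act_pointE p ga) memv_img. Qed.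

(** Each vector of the cone is sent into the cone or its opposite, and convexity
    prevents both from occurring. *)
Lemma lift_exists a : automorphism Omega a -> exists g, lifts a g.
Proof.
move=> aO; have ga := pgl_rep a; set g := rep a in ga.
have g0 := pgl_line_lker ga.
have cN v : cone v -> cone (g v) \/ cone (- g v).
  move=> cv; have [fv [p Op vp]] := cv.
  have Oa : Omega (act_point a p) by rewrite -aO; exists p.
  have gp : g v \in (act_point a p : {vspace V}) by exact: act_mem.
  have fg : f (g v) != 0.
    have := Omega_chart Om Oa; apply: contraNN => /eqP fg.
    have gv0 : g v != 0 by rewrite lker_neq0// (cone_neq0 cv).
    have [k pE] := pspace_line gv0 gp (memv_pick _).
    by rewrite /pvec pE fZ fg mulr0.
  case: (ltrP 0 (f (g v))) => fg0; first by left; exact: (Omega_cone Oa gp).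
  right; apply: (Omega_cone Oa); first by rewrite memvN.
  by rewrite -scaleN1r fZ mulN1r oppr_gt0 lt_neqAle fg.
have [v0 [cv0 _]] := cone_nonempty Om.
have [k k1 kv0] : exists2 k : R, k != 0 & cone (k *: g v0).
  have [c|c] := cN _ cv0; first by exists 1; rewrite ?oner_eq0// scale1r.
  by exists (-1); rewrite ?oppr_eq0 ?oner_eq0// scaleN1r.
pose h := k *: g; have ha : <[h]>%VS = a by exact: pgl_lineZ.
have h0 := pgl_line_lker ha.
have hE v : h v = k *: g v by rewrite lfunE.
have hN v : cone v -> cone (h v) \/ cone (- h v).
  have coneZ' (l : R) w : l != 0 -> cone w \/ cone (- w) -> cone (l *: w) \/ cone (- (l *: w)).
    move=> l0 cw; case: (ltrP 0 l) => l1.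
      by case: cw => cw; [left|right; rewrite -scalerN]; exact: coneZ.
    have l2 : 0 < - l by rewrite oppr_gt0 lt_neqAle l0.
    case: cw => cw; [right; rewrite -scaleNr|left]; first exact: coneZ.
    by rewrite -[l]opprK scaleNr -scalerN; exact: coneZ.
  by move=> /cN; rewrite hE; exact: coneZ'.
(* the image of a convex cone minus the origin cannot meet both [cone] and its
   opposite without meeting the kernel of the chart functional *)
have hc v : cone v -> cone (h v).
  move=> cv; have [//|cN'] := hN v cv; exfalso.
  have fa : 0 < f (h v0) by rewrite hE; case: kv0.
  have fb : f (h v) < 0 by case: cN' => + _; rewrite -scaleN1r fZ mulN1r oppr_gt0.
  pose w := (- f (h v)) *: v0 + f (h v0) *: v.
  have cw : cone w by apply: (coneD Om); apply: coneZ => //; rewrite oppr_gt0.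
  have fw : f (h w) = 0 by rewrite lfD !lfZ fD !fZ; ring.
  by have [[]|[]] := hN w cw; rewrite -1?scaleN1r ?fZ fw ?mulr0 ltxx.
exists h; split=> // v; split=> [/hc//|ch].
have [_ [p Op hp]] := ch; have : (act_point a @` Omega) p by rewrite aO.
move=> [q Oq qp]; have cq := cone_aff Om Oq; set w := aff f q in cq.
have hw : h w \in (p : {vspace V}) by rewrite -qp; apply: act_mem => //; exact: aff_mem.
have [l lE] := pspace_line (cone_neq0 ch) hp hw.
have fl : 0 < f (h w) by case: (hc _ cq).
have fh : 0 < f (h v) by case: ch.
have l0 : 0 < l by move: fl; rewrite lE fZ pmulr_lgt0.
have -> : v = l^-1 *: w.
  apply/eqP; rewrite -subr_eq0 -(lker_neq0 _ h0) lfB lfZ lE scalerA.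
  by rewrite mulVf ?gt_eqF// scale1r subrr.
by apply: coneZ => //; rewrite invr_gt0.
Qed.

Lemma lift_ccone a g v : lifts a g -> ccone v <-> ccone (g v).
Proof.
move=> [ga gc]; have g0 := pgl_line_lker ga.
have main (h : 'End(V)) : (forall v, cone v -> cone (h v)) -> forall v, ccone v -> ccone (h v).
  move=> hc w cw e e0; have [B B0 hB] := operator_bounded h.
  have [w' cw' ww'] := cw (e / B) (divr_gt0 e0 B0).
  exists (h w'); first exact: hc.
  by rewrite -lfB (le_lt_trans (hB _))// mulrC -ltr_pdivlMr.
split; first by apply: main => w /gc.
move=> /(main (g^-1)%VF _); rewrite lfun_Kinv//; apply => w cw.
by apply/gc; rewrite lfun_invK.
Qed.

Lemma lift_inv a g : lifts a g -> lifts (a^-1)%g (g^-1)%VF.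
Proof.
move=> [ga gc]; have g0 := pgl_line_lker ga; split; first exact: pgl_line_inv.
by move=> v; rewrite (gc ((g^-1)%VF v)) lfun_invK.
Qed.

Lemma lift_scale a g (k : R) : 0 < k -> lifts a g -> lifts a (k *: g).
Proof.
move=> k0 [ga gc]; split; first by apply: pgl_lineZ => //; rewrite gt_eqF.
move=> v; rewrite gc lfunE /=; split=> [|/(coneZ (_ : 0 < k^-1))]; first exact: coneZ.
by rewrite scalerA mulVf ?gt_eqF// scale1r invr_gt0; exact.
Qed.

Lemma lift_aff a g p : lifts a g -> chart f p -> ccone (aff f p) ->
  [/\ 0 < f (g (aff f p)), chart f (act_point a p) &
      g (aff f p) = f (g (aff f p)) *: aff f (act_point a p)].
Proof.
move=> ag cp ca; have [ga gc] := ag; have cg := proj1 (lift_ccone _ ag) ca.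
have g0 : g (aff f p) != 0.
  by rewrite (lker_neq0 _ (pgl_line_lker ga)); exact: aff_neq0.
have fg : 0 < f (g (aff f p)).
  rewrite lt_def (ccone_f Om cg) andbT; apply: contra_neq g0; exact: (ccone_f0 Om cg).
have gp := act_mem ga (aff_mem f p); split=> //; first by apply: chartP gp _; rewrite gt_eqF.
by rewrite (aff_eq gp) ?gt_eqF// scalerA mulfV ?scale1r// gt_eqF.
Qed.

Lemma act_Omega a p : automorphism Omega a -> Omega p -> Omega (act_point a p).
Proof. by move=> aO Op; rewrite -aO; exists p. Qed.

Lemma hilb_act a p q : automorphism Omega a -> Omega p -> Omega q ->
  hilb (act_point a p) (act_point a q) = hilb p q.
Proof.
move=> aO Op Oq; have [g ag] := lift_exists aO.
have [Oap Oaq] := (act_Omega aO Op, act_Omega aO Oq).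
have sub (x y : V) r : hle x y r <-> hle (g x) (g y) r.
  split=> -[l [m [? ? cl cm ?]]]; exists l, m; split=> //.
  - by rewrite -lfZ -lfB; apply: (proj1 (lift_ccone _ ag)).
  - by rewrite -lfZ -lfB; apply: (proj1 (lift_ccone _ ag)).
  - by apply: (proj2 (lift_ccone _ ag)); rewrite lfB lfZ.
  - by apply: (proj2 (lift_ccone _ ag)); rewrite lfB lfZ.
have [fp cp gp] := lift_aff ag (Omega_chart Om Op) (cone_ccone (cone_aff Om Op)).
have [fq cq gq] := lift_aff ag (Omega_chart Om Oq) (cone_ccone (cone_aff Om Oq)).
have E r : hilb (act_point a p) (act_point a q) <= r <-> hilb p q <= r.
  rewrite (hilbert_le Om _ Oap Oaq) (hilbert_le Om _ Op Oq) (sub (aff f p)) gp gq.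
  split=> H; first exact: hleZ.
  have := hleZ Om (_ : 0 < (f (g (aff f p)))^-1) (_ : 0 < (f (g (aff f q)))^-1) H.
  by rewrite !scalerK ?gt_eqF// !invr_gt0; exact.
by apply/le_anti/andP; split; apply/E.
Qed.

Lemma act_pointM a b p : act_point (a * b)%g p = act_point a (act_point b p).
Proof.
have [v v1 vp] := pspace_unit p; have v0 := unit_neq0 v1.
have ab := pgl_line_mul (pgl_rep a) (pgl_rep b).
apply: (pspace_eqP (v := (rep a \o rep b)%VF v)).
- by rewrite (lker_neq0 _ (pgl_line_lker ab)).
- exact: act_mem.
- by rewrite comp_lfunE; apply: act_mem (pgl_rep _) _; exact: act_mem (pgl_rep _) _.
Qed.

Lemma act_point1 p : act_point 1%g p = p.
Proof.
have [v v1 vp] := pspace_unit p; apply: (pspace_eqP (unit_neq0 v1)) => //.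
have := act_mem (pgl_classE (@lker_id0 R V)) vp; rewrite id_lfunE.
by rewrite (_ : pgl_class _ = 1%g).
Qed.

Lemma act_segment a p q (z : pspace V) : automorphism Omega a -> chart f p -> chart f q ->
  ccone (aff f p) -> ccone (aff f q) ->
  segment f `[0, 1[ p q z -> segment f `[0, 1[ (act_point a p) (act_point a q) (act_point a z).
Proof.
move=> aO cp cq ccp ccq [cz [t]]; rewrite in_itv /= => /andP[t0 t1] zE.
have [g ag] := lift_exists aO.
have [fp cap gp] := lift_aff ag cp ccp; have [fq caq gq] := lift_aff ag cq ccq.
have ccz : ccone (aff f z).
  by rewrite zE; apply: (cconeD Om); apply: (cconeZ Om) => //; rewrite subr_ge0 ltW.
have [fz caz gz] := lift_aff ag cz ccz; split=> //.
have fzE : f (g (aff f z)) = (1 - t) * f (g (aff f p)) + t * f (g (aff f q)).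
  by rewrite zE lfD !lfZ fD !fZ.
have tz : 1 - t * f (g (aff f q)) / f (g (aff f z)) =
    (1 - t) * f (g (aff f p)) / f (g (aff f z)).
  by apply: (mulIf (lt0r_neq0 fz)); rewrite mulrBl mul1r !divfK ?gt_eqF// fzE addrK.
exists (t * f (g (aff f q)) / f (g (aff f z))).
  rewrite in_itv /= divr_ge0 ?mulr_ge0 ?(ltW fq) ?(ltW fz)//= -subr_gt0 tz.
  by rewrite divr_gt0 ?mulr_gt0// subr_gt0.
rewrite tz; apply: (@scalerI _ _ (f (g (aff f z)))); first by rewrite gt_eqF.
have gzE : g (aff f z) = (1 - t) *: g (aff f p) + t *: g (aff f q).
  by rewrite zE; move: (aff f p) (aff f q) => x y; rewrite lfD !lfZ.
rewrite -gz [LHS]gzE; move: (f (g (aff f z))) (f (g (aff f p))) (f (g (aff f q))) fz gp gq.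
move=> k l m k0 -> ->; move: (aff f (act_point a p)) (aff f (act_point a q)) => x y.
by rewrite scalerDr !scalerA ![k * _]mulrC !divfK ?gt_eqF.
Qed.

End Lifts.

(** * The ideal boundary *)

Lemma infinite_seq (T : Type) (A : set T) : infinite_set A ->
  exists2 x : nat -> T, forall k, A (x k) & injective x.
Proof.
move=> /infiniteP/card_leP[F].
exists (fun k => val (F (exist _ k (mem_set (I : setT k))))) => [k|k l kl].
  by apply: set_mem; exact: (valP (F _)).
pose j (k : nat) : [set: nat] := exist (fun x => x \in [set: nat]) k (mem_set I).
suff : j k = j l by move=> /(congr1 val).
by apply: ('inj_F); rewrite ?inE//; exact: val_inj.
Qed.

(** By compactness, it suffices to identify the limits of subsequences. *)
Lemma vcvg_of_limits (R : realType) (V : euclidType R) (x : nat -> V) v (B : R) :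
  (forall k, enorm (x k) <= B) ->
  (forall phi l, (forall k, (k <= phi k)%N) -> vcvg (x \o phi) l -> l = v) -> vcvg x v.
Proof.
move=> xB xl e e0; apply: contrapT => H.
have {}H N : exists k, (N <= k)%N /\ e <= enorm (x k - v).
  apply: contrapT => H'; apply: H; exists N => //= k Nk.
  by rewrite ltNge; apply/negP => ek; apply: H'; exists k.
have [psi psiP] := choice H.
have [phi phik [l xcl]] := @bolzano_weierstrass1 _ _ (x \o psi) B (fun k => xB _).
have lv : l = v.
  apply: (xl (psi \o phi)) => // k /=.
  by apply: (leq_trans (phik k)); have [] := psiP (phi k).
have [N _ NP] := xcl e e0; have := NP N (leqnn N).
by rewrite /= lv ltNge; have [_ ->] := psiP (phi N).
Qed.

Section Cocompact.
Context {R : realType} {V : euclidType R} (f : {scalar V}) (Omega C : set (pspace V)).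
Context (Gam : set (PGL V)) (b0 : pspace V).
Context (RCC : regular_convex_cocompact f Omega C Gam) (Cb0 : C b0).
Implicit Types (u v w x y z : V) (p q : pspace V) (g h : 'End(V)) (a b c : PGL V).
Local Notation cone := (cone f Omega).
Local Notation ccone := (ccone f Omega).
Local Notation hilb := (hilbert f Omega).
Local Notation hle := (hle f Omega).
Local Notation aff := (aff f).
Local Notation orb a := (act_point a b0).
(** The ideal boundary: it turns out to be the limit set, and unlike the latter it is
    directly accessible to convexity arguments. *)
Definition bd p := closure C p /\ frontier Omega p.

Lemma rcc_domain : proper_convex_domain f Omega. Proof. by case: RCC. Qed.
Let Om := rcc_domain.
Lemma rcc_subgroup : subgroup Gam. Proof. by case: RCC => _ [[]]. Qed.
Let CO p : C p -> Omega p. Proof. by have [_ _ [CO _ _ _ _] _ _] := RCC; exact: CO. Qed.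
Lemma C_act a p : Gam a -> C p -> C (act_point a p).
Proof. by move=> Ga Cp; have [_ _ [_ _ _ _ /(_ _ Ga) <-] _ _] := RCC; exists p. Qed.

Lemma C_orb a : Gam a -> C (orb a). Proof. by move=> Ga; exact: C_act. Qed.

Lemma O_orb a : Gam a -> Omega (orb a). Proof. by move=> Ga; exact/CO/C_orb. Qed.

Lemma C_aff p : C p -> cone (aff p) /\ f (aff p) = 1.
Proof. by move=> /CO Op; split; [exact: cone_aff|exact/f_aff/(Omega_chart Om Op)]. Qed.

Lemma closure_C p : closure C p <-> chart f p /\
  forall e : R, 0 < e -> exists2 q, C q & enorm (aff q - aff p) < e.
Proof.
split=> [cp|[cp H]].
  have [cf _] : chart f p /\ ccone (aff p).
    by apply/(closureP Om) => B /cp[q [/CO Oq Bq]]; exists q.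
  split=> // e e0; have [d d0 dP] := aff_cont cf e0.
  have [q [Cq]] := cp _ (nbhsx_ballx p d d0); rewrite ballEmdist /= metric_sym => qp.
  by exists q => //; have [] := dP q qp.
move=> B /nbhs_ballP[e /= e0 eB]; have [d d0 dP] := near_mdist (aff_neq0 cp) e0.
have [q Cq qp] := H d d0; exists q; split=> //.
apply: eB; rewrite ballEmdist /= metric_sym.
by have [] := dP p q (aff q) (aff_mem _ p) (aff_mem _ q) qp.
Qed.

Lemma bd_aff p : bd p -> [/\ chart f p, ccone (aff p), ~ cone (aff p) & f (aff p) = 1].
Proof. by move=> [_ /(frontierP Om)[cp cc nc]]; split=> //; exact: f_aff. Qed.

Lemma bdP p : chart f p -> closure C p -> ~ Omega p -> bd p.
Proof.
move=> cp clp nO; split=> //; apply/(frontierP Om).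
have [_ cc] : chart f p /\ ccone (aff p).
  by apply/(closureP Om) => B /clp[q [/CO Oq Bq]]; exists q.
by split=> //; rewrite -(OmegaE Om cp).
Qed.

Lemma C_closed p : closure C p -> Omega p -> C p.
Proof. by have [_ _ [_ _ cC _ _] _ _] := RCC => cp Op; exact: cC. Qed.

(** The half-open segment stays in the open cone because [b] is inside, and in [C]
    because [C] is closed in the domain. *)
Lemma segment_C (b p q : pspace V) (t : R) : C b -> closure C p -> 0 <= t < 1 -> chart f q ->
  aff q = (1 - t) *: aff b + t *: aff p -> C q.
Proof.
move=> Cb clp /andP[t0 t1] cq qE; have [cp H] := proj1 (closure_C p) clp.
have [cb fb] := C_aff Cb.
have Oq : Omega q.
  apply/(OmegaE Om cq); rewrite qE; apply: (cone_cconeD Om).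
    by apply: coneZ => //; rewrite subr_gt0.
  apply: (cconeZ Om) => //; suff [] : chart f p /\ ccone (aff p) by [].
  by apply/(closureP Om) => B /clp[r [/CO Or Br]]; exists r.
apply: C_closed => //; apply/closure_C; split=> // e e0.
have [r Cr rp] := H e e0; have [cr fr] := C_aff Cr.
have [_ _ [_ _ _ Ccv _] _ _] := RCC.
pose v := (1 - t) *: aff b + t *: aff r.
have fv : f v = 1 by exact: f_chord.
have v0 := f1_neq0 fv; have Ev := pt_aff v0 fv.
exists (pt v0).
  apply: (Ccv b r Cb Cr); split; first by apply: f_aff_chart; rewrite Ev fv oner_eq0.
  by exists t => //; rewrite in_itv /= t0 ltW.
rewrite Ev qE /v; move: (aff b) (aff r) (aff p) rp => x y z rp.
rewrite opprD addrACA subrr add0r -scalerBr enormZ ger0_norm//.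
by apply: (le_lt_trans _ rp); rewrite ler_piMl ?enorm_ge0// ltW.
Qed.

(** An open segment through a boundary point cannot enter the open cone, otherwise
    the point itself would be inside; extremity then collapses it. *)
Lemma bd_extreme p y w (t : R) : bd p -> ccone y -> ccone w -> f y = 1 -> f w = 1 ->
  0 < t < 1 -> aff p = (1 - t) *: y + t *: w -> y = w.
Proof.
move=> bp cy cw fy fw /andP[t0 t1] pE; have [cp ccp ncp fp] := bd_aff bp.
have [_ _ _ _ /(_ p (proj1 bp) (proj2 bp)) [_ ext]] := RCC.
apply: contrapT => yw.
have [y0 w0] := (f1_neq0 fy, f1_neq0 fw).
have [Ey Ew] := (pt_aff y0 fy, pt_aff w0 fw).
apply: (ext (pt y0) (pt w0)).
- by apply: f_aff_chart; rewrite Ey fy oner_eq0.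
- by apply: f_aff_chart; rewrite Ew fw oner_eq0.
- by move=> /(congr1 aff); rewrite Ey Ew.
- move=> q [cq [s]]; rewrite in_itv /= Ey Ew => /andP[s0 s1] qE.
  apply/(frontierP Om); split=> //.
    by rewrite qE; apply: (cconeD Om); apply: (cconeZ Om) => //; lra.
  move=> ccq; apply: ncp; have [ts|st|ts] := ltgtP t s.
  + have -> : aff p = (t / s) *: aff q + (1 - t / s) *: y.
      rewrite pE qE scalerDr !scalerA divfK ?gt_eqF// addrAC -scalerDl.
      by congr (_ *: _ + _); field; rewrite gt_eqF.
    apply: (cone_cconeD Om); first by apply: coneZ => //; rewrite divr_gt0.
    by apply: (cconeZ Om) => //; rewrite subr_ge0 ler_pdivrMr// mul1r ltW.
  + have s1' : 0 < 1 - s by rewrite subr_gt0.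
    have -> : aff p = ((1 - t) / (1 - s)) *: aff q + (1 - (1 - t) / (1 - s)) *: w.
      rewrite pE qE scalerDr !scalerA divfK ?gt_eqF// -addrA -scalerDl.
      by congr (_ + _ *: _); field; rewrite gt_eqF.
    apply: (cone_cconeD Om); first by apply: coneZ => //; rewrite divr_gt0// subr_gt0.
    by apply: (cconeZ Om) => //; rewrite subr_ge0 ler_pdivrMr// mul1r; lra.
  + by rewrite pE ts -qE.
- split=> //; exists t; first by rewrite in_itv /= t0.
  by rewrite Ey Ew.
Qed.

Lemma Omega_bounded : exists2 M : R, 0 < M & forall p, Omega p -> enorm (aff p) <= M.
Proof.
have [M M0 MP] := cone_bounded Om; exists M => // p Op.
by have := MP _ (cone_aff Om Op); rewrite (f_aff (Omega_chart Om Op)) mulr1.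
Qed.

(** A bounded Hilbert distance traps a limit of the second sequence in the open face
    of the first limit, and this face is a single point. *)
Lemma bd_face (p q : nat -> pspace V) (z : pspace V) (r : R) : (forall k, Omega (p k)) ->
  (forall k, Omega (q k)) -> (forall k, hilb (p k) (q k) <= r) ->
  bd z -> vcvg (fun k => aff (p k)) (aff z) -> vcvg (fun k => aff (q k)) (aff z).
Proof.
move=> Op Oq pq bz pz; have [M M0 MP] := Omega_bounded.
have [cz ccz ncz fz] := bd_aff bz.
have fa p' : Omega p' -> f (aff p') = 1 by move=> O'; exact/f_aff/(Omega_chart Om).
apply: (@vcvg_of_limits _ _ _ _ M) => [k|phi l phik ql]; first exact: MP.
have [B B0 fB'] := functional_bounded f.
have fl : f l = 1.
  apply/eqP; rewrite -subr_eq0 -normr_le0.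
  rewrite (vcvg_le (N := fun v => `|f v - 1|) (a := 0) _ ql)//.
  exists B => // v w; have := fB' (v - w); rewrite fB.
    by have := ler_distD (f w) (f v) 1; lra.
  by move=> k; rewrite /= fa// subrr normr0.
have cl : ccone l.
  by apply: (vcvg_ccone ql) => k; exact/cone_ccone/cone_aff.
pose E := expR (2 * r); have E0 : 0 < E := expR_gt0 _.
have ccE : ccone (E *: aff z - l).
  apply: (vcvg_ccone (x := fun k => E *: aff (p (phi k)) - aff (q (phi k)))).
    by apply: vcvgB => //; apply: vcvgZ; exact: (vcvg_sub phik pz).
  move=> k; have [l' [m [l0 m0 cl' cm lm]]] := proj1 (hilbert_le Om _ (Op (phi k)) (Oq (phi k)))
    (pq (phi k)).
  have l1 : 1 <= l' by have := ccone_f Om cl'; rewrite fB fZ !fa// mulr1 subr_ge0.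
  have mE : m <= E by apply: (le_trans _ lm); rewrite ler_peMl// ltW.
  have -> : E *: aff (p (phi k)) - aff (q (phi k)) =
      (E - m) *: aff (p (phi k)) + (m *: aff (p (phi k)) - aff (q (phi k))).
    by move: (aff (p (phi k))) (aff (q (phi k))) => x x'; rewrite scalerBl addrA subrK.
  apply: (cconeD Om) => //; apply: (cconeZ Om); rewrite ?subr_ge0//.
  exact/cone_ccone/cone_aff.
have Ez : ccone ((E + 1) *: aff z - l).
  by rewrite scalerDl scale1r addrAC; exact: cconeD.
pose w := E^-1 *: ((E + 1) *: aff z - l).
have fw : f w = 1 by rewrite fZ fB fZ fz fl mulr1 addrK mulVf// gt_eqF.
have E1 : 0 < E + 1 by rewrite addr_gt0.
have wl : w = l.
  apply: (bd_extreme (t := (E + 1)^-1) bz _ cl fw fl).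
  - by apply: (cconeZ Om) => //; rewrite invr_ge0 ltW.
  - by rewrite invr_gt0 E1 invf_lt1// ltrDr.
  have -> : 1 - (E + 1)^-1 = (E + 1)^-1 * E by field; rewrite gt_eqF.
  rewrite /w scalerA -mulrA divff ?gt_eqF// mulr1 scalerBr subrK.
  by rewrite scalerK// gt_eqF.
apply/esym; apply: (@scalerI _ _ (E + 1)); first by rewrite gt_eqF.
have : E *: w = (E + 1) *: aff z - l by rewrite /w scalerA mulfV ?gt_eqF// scale1r.
by rewrite wl => H; rewrite [RHS]scalerDl scale1r H subrK.
Qed.

Lemma bw_C (p : nat -> pspace V) : (forall k, C (p k)) ->
  exists2 phi : nat -> nat, forall k, (k <= phi k)%N &
  exists q, [/\ chart f q, closure C q & vcvg (fun k => aff (p (phi k))) (aff q)].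
Proof.
move=> Cp; have [M M0 MP] := Omega_bounded.
have [phi phik [l pl]] := bolzano_weierstrass1 (fun k => MP _ (CO (Cp k))).
exists phi => //; have [B B0 fB'] := functional_bounded f.
have fl : f l = 1.
  apply/eqP; rewrite -subr_eq0 -normr_le0.
  rewrite (vcvg_le (N := fun v => `|f v - 1|) (a := 0) _ pl)//.
  exists B => // v w; have := fB' (v - w); rewrite fB.
    by have := ler_distD (f w) (f v) 1; lra.
  by move=> k; rewrite /= (proj2 (C_aff (Cp _))) subrr normr0.
have l0 := f1_neq0 fl; have lE := pt_aff l0 fl.
have cl : chart f (pt l0) by apply: f_aff_chart; rewrite lE fl oner_eq0.
exists (pt l0); split=> //; last by rewrite lE.
apply/closure_C; split=> // e e0; have [N _ NP] := pl e e0.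
by exists (p (phi N)); [exact: Cp|rewrite lE; exact: (NP N (leqnn N))].
Qed.

(** Subsequential limits inside the domain are excluded because the Hilbert metric is
    bounded near such a point. *)
Lemma bw_bd (p : nat -> pspace V) : (forall k, C (p k)) ->
  (forall r : R, \forall k \near \oo, r < hilb b0 (p k)) ->
  exists2 phi : nat -> nat, forall k, (k <= phi k)%N &
  exists2 q, bd q & vcvg (fun k => aff (p (phi k))) (aff q).
Proof.
move=> Cp pinf; have [phi phik [q [cq clq pq]]] := bw_C Cp; exists phi => //.
exists q => //; apply: bdP => // Oq.
have [d d0 dP] := hilb_near Om Oq; have [N _ NP] := pinf (hilb b0 q + 1).
near \oo => k.
have [Op qp] : Omega (p (phi k)) /\ hilb q (p (phi k)) <= 1.
  by apply: dP; [exact/(Omega_chart Om)/CO|near: k; exact: pq].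
have : hilb b0 q + 1 < hilb b0 (p (phi k)).
  by apply: NP => /=; apply: (leq_trans _ (phik k)); near: k; exists N.
apply/negP; rewrite -leNgt.
by have := hilb_triangle Om (CO Cb0) Oq Op; move: qp; lra.
Unshelve. all: by end_near. Qed.

End Cocompact.

(** * Properness of the action *)

Section Proper.
Context {R : realType} {V : euclidType R} (f : {scalar V}) (Omega C : set (pspace V)).
Context (Gam : set (PGL V)) (b0 : pspace V).
Context (RCC : regular_convex_cocompact f Omega C Gam) (Cb0 : C b0).
Implicit Types (u v w x y z : V) (p q : pspace V) (g h : 'End(V)) (a b c : PGL V).
Local Notation cone := (cone f Omega).
Local Notation ccone := (ccone f Omega).
Local Notation hilb := (hilbert f Omega).
Local Notation hle := (hle f Omega).
Local Notation aff := (aff f).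
Local Notation orb a := (act_point a b0).
Local Notation D a := (hilbert f Omega b0 (act_point a b0)).
Local Notation bd := (bd Omega C).
Let Om := rcc_domain RCC.
Let CO p : C p -> Omega p. Proof. by have [_ _ [CO _ _ _ _] _ _] := RCC; exact: CO. Qed.
Let G1 : Gam 1%g. Proof. by have [] := rcc_subgroup RCC. Qed.
Let GM a b : Gam a -> Gam b -> Gam (a * b)%g.
Proof. by have [_ H _] := rcc_subgroup RCC; exact: H. Qed.
Let GV a : Gam a -> Gam a^-1%g. Proof. by have [_ _ H] := rcc_subgroup RCC; exact: H. Qed.
Let Gaut a : Gam a -> automorphism Omega a. Proof. by have [_ [_ H] _ _ _] := RCC; exact: H. Qed.
Let Oorb a : Gam a -> Omega (orb a). Proof. exact: (O_orb RCC Cb0). Qed.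
Let Ob0 : Omega b0. Proof. exact: CO. Qed.

Lemma hilb_orb a b : Gam a -> Gam b -> hilb (orb a) (orb b) = D (a^-1 * b)%g.
Proof.
move=> Ga Gb; rewrite -(hilb_act Om (Gaut (GV Ga)) (Oorb Ga) (Oorb Gb)) -!act_pointM.
by rewrite mulVg act_point1.
Qed.

Lemma D_inv a : Gam a -> D (a^-1)%g = D a.
Proof.
move=> Ga; have := hilb_orb Ga G1; rewrite mulg1 act_point1 => <-.
by apply: (hilb_sym Om) => //; exact: Oorb.
Qed.

(** After normalization at the base vector, the image of a ball around it is a subset
    of a bounded part of the cone. *)
Lemma lift_bounded : exists2 K : R, 0 < K & forall a g v, lifts f Omega a g ->
  enorm (g v) <= K * f (g (aff b0)) * enorm v.
Proof.
have cb := cone_aff Om Ob0; set b := aff b0 in cb *.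
have [d d0 dP] := cone_open Om cb; have [M M0 MP] := cone_bounded Om.
exists (6 * M / d) => [|a g v [ga gc]]; first by rewrite divr_gt0// mulr_gt0.
have [->|v0] := eqVneq v 0; first by rewrite linear0 enorm0 mulr0.
have nv : 0 < enorm v by rewrite enorm_gt0.
pose k := d / (2 * enorm v); have k0 : 0 < k by rewrite divr_gt0// mulr_gt0.
have kv : enorm (k *: v) < d.
  by rewrite enormZ gtr0_norm// /k invfM mulrA divfK ?gt_eqF//; lra.
have c1 : cone (g (b + k *: v)) by apply: (proj1 (gc _)); apply: dP; rewrite addrAC subrr add0r.
have c2 : cone (g (b - k *: v)) by apply: (proj1 (gc _)); apply: dP; rewrite addrAC subrr add0r enormN.
have cg := proj1 (gc b) cb.
have fgv : f (g (b + k *: v)) <= 2 * f (g b).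
  have [+ _] := c2; rewrite lfB lfD fB fD; move: (f (g (k *: v))) (f (g b)) => x y; lra.
have : k * enorm (g v) <= 3 * M * f (g b).
  have -> : k * enorm (g v) = enorm (g (b + k *: v) - g b).
    by rewrite lfD addrAC subrr add0r lfZ enormZ gtr0_norm.
  apply: (le_trans (enormB _ _)); have := MP _ c1; have := MP _ cg.
  have : M * f (g (b + k *: v)) <= M * (2 * f (g b)) by rewrite ler_pM2l.
  lra.
rewrite -ler_pdivlMl// => /le_trans; apply.
by rewrite le_eqVlt; apply/orP; left; apply/eqP; rewrite /k; field; rewrite !gt_eqF.
Qed.

(** Normalized lifts of the elements of a ball, and their inverses, are bounded; an
    infinite ball would contain a sequence of distinct elements with Cauchy lifts, whose
    quotients accumulate at the identity, against discreteness. *)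
Lemma finite_balls (r : R) : finite_set [set a | Gam a /\ D a <= r].
Proof.
apply: contrapT => /infinite_seq[x xG xI].
have cb := cone_aff Om Ob0; have fb : f (aff b0) = 1 by exact/f_aff/(Omega_chart Om).
have /choice[gs gsP] k : exists g, lifts f Omega (x k) g /\ f (g (aff b0)) = 1.
  have [g gl] := lift_exists Om (Gaut (proj1 (xG k))).
  have [fg _ _] := lift_aff Om gl (Omega_chart Om Ob0) (cone_ccone cb).
  exists ((f (g (aff b0)))^-1 *: g); split; first by apply: lift_scale; rewrite ?invr_gt0.
  by rewrite lfunE /= fZ mulVf// gt_eqF.
have [K K0 KP] := lift_bounded.
pose E := expR (2 * r); have E0 : 0 < E := expR_gt0 _.
have gB k v : enorm (gs k v) <= K * enorm v.
  by have [gl g1] := gsP k; have := KP _ _ v gl; rewrite g1 mulr1.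
have gVB k v : enorm ((gs k)^-1%VF v) <= K * E * enorm v.
  have [gl g1] := gsP k; have [Gx Dx] := xG k; have gi := lift_inv gl.
  apply: (le_trans (KP _ _ v gi)); rewrite ler_wpM2r ?enorm_ge0// ler_pM2l//.
  have [_ _ gE] := lift_aff Om gl (Omega_chart Om Ob0) (cone_ccone cb).
  move: gE; rewrite g1 scale1r => gE.
  have [l [m [l0 m0 cl cm lm]]] := proj1 (hilbert_le Om _ Ob0 (Oorb Gx)) Dx.
  have m1 : 1 <= m.
    have := ccone_f Om cm; rewrite fB fZ fb (f_aff (Omega_chart Om (Oorb Gx))) mulr1.
    by rewrite subr_ge0.
  have := proj1 (lift_ccone _ gi) cl; rewrite -gE lfB lfZ.
  rewrite (lfun_Kinv _ (pgl_line_lker (proj1 gl)))// => /(ccone_f Om).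
  rewrite fB fZ fb mulr1 subr_ge0 => /le_trans; apply.
  by apply: (le_trans _ lm); rewrite ler_peMr// ltW.
have [e eo en] := @exists_orthoseq R V.
have e1 (i : nat) : (i < size e)%N -> enorm e`_i = 1.
  by move=> ie; apply/enorm1P; rewrite eo// eqxx.
have [|phi phik [l lP]] := @bolzano_weierstrass R V (size e) (fun k i => gs k e`_i) K.
  by move=> k i; apply: (le_trans (gB k _)); rewrite e1// mulr1.
have close (d : R) : 0 < d -> \forall k \near \oo, forall j, (k <= j)%N -> forall v,
    enorm (gs (phi j) v - gs (phi k) v) <= d * enorm v.
  move=> d0; pose d1 := d / (2 * (size e).+1%:R).
  have d10 : 0 < d1 by rewrite divr_gt0// mulr_gt0.
  have [N NP] : exists N : nat, forall (i : 'I_(size e)) k, (N <= k)%N ->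
      enorm (gs (phi k) e`_i - l i) < d1.
    have /choice[Ns NsP] (i : 'I_(size e)) : exists N : nat, forall k, (N <= k)%N ->
        enorm (gs (phi k) e`_i - l i) < d1.
      by have [N _ NP] := lP i d1 d10; exists N.
    by exists (\max_i Ns i) => i k ik; apply: NsP; apply: leq_trans ik; exact: leq_bigmax.
  exists N => // k /= Nk j kj v.
  have -> : gs (phi j) v - gs (phi k) v =
      \sum_(i < size e) dotp v e`_i *: (gs (phi j) e`_i - gs (phi k) e`_i).
    rewrite [in LHS](orthoseq_expand v eo en) [X in X - _]linear_sum [X in _ - X]linear_sum.
    by rewrite -sumrB; apply: eq_bigr => i _; rewrite scalerBr; congr (_ - _); exact: lfZ.
  apply: (le_trans (enorm_sum _ _ _)).
  have -> : d * enorm v = \sum_(i < (size e).+1) (2 * d1 * enorm v).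
    rewrite sumr_const card_ord -mulr_natr /d1; field.
    by rewrite addrC natr1 pnatr_eq0.
  rewrite big_ord_recr /= -[leLHS]addr0 lerD//; last first.
    by rewrite !mulr_ge0 ?enorm_ge0// ltW.
  apply: ler_sum => i _; rewrite enormZ mulrC.
  have ab : `|dotp v e`_i| <= enorm v.
    by apply: (le_trans (dotp_le _ _)); rewrite e1 ?mulr1.
  apply: ler_pM => //; first exact: enorm_ge0.
  apply: (le_trans (enorm_triangle (l i) _ _)).
  have := NP i j (leq_trans Nk kj); have := NP i k Nk.
  by rewrite (enorm_dist (l i)); lra.
have [_ Giso] : discrete_subgroup Gam by case: RCC => _ [].
have [_ [U /= U1 UG]] := Giso _ G1.
have [U' [oU' U'1 U'U]] : exists U' : set (PGL V), [/\ pgl_open U', U' 1%g & U' `<=` U].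
  by move: U1; rewrite nbhsE /= => -[U' [? ?] ?]; exists U'.
have [d d0 dP] := oU' _ _ U'1 (pgl_classE (@lker_id0 R V)).
have d1 : 0 < d / (K * E) by rewrite divr_gt0// mulr_gt0.
have [N _ NP] := close _ d1.
have [kN xx] : (phi N <= phi (phi N).+1)%N /\ x (phi N) = x (phi (phi N).+1).
  have Nk : (N <= (phi N).+1)%N by exact: leqW.
  split; first exact: ltnW (leq_trans _ (phik _)).
  set k := (phi N).+1 in Nk *.
  have [glN _] := gsP (phi N); have [glk _] := gsP (phi k).
  have : (U `&` Gam) ((x (phi N))^-1 * x (phi k))%g.
    split; last by apply: GM; [apply: GV|]; case: (xG (phi N)); case: (xG (phi k)).
    apply: U'U; apply: (dP _ ((gs (phi N))^-1 \o gs (phi k))%VF).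
      by apply: pgl_line_mul; [exact: pgl_line_inv (proj1 glN)|exact: (proj1 glk)].
    move=> v; rewrite comp_lfunE id_lfunE.
    rewrite -{2}[v](lfun_Kinv v (pgl_line_lker (proj1 glN))) -lfB.
    apply: (le_trans (gVB _ _)); have := NP N (leqnn N) k Nk v.
    by rewrite [d / _ * _]mulrAC ler_pdivlMr ?mulr_gt0// mulrC.
  rewrite UG => /= H; apply/esym; rewrite -[RHS]mulg1 -H mulgA mulgV mul1g.
  done.
by move/xI: xx => xx; have := phik (phi N).+1; rewrite -xx ltnn.
Qed.

End Proper.

(** * Coboundedness *)

Section Cobounded.
Context {R : realType} {V : euclidType R} (f : {scalar V}) (Omega C : set (pspace V)).
Context (Gam : set (PGL V)) (b0 : pspace V).
Context (RCC : regular_convex_cocompact f Omega C Gam) (Cb0 : C b0).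
Implicit Types (u v w x y : V) (p q z : pspace V) (g h : 'End(V)) (a b c : PGL V).
Local Notation cone := (cone f Omega).
Local Notation ccone := (ccone f Omega).
Local Notation hilb := (hilbert f Omega).
Local Notation hle := (hle f Omega).
Local Notation aff := (aff f).
Local Notation orb a := (act_point a b0).
Local Notation D a := (hilbert f Omega b0 (act_point a b0)).
Local Notation bd := (bd Omega C).
Let Om := rcc_domain RCC.
Let CO p : C p -> Omega p. Proof. by have [_ _ [CO _ _ _ _] _ _] := RCC; exact: CO. Qed.
Let G1 : Gam 1%g. Proof. by have [] := rcc_subgroup RCC. Qed.
Let GM a b : Gam a -> Gam b -> Gam (a * b)%g.
Proof. by have [_ H _] := rcc_subgroup RCC; exact: H. Qed.
Let GV a : Gam a -> Gam a^-1%g. Proof. by have [_ _ H] := rcc_subgroup RCC; exact: H. Qed.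
Let Gaut a : Gam a -> automorphism Omega a. Proof. by have [_ [_ H] _ _ _] := RCC; exact: H. Qed.
Let Oorb a : Gam a -> Omega (orb a). Proof. exact: (O_orb RCC Cb0). Qed.
Let Ob0 : Omega b0. Proof. exact: CO. Qed.

Let faff p : C p -> f (aff p) = 1. Proof. by move=> Cp; have [] := C_aff RCC Cp. Qed.

(** The [n]-neighbourhood of the orbit, with the open cone in place of the closed
    one so as to obtain a relatively open set. *)
Definition orbit_nbhd (n : nat) : set (pspace V) := [set z | C z /\ exists a l m,
  [/\ Gam a, 0 < l, 0 < m, cone (l *: aff (orb a) - aff z) /\ cone (m *: aff z - aff (orb a)) &
      l * m <= expR (2 * n%:R)]].

Lemma orbit_nbhd_act n c (z : pspace V) : Gam c -> orbit_nbhd n z -> orbit_nbhd n (act_point c z).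
Proof.
move=> Gc [Cz [a [l [m [Ga l0 m0 [c1 c2] lm]]]]]; split; first exact: (C_act RCC).
have [g gc] := lift_exists Om (Gaut Gc).
have lift p : Omega p -> exists2 k : R, 0 < k & g (aff p) = k *: aff (act_point c p).
  move=> Op; have [k0 _ kE] := lift_aff Om gc (Omega_chart Om Op) (cone_ccone (cone_aff Om Op)).
  by exists (f (g (aff p))).
have [k k0 kE] := lift _ (CO Cz); have [k' k'0 k'E] := lift _ (Oorb Ga).
rewrite -act_pointM in k'E.
exists (c * a)%g, (l * (k' / k)), (m * (k / k')); split; first exact: GM.
- by rewrite mulr_gt0// divr_gt0.
- by rewrite mulr_gt0// divr_gt0.
- split.
    have := proj1 (proj2 gc _) c1; rewrite lfB lfZ kE k'E.
    have ki : 0 < k^-1 by rewrite invr_gt0.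
    move: (aff (orb (c * a)%g)) (aff (act_point c z)) => y w /(coneZ ki); rewrite scalerBr (scalerK (lt0r_neq0 k0)) !scalerA.
    by congr (cone (_ *: _ - _)); field; rewrite gt_eqF.
  have := proj1 (proj2 gc _) c2; rewrite lfB lfZ kE k'E.
  have ki : 0 < k'^-1 by rewrite invr_gt0.
  move: (aff (orb (c * a)%g)) (aff (act_point c z)) => y w /(coneZ ki); rewrite scalerBr (scalerK (lt0r_neq0 k'0)) !scalerA.
  by congr (cone (_ *: _ - _)); field; rewrite gt_eqF.
- by apply: le_trans lm; rewrite le_eqVlt; apply/orP; left; apply/eqP; field; rewrite !gt_eqF.
Qed.

Lemma orbit_nbhd_open n : open_in C (orbit_nbhd n).
Proof.
pose U := [set z : pspace V | chart f z /\ exists a l m, [/\ Gam a, 0 < l, 0 < m,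
  cone (l *: aff (orb a) - aff z) /\ cone (m *: aff z - aff (orb a)) &
      l * m <= expR (2 * n%:R)]].
exists U; last first.
  by apply/seteqP; split=> z [Cz]; [move=> H; split=> //; split=> //|move=> [_ H]; split=> //];
     exact: (Omega_chart Om (CO Cz)).
rewrite openE => z [cz [a [l [m [Ga l0 m0 [c1 c2] lm]]]]]; apply/nbhs_ballP.
have [d1 d10 d1P] := cone_open Om c1; have [d2 d20 d2P] := cone_open Om c2.
have e0 : 0 < Num.min d1 (d2 / m) by rewrite lt_min d10 divr_gt0.
have [d d0 dP] := aff_cont cz e0; exists d => //= q; rewrite ballEmdist /= metric_sym => /dP[cq].
rewrite lt_min => /andP[qz1 qz2]; split=> //; exists a, l, m; split=> //; split.
  apply: d1P; rewrite enorm_dist; move: (aff q) (aff z) (l *: _) qz1 => x y w.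
  by congr (enorm _ < _); rewrite opprB [RHS]addrC addrA subrK.
apply: d2P; move: qz2; rewrite ltr_pdivlMr// => /(le_lt_trans _); apply.
have -> : m *: aff q - aff (orb a) - (m *: aff z - aff (orb a)) = m *: (aff q - aff z).
  rewrite scalerBr; move: (m *: aff q) (m *: aff z) (aff (orb a)) => x y w.
  by rewrite opprB addrA subrK.
by rewrite enormZ gtr0_norm// mulrC.
Qed.

(** The invariant open sets [orbit_nbhd n] increase to [C]. *)
Lemma cobounded : exists r : R, forall z, C z -> exists2 a, Gam a & hilb z (orb a) <= r.
Proof.
have [_ _ _ cpt _] := RCC.
have [F' [F'F finF CF']] : exists F' : set (set (pspace V)),
    [/\ F' `<=` range orbit_nbhd, finite_set F' & C `<=` \bigcup_(W in F') W].
  apply: cpt => [W [n _ <-]|z Cz].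
    split=> [|c Gc]; first exact: orbit_nbhd_open.
    apply/seteqP; split=> [_ [z zW <-]|z zW]; first exact: orbit_nbhd_act.
    exists (act_point c^-1%g z); first by apply: orbit_nbhd_act => //; exact: GV.
    by rewrite -act_pointM mulgV act_point1.
  pose r := hilb z b0; have [l [m [l0 m0 cl cm lm]]] :=
    proj1 (hilbert_le Om r (CO Cz) Ob0) (lexx _).
  pose n := (Num.truncn `|r|).+1; exists (orbit_nbhd n.+1); first by exists n.+1.
  split=> //; exists 1%g, (2 * l), (2 * m); rewrite act_point1.
  split=> //; rewrite ?mulr_gt0//.
    have cz := cone_aff Om (CO Cz); have cb := cone_aff Om Ob0.
    have E (k : R) (x y : V) : (2 * k) *: x - y = k *: x + (k *: x - y).
      by rewrite mulrDl mul1r scalerDl addrA.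
    by split; rewrite E; apply: (cone_cconeD Om) => //; apply: coneZ.
  have -> : 2 * l * (2 * m) = 4 * (l * m) by ring.
  have rn : r <= n%:R by apply: (le_trans (ler_norm r)); exact/ltW/truncnS_gt.
  have -> : 2 * n.+1%:R = 2 * n%:R + 2 :> R by rewrite -[n.+1%:R]natr1 mulrDr mulr1.
  rewrite expRD [leRHS]mulrC; apply: ler_pM => //; first by rewrite mulr_ge0// ltW.
    have -> : 2 = 1 + 1 :> R by [].
    rewrite expRD; have := @expR_ge1Dx R 1.
    by move=> e2; apply: (le_trans _ (ler_pM _ _ e2 e2)) => //; lra.
  by apply: (le_trans lm); rewrite ler_expR ler_pM2l.
have [N NP] : exists N : nat, forall W, F' W -> W `<=` orbit_nbhd N.
  have mono n n' : (n <= n')%N -> orbit_nbhd n `<=` orbit_nbhd n'.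
    move=> nn z [Cz [a [l [m [? ? ? ? lm]]]]]; split=> //; exists a, l, m; split=> //.
    by apply: (le_trans lm); rewrite ler_expR ler_pM2l// ler_nat.
  have [s sE] := proj1 (finite_seqP _) finF.
  suff [N NP] : exists N : nat, forall W, W \in s -> W `<=` orbit_nbhd N.
    by exists N => W; rewrite sE /= => /NP.
  have : forall W, W \in s -> range orbit_nbhd W by move=> W Ws; apply: F'F; rewrite sE.
  elim: s {sE} => [|W s IH] H; first by exists 0%N.
  have [N NP] := IH (fun W' W's => H W' (mem_behead (s := W :: s) W's)).
  have [n _ nW] := H W (mem_head _ _).
  exists (maxn n N) => W'; rewrite inE => /orP[/eqP ->|/NP/subset_trans]; last first.
    by apply; apply: mono; exact: leq_maxr.
  by rewrite -nW; apply: mono; exact: leq_maxl.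
exists N%:R => z Cz; have [W FW Wz] := CF' z Cz.
have [_ [a [l [m [Ga l0 m0 [c1 c2] lm]]]]] := NP W FW z Wz.
exists a => //; apply/(hilbert_le Om) => //; [exact: CO|exact: Oorb|].
by exists l, m; split=> //; exact: cone_ccone.
Qed.

Lemma escapes_D (x : nat -> PGL V) : (forall k, Gam (x k)) -> escapes x ->
  forall r : R, \forall k \near \oo, r < D (x k).
Proof.
move=> Gx xe r; have := xe _ (finite_balls RCC Cb0 r).
by apply: filterS => k H; rewrite ltNge; apply/negP => xr; apply: H.
Qed.

Lemma escapes_bd (x : nat -> PGL V) : (forall k, Gam (x k)) -> escapes x ->
  exists2 phi : nat -> nat, forall k, (k <= phi k)%N &
  exists2 q, bd q & vcvg (fun k => aff (orb (x (phi k)))) (aff q).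
Proof.
move=> Gx xe; apply: (@bw_bd _ _ _ _ _ _ _ RCC Cb0 (fun k => orb (x k))) => [k|]; first exact: (C_orb RCC Cb0 (Gx k)).
exact: escapes_D.
Qed.

(** Continuity of the action, with explicit estimates in the chart. *)
Lemma bd_act c q : Gam c -> bd q -> bd (act_point c q).
Proof.
move=> Gc bq; have [cq ccq ncq fq] := bd_aff RCC bq.
have [g gc] := lift_exists Om (Gaut Gc).
have [k0 cp kE] := lift_aff Om gc cq ccq.
set k := f _ in k0 kE; have cpE : aff (act_point c q) = k^-1 *: g (aff q).
  by rewrite kE scalerK// gt_eqF.
apply: (bdP RCC) => //.
  apply/(closure_C RCC); split=> // e e0.
  have [B B0 gB] := operator_bounded g; have [M M0 MP] := Omega_bounded RCC.
  have [Bf Bf0 fB'] := functional_bounded f.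
  have [_ clq] := proj1 (closure_C RCC _) (proj1 bq).
  pose e1 := e * k / (B * (1 + Bf * M)).
  have D0 : 0 < B * (1 + Bf * M) by rewrite mulr_gt0// ltr_pwDl// mulr_ge0 ?ltW.
  have [p Cp pq] := clq e1 (divr_gt0 (mulr_gt0 e0 k0) D0).
  have Cap := C_act RCC Gc Cp; exists (act_point c p) => //.
  have [l0 _ lE] := lift_aff Om gc (Omega_chart Om (CO Cp)) (cone_ccone (cone_aff Om (CO Cp))).
  set l := f _ in l0 lE.
  (* with [g p = l p'], [g q = k q']: k (p' - q') = g (p - q) - (l - k) p' *)
  have kpq : k *: (aff (act_point c p) - aff (act_point c q)) =
      g (aff p - aff q) - (l - k) *: aff (act_point c p).
    rewrite lfB lE kE; move: (aff (act_point c p)) (aff (act_point c q)) => y w.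
    by rewrite scalerBl opprB scalerBr [LHS]addrC [in RHS]addrC addrA subrK addrC.
  have : k * enorm (aff (act_point c p) - aff (act_point c q)) < k * e; last by rewrite ltr_pM2l.
  rewrite -{1}(gtr0_norm k0) -enormZ kpq; apply: (le_lt_trans (enormB _ _)); rewrite enormZ.
  have gpq := gB (aff p - aff q).
  have lk : `|l - k| <= Bf * enorm (g (aff p - aff q)).
    by rewrite /l /k -fB -lfB; exact: fB'.
  have : `|l - k| * enorm (aff (act_point c p)) <= Bf * (B * enorm (aff p - aff q)) * M.
    apply: ler_pM => //; first exact: enorm_ge0; last exact: MP (CO Cap).
    by apply: (le_trans lk); rewrite ler_pM2l.
  move: pq; rewrite /e1 ltr_pdivlMr// => pq H; apply: (le_lt_trans (lerD gpq H)).
  by move: (enorm (aff p - aff q)) pq => t pq; lra.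
move=> Oc; apply: ncq; apply/(OmegaE Om cq).
have := act_Omega (Gaut (GV Gc)) Oc; by rewrite -act_pointM mulVg act_point1.
Qed.

End Cobounded.

(** * Rays and coarse geodesics *)

Lemma dist_perturb (R : realFieldType) (ab pq pb aq pa qb r : R) : pa <= r -> qb <= r ->
  aq <= ab + qb -> pq <= pa + aq -> pb <= pq + qb -> ab <= pa + pb ->
  - (2 * r) <= ab - pq <= 2 * r.
Proof. by move=> *; apply/andP; split; lra. Qed.

Section Rays.
Context {R : realType} {V : euclidType R} (f : {scalar V}) (Omega C : set (pspace V)).
Context (Gam : set (PGL V)) (b0 : pspace V).
Context (RCC : regular_convex_cocompact f Omega C Gam) (Cb0 : C b0).
Implicit Types (u v w x y : V) (p q z : pspace V) (g h : 'End(V)) (a b : PGL V).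
Local Notation cone := (cone f Omega).
Local Notation ccone := (ccone f Omega).
Local Notation hilb := (hilbert f Omega).
Local Notation hle := (hle f Omega).
Local Notation aff := (aff f).
Local Notation orb a := (act_point a b0).
Local Notation D a := (hilbert f Omega b0 (act_point a b0)).
Local Notation bd := (bd Omega C).
Let Om := rcc_domain RCC.
Let CO p : C p -> Omega p. Proof. by have [_ _ [CO _ _ _ _] _ _] := RCC; exact: CO. Qed.
Let G1 : Gam 1%g. Proof. by have [] := rcc_subgroup RCC. Qed.
Let GM a b : Gam a -> Gam b -> Gam (a * b)%g.
Proof. by have [_ H _] := rcc_subgroup RCC; exact: H. Qed.
Let GV a : Gam a -> Gam a^-1%g. Proof. by have [_ _ H] := rcc_subgroup RCC; exact: H. Qed.
Let Gaut a : Gam a -> automorphism Omega a. Proof. by have [_ [_ H] _ _ _] := RCC; exact: H. Qed.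
Let Oorb a : Gam a -> Omega (orb a). Proof. exact: (O_orb RCC Cb0). Qed.
Let Ob0 : Omega b0. Proof. exact: CO. Qed.

Let faff p : C p -> f (aff p) = 1. Proof. by move=> Cp; have [] := C_aff RCC Cp. Qed.

Lemma point_of v : f v = 1 -> exists2 p, chart f p & aff p = v.
Proof.
move=> fv; exists (pt (f1_neq0 fv)); last exact: pt_aff.
by apply: f_aff_chart; rewrite pt_aff// fv oner_eq0.
Qed.

(** The chord through [p] and the boundary point [q] leaves the cone exactly at [q]. *)
Lemma ray_exists p q : C p -> bd q -> exists z : R -> pspace V,
  [/\ z 0 = p,
      forall c : R, 0 <= c -> C (z c) /\ segment f `[0, 1[ p q (z c),
      forall c c' : R, 0 <= c -> c <= c' -> hilb (z c) (z c') = c' - c &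
      forall p', segment f `[0, 1[ p q p' -> exists2 c : R, 0 <= c & p' = z c].
Proof.
move=> Cp bq; have [cq ccq ncq fq] := bd_aff RCC bq; have [cp fp] := C_aff RCC Cp.
have pq : aff p <> aff q by move=> pq; apply: ncq; rewrite -pq.
have [s [t [/andP[s0 t0] ch]]] := chord_exists Om cp fp fq pq.
have [_ _ _ _ chP] := ch.
have t1 : t = 1.
  have [c1 c2] := chP 1; rewrite subrr scale0r add0r scale1r in c1 c2.
  have /andP[_ t1] := proj1 c2 ccq; apply/eqP; rewrite eq_le t1 andbT leNgt.
  by apply/negP => t1'; apply/ncq/c1; rewrite t1' andbT; lra.
have [z [ze [zP hz ze0 zsurj]]] := geodesic Om ch s0 t0; rewrite t1 in zP zsurj.
have zch c : chart f (z c).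
  by apply: f_aff_chart; rewrite (proj2 (zP c)) f_chord// oner_eq0.
exists z; split.
- apply: (aff_inj (zch 0)); have [_ ->] := zP 0.
  by rewrite ze0 subr0 scale1r scale0r addr0.
- move=> c c0; have [/andP[_ z1] zE] := zP c; have [z0 _] := hz 0 c c0; rewrite ze0 in z0.
  split; first by apply: (segment_C RCC Cp (proj1 bq) _ (zch c) zE); rewrite z0.
  by split=> //; exists (ze c) => //; rewrite in_itv /= z0.
- by move=> c c' _ /hz[].
- move=> y [_ [r]]; rewrite in_itv /= => /andP[r0 r1] yE.
  have [|c [-> _ cr]] := zsurj y r _ yE; first by rewrite r1 andbT; lra.
  by exists c => //; rewrite cr.
Qed.

Lemma geodesic_segment p q : C p -> C q -> exists z : R -> pspace V,
  [/\ z 0 = p, z (hilb p q) = q,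
      forall c : R, 0 <= c <= hilb p q -> C (z c) /\ segment f `[0, 1] p q (z c) &
      forall c c' : R, 0 <= c -> c <= c' -> c' <= hilb p q -> hilb (z c) (z c') = c' - c].
Proof.
move=> Cp Cq; have [cp fp] := C_aff RCC Cp; have [cq fq] := C_aff RCC Cq.
have [->|pq] := eqVneq p q.
  exists (fun=> q); rewrite hilbxx; split=> // [c _|c c' c0 cc c'0]; last first.
    by apply/le_anti/andP; split; move: c0 cc c'0; lra.
  split=> //; split; first exact: (Omega_chart Om (CO Cq)).
  by exists 0; rewrite ?in_itv /= ?lexx ?ler01// subr0 scale1r scale0r addr0.
have pq' : aff p <> aff q.
  by move=> /(aff_inj (Omega_chart Om (CO Cp))) pq'; rewrite pq' eqxx in pq.
have [s [t [/andP[s0 t0] ch]]] := chord_exists Om cp fp fq pq'.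
have [_ _ _ _ chP] := ch.
have t1 : 1 < t.
  by have [c1 _] := chP 1; move: c1; rewrite subrr scale0r add0r scale1r => /proj1/(_ cq)/andP[].
have [z [ze [zP hz ze0 zsurj]]] := geodesic Om ch s0 t0.
have zch c : chart f (z c).
  by apply: f_aff_chart; rewrite (proj2 (zP c)) f_chord// oner_eq0.
have z0 : z 0 = p.
  apply: (aff_inj (zch 0)); have [_ ->] := zP 0.
  by rewrite ze0 subr0 scale1r scale0r addr0.
have [||c1 [qz zec1 c10]] := zsurj q 1; first by rewrite t1 andbT; lra.
  by rewrite subrr scale0r add0r scale1r.
have c1E : c1 = hilb p q.
  by rewrite qz -{1}z0; have [_ ->] := hz 0 c1 (etrans c10 ler01); rewrite subr0.
exists z; split=> //; first by rewrite -c1E -qz.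
  move=> c /andP[c0]; rewrite -c1E => cc1; have [_ zE] := zP c.
  have [ze_0 _] := hz 0 c c0; rewrite ze0 in ze_0.
  have [ze_1 _] := hz c c1 cc1; rewrite zec1 in ze_1.
  have sg : segment f `[0, 1] p q (z c).
    by split=> //; exists (ze c) => //; rewrite in_itv /= ze_0 ze_1.
  by split=> //; have [_ _ [_ _ _ cv _] _ _] := RCC; exact: cv Cp Cq _ sg.
by move=> c c' c0 cc' _; have [_ ->] := hz c c' cc'.
Qed.

Lemma orb_dist a b p q (r : R) : Gam a -> Gam b -> C p -> C q ->
  hilb p (orb a) <= r -> hilb q (orb b) <= r -> `|D (a^-1 * b)%g - hilb p q| <= 2 * r.
Proof.
move=> Ga Gb Cp Cq pa qb; rewrite -(hilb_orb RCC Cb0)//.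
have [Oa Ob Op Oq] : [/\ Omega (orb a), Omega (orb b), Omega p & Omega q].
  by split; [exact: Oorb|exact: Oorb|exact: CO|exact: CO].
have := hilb_triangle Om Oa Op Ob; have := hilb_triangle Om Op Oq Ob.
have := hilb_triangle Om Op Oa Oq; have := hilb_triangle Om Oa Ob Oq.
rewrite (hilb_sym Om Oa Op) (hilb_sym Om Ob Oq) ler_norml.
exact: dist_perturb.
Qed.

Lemma D_length : length_function Gam (fun a => D a).
Proof.
split.
- by move=> a Ga; apply: (hilb_ge0 Om) => //; exact: Oorb.
- by move=> a; exact: (D_inv RCC Cb0).
- move=> a b Ga Gb; have := hilb_triangle Om Ob0 (Oorb Ga) (Oorb (GM Ga Gb)).
  by rewrite (hilb_orb RCC Cb0 Ga (GM Ga Gb)) mulgA mulVg mul1g.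
- exact: (finite_balls RCC Cb0).
Qed.

Lemma D1 : D 1%g = 0. Proof. by rewrite act_point1 hilbxx. Qed.

(** Unit steps on the geodesic to the orbit point, each replaced by a nearby orbit
    point.  The last step, of length less than one, ends exactly at the orbit point. *)
Lemma coarse_geodesic : exists c0 : R, forall a, Gam a -> exists beta N,
  [/\ beta 0%N = 1%g, beta N = a & coarse_path Gam (fun a => D a) c0 beta N].
Proof.
have [r0 r0P] := cobounded RCC Cb0; pose r := Num.max r0 0; exists (2 * r + 1) => a Ga.
have r_ge0 : 0 <= r by rewrite le_max lexx orbT.
have [z [z0 zd zC zh]] := geodesic_segment Cb0 (C_orb RCC Cb0 Ga).
set d := D a in zd zC zh; have d0 : 0 <= d by apply: (hilb_ge0 Om) => //; exact: Oorb.
have /andP[Nd dN] := truncn_itv d0; set M := Num.truncn d in Nd dN.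
pose pos (i : nat) : R := Num.min i%:R d.
have pos0 i : 0 <= pos i <= d by rewrite le_min ler0n d0 ge_min lexx orbT.
have /choice[b bP] i : exists b, Gam b /\ hilb (z (pos i)) (orb b) <= r.
  have [b Gb bi] := r0P _ (proj1 (zC _ (pos0 i))); exists b; split=> //.
  by rewrite le_max bi.
pose beta i : PGL V := if i == 0%N then 1%g else if i == M.+1 then a else b i.
have beP i : Gam (beta i) /\ ((i <= M.+1)%N -> hilb (z (pos i)) (orb (beta i)) <= r).
  rewrite /beta; have [->|i0] := eqVneq i 0%N.
    by split=> // _; rewrite /pos min_l// z0 act_point1 hilbxx.
  have [->|iM] := eqVneq i M.+1; last by split=> [|_]; case: (bP i).
  by split=> // _; rewrite /pos (min_r (ltW dN)) zd hilbxx.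
exists beta, M.+1; split; rewrite /beta ?eqxx//; split=> [i|i j /andP[ij jM]].
  by case: (beP i).
have [Gi /(_ (leq_trans ij jM)) hi] := beP i; have [Gj /(_ jM) hj] := beP j.
have pij : pos i <= pos j by rewrite le_min !ge_min ler_nat ij lexx orbT.
have [/andP[i0 _] /andP[_ jd]] := (pos0 i, pos0 j).
have := orb_dist Gi Gj (proj1 (zC _ (pos0 i))) (proj1 (zC _ (pos0 j))) hi hj.
rewrite (zh _ _ i0 pij jd) -/(beta i) -/(beta j).
have posj : j%:R - 1 <= pos j <= j%:R.
  rewrite /pos le_min ge_min lexx /= andbT gerBl ler01 /=.
  by rewrite lerBlDr (le_trans (_ : _ <= M.+1%:R)) ?ler_nat// -natr1 lerD2r.
have posi : i%:R - 1 <= pos i <= i%:R.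
  rewrite /pos le_min ge_min lexx /= andbT gerBl ler01 /=.
  by rewrite lerBlDr (le_trans (_ : _ <= M.+1%:R)) ?ler_nat ?(leq_trans ij)// -natr1 lerD2r.
move: posj posi; rewrite natrB// !ler_norml => /andP[? ?] /andP[? ?]; lra.
Qed.

Lemma coarse_ray : exists2 r : R, 0 <= r & forall q, bd q ->
  exists (z : nat -> pspace V) (beta : nat -> PGL V),
  [/\ forall i, [/\ C (z i), segment f `[0, 1[ b0 q (z i), Gam (beta i) &
        hilb (z i) (orb (beta i)) <= r],
      forall i j, (i <= j)%N -> hilb (z i) (z j) = (j - i)%:R,
      forall i j, (i <= j)%N -> `|D ((beta i)^-1 * beta j)%g - (j - i)%:R| <= 2 * r &
      z 0%N = b0 /\ beta 0%N = 1%g].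
Proof.
have [r0 r0P] := cobounded RCC Cb0; pose r := Num.max r0 0; exists r => [|q bq].
  by rewrite le_max lexx orbT.
have r_ge0 : 0 <= r by rewrite le_max lexx orbT.
have [z [z0 zC zh _]] := ray_exists Cb0 bq.
have /choice[b bP] (i : nat) : exists b, [/\ Gam b, hilb (z i%:R) (orb b) <= r &
    i = 0%N -> b = 1%g].
  have [->|i0] := eqVneq i 0%N.
    by exists 1%g; rewrite z0 act_point1 hilbxx.
  have [b Gb bi] := r0P _ (proj1 (zC _ (ler0n _ i))); exists b; split=> //.
    by rewrite le_max bi.
  by move=> iE; rewrite iE eqxx in i0.
have hij i j : (i <= j)%N -> hilb (z i%:R) (z j%:R) = (j - i)%:R.
  by move=> ij; rewrite zh ?ler_nat// natrB.
exists (fun i => z i%:R), b; split.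
- by move=> i; have [? ? _] := bP i; have [? ?] := zC _ (ler0n _ i).
- exact: hij.
- move=> i j ij; have [Gi hi _] := bP i; have [Gj hj _] := bP j.
  have := orb_dist Gi Gj (proj1 (zC _ (ler0n _ i))) (proj1 (zC _ (ler0n _ j))) hi hj.
  by rewrite hij.
by split=> //; have [_ _ ->] := bP 0%N.
Qed.

End Rays.

(** * Visibility *)

Lemma injective_escapes (T : eqType) (x : nat -> T) : injective x -> escapes x.
Proof.
move=> xI A /finite_seqP[s ->]; elim: s => [|a s [N _ NP]]; first by exists 0%N.
have [[k0 <-]|H] := pselect (exists k, x k = a).
  exists (maxn N k0.+1) => // k /=; rewrite geq_max => /andP[Nk kk].
  rewrite inE => /orP[/eqP/xI kE|]; last exact: NP.
  by rewrite kE ltnn in kk.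
exists N => // k /= Nk; rewrite inE => /orP[/eqP xk|]; last exact: NP.
by apply: H; exists k.
Qed.

Lemma align_perturb (R : realFieldType) (da db dab y z yz ya zb r : R) :
  da <= y + ya -> z <= db + zb -> dab <= ya + yz + zb -> z = y + yz -> ya <= r -> zb <= r ->
  da + dab <= db + 4 * r.
Proof. by move=> *; lra. Qed.

Lemma order_perturb (R : realFieldType) (da db y z ya zb r : R) :
  ya <= r -> zb <= r -> da + 2 * r <= db -> y <= da + ya -> db <= z + zb -> y <= z.
Proof. by move=> *; lra. Qed.

Section Visibility.
Context {R : realType} {V : euclidType R} (f : {scalar V}) (Omega C : set (pspace V)).
Context (Gam : set (PGL V)) (b0 : pspace V).
Context (RCC : regular_convex_cocompact f Omega C Gam) (Cb0 : C b0).
Implicit Types (u v w x : V) (p q y z : pspace V) (g h : 'End(V)) (a b : PGL V).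
Local Notation cone := (cone f Omega).
Local Notation ccone := (ccone f Omega).
Local Notation hilb := (hilbert f Omega).
Local Notation hle := (hle f Omega).
Local Notation aff := (aff f).
Local Notation orb a := (act_point a b0).
Local Notation D a := (hilbert f Omega b0 (act_point a b0)).
Local Notation bd := (bd Omega C).
Let Om := rcc_domain RCC.
Let CO p : C p -> Omega p. Proof. by have [_ _ [CO _ _ _ _] _ _] := RCC; exact: CO. Qed.
Let GV a : Gam a -> Gam a^-1%g. Proof. by have [_ _ H] := rcc_subgroup RCC; exact: H. Qed.
Let Gaut a : Gam a -> automorphism Omega a. Proof. by have [_ [_ H] _ _ _] := RCC; exact: H. Qed.
Let Oorb a : Gam a -> Omega (orb a). Proof. exact: (O_orb RCC Cb0). Qed.
Let Ob0 : Omega b0. Proof. exact: CO. Qed.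

Lemma ray_additive q y z : bd q -> segment f `[0, 1[ b0 q y -> segment f `[0, 1[ b0 q z ->
  hilb b0 y <= hilb b0 z -> hilb b0 z = hilb b0 y + hilb y z.
Proof.
move=> bq sy sz; have [g [g0 gC gh gS]] := ray_exists RCC Cb0 bq.
have [c c0 ->] := gS _ sy; have [c' c'0 ->] := gS _ sz.
have h0 t : 0 <= t -> hilb b0 (g t) = t by move=> t0; rewrite -{1}g0 gh// subr0.
by rewrite !h0// => cc; rewrite gh// addrC subrK.
Qed.

(** Both orbit points are close to the same ray, in this order. *)
Lemma ray_aligned q y z a b (r : R) : bd q -> C y -> C z ->
  segment f `[0, 1[ b0 q y -> segment f `[0, 1[ b0 q z -> Gam a -> Gam b ->
  hilb y (orb a) <= r -> hilb z (orb b) <= r -> D a + 2 * r <= D b ->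
  D a + D (a^-1 * b)%g <= D b + 4 * r.
Proof.
move=> bq Cy Cz sy sz Ga Gb ya zb ab.
have [Oa Ob Oy Oz] : [/\ Omega (orb a), Omega (orb b), Omega y & Omega z].
  by split; [exact: Oorb|exact: Oorb|exact: CO|exact: CO].
have t1 := hilb_triangle Om Ob0 Oa Oy; have t2 := hilb_triangle Om Ob0 Oz Ob.
have t3 := hilb_triangle Om Ob0 Oy Oa; have t4 := hilb_triangle Om Ob0 Ob Oz.
have t5 := hilb_triangle Om Oa Oy Ob; have t6 := hilb_triangle Om Oy Oz Ob.
rewrite -(hilb_orb RCC Cb0 Ga Gb).
rewrite (hilb_sym Om Oa Oy) in t1 t5; rewrite (hilb_sym Om Ob Oz) in t4.
have yz : hilb b0 y <= hilb b0 z := order_perturb ya zb ab t1 t2.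
have E := ray_additive bq sy sz yz.
apply: (align_perturb t3 t4 _ E ya zb); apply: (le_trans t5).
by rewrite -addrA lerD2l.
Qed.

Lemma lim_C (p : nat -> pspace V) v : (forall k, C (p k)) -> vcvg (fun k => aff (p k)) v ->
  exists q, [/\ chart f q, closure C q & aff q = v].
Proof.
move=> Cp pv; have [phi phik [q [cq clq qv]]] := bw_C RCC Cp; exists q; split=> //.
by apply: (vcvg_unique qv); exact: (vcvg_sub phik pv).
Qed.

(** If both ends converge to the same boundary point, so does the segment, and then
    so does the base point by [bd_face]. *)
Lemma ends_distinct (p q m : nat -> pspace V) (x' y' : pspace V) (r : R) :
  (forall k, [/\ C (p k), C (q k), Omega (m k) & segment f `[0, 1] (p k) (q k) (m k)]) ->
  (forall k, hilb (m k) b0 <= r) -> bd x' ->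
  vcvg (fun k => aff (p k)) (aff x') -> vcvg (fun k => aff (q k)) (aff y') -> x' <> y'.
Proof.
move=> H mr bx px qy xy; rewrite -xy in qy.
have mx : vcvg (fun k => aff (m k)) (aff x').
  move=> e e0; have e2 : 0 < e / 2 by rewrite divr_gt0.
  near=> k; have [_ _ _ [_ [t]]] := H k; rewrite in_itv /= => /andP[t0 t1] mE.
  have hp : enorm (aff (p k) - aff x') < e / 2 by near: k; exact: px.
  have hq : enorm (aff (q k) - aff x') < e / 2 by near: k; exact: qy.
  rewrite mE; move: (aff (p k)) (aff (q k)) (aff x') hp hq => u w v hu hw.
  have -> : (1 - t) *: u + t *: w - v = (1 - t) *: (u - v) + t *: (w - v).
    rewrite !scalerBr addrACA -opprD -scalerDl.
    by rewrite subrK scale1r.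
  apply: (le_lt_trans (enormD _ _)); rewrite !enormZ (ger0_norm t0).
  rewrite (ger0_norm (_ : 0 <= 1 - t)) ?subr_ge0//.
  have a1 : (1 - t) * enorm (u - v) <= (1 - t) * (e / 2) by rewrite ler_wpM2l ?subr_ge0// ltW.
  have a2 : t * enorm (w - v) <= t * (e / 2) by rewrite ler_wpM2l// ltW.
  by move: a1 a2 e0; lra.
have Omk k : Omega (m k) by case: (H k).
have := bd_face RCC Omk (fun=> Ob0) mr bx mx.
move=> /(vcvg_unique (vcvg_cst _)) E; have [cx _ ncx _] := bd_aff RCC bx.
by apply: ncx; rewrite -E; exact: cone_aff.
Unshelve. all: by end_near. Qed.

Lemma segment_open p q z : chart f q -> segment f `[0, 1] p q z -> z <> q ->
  segment f `[0, 1[ p q z.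
Proof.
move=> cq [cz [t]]; rewrite in_itv /= => /andP[t0 t1] zE zq; split=> //; exists t => //.
rewrite in_itv /= t0 lt_neqAle t1 andbT; apply: contra_not_neq zq => tE.
by apply: (aff_inj cz); rewrite zE tE subrr scale0r add0r scale1r.
Qed.

Lemma segment_closed p q z : segment f `[0, 1[ p q z -> segment f `[0, 1] p q z.
Proof.
move=> [cz [t]]; rewrite in_itv /= => /andP[t0 t1] zE; split=> //; exists t => //.
by rewrite in_itv /= t0 ltW.
Qed.

(** Translating the midpoints of longer and longer geodesic segments back to the base
    point gives segments through a fixed ball with both ends going to infinity. *)
Lemma two_bd : infinite_set Gam -> exists q q', [/\ bd q, bd q' & q <> q'].
Proof.
move=> /infinite_seq[x Gx xI]; have xe := injective_escapes xI.
have [r r0 rP] : exists2 r : R, 0 <= r & forall z, C z -> exists2 a, Gam a & hilb z (orb a) <= r.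
  have [r rP] := cobounded RCC Cb0; exists (Num.max r 0); first by rewrite le_max lexx orbT.
  by move=> z /rP[a Ga za]; exists a; rewrite // le_max za.
have /choice[m mP] k : exists m, [/\ C m, segment f `[0, 1] b0 (orb (x k)) m,
    hilb b0 m = D (x k) / 2 & hilb m (orb (x k)) = D (x k) / 2].
  have [g [g0 gd gC gh]] := geodesic_segment RCC Cb0 (C_orb RCC Cb0 (Gx k)).
  set d := D (x k) in gd gC gh *; have d0 : 0 <= d by apply: (hilb_ge0 Om) => //; exact: Oorb.
  have d2 : 0 <= d / 2 by rewrite divr_ge0.
  have d2d : d / 2 <= d by move: d0; lra.
  have [Cm sm] : C (g (d / 2)) /\ segment f `[0, 1] b0 (orb (x k)) (g (d / 2)).
    by apply: gC; rewrite d2.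
  exists (g (d / 2)); split=> //; first by rewrite -{1}g0 gh// subr0.
  by rewrite -gd gh//; move: d0; lra.
have /choice[h hP] k : exists a, Gam a /\ hilb (m k) (orb a) <= r.
  by have [Cm _ _ _] := mP k; have [a Ga ma] := rP _ Cm; exists a.
pose i k := ((h k)^-1)%g; have Gi k : Gam (i k) by apply: GV; case: (hP k).
have Oh k : Omega (orb (h k)) by apply: Oorb; case: (hP k).
have Ox k : Omega (orb (x k)) by exact: Oorb.
have Cmk k : C (m k) by case: (mP k).
have hb (p : nat -> pspace V) k : Omega (p k) -> hilb b0 (act_point (i k) (p k)) = hilb (orb (h k)) (p k).
  move=> Op; rewrite -(hilb_act Om (Gaut (Gi k)) (Oh k) Op) -act_pointM mulVg.
  by rewrite act_point1.
have inf (p : nat -> pspace V) : (forall k, C (p k)) -> (forall k, D (x k) / 2 <= hilb (m k) (p k)) ->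
    forall s : R, \forall k \near \oo, s < hilb b0 (act_point (i k) (p k)).
  move=> Cp mp s; near=> k.
  have : 2 * (s + r) < D (x k) by near: k; exact: (escapes_D RCC Cb0 Gx xe).
  have [_ hm] := hP k; have := mp k.
  rewrite hb; last exact: CO (Cp k).
  have := hilb_triangle Om (CO (Cmk k)) (Oh k) (CO (Cp k)); move: hm; lra.
pose p k := act_point (i k) b0; pose q k := act_point (i k) (orb (x k)).
have Cp k : C (p k) by exact: (C_act RCC).
have Cq k : C (q k) by apply: (C_act RCC) => //; exact: (C_orb RCC).
have pinf : forall s : R, \forall k \near \oo, s < hilb b0 (p k).
  apply: (inf (fun=> b0)) => // k.
  by have [_ _ <- _] := mP k; rewrite (hilb_sym Om Ob0 (CO (Cmk k))).
have qinf : forall s : R, \forall k \near \oo, s < hilb b0 (q k).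
  apply: (inf (fun k => orb (x k))) => k; first exact: (C_orb RCC Cb0 (Gx k)).
  by have [_ _ _ ->] := mP k.
have [phi phik [x' bx px]] := bw_bd RCC Cb0 Cp pinf.
have qinf' (s : R) : \forall k \near \oo, s < hilb b0 (q (phi k)).
  by have [N _ NP] := qinf s; exists N => // k /= Nk; apply: NP; exact: leq_trans (phik k).
have [psi psik [y' by' qy]] := bw_bd RCC Cb0 (fun k => Cq (phi k)) qinf'.
exists x', y'; split=> //.
apply: (@ends_distinct (fun k => p (phi (psi k))) (fun k => q (phi (psi k)))
  (fun k => act_point (i (phi (psi k))) (m (phi (psi k)))) _ _ r) => //; last first.
- exact: (vcvg_sub psik px).
- move=> k; move: (phi (psi k)) => {}k; rewrite (hilb_sym Om _ Ob0).
    rewrite (hb m)//; last exact: CO (Cmk k).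
    by rewrite (hilb_sym Om (Oh k) (CO (Cmk k))); case: (hP k).
  exact: CO (C_act RCC (Gi k) (Cmk k)).
move=> k; move: (phi (psi k)) => {}k; split=> //; first exact: CO (C_act RCC (Gi k) (Cmk k)).
have [_ sm _ mx] := mP k; have [E|mn] := pselect (m k = orb (x k)); last first.
  apply: segment_closed; apply: (act_segment Om (Gaut (Gi k))).
  - exact: (Omega_chart Om Ob0).
  - exact: (Omega_chart Om (Ox k)).
  - exact/cone_ccone/cone_aff.
  - exact/cone_ccone/(cone_aff Om (Ox k)).
  - by apply: segment_open => //; exact: (Omega_chart Om (Ox k)).
rewrite E; split; first exact: (Omega_chart Om (CO (Cq k))).
exists 1; first by rewrite in_itv /= ler01 lexx.
by rewrite subrr scale0r add0r scale1r.
Unshelve. all: by end_near. Qed.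

(** Seen from the orbit point, the base point goes to some limit [w].  Any ray towards
    a boundary point distinct from [w] then passes at bounded distance from the
    orbit point, since the segment from [w] to this point meets the domain by extremity;
    two boundary points suffice to have one distinct from [w]. *)
Lemma orbit_visible : infinite_set Gam -> exists2 r : R, 0 <= r & forall a, Gam a ->
  exists q z, [/\ bd q, C z, segment f `[0, 1[ b0 q z & hilb z (orb a) <= r].
Proof.
move=> /two_bd[x1 [x2 [bx1 bx2 x12]]]; apply: contrapT => H.
have {}H (n : nat) : exists a, Gam a /\ forall q z, bd q -> C z ->
    segment f `[0, 1[ b0 q z -> n%:R < hilb z (orb a).
  apply: contrapT => H'; apply: H; exists n%:R; first exact: ler0n.
  move=> a Ga; apply: contrapT => H2; apply: H'; exists a; split=> // q z bq Cz sz.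
  by rewrite ltNge; apply/negP => zn; apply: H2; exists q, z.
have [a aP] := choice H; pose i n := ((a n)^-1)%g.
have Gi n : Gam (i n) by apply: GV; case: (aP n).
have Ga n : Gam (a n) by case: (aP n).
have far n q z : bd q -> C z -> segment f `[0, 1[ (orb (i n)) q z -> n%:R < hilb z b0.
  move=> bq Cz sz; have [cq ccq _ _] := bd_aff RCC bq.
  have : segment f `[0, 1[ b0 (act_point (a n) q) (act_point (a n) z).
    have {1}-> : b0 = act_point (a n) (orb (i n)) by rewrite -act_pointM mulgV act_point1.
    apply: (act_segment Om (Gaut (Ga n))) => //.
      exact: (Omega_chart Om (Oorb (Gi n))).
    exact/cone_ccone/(cone_aff Om (Oorb (Gi n))).
  have [_ /(_ (act_point (a n) q) (act_point (a n) z)) H'] := aP n => /H' -/(_ _ _).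
  rewrite (hilb_act Om (Gaut (Ga n)) (CO Cz) Ob0); apply; last exact: (C_act RCC).
  exact: (bd_act RCC).
have Cw n : C (orb (i n)) by exact: (C_orb RCC).
have [phi phik [w [cw clw wl]]] := bw_C RCC Cw.
have bounded (m : nat -> pspace V) q : Omega q -> (forall k, C (m k)) ->
    vcvg (fun k => aff (m k)) (aff q) ->
    (forall k, (phi k)%:R < hilb (m k) b0) -> False.
  move=> Oq Cm mq mfar; have [d d0 dP] := hilb_near Om Oq.
  have [N _ NP] := mq d d0; pose k := maxn N (Num.truncn (hilb q b0 + 1)).+1.
  have Nk : (N <= k)%N by rewrite leq_max leqnn.
  have [_ qm] := dP _ (Omega_chart Om (CO (Cm k))) (NP k Nk).
  have kb : hilb q b0 + 1 < k%:R.
    by rewrite (lt_le_trans (truncnS_gt _))// ler_nat leq_max leqnn orbT.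
  have := hilb_triangle Om (CO (Cm k)) Oq Ob0.
  rewrite (hilb_sym Om (CO (Cm k)) Oq) => h3.
  have h4 : k%:R <= (phi k)%:R :> R by rewrite ler_nat.
  by move: (mfar k) qm kb h3 h4; lra.
have [Ow|nOw] := pselect (Omega w).
  apply: (bounded _ _ Ow (fun k => Cw (phi k)) wl) => k.
  apply: (far _ x1) => //; split; first exact: (Omega_chart Om (CO (Cw _))).
  by exists 0; rewrite ?in_itv /= ?lexx ?ltr01// subr0 scale1r scale0r addr0.
have bw := bdP RCC cw clw nOw.
have [x [bx xw]] : exists x : pspace V, bd x /\ w <> x.
  by have [wx|wx] := pselect (w = x1); [exists x2; rewrite wx|exists x1].
have [cx ccx ncx fx] := bd_aff RCC bx; have [_ ccw _ fw] := bd_aff RCC bw.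
have h01 : 0 < (2^-1 : R) < 1 by rewrite invr_gt0 invf_lt1 ?ltr1n ?ltr0n.
pose mid p := (1 - 2^-1) *: aff p + 2^-1 *: aff x.
have /choice[m mP] k : exists m, chart f m /\ aff m = mid (orb (i (phi k))).
  have [m cm mE] := point_of (f_chord 2^-1 (proj2 (C_aff RCC (Cw (phi k)))) fx).
  by exists m.
have Cm k : C (m k).
  have [cm mE] := mP k; apply: (segment_C RCC (Cw (phi k)) (proj1 bx) _ cm mE).
  by case/andP: h01 => /ltW -> ->.
have ml : vcvg (fun k => aff (m k)) (mid w).
  have -> : (fun k => aff (m k)) = (fun k => mid (orb (i (phi k)))).
    by apply/funext => k; case: (mP k).
  by apply: vcvgD; [exact: vcvgZ|exact: vcvg_cst].
have [q [cq clq qE]] := lim_C Cm ml.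
have Oq : Omega q.
  apply: contrapT => nq; apply: xw; apply: (aff_inj cw).
  by apply: (bd_extreme RCC (bdP RCC cq clq nq) ccw ccx fw fx h01); rewrite qE.
rewrite -qE in ml; apply: (bounded m q Oq Cm ml) => k; apply: (far _ x) => //.
have [cm mE] := mP k; split=> //; exists 2^-1 => //.
by rewrite in_itv /=; case/andP: h01 => /ltW -> ->.
Qed.

End Visibility.

(** * Rank one limits *)

Section Collapse.
Context {R : realType} {V : euclidType R} (f : {scalar V}) (Omega C : set (pspace V)).
Context (Gam : set (PGL V)) (b0 : pspace V).
Context (RCC : regular_convex_cocompact f Omega C Gam) (Cb0 : C b0).
Implicit Types (u v w x : V) (p q y z : pspace V) (g h : 'End(V)) (a b : PGL V).
Local Notation cone := (cone f Omega).
Local Notation ccone := (ccone f Omega).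
Local Notation hilb := (hilbert f Omega).
Local Notation hle := (hle f Omega).
Local Notation aff := (aff f).
Local Notation orb a := (act_point a b0).
Local Notation bd := (bd Omega C).
Let Om := rcc_domain RCC.
Let CO p : C p -> Omega p. Proof. by have [_ _ [CO _ _ _ _] _ _] := RCC; exact: CO. Qed.
Let Gaut a : Gam a -> automorphism Omega a. Proof. by have [_ [_ H] _ _ _] := RCC; exact: H. Qed.
Let Oorb a : Gam a -> Omega (orb a). Proof. exact: (O_orb RCC Cb0). Qed.
Let Ob0 : Omega b0. Proof. exact: CO. Qed.

Section RankOne.
Context (x : nat -> PGL V) (q : pspace V).
Context (Gx : forall k, Gam (x k)) (bq : bd q).
Context (xq : vcvg (fun k => aff (orb (x k))) (aff q)).
Local Notation Y := (aff q).

(** By [bd_face] the orbit of any point of the domain has the same limit, and by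
    definition of the Hilbert metric the sizes of the images are comparable. *)
Let collapse_cone w (e : R) : cone w -> 0 < e -> \forall k \near \oo, forall h,
  lifts f Omega (x k) h -> enorm (h w - f (h w) *: Y) <= e * f (h (aff b0)).
Proof.
move=> cw e0; have [fw [p Op wp]] := cw; have wE := aff_eq wp (lt0r_neq0 fw).
have [l [m [l0 m0 cl cm lm]]] := proj1 (hilbert_le Om _ Op Ob0) (lexx _).
(* [f w * l] bounds the size of [w] against the base vector *)
pose L := f w * l; have L0 : 0 < L by rewrite mulr_gt0.
have Oxp k : Omega (act_point (x k) p) by exact: act_Omega (Gaut (Gx k)) Op.
have xp : vcvg (fun k => aff (act_point (x k) p)) Y.
  apply: (bd_face RCC (fun k => Oorb (Gx k)) Oxp (r := hilb b0 p) _ bq xq) => k.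
  by rewrite (hilb_act Om (Gaut (Gx k)) Ob0 Op).
have [N _ NP] := xp (e / L) (divr_gt0 e0 L0); exists N => // k /NP pk h hx.
have [_ _ hE] := lift_aff Om hx (Omega_chart Om Op) (cone_ccone (cone_aff Om Op)).
have wE' : w = f w *: aff p by rewrite wE scalerA mulfV ?scale1r// gt_eqF.
have fhw : 0 < f (h w) by have [+ _] := proj1 (proj2 hx _) cw.
have hwE : h w = f (h w) *: aff (act_point (x k) p).
  rewrite wE' lfZ fZ hE fZ (f_aff (Omega_chart Om (Oxp k))) mulr1.
  by move: (aff (act_point _ _)) => y; rewrite scalerA.
rewrite {1}hwE -scalerBr enormZ gtr0_norm//.
have fle : f (h w) <= L * f (h (aff b0)).
  have := ccone_f Om (proj1 (lift_ccone _ hx) cl); rewrite lfB lfZ fB fZ subr_ge0.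
  by move=> H; rewrite [in leLHS]wE' lfZ fZ /L -mulrA ler_pM2l.
have -> : e * f (h (aff b0)) = L * f (h (aff b0)) * (e / L) by field; rewrite gt_eqF.
by apply: ler_pM => //; [exact: ltW|exact: enorm_ge0|exact: ltW].
Qed.

(** The error term is linear in [w], and [w] is a difference of cone vectors up to
    scaling. *)
Let collapse_vec w (e : R) : 0 < e -> \forall k \near \oo, forall h,
  lifts f Omega (x k) h -> enorm (h w - f (h w) *: Y) <= e * f (h (aff b0)).
Proof.
move=> e0; have cb := cone_aff Om Ob0; have [d d0 dP] := cone_open Om cb.
pose t := d / (enorm w + 1); have w1 : 0 < enorm w + 1 by rewrite ltr_pwDr// enorm_ge0.
have t0 : 0 < t by rewrite divr_gt0.
have ct : cone (aff b0 + t *: w).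
  apply: dP; rewrite addrAC subrr add0r enormZ gtr0_norm// /t mulrAC ltr_pdivrMr//.
  by rewrite ltr_pM2l// ltrDl.
have e1 : 0 < e * t / 2 by rewrite divr_gt0// mulr_gt0.
have [N1 _ N1P] := collapse_cone ct e1; have [N2 _ N2P] := collapse_cone cb e1.
exists (maxn N1 N2) => // k /=; rewrite geq_max => /andP[k1 k2] h hx.
have := lerD (N1P k k1 h hx) (N2P k k2 h hx).
move=> /(le_trans (enormB _ _)).
have -> : h (aff b0 + t *: w) - f (h (aff b0 + t *: w)) *: Y -
    (h (aff b0) - f (h (aff b0)) *: Y) = t *: (h w - f (h w) *: Y).
  move: (aff b0) => b; rewrite lfD lfZ fD fZ; move: (h b) (h w) Y => u v y.
  by rewrite scalerDl opprD addrACA [X in X - _]addrC addrK scalerBr scalerA.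
rewrite enormZ gtr0_norm// => H; rewrite -(ler_pM2l t0); apply: (le_trans H).
by rewrite le_eqVlt; apply/orP; left; apply/eqP; field.
Qed.

Let collapse (e : R) : 0 < e -> \forall k \near \oo, forall h, lifts f Omega (x k) h ->
  forall w, enorm (h w - f (h w) *: Y) <= e * f (h (aff b0)) * enorm w.
Proof.
move=> e0; have [es eo en] := @exists_orthoseq R V.
have n0 : 0 < (size es).+1%:R :> R by rewrite ltr0n.
have /choice[Ns NsP] (i : 'I_(size es)) : exists N : nat, forall k, (N <= k)%N ->
    forall h, lifts f Omega (x k) h ->
    enorm (h es`_i - f (h es`_i) *: Y) <= e / (size es).+1%:R * f (h (aff b0)).
  by have [N _ NP] := collapse_vec es`_i (divr_gt0 e0 n0); exists N.
exists (\max_i Ns i) => // k /= kN h hx w.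
have fb : 0 < f (h (aff b0)) by have [] := proj1 (proj2 hx _) (cone_aff Om Ob0).
have -> : h w - f (h w) *: Y =
    \sum_(i < size es) dotp w es`_i *: (h es`_i - f (h es`_i) *: Y).
  have hw : h w = \sum_(i < size es) dotp w es`_i *: h es`_i.
    rewrite [in LHS](orthoseq_expand w eo en) [LHS]linear_sum.
    by apply: eq_bigr => i _; exact: lfZ.
  rewrite hw [X in X *: _]linear_sum scaler_suml -sumrB; apply: eq_bigr => i _.
  by rewrite scalerBr fZ; move: Y => y; rewrite scalerA.
apply: (le_trans (enorm_sum _ _ _)).
apply: (le_trans (y := \sum_(i < size es) (enorm w * (e / (size es).+1%:R * f (h (aff b0)))))).
  apply: ler_sum => i _; rewrite enormZ; apply: ler_pM => //; first exact: enorm_ge0.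
    apply: (le_trans (dotp_le _ _)); rewrite [enorm es`_i](_ : _ = 1) ?mulr1//.
    by apply/enorm1P; rewrite eo// eqxx.
  exact: (NsP i k (leq_trans (leq_bigmax i) kN) h hx).
rewrite sumr_const card_ord -[leLHS]mulr_natr.
have -> : enorm w * (e / (size es).+1%:R * f (h (aff b0))) * (size es)%:R =
    e * f (h (aff b0)) * enorm w * ((size es)%:R / (size es).+1%:R) by ring.
rewrite ler_piMr ?mulr_ge0 ?enorm_ge0 ?(ltW e0) ?(ltW fb)//.
by rewrite ler_pdivrMr// mul1r ler_nat.
Qed.

(** The deviation of [g] from the rank one map onto the line of [Y], with linear form
    [f o g], is small compared to the norm of [g].  On the kernel of this form [g] is
    small, which bounds the second singular value. *)
Lemma rank_one (e : R) : 0 < e -> \forall k \near \oo, forall g s1 s2 u v,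
  <[g]>%VS = x k -> svtop g s1 s2 u v ->
  s2 <= e * s1 /\ exists c : R, enorm (c *: u - Y) <= e.
Proof.
move=> e0; have [B B0 fB'] := functional_bounded f.
have cb := cone_aff Om Ob0; have [cq _ _ fY] := bd_aff RCC bq.
have Y0 : 0 < enorm Y by rewrite enorm_gt0 aff_neq0.
have b00 : 0 < enorm (aff b0) by rewrite enorm_gt0 (cone_neq0 cb).
pose A := B * enorm Y + 1; have A0 : 0 < A by rewrite addr_gt0// mulr_gt0.
pose K := B * enorm (aff b0); have K0 : 0 < K by rewrite mulr_gt0.
(* [e1] bounds the deviation of g from the line of Y relatively to s1 *)
pose e1 := Num.min (e / A) (Num.min 2^-1 (e / (2 * enorm Y))).
have e10 : 0 < e1.
  by rewrite !lt_min divr_gt0//= invr_gt0 ltr0n /= divr_gt0// mulr_gt0.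
have [N _ NP] := collapse (divr_gt0 e10 K0); exists N => // k /NP H g s1 s2 u v gx gs.
have [h hx] := lift_exists Om (Gaut (Gx k)).
have [c c0 gE] := pgl_line_eq gx (proj1 hx).
have fb : 0 < f (h (aff b0)) by have [] := proj1 (proj2 hx _) cb.
have {}H w : exists m : R, enorm (g w - m *: Y) <= e1 * s1 * enorm w /\
    (f (g w) = 0 -> m = 0).
  exists (c * f (h w)); rewrite gE lfunE /= fZ; split=> //.
  rewrite -scalerA -scalerBr enormZ; apply: (le_trans (ler_wpM2l (normr_ge0 _) (H h hx w))).
  rewrite mulrA; apply: ler_wpM2r; first exact: enorm_ge0.
  have -> : `|c| * (e1 / K * f (h (aff b0))) = e1 * (`|c| * f (h (aff b0)) / K) by ring.
  rewrite ler_pM2l// ler_pdivrMr//.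
  have := svtop_norm (aff b0) gs; rewrite gE lfunE /= enormZ => H1.
  have H2 := le_trans (ler_norm _) (fB' (h (aff b0))).
  rewrite /K [s1 * _]mulrCA; apply: (le_trans _ (ler_wpM2l (ltW B0) H1)).
  by rewrite mulrCA ler_wpM2l.
have [/andP[s20 s21] [u1 v1] gv _ _] := gs; have s10 := le_trans s20 s21.
split.
  apply: (svtop_minmax gs (p := fun w => f (g w))) => [|a b w w'|w fw].
  - by rewrite mulr_ge0// ltW.
  - by rewrite lfD !lfZ fD !fZ.
  have [m [mP /(_ fw) m0]] := H w; move: mP; rewrite m0 scale0r subr0 => /le_trans; apply.
  rewrite ler_wpM2r ?enorm_ge0// ler_wpM2r// /e1 ge_min; apply/orP; left.
  by rewrite ler_pdivrMr// ler_peMr ?(ltW e0)// lerDr mulr_ge0// ltW.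
have s1_gt0 : 0 < s1.
  rewrite -(pmulr_lgt0 _ b00); apply: lt_le_trans (svtop_norm (aff b0) gs).
  rewrite enorm_gt0; apply: contra_neq c0 => gb0; have := f0 f; rewrite -gb0 gE lfunE /= fZ.
  by move=> /eqP; rewrite mulf_eq0 (gt_eqF fb) orbF => /eqP.
have [m [+ _]] := H v; rewrite gv v1 mulr1.
have -> : s1 *: u - m *: Y = s1 *: (u - (m / s1) *: Y).
  by rewrite scalerBr; move: Y => y; rewrite scalerA mulrC divfK ?gt_eqF.
rewrite enormZ gtr0_norm// mulrC ler_pM2r//; set m' := m / s1 => um.
have m'Y : 2^-1 <= `|m'| * enorm Y.
  have := enorm_triangle (m' *: Y) u 0; rewrite !subr0 u1 enormZ => H1.
  have e12 : e1 <= 2^-1 by rewrite /e1 !ge_min lexx !orbT.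
  by move: H1 um e12; set z := `|m'| * _; lra.
have m0 : 0 < `|m'|.
  by rewrite -(pmulr_lgt0 _ Y0) (lt_le_trans _ m'Y)// invr_gt0.
have m'0 : m' != 0 by rewrite -normr_gt0.
exists m'^-1; rewrite -(ler_pM2l m0) -enormZ scalerBr scalerA mulfV// scale1r.
apply: (le_trans um); rewrite (le_trans (y := e / (2 * enorm Y)))//.
  by rewrite /e1 !ge_min lexx !orbT.
rewrite ler_pdivrMr ?mulr_gt0//.
have -> : `|m'| * e * (2 * enorm Y) = e * (2 * (`|m'| * enorm Y)) by ring.
by rewrite ler_peMr ?(ltW e0)//; move: m'Y; lra.
Qed.

End RankOne.

End Collapse.

(** * The limit set of a convex cocompact group *)

Section LimitSet.
Context {R : realType} {V : euclidType R} (f : {scalar V}) (Omega C : set (pspace V)).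
Context (Gam : set (PGL V)) (b0 : pspace V).
Context (RCC : regular_convex_cocompact f Omega C Gam) (Cb0 : C b0).
Implicit Types (u v w x : V) (p q y z : pspace V) (g h : 'End(V)) (a b : PGL V).
Local Notation cone := (cone f Omega).
Local Notation ccone := (ccone f Omega).
Local Notation hilb := (hilbert f Omega).
Local Notation hle := (hle f Omega).
Local Notation aff := (aff f).
Local Notation orb a := (act_point a b0).
Local Notation D a := (hilbert f Omega b0 (act_point a b0)).
Local Notation bd := (bd Omega C).
Let Om := rcc_domain RCC.
Let CO p : C p -> Omega p. Proof. by have [_ _ [CO _ _ _ _] _ _] := RCC; exact: CO. Qed.
Let G1 : Gam 1%g. Proof. by have [] := rcc_subgroup RCC. Qed.
Let GM a b : Gam a -> Gam b -> Gam (a * b)%g.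
Proof. by have [_ H _] := rcc_subgroup RCC; exact: H. Qed.
Let GV a : Gam a -> Gam a^-1%g. Proof. by have [_ _ H] := rcc_subgroup RCC; exact: H. Qed.
Let Gaut a : Gam a -> automorphism Omega a. Proof. by have [_ [_ H] _ _ _] := RCC; exact: H. Qed.
Let Oorb a : Gam a -> Omega (orb a). Proof. exact: (O_orb RCC Cb0). Qed.
Let Ob0 : Omega b0. Proof. exact: CO. Qed.

Lemma infinite_dim : infinite_set Gam -> (1 < \dim {:V})%N.
Proof.
move=> /(two_bd RCC Cb0)[p [q [bp bq pq]]]; rewrite ltnNge; apply/negP => n1; apply: pq.
have full (r : pspace V) : r = fullv :> {vspace V}.
  by apply/eqP; rewrite eqEdim subvf /= dim_proj.
by apply: val_inj; rewrite /= !full.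
Qed.

Lemma attracting_cvg (x : nat -> PGL V) q (r : nat -> pspace V) : (1 < \dim {:V})%N ->
  (forall k, Gam (x k)) -> bd q -> vcvg (fun k => aff (orb (x k))) (aff q) ->
  (forall k, is_U1 (x k) (r k)) -> pcvg r q.
Proof.
move=> n1 Gx bq xq xr e e0; have [cq _ _ _] := bd_aff RCC bq.
have [d d0 dP] := near_mdist (aff_neq0 cq) e0.
have d2 : 0 < d / 2 by rewrite divr_gt0.
have := rank_one RCC Cb0 Gx bq xq d2; apply: filterS => k H.
have [g [s1 [s2 [u [v [gx gs up]]]]]] := U1_svtop n1 (xr k).
have [_ [c cu]] := H g s1 s2 u v gx gs.
have [||_] := dP q (r k) (c *: u) (aff_mem _ q); rewrite ?memvZ//.
by apply: (le_lt_trans cu); rewrite ltr_pdivrMr// ltr_pMr// ltr1n.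
Qed.

Lemma escapes_alpha1 (x : nat -> PGL V) (r : R) : (1 < \dim {:V})%N ->
  (forall k, Gam (x k)) -> escapes x -> \forall k \near \oo, r < alpha1 (x k).
Proof.
move=> n1 Gx xe; apply: contrapT => H.
have /choice[psi psiP] N : exists k, (N <= k)%N /\ alpha1 (x k) <= r.
  apply: contrapT => H'; apply: H; exists N => //= k Nk; rewrite ltNge; apply/negP => kr.
  by apply: H'; exists k.
have psik k : (k <= psi k)%N by case: (psiP k).
have [phi phik [q bq xq]] :=
  escapes_bd RCC Cb0 (fun k => Gx (psi k)) (escapes_comp psik xe).
have [N _ NP] := rank_one RCC Cb0 (fun k => Gx (psi (phi k))) bq xq
  (divr_gt0 (expR_gt0 (- r)) (ltr0Sn R 1)).
have gx := pgl_rep (x (psi (phi N))).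
have [s1 [s2 [u [v gs]]]] := svtop_exists n1 gx.
have [s1_gt0 _ s2E] := svtop_alpha n1 gx gs.
have [+ _] := NP N (leqnn N) _ s1 s2 u v gx gs.
rewrite s2E mulrC ler_pM2r// leNgt => /negP; apply.
apply: (lt_le_trans (y := expR (- r))).
  by rewrite ltr_pdivrMr// ltr_pMr ?expR_gt0// ltr1n.
by rewrite ler_expR lerN2; case: (psiP (phi N)).
Qed.

Lemma bd_sequence q : bd q -> exists x : nat -> PGL V,
  [/\ forall k, Gam (x k), escapes x & vcvg (fun k => aff (orb (x k))) (aff q)].
Proof.
move=> bq; have [cq ccq ncq fq] := bd_aff RCC bq.
have [_ clq] := proj1 (closure_C RCC q) (proj1 bq).
have /choice[p pP] k : exists p, C p /\ enorm (aff p - aff q) < k.+1%:R^-1.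
  by have [|p ? ?] := clq k.+1%:R^-1; [rewrite invr_gt0|exists p].
have [r rP] := cobounded RCC Cb0.
have /choice[x xP] k : exists a, Gam a /\ hilb (p k) (orb a) <= r.
  by have [a ? ?] := rP _ (proj1 (pP k)); exists a.
have Gx k : Gam (x k) by case: (xP k).
have pq : vcvg (fun k => aff (p k)) (aff q).
  move=> e e0; exists (Num.truncn e^-1) => // k /= ek; apply: (lt_trans (proj2 (pP k))).
  by rewrite invf_plt ?posrE//; apply: (lt_le_trans (truncnS_gt _)); rewrite ler_nat.
have xq : vcvg (fun k => aff (orb (x k))) (aff q).
  apply: (bd_face RCC (fun k => CO (proj1 (pP k))) (fun k => Oorb (Gx k)) (r := r) _ bq pq) => k.
  by case: (xP k).
exists x; split=> //.
have [M M0 MP] := Omega_bounded RCC.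
(* each orbit point is at positive distance from the limit *)
move=> A /finite_seqP[s ->]; elim: s => [|a s [N1 _ N1P]]; first by exists 0%N.
have [Ga|nGa] := pselect (Gam a); last first.
  exists N1 => // k /= N1k; rewrite inE => /orP[/eqP xa|]; last exact: N1P.
  by apply: nGa; rewrite -xa.
have d0 : 0 < enorm (aff (orb a) - aff q).
  rewrite enorm_gt0 subr_eq0; apply/eqP => E; apply: ncq; rewrite -E.
  exact: cone_aff (Oorb Ga).
have [N2 _ N2P] := xq _ d0; exists (maxn N1 N2) => // k /=; rewrite geq_max => /andP[k1 k2].
rewrite inE => /orP[/eqP xa|]; last exact: N1P.
by have := N2P k k2; rewrite /= xa ltxx.
Qed.

(** Extraction and [attracting_cvg] identify cluster points of attracting directions
    with limits of orbit points. *)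
Lemma limit_setE : infinite_set Gam -> limit_set Gam = bd.
Proof.
move=> /infinite_dim n1; apply/seteqP; split=> q.
  move=> [x [r [Gx xe xr rq]]].
  have [psi psik rpsi] := pcluster_sub 0 rq.
  have psik' k : (k <= psi k)%N by rewrite -{1}[k]addn0.
  have [phi phik [y by' xy]] :=
    escapes_bd RCC Cb0 (fun k => Gx (psi k)) (escapes_comp psik' xe).
  suff -> : q = y by [].
  apply: (pcvg_unique (pcvg_sub phik rpsi)).
  by apply: (attracting_cvg n1 _ by' xy) => k; [exact: Gx|exact: xr].
move=> bq; have [x [Gx xe xq]] := bd_sequence bq.
have [N _ NP] := escapes_alpha1 0 n1 Gx xe.
have kN k : (k <= k + N)%N by exact: leq_addr.
have /choice[r rP] k : exists r, is_U1 (x (k + N)%N) r.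
  by apply: U1_exists => //; apply: NP; exact: leq_addl.
exists (fun k => x (k + N)%N), r; split=> //.
  exact: (escapes_comp kN xe).
apply: pcvg_pcluster; apply: (attracting_cvg n1 (x := fun k => x (k + N)%N) _ bq) => //.
exact: (vcvg_sub kN xq).
Qed.

Lemma bd_flag q : infinite_set Gam -> bd q -> exists2 F, flag_limit_set Gam F & F.1 = q.
Proof.
move=> Ginf; have n1 := infinite_dim Ginf; rewrite -(limit_setE Ginf); apply: limit_flag => //.
by move=> x Gx xe; exact: (escapes_alpha1 0 n1 Gx xe).
Qed.

End LimitSet.

(** * Gap and alignment for Anosov representations *)

(** Excludes degenerate targets, in which the second singular value does not exist. *)
Lemma pgl_dim1 (R : realType) (W : euclidType R) (x y : PGL W) : (\dim {:W} <= 1)%N -> x = y.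
Proof.
move=> W1; have g0 := lker_rep x; have h0 := lker_rep y.
suff [k k0 E] : exists2 k : R, k != 0 & rep x = k *: rep y.
  by apply: val_inj; rewrite /= -(pgl_rep x) E (pgl_lineZ k0 (pgl_rep y)).
have [[v v0]|H] := pselect (exists v : W, v != 0); last first.
  exists 1; rewrite ?oner_eq0// scale1r; apply/lfunP => w.
  have -> : w = 0 by apply/eqP; apply: contrapT => /negP w0; apply: H; exists w.
  by rewrite !linear0.
have full (w : W) : w != 0 -> fullv = <[w]>%VS :> {vspace W}.
  by move=> w0; apply/esym/eqP; rewrite eqEdim subvf /= dim_vline w0.
have hv0 : rep y v != 0 by rewrite lker_neq0.
have [k kE] : exists k : R, rep x v = k *: rep y v.
  by apply/vlineP; rewrite -(full _ hv0) memvf.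
exists k.
  apply: contra_neq (_ : rep x v != 0); last by rewrite lker_neq0.
  by move=> k0; rewrite kE k0 scale0r.
apply/lfunP => w; have /vlineP[l ->] : w \in <[v]>%VS by rewrite -(full _ v0) memvf.
by rewrite lfunE /= !lfZ kE !scalerA mulrC.
Qed.

Section Anosov.
Context {R : realType} {V : euclidType R} (f : {scalar V}) (Omega C : set (pspace V)).
Context (Gam : set (PGL V)) (b0 : pspace V).
Context (RCC : regular_convex_cocompact f Omega C Gam) (Cb0 : C b0).
Implicit Types (u v w x : V) (p q y z : pspace V) (g h : 'End(V)) (a b : PGL V).
Local Notation cone := (cone f Omega).
Local Notation ccone := (ccone f Omega).
Local Notation hilb := (hilbert f Omega).
Local Notation hle := (hle f Omega).
Local Notation aff := (aff f).
Local Notation orb a := (act_point a b0).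
Local Notation D a := (hilbert f Omega b0 (act_point a b0)).
Local Notation bd := (bd Omega C).
Let Om := rcc_domain RCC.
Let CO p : C p -> Omega p. Proof. by have [_ _ [CO _ _ _ _] _ _] := RCC; exact: CO. Qed.
Let G1 : Gam 1%g. Proof. by have [] := rcc_subgroup RCC. Qed.
Let GM a b : Gam a -> Gam b -> Gam (a * b)%g.
Proof. by have [_ H _] := rcc_subgroup RCC; exact: H. Qed.
Let GV a : Gam a -> Gam a^-1%g. Proof. by have [_ _ H] := rcc_subgroup RCC; exact: H. Qed.
Let Gaut a : Gam a -> automorphism Omega a. Proof. by have [_ [_ H] _ _ _] := RCC; exact: H. Qed.
Let Oorb a : Gam a -> Omega (orb a). Proof. exact: (O_orb RCC Cb0). Qed.
Let Ob0 : Omega b0. Proof. exact: CO. Qed.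
Context {W : euclidType R} (rho : PGL V -> PGL W).
Context (rhoM : forall a b, Gam a -> Gam b -> rho (a * b)%g = (rho a * rho b)%g).
Context (rhoI : forall a b, Gam a -> Gam b -> rho a = rho b -> a = b).
Context (Anos : projective_anosov (rho @` Gam)).
Let Gsub := rcc_subgroup RCC.
Let rho1' : rho 1%g = 1%g := rho1 Gsub rhoM.
Let rhoV' := rhoV Gsub rhoM.

Lemma infinite_target_dim : infinite_set Gam -> (1 < \dim {:W})%N.
Proof.
move=> Ginf; rewrite ltnNge; apply/negP => W1; apply: Ginf.
suff -> : Gam = [set 1%g] by exact: finite_set1.
apply/seteqP; split=> a; last by move=> ->.
by move=> Ga; apply: rhoI => //; exact: pgl_dim1.
Qed.

(** The Anosov property bounds the gap from below by the word length, and the word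
    length bounds the displacement from above by the triangle inequality. *)
Lemma rho_gap : exists lam A : R, 0 < lam /\
  forall a, Gam a -> lam * D a - A <= alpha1 (rho a).
Proof.
have [[_ _ _] [S [[SG gen] [k [A [k1 A0 H]]]]]] := Anos.
have D0 a : Gam a -> 0 <= D a by move=> Ga; apply: (hilb_ge0 Om) => //; exact: Oorb.
have [K [K1 KP]] : exists K : R, 1 <= K /\ forall s, s \in S -> exists2 a, Gam a & rho a = s /\ D a <= K.
  have : forall s, s \in S -> (rho @` Gam) s by [].
  elim: S {SG gen H} => [_|s S IH H]; first by exists 1.
  have [K [K1 KP]] := IH (fun t tS => H t (mem_behead (s := s :: S) tS)).
  have [a Ga as'] := H s (mem_head _ _); exists (Num.max K (D a)); split=> [|t].
    by rewrite le_max K1.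
  rewrite inE => /orP[/eqP ->|/KP[b Gb [bt bK]]]; first by exists a => //; rewrite le_max lexx orbT.
  by exists b => //; rewrite le_max bK.
have words (w : seq (PGL W)) : {subset w <= S ++ [seq s^-1%g | s <- S]} ->
    exists2 a, Gam a & rho a = (\prod_(s <- w) s)%g /\ D a <= K * (size w)%:R.
  elim: w => [_|s w IH ws]; first by exists 1%g; rewrite ?big_nil ?act_point1 ?hilbxx ?mulr0.
  have [|a Ga [aw aK]] := IH; first by move=> t tw; apply: ws; rewrite inE tw orbT.
  have [b Gb [bs bK]] : exists2 b, Gam b & rho b = s /\ D b <= K.
    have := ws s (mem_head _ _); rewrite mem_cat => /orP[/KP//|/mapP[t /KP[b Gb [bt bK]] ->]].
    by exists (b^-1)%g; [exact: GV|rewrite rhoV'// bt (D_inv RCC Cb0)].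
  exists (b * a)%g; first exact: GM.
  rewrite rhoM// bs aw big_cons; split=> //=.
  have [_ _ Dtri _] := D_length RCC Cb0; apply: (le_trans (Dtri _ _ Gb Ga)).
  by rewrite -natr1 mulrDr mulr1 addrC lerD.
have K0 : 0 < K by apply: lt_le_trans K1.
have k0 : 0 < k by apply: lt_trans k1.
exists (k * K)^-1, A; split=> [|a Ga]; first by rewrite invr_gt0 mulr_gt0.
have [l [lw lmin]] : exists l, word_length S (rho a) l.
  have ex : exists l, `[< is_word S l (rho a) >].
    by have [|l lw] := gen (rho a); [exists a|exists l; apply/asboolP].
  case: (ex_minnP ex) => l /asboolP lw lmin; exists l; split=> // j jw.
  by apply: lmin; apply/asboolP.
have /andP[le_al _] : k^-1 * l%:R - A <= alpha1 (rho a) <= k * l%:R + A.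
  by apply: H => //; exists a.
have [w [sw wS wE]] := lw.
have [b Gb [bw bK]] := words w wS; have ab : a = b by apply: rhoI => //; rewrite wE -bw.
apply: (le_trans _ le_al); rewrite lerD2r invfM -mulrA ler_pM2l ?invr_gt0//.
by rewrite ler_pdivrMl// ab -sw.
Qed.

Lemma rho_proper : alpha1_proper (rho @` Gam).
Proof.
have [lam [A [lam0 gap]]] := rho_gap => r.
apply: (sub_finite_set _ (finite_image rho (finite_balls RCC Cb0 ((r + A) / lam)))).
move=> _ [[a Ga <-] ar]; exists a => //; split=> //.
by rewrite ler_pdivlMr// mulrC; have := gap a Ga; move: ar; lra.
Qed.

Lemma rho_escapes (x : nat -> PGL V) : (forall k, Gam (x k)) -> escapes x -> escapes (rho \o x).
Proof.
move=> Gx xe A /finite_seqP[s ->]; elim: s => [|a s [N _ NP]]; first by exists 0%N.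
have [[b [Gb ba]]|H] := pselect (exists b, Gam b /\ rho b = a).
  have [M _ MP] := xe _ (finite_set1 b); exists (maxn N M) => // k /=.
  rewrite geq_max => /andP[Nk Mk]; rewrite inE => /orP[/eqP xa|]; last exact: NP.
  by apply: (MP k Mk); apply: rhoI => //; rewrite ba.
exists N => // k /= Nk; rewrite inE => /orP[/eqP xk|]; last exact: NP.
by apply: H; exists (x k).
Qed.

Lemma segment_additive p q z : C p -> C q -> segment f `[0, 1] p q z ->
  hilb p q = hilb p z + hilb z q.
Proof.
move=> Cp Cq [cz [t]]; rewrite in_itv /= => /andP[t0 t1] zE.
have [pq|pq] := eqVneq p q.
  suff -> : z = p by rewrite hilbxx add0r.
  apply: (aff_inj cz); rewrite zE pq; move: (aff q) => u.
  by rewrite -scalerDl subrK scale1r.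
have [cp fp] := C_aff RCC Cp; have [cq fq] := C_aff RCC Cq.
have pq' : aff p <> aff q.
  by move=> /(aff_inj (Omega_chart Om (CO Cp))) pq'; rewrite pq' eqxx in pq.
have [s [t' [/andP[s0 t'0] ch]]] := chord_exists Om cp fp fq pq'.
have [_ _ _ _ chP] := ch.
have t'1 : 1 < t'.
  by have [c1 _] := chP 1; move: c1; rewrite subrr scale0r add0r scale1r => /proj1/(_ cq)/andP[].
have pE : aff p = (1 - 0) *: aff p + 0 *: aff q by rewrite subr0 scale1r scale0r addr0.
have qE : aff q = (1 - 1) *: aff p + 1 *: aff q by rewrite subrr scale0r add0r scale1r.
have st : s < t by exact: lt_le_trans s0 t0.
have tt' : t < t' by exact: le_lt_trans t1 t'1.
rewrite (hilbert_hfun Om ch s0 ler01 t'1 pE qE) (hilbert_hfun Om ch s0 t0 tt' pE zE).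
by rewrite (hilbert_hfun Om ch st t1 t'1 zE qE) [RHS]addrC addrA subrK.
Qed.

(** The midpoints of the segments between the two orbits converge inside the domain by
    extremity, so these segments pass at bounded distance from the base point. *)
Lemma distinct_aligned (x y : nat -> PGL V) p q : (forall k, Gam (x k)) -> (forall k, Gam (y k)) ->
  bd p -> bd q -> p <> q -> vcvg (fun k => aff (orb (x k))) (aff p) ->
  vcvg (fun k => aff (orb (y k))) (aff q) ->
  exists r : R, \forall k \near \oo, D (x k)^-1%g + D (y k) <= D ((x k)^-1 * y k)%g + r.
Proof.
move=> Gx Gy bp bq pq xp yq.
have [cp ccp ncp fp] := bd_aff RCC bp; have [cq ccq ncq fq] := bd_aff RCC bq.
have Cx k := C_orb RCC Cb0 (Gx k); have Cy k := C_orb RCC Cb0 (Gy k).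
have h01 : 0 < (2^-1 : R) < 1 by rewrite invr_gt0 invf_lt1 ?ltr1n ?ltr0n.
pose mid u w : V := (1 - 2^-1) *: u + 2^-1 *: w.
have /choice[m mP] k : exists m, chart f m /\ aff m = mid (aff (orb (x k))) (aff (orb (y k))).
  have [m cm mE] := point_of (f_chord 2^-1 (proj2 (C_aff RCC (Cx k))) (proj2 (C_aff RCC (Cy k)))).
  by exists m.
have sm k : segment f `[0, 1] (orb (x k)) (orb (y k)) (m k).
  have [cm mE] := mP k; split=> //; exists 2^-1 => //.
  by rewrite in_itv /=; case/andP: h01 => /ltW -> /ltW ->.
have Cm k : C (m k).
  by have [_ _ [_ _ _ cv _] _ _] := RCC; exact: (cv _ _ (Cx k) (Cy k)).
have ml : vcvg (fun k => aff (m k)) (mid (aff p) (aff q)).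
  have -> : (fun k => aff (m k)) = (fun k => mid (aff (orb (x k))) (aff (orb (y k)))).
    by apply/funext => k; case: (mP k).
  by apply: vcvgD; exact: vcvgZ.
have [w [cw clw wE]] := lim_C RCC Cm ml.
have Ow : Omega w.
  apply: contrapT => nw; apply: pq; apply: (aff_inj cp).
  by apply: (bd_extreme RCC (bdP RCC cw clw nw) ccp ccq fp fq h01); rewrite wE.
rewrite -wE in ml; have [d d0 dP] := hilb_near Om Ow.
exists (2 * (hilb b0 w + 1)); have := ml d d0; apply: filterS => k mk.
have [Omk wm] := dP _ (Omega_chart Om (CO (Cm k))) mk.
rewrite (D_inv RCC Cb0 (Gx k)) -(hilb_orb RCC Cb0 (Gx k) (Gy k)).
rewrite (segment_additive (Cx k) (Cy k) (sm k)) (hilb_sym Om (CO (Cx k)) Omk).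
have h1 := hilb_triangle Om Ob0 Omk (CO (Cx k)); have h2 := hilb_triangle Om Ob0 Omk (CO (Cy k)).
have h3 := hilb_triangle Om Ob0 Ow Omk.
move: h1 h2 h3 wm.
move: (D (x k)) (D (y k)) (hilb b0 (m k)) (hilb b0 w) (hilb w (m k)).
move: (hilb (m k) (orb (x k))) (hilb (m k) (orb (y k))) => t1 t2 t3 t4 t5 t6 t7.
lra.
Qed.

(** Once [x k] moves the base point close to [q], the segment from the base point to it passes near each
    given point of the ray to [q], with a constant independent of this point. *)
Lemma prefix_aligned : exists r : R, forall q, bd q -> exists beta : nat -> PGL V,
  [/\ forall i, Gam (beta i),
      forall i : nat, i%:R - r <= D (beta i) &
      forall (x : nat -> PGL V), (forall k, Gam (x k)) -> vcvg (fun k => aff (orb (x k))) (aff q) ->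
        forall i, \forall k \near \oo, D (beta i) + D ((beta i)^-1 * x k)%g <= D (x k) + r].
Proof.
have [r r0 rP] := coarse_ray RCC Cb0; exists (2 * r + 2) => q bq.
have [z [beta [zP zh bh [z0 b0']]]] := rP q bq.
have Gb i : Gam (beta i) by case: (zP i).
exists beta; split=> //.
  move=> i; have := bh 0%N i (leq0n i); rewrite b0' invg1 mul1g subn0 ler_norml.
  by move=> /andP[+ _]; lra.
move=> x Gx xq i; have [Cz [cz [t ti zE]] _ zb] := zP i.
move: ti; rewrite in_itv /= => /andP[t0 t1].
have Cx k := C_orb RCC Cb0 (Gx k).
pose pnt u : V := (1 - t) *: aff b0 + t *: u.
have fb := proj2 (C_aff RCC Cb0).
have /choice[m mP] k : exists m, chart f m /\ aff m = pnt (aff (orb (x k))).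
  have [m cm mE] := point_of (f_chord t fb (proj2 (C_aff RCC (Cx k)))).
  by exists m.
have sm k : segment f `[0, 1] b0 (orb (x k)) (m k).
  by have [cm mE] := mP k; split=> //; exists t => //; rewrite in_itv /= t0 ltW.
have Cm k : C (m k).
  by have [_ _ [_ _ _ cv _] _ _] := RCC; exact: (cv _ _ Cb0 (Cx k)).
have ml : vcvg (fun k => aff (m k)) (aff (z i)).
  have -> : (fun k => aff (m k)) = (fun k => pnt (aff (orb (x k)))).
    by apply/funext => k; case: (mP k).
  by rewrite zE; apply: vcvgD; [exact: vcvg_cst|exact: vcvgZ].
have [d d0 dP] := hilb_near Om (CO Cz).
have := ml d d0; apply: filterS => k mk.
have [Omk zm] := dP _ (Omega_chart Om (CO (Cm k))) mk.
have mb : hilb (m k) (orb (beta i)) <= r + 1.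
  have := hilb_triangle Om Omk (CO Cz) (Oorb (Gb i)); rewrite (hilb_sym Om Omk (CO Cz)).
  by move: zb zm; lra.
rewrite -(hilb_orb RCC Cb0 (Gb i) (Gx k)) (segment_additive Cb0 (Cx k) (sm k)).
have h1 := hilb_triangle Om Ob0 Omk (Oorb (Gb i)).
have h2 := hilb_triangle Om (Oorb (Gb i)) Omk (Oorb (Gx k)).
rewrite (hilb_sym Om (Oorb (Gb i)) Omk) in h2.
move: h1 h2 mb; move: (D (beta i)) (hilb (orb (beta i)) (orb (x k))) (hilb b0 (m k)).
move: (hilb (m k) (orb (x k))) (hilb (m k) (orb (beta i))) => t2 t3 t4 t5 t6.
lra.
Qed.

End Anosov.

(** * The boundary map *)

Lemma unit_line (R : realType) (W : euclidType R) (p : pspace W) v w : enorm v = 1 -> enorm w = 1 ->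
  v \in (p : {vspace W}) -> w \in (p : {vspace W}) -> exists2 k : R, `|k| = 1 & w = k *: v.
Proof.
move=> v1 w1 vp wp; have [k wE] := pspace_line (unit_neq0 v1) vp wp; exists k => //.
by move: w1; rewrite wE enormZ v1 mulr1.
Qed.

Lemma small_sum (R : realFieldType) (t a b e : R) : t <= 2 * e -> a < e -> b < e -> 0 < e ->
  8 * e <= t + a + b -> False.
Proof. by move=> *; lra. Qed.

Section LimitMap.
Context {R : realType} {V : euclidType R} (f : {scalar V}) (Omega C : set (pspace V)).
Context (Gam : set (PGL V)) (b0 : pspace V).
Context (RCC : regular_convex_cocompact f Omega C Gam) (Cb0 : C b0).
Implicit Types (p q z : pspace V) (a b : PGL V).
Local Notation cone := (cone f Omega).
Local Notation ccone := (ccone f Omega).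
Local Notation hle := (hle f Omega).
Local Notation aff := (aff f).
Local Notation orb a := (act_point a b0).
Local Notation D a := (hilbert f Omega b0 (act_point a b0)).
Local Notation bd := (bd Omega C).
Let CO p : C p -> Omega p. Proof. by have [_ _ [CO _ _ _ _] _ _] := RCC; exact: CO. Qed.
Let GM a b : Gam a -> Gam b -> Gam (a * b)%g.
Proof. by have [_ H _] := rcc_subgroup RCC; exact: H. Qed.
Let GV a : Gam a -> Gam a^-1%g. Proof. by have [_ _ H] := rcc_subgroup RCC; exact: H. Qed.
Context {W : euclidType R} (rho : PGL V -> PGL W).
Context (rhoM : forall a b, Gam a -> Gam b -> rho (a * b)%g = (rho a * rho b)%g).
Context (rhoI : forall a b, Gam a -> Gam b -> rho a = rho b -> a = b).
Context (Anos : projective_anosov (rho @` Gam)) (Ginf : infinite_set Gam).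
Let Gsub := rcc_subgroup RCC.
Let n1 := infinite_target_dim RCC rhoI Ginf.

Lemma anosov_right r : exists2 K : R, 0 <= K & forall a b, Gam a -> Gam b -> D b <= r ->
  `|alpha1 (rho (a * b)%g) - alpha1 (rho a)| <= K.
Proof. exact: (alpha1_right (D_length RCC Cb0) rhoM n1). Qed.

Lemma anosov_aligned c : exists K : R, forall a b, Gam a -> Gam b ->
  D a + D b <= D (a * b)%g + c ->
  alpha1 (rho a) + alpha1 (rho b) <= alpha1 (rho (a * b)%g) + K.
Proof.
have [c0 path] := coarse_geodesic RCC Cb0; have [lam [A [lam0 gap]]] := rho_gap RCC Cb0 rhoM rhoI Anos.
exact: (alpha1_aligned Gsub (D_length RCC Cb0) path rhoM n1 lam0 gap c).
Qed.

Lemma anosov_directions c : exists2 K : R, 0 < K & forall x y, Gam x -> Gam y ->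
  D x + D y <= D (x * y)%g + c ->
  forall g h s1 s2 u v t1 t2 u' v' r1 r2 u'' v'',
  <[g]>%VS = rho x -> <[h]>%VS = rho y ->
  svtop g s1 s2 u v -> svtop h t1 t2 u' v' -> svtop (g \o h)%VF r1 r2 u'' v'' ->
  [/\ enorm (u'' - dotp u u'' *: u) <= K * expR (- alpha1 (rho x)),
      enorm (v'' - dotp v' v'' *: v') <= K * expR (- alpha1 (rho y)) &
      K^-1 <= `|dotp v u'| + expR (- alpha1 (rho x)) + expR (- alpha1 (rho y))].
Proof.
have [c0 path] := coarse_geodesic RCC Cb0; have [lam [A [lam0 gap]]] := rho_gap RCC Cb0 rhoM rhoI Anos.
exact: (aligned_directions Gsub (D_length RCC Cb0) path rhoM n1 lam0 gap c).
Qed.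

Lemma aligned_right c : exists2 K : R, 0 < K & forall x y, Gam x -> Gam y ->
  D x + D y <= D (x * y)%g + c -> forall h k t1 t2 u' v' r1 r2 u'' v'',
  <[h]>%VS = rho y -> <[k]>%VS = rho (x * y)%g -> svtop h t1 t2 u' v' -> svtop k r1 r2 u'' v'' ->
  enorm (v'' - dotp v' v'' *: v') <= K * expR (- alpha1 (rho y)).
Proof.
have [K K0 KP] := anosov_directions c; exists K => // x y Gx Gy xy h k t1 t2 u' v' r1 r2 u'' v''.
move=> hy kxy hs ks; have h0 := pgl_line_lker hy.
pose g := (k \o h^-1)%VF.
have gx : <[g]>%VS = rho x.
  have -> : rho x = (rho (x * y)%g * (rho y)^-1)%g by rewrite rhoM// mulgK.
  by apply: pgl_line_mul => //; exact: pgl_line_inv.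
have gh : (g \o h)%VF = k.
  by apply/lfunP => w; rewrite !comp_lfunE lfun_Kinv.
have [s1 [s2 [u [v gs]]]] := svtop_exists n1 gx.
rewrite -gh in ks.
by have [] := KP x y Gx Gy xy g h _ _ _ _ _ _ _ _ _ _ _ _ gx hy gs hs ks.
Qed.

Lemma alpha1_inf (x : nat -> PGL V) (e : R) : (forall k, Gam (x k)) -> escapes x -> 0 < e ->
  \forall k \near \oo, expR (- alpha1 (rho (x k))) < e.
Proof.
move=> Gx xe e0.
have Rx k : (rho @` Gam) (rho (x k)) by exists (x k).
have := proper_escapes (- ln e) (rho_proper RCC Cb0 rhoM rhoI Anos) Rx (rho_escapes rhoI Gx xe).
by apply: filterS => k; rewrite ltrNl -[e in _ -> _ < e](lnK e0) ltr_expR.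
Qed.

(** Records the boundary point of the domain approached by the group elements that
    define the limit flag, along a subsequence for which everything converges. *)
Definition flag_over (F : flag W) q := exists (x : nat -> PGL V) (G : nat -> flag W),
  [/\ forall k, Gam (x k), escapes x, forall k, is_U1flag (rho (x k)) (G k),
      pcvg (fun k => (G k).1) F.1 /\ pcvg (fun k => hnormal (G k).2) (hnormal F.2) &
      vcvg (fun k => aff (orb (x k))) (aff q)].

Lemma flag_over_exists F : flag_limit_set (rho @` Gam) F -> exists2 q, bd q & flag_over F q.
Proof.
move=> [y [G [Gy ye yG /fcluster GF]]].
have /choice[x xP] k : exists x, Gam x /\ rho x = y k by have [x ? ?] := Gy k; exists x.
have Gx k : Gam (x k) by case: (xP k).
have xe : escapes x.
  move=> A finA; have := ye _ (finite_image rho finA).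
  by apply: filterS => k H Ax; apply: H; exists (x k) => //; case: (xP k).
have /choice[psi psiP] k : exists j, (k <= j)%N /\ mdist (G j).1 F.1 < k.+1%:R^-1 /\
    mdist (hnormal (G j).2) (hnormal F.2) < k.+1%:R^-1.
  by have [|j ? ?] := GF k.+1%:R^-1 k; [rewrite invr_gt0|exists j].
have psik k : (k <= psi k)%N by case: (psiP k).
have [phi phik [q bq xq]] := escapes_bd RCC Cb0 (fun k => Gx (psi k)) (escapes_comp psik xe).
exists q => //; exists (fun k => x (psi (phi k))), (fun k => G (psi (phi k))).
have small (e : R) : 0 < e -> \forall k \near \oo, (phi k).+1%:R^-1 < e.
  move=> e0; exists (Num.truncn e^-1) => // k /= ek.
  rewrite invf_plt ?posrE//; apply: (lt_le_trans (truncnS_gt _)).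
  by rewrite ler_nat ltnS (leq_trans ek).
split=> //.
- exact: (escapes_comp phik (escapes_comp psik xe)).
- by move=> k; have [_ ->] := xP (psi (phi k)); exact: yG.
split=> e e0; have := small e e0; apply: filterS => k; apply: lt_trans.
  by have [_ []] := psiP (phi k).
by have [_ []] := psiP (phi k).
Qed.

(** The quotients of the two sequences are aligned, so the attracting point of one
    sequence keeps away from the hyperplane of the other, which contains its own
    attracting point. *)
Lemma flag_over_transverse F F' q q' : flag_over F q -> flag_over F' q' -> bd q -> bd q' ->
  q <> q' -> F.1 <> F'.1.
Proof.
move=> [x [G [Gx xe xG [GF _] xq]]] [y [G' [Gy ye yG [GF' _] yq]]] bq bq' qq FF.
have [r al] := distinct_aligned RCC Cb0 Gx Gy bq bq' qq xq yq.
have [K K0 KP] := anosov_directions r; pose e := (8 * K)^-1.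
have e0 : 0 < e by rewrite invr_gt0 mulr_gt0.
have [p p1 pF] := pspace_unit F.1.
have [d d0 dP] := @near_unit R W _ e0.
have Gi k : Gam (x k)^-1%g by exact: GV.
have nx := alpha1_inf Gi (escapes_invg xe) e0; have ny := alpha1_inf Gy ye e0.
have nG := GF d d0; have := GF' d d0; rewrite -FF => nG'.
move: nG nG' nx ny al => [N1 _ N1P] [N2 _ N2P] [N3 _ N3P] [N4 _ N4P] [N5 _ N5P].
pose k := maxn N1 (maxn N2 (maxn N3 (maxn N4 N5))).
have /andP[k1 /andP[k2 /andP[k3 /andP[k4 k5]]]] :
    [&& (N1 <= k)%N, (N2 <= k)%N, (N3 <= k)%N, (N4 <= k)%N & (N5 <= k)%N].
  by rewrite -!geq_max.
have dk := N1P k k1; have dk' := N2P k k2; have h1 := N3P k k3; have h2 := N4P k k4.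
have alk := N5P k k5.
have [w [w1 wG wp]] := dP F.1 (G k).1 p dk p1 pF.
have [w' [w'1 wG' wp']] := dP F.1 (G' k).1 p dk' p1 pF.
have [g [s1 [s2 [u [v [t1 [t2 [u1 [v1 [gx gs gis [uF vF] uv]]]]]]]]]] := U1flag_svtop n1 (xG k).
have [h [s1' [s2' [u' [v' [t1' [t2' [u1' [v1' [hy hs his [uF' vF'] uv']]]]]]]]]] := U1flag_svtop n1 (yG k).
have gi : <[(g^-1)%VF]>%VS = rho (x k)^-1%g.
  by rewrite (rhoV Gsub rhoM)//; exact: pgl_line_inv.
have [r1 [r2 [u'' [v'' ghs]]]] := svtop_exists n1 (pgl_line_mul gi hy).
have [_ _] := KP _ _ (Gi k) (Gy k) alk _ _ _ _ _ _ _ _ _ _ _ _ _ _ gi hy gis hs ghs.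
have [_ [un vn] _ _ _] := gs; have [_ [un' vn'] _ _ _] := hs; have [_ [u1n v1n] _ _ _] := gis.
have [a a1 wE] := unit_line un w1 uF wG; have [b b1 wE'] := unit_line w'1 un' wG' uF'.
have : `|dotp v1 u'| <= 2 * e.
  have -> : dotp v1 u' = b * dotp v1 (w' - w).
    by rewrite wE' dotpZr dotpBr wE dotpZr [dotp v1 u]dotpC uv mulr0 subr0.
  rewrite normrM b1 mul1r (le_trans (dotp_le _ _))// v1n mul1r.
  apply: (le_trans (enorm_triangle p w' w)); rewrite [enorm (p - w)]enorm_dist.
  by rewrite mulrDl mul1r lerD// ltW.
have Ke : K^-1 = 8 * e by rewrite /e invfM; field; rewrite gt_eqF.
by rewrite Ke => dot2; exact: (small_sum dot2 h1 h2 e0).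
Qed.

(** The hyperplane of [x k] is given by the most expanded direction of its inverse,
    which up to an error exponentially small in the length of the prefix is the one of
    the inverse of the prefix, common to the two sequences. *)
Lemma flag_over_hyper F F' q : flag_over F q -> flag_over F' q -> bd q -> F.2 = F'.2.
Proof.
move=> Fq Fq' bq; rewrite -[F.2]hnormalK -[F'.2]hnormalK; congr (hyper_of _).
have [r rP] := prefix_aligned RCC Cb0; have [beta [Gb bD bal]] := rP q bq.
have [K K0 KP] := aligned_right r.
have [p p1 pF] := pspace_unit (hnormal F.2); have [p' p'1 pF'] := pspace_unit (hnormal F'.2).
have be : escapes (fun i => (beta i)^-1%g).
  apply: escapes_invg => A /finite_seqP[s ->]; elim: s => [|a s [N _ NP]]; first by exists 0%N.
  exists (maxn N (Num.truncn (D a + r)).+1) => // i /=; rewrite geq_max => /andP[Ni ai].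
  rewrite inE => /orP[/eqP ba|]; last exact: NP.
  have := bD i; rewrite ba lerBlDr leNgt => /negP; apply.
  by apply: (lt_le_trans (truncnS_gt _)); rewrite ler_nat.
have close (F0 : flag W) (e : R) : 0 < e -> flag_over F0 q -> \forall i \near \oo,
    forall (p0 : W) (h : 'End(W)) t1 t2 u' v', enorm p0 = 1 ->
    p0 \in (hnormal F0.2 : {vspace W}) ->
    <[h]>%VS = rho (beta i)^-1%g -> svtop h t1 t2 u' v' ->
    exists c : R, enorm (p0 - c *: v') < e.
  move=> e0 [x [G [Gx xe xG [_ GF] xq]]].
  have e2 : 0 < e / 2 by rewrite divr_gt0.
  have := alpha1_inf (fun i => GV (Gb i)) be (divr_gt0 e2 K0); apply: filterS => i ie.
  move=> p0 h t1 t2 u' v' p01 pF0 hb hs.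
  have [d d0 dP] := @near_unit R W _ e2.
  have nG := GF d d0; have nb := bal x Gx xq i.
  near \oo => k.
  have dk : mdist (hnormal (G k).2) (hnormal F0.2) < d by near: k.
  have bk : D (beta i) + D ((beta i)^-1 * x k)%g <= D (x k) + r by near: k.
  have [w [w1 wG wp]] := dP (hnormal F0.2) (hnormal (G k).2) p0 dk p01 pF0.
  have [g [s1 [s2 [u [v [t1' [t2' [u1 [v1 [gx gs gis [uF vF] uv]]]]]]]]]] := U1flag_svtop n1 (xG k).
  have [_ [u1n v1n] _ _ _] := gis; have [a a1 wE] := unit_line v1n w1 vF wG.
  have xbE : ((x k)^-1 * beta i * (beta i)^-1 = (x k)^-1)%g by rewrite mulgK.
  have alk : D ((x k)^-1 * beta i)%g + D (beta i)^-1%g <= D ((x k)^-1 * beta i * (beta i)^-1)%g + r.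
    have -> : D ((x k)^-1 * beta i)%g = D ((beta i)^-1 * x k)%g.
      by rewrite -(D_inv RCC Cb0 (GM (GV (Gb i)) (Gx k))) invgM invgK.
    by rewrite xbE (D_inv RCC Cb0 (Gx k)) (D_inv RCC Cb0 (Gb i)) addrC.
  have gi : <[(g^-1)%VF]>%VS = rho ((x k)^-1 * beta i * (beta i)^-1)%g.
    by rewrite xbE (rhoV Gsub rhoM)//; exact: pgl_line_inv.
  have := KP _ _ (GM (GV (Gx k)) (Gb i)) (GV (Gb i)) alk _ _ _ _ _ _ _ _ _ _ hb gi hs gis.
  move=> H; exists (a * dotp v' v1).
  have : enorm (w - (a * dotp v' v1) *: v') < e / 2.
    rewrite wE -scalerA -scalerBr enormZ a1 mul1r (le_lt_trans H)//.
    by rewrite mulrC -ltr_pdivlMr.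
  move=> wv; apply: (le_lt_trans (enorm_triangle w p0 _)).
  by rewrite [enorm (p0 - w)]enorm_dist [e]splitr ltrD.
have para (e : R) : 0 < e -> e <= 2^-1 -> enorm (p' - dotp p p' *: p) <= 4 * e.
  move=> e0 e1; have [N1 _ N1P] := close F e e0 Fq; have [N2 _ N2P] := close F' e e0 Fq'.
  pose i := maxn N1 N2.
  have [t1 [t2 [u' [v' hs]]]] := svtop_exists n1 (pgl_rep (rho (beta i)^-1%g)).
  have [c pc] := N1P i (leq_maxl _ _) p _ _ _ _ _ p1 pF (pgl_rep _) hs.
  have [c' pc'] := N2P i (leq_maxr _ _) p' _ _ _ _ _ p'1 pF' (pgl_rep _) hs.
  have [_ [_ v1] _ _ _] := hs.
  have nc : 2^-1 <= `|c|.
    have := enorm_triangle (c *: v') p 0; rewrite !subr0 p1 enormZ v1 mulr1.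
    by move: pc e1; lra.
  have nc' : `|c'| <= 3 * 2^-1.
    have := enorm_triangle p' (c' *: v') 0; rewrite !subr0 p'1 enormZ v1 mulr1.
    by rewrite [enorm (_ - p')]enorm_dist; move: pc' e1; lra.
  have c0 : 0 < `|c| by apply: lt_le_trans nc; rewrite invr_gt0.
  pose k := c' / c.
  have nk : `|k| <= 3 by rewrite /k normrM normfV ler_pdivrMr//; move: nc nc'; lra.
  apply: (le_trans (y := enorm (p' - k *: p))).
    have E : p' - k *: p = (dotp p p' - k) *: p + (p' - dotp p p' *: p).
      by rewrite scalerBl [RHS]addrC addrA subrK.
    rewrite -(@ler_pXn2r _ 2) ?nnegrE ?enorm_ge0// [in leRHS]E [leRHS]enorm_pyth.
      by rewrite lerDr sqr_ge0.
    by rewrite dotpZl dotpBr dotpZr -sqr_enorm p1 expr1n mulr1 subrr mulr0.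
  have E : p' - k *: p = (p' - c' *: v') - k *: (p - c *: v').
    have -> : k *: (p - c *: v') = k *: p - c' *: v'.
      by rewrite scalerBr scalerA /k divfK// -normr_gt0.
    by rewrite opprB addrA subrK.
  rewrite E; apply: (le_trans (enormB _ _)); rewrite enormZ.
  have : `|k| * enorm (p - c *: v') <= 3 * e.
    by apply: ler_pM => //; [exact: enorm_ge0|exact: ltW].
  by move: pc'; lra.
have {}para : p' = dotp p p' *: p.
  apply/eqP; rewrite -subr_eq0 -enorm_eq0 eq_le enorm_ge0 andbT; apply/ler_addgt0Pl => e e0.
  have e4 : 0 < Num.min (e / 4) 2^-1 by rewrite lt_min divr_gt0//= invr_gt0.
  apply: (le_trans (para _ e4 _)); first by rewrite ge_min lexx orbT.
  rewrite addr0 (le_trans (y := 4 * (e / 4)))//; last by rewrite mulrC divfK.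
  by rewrite ler_pM2l// ge_min lexx.
apply: (pspace_eqP (unit_neq0 p'1)) => //.
by rewrite para memvZ.
Unshelve. all: by end_near. Qed.

Theorem limit_flag_inj F F' : flag_limit_set (rho @` Gam) F -> flag_limit_set (rho @` Gam) F' ->
  F.1 = F'.1 -> F = F'.
Proof.
move=> /flag_over_exists[q bq Fq] /flag_over_exists[q' bq' Fq'] FF.
have qq : q = q'.
  by apply: contrapT => qq; exact: (flag_over_transverse Fq Fq' bq bq' qq).
rewrite -qq in Fq'; have := flag_over_hyper Fq Fq' bq.
by case: F F' FF {Fq Fq'} => [? ?] [? ?] /= -> ->.
Qed.

Section BoundaryMap.
Context (xi : flag V -> flag W) (xi1 : pspace V -> pspace W).
Context (xiL : limit_map Gam rho xi) (xi1P : induced_map Gam xi xi1).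

(** Both inclusions lift points to flags, on which [xi] is a bijection. *)
Theorem limit_set_rho : limit_set (rho @` Gam) = xi1 @` bd.
Proof.
have [[xiF _ xiS] _ _ _] := xiL.
have rV (y : PGL W) : (rho @` Gam) y -> (rho @` Gam) y^-1%g.
  by move=> [b Gb <-]; exists b^-1%g; [exact: GV|rewrite (rhoV Gsub rhoM)].
apply/seteqP; split=> [p pL|_ [q bq <-]].
  have [|F FL <-] := limit_flag n1 rV _ pL.
    by move=> x Gx xe; exact: (proper_escapes 0 (rho_proper RCC Cb0 rhoM rhoI Anos)).
  have [F0 F0L F0E] := xiS F FL; exists F0.1; last by rewrite (xi1P F0L) F0E.
  by rewrite -(limit_setE RCC Cb0 Ginf); exact: flag_limit_point.
have [F0 F0L F0E] := bd_flag RCC Cb0 Ginf bq; rewrite -F0E (xi1P F0L).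
exact: flag_limit_point (xiF _ F0L).
Qed.

Theorem xi1_inj q q' : bd q -> bd q' -> xi1 q = xi1 q' -> q = q'.
Proof.
have [[xiF xiI _] _ _ _] := xiL.
move=> /(bd_flag RCC Cb0 Ginf)[F FL <-] /(bd_flag RCC Cb0 Ginf)[F' FL' <-].
rewrite (xi1P FL) (xi1P FL') => E; congr (_.1); apply: xiI; rewrite ?inE//.
exact: limit_flag_inj (xiF _ FL) (xiF _ FL') E.
Qed.

End BoundaryMap.

End LimitMap.

(** * Counting and Hausdorff measure *)

Section Counting.
Context {R : realType}.

Lemma uniq_sum_le (T : eqType) (w : T -> R) (l1 l2 : seq T) : (forall x, 0 <= w x) ->
  uniq l1 -> {subset l1 <= l2} -> \sum_(x <- l1) w x <= \sum_(x <- l2) w x.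
Proof.
move=> w0; elim: l1 l2 => [|a l1 IH] l2 /=; first by rewrite big_nil sumr_ge0.
move=> /andP[al ul] sub; have a2 : a \in l2 by apply: sub; exact: mem_head.
rewrite big_cons (perm_big _ (perm_to_rem a2)) big_cons lerD2l IH// => x xl.
have : x \in a :: rem a l2.
  by rewrite -(perm_mem (perm_to_rem a2)); apply: sub; rewrite inE xl orbT.
by rewrite inE => /orP[/eqP xa|//]; rewrite -xa xl in al.
Qed.

(** The factorization [x = gamma i * y] with [y] not longer than [x] bounds the sum [Q t]
    over a ball by [Q M + Q t / 2], and [Q t] is finite. *)
Lemma counting_bound (G : groupType) (Gam : set G) (D w : G -> R) (I : seq nat)
    (gamma : nat -> G) (c : nat -> R) (M : R) :
  (forall x, 0 <= w x) -> (forall i, 0 <= c i) -> \sum_(i <- I) c i <= 2^-1 ->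
  (forall r, finite_set [set x | Gam x /\ D x <= r]) ->
  (forall x, Gam x -> M < D x -> exists i, [/\ i \in I, Gam ((gamma i)^-1 * x)%g,
     D ((gamma i)^-1 * x)%g <= D x & w x <= c i * w ((gamma i)^-1 * x)%g]) ->
  exists B : R, forall l, uniq l -> (forall x, x \in l -> Gam x) -> \sum_(x <- l) w x <= B.
Proof.
move=> w0 c0 cI fin fact.
have /choice[L LP] (t : R) : exists l : seq G, uniq l /\ forall x, x \in l <-> (Gam x /\ D x <= t).
  have [l lE] := proj1 (finite_seqP _) (fin t); exists (undup l); split; first exact: undup_uniq.
  by move=> x; rewrite mem_undup; have := congr1 (fun A => A x) lE => /= ->.
pose Q t := \sum_(x <- L t) w x.
have Q0 t : 0 <= Q t by apply: sumr_ge0.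
have Qle t : Q t <= Q M + 2^-1 * Q t.
  have [ut Lt] := LP t; have [uM LM] := LP M.
  pose a x := if x \in L M then w x else 0.
  pose b i x := if ((gamma i)^-1 * x)%g \in L t then c i * w ((gamma i)^-1 * x)%g else 0.
  have wab x : x \in L t -> w x <= a x + \sum_(i <- I) b i x.
    move=> xt; have b0 i : 0 <= b i x by rewrite /b; case: ifP => // _; rewrite mulr_ge0.
    have [Gx Dx] := proj1 (Lt x) xt; rewrite /a; case: ifP => xM.
      by rewrite lerDl sumr_ge0.
    rewrite add0r; have [|i [iI Gi Di wi]] := fact x Gx.
      by rewrite ltNge; apply/negP => DM; move/negP: xM; apply; apply/LM.
    have -> : \sum_(i <- I) b i x = b i x + \sum_(j <- rem i I) b j x.
      by rewrite (perm_big _ (perm_to_rem iI)) big_cons.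
    apply: (le_trans wi); have -> : c i * w ((gamma i)^-1 * x)%g = b i x.
      by rewrite /b ifT//; apply/Lt; split=> //; exact: le_trans Di Dx.
    by rewrite lerDl sumr_ge0.
  apply: (le_trans (y := \sum_(x <- L t) (a x + \sum_(i <- I) b i x))).
    by rewrite /Q !(big_seq_cond xpredT) ler_sum// => x /andP[xt _]; exact: wab.
  rewrite big_split /= lerD//.
    rewrite -big_mkcond -big_filter; apply: uniq_sum_le => //; first exact: filter_uniq.
    by move=> x; rewrite mem_filter => /andP[].
  rewrite exchange_big /=; apply: (le_trans (y := \sum_(i <- I) c i * Q t)); last first.
    by rewrite -mulr_suml ler_wpM2r.
  apply: ler_sum => i _; rewrite -big_mkcond -mulr_sumr ler_wpM2l//.
  rewrite -big_filter; set F := [seq x <- _ | _].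
  have -> : \sum_(x <- F) w ((gamma i)^-1 * x)%g =
      \sum_(y <- [seq ((gamma i)^-1 * x)%g | x <- F]) w y by rewrite big_map.
  apply: uniq_sum_le => //.
    rewrite map_inj_uniq; first exact: filter_uniq.
    exact: mulgI.
  by move=> y /mapP[x]; rewrite mem_filter => /andP[xt _] ->.
exists (2 * Q M) => l ul lG.
have [t lt] : exists t : R, forall x, x \in l -> D x <= t.
  elim: l {ul lG} => [|x l [t IH]]; first by exists 0.
  exists (Num.max (D x) t) => y; rewrite inE => /orP[/eqP ->|/IH yt].
    by rewrite le_max lexx.
  by rewrite le_max yt orbT.
apply: (le_trans (y := Q t)).
  by apply: uniq_sum_le => // x xl; apply/(proj2 (LP t)); split; [exact: lG|exact: lt].
by have := Qle t; lra.
Qed.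

Local Open Scope ereal_scope.

Lemma esum_lty (T : choiceType) (A : set T) (w : T -> R) :
  (exists B : R, forall l, uniq l -> (forall x, x \in l -> A x) -> (\sum_(x <- l) w x <= B)%R) ->
  \esum_(x in A) (w x)%:E < +oo.
Proof.
move=> [B BP]; apply: (@le_lt_trans _ _ B%:E); last exact: ltry.
apply: ge_ereal_sup => _ [X [finX XA] <-]; rewrite fsbig_finite// sumEFin lee_fin.
by apply: BP => // x; rewrite in_fset_set// inE => /XA.
Qed.

Lemma esum_tail (T : choiceType) (A : set T) (w : T -> R) (d : R) :
  (forall x, 0 <= w x)%R -> \esum_(x in A) (w x)%:E < +oo -> (0 < d)%R ->
  exists2 X, finite_set X & forall Y, X `<=` Y -> \esum_(x in A `\` Y) (w x)%:E <= d%:E.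
Proof.
move=> w0 fin d0; have w0' x : A x -> 0 <= (w x)%:E by rewrite lee_fin.
have E0 : 0 <= \esum_(x in A) (w x)%:E by exact: esum_ge0.
have Efin : \esum_(x in A) (w x)%:E \is a fin_num by rewrite ge0_fin_numE.
have : \esum_(x in A) (w x)%:E - d%:E < \esum_(x in A) (w x)%:E.
  by rewrite lteBlDr// lteDl// lte_fin.
move=> /ereal_sup_gt[_ [X [finX XA] <-] XP]; exists X => // Y XY.
apply: (le_trans (y := \esum_(x in A `\` X) (w x)%:E)).
  rewrite [leLHS]esum_mkcond [leRHS]esum_mkcond; apply: le_esum => x _.
  rewrite !in_setD; case: (boolP (x \in A)) => //= _.
  case: (boolP (x \in Y)) => xY /=; first by case: ifP => _; rewrite ?lee_fin.
  by rewrite ifT//; apply: contraNN xY; rewrite !inE; exact: XY.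
have := @esumID R T X A (fun x => (w x)%:E) w0'; rewrite (setIidr XA) -setDE (esum_fset finX); last by move=> x _; rewrite lee_fin.
move=> E; move: XP; rewrite lteBlDr// E; set a := \sum_(x \in X) _; set b := \esum_(x in _) _ => ab.
have afin : a \is a fin_num.
  by rewrite /a fsbig_finite// sumEFin.
by move: ab; rewrite lteD2lE// => /ltW.
Qed.

(** Transfers a series indexed by integers to a sum over a set that injects into them. *)
Lemma esum_indexed (T : choiceType) (A : set T) (iota : T -> nat) (v : nat -> \bar R)
    (w : T -> \bar R) : {in A &, injective iota} -> (forall n, 0 <= v n) ->
  (forall x, A x -> v (iota x) <= w x) -> (forall n, (forall x, A x -> iota x <> n) -> v n = 0) ->
  \sum_(0 <= n <oo) v n <= \esum_(x in A) w x.
Proof.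
move=> iinj v0 vw vz; rewrite nneseries_esumT//.
have -> : \esum_(n in [set: nat]) v n = \esum_(n in iota @` A) v n.
  rewrite [RHS]esum_mkcond; apply: eq_esum => n _; case: ifPn => //.
  by rewrite notin_setE => nA; apply: vz => x Ax xn; apply: nA; exists x.
by rewrite esum_image//; exact: le_esum.
Qed.

End Counting.

Section Hausdorff.
Local Open Scope ereal_scope.
Context {R : realType} (T : metricType R).
Implicit Types (A B : set T).

Lemma diam_pow_ge0 (s : R) B : 0 <= diam_pow s B.
Proof. by rewrite /diam_pow; case: ifP => // _; exact: poweR_ge0. Qed.

Lemma diam_le B (d : R) : (forall x y, B x -> B y -> mdist x y <= d)%R -> diam B <= d%:E.
Proof. by move=> H; apply: ge_ereal_sup => _ [x Bx [y By <-]]; rewrite lee_fin; exact: H. Qed.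

Lemma diam_pow_le (s : R) B (d : R) : (0 <= s)%R -> (0 <= d)%R ->
  (forall x y, B x -> B y -> mdist x y <= d)%R -> diam_pow s B <= (d `^ s)%:E.
Proof.
move=> s0 d0 Bd; rewrite /diam_pow; case: ifPn => [_|B0]; first by rewrite lee_fin powR_ge0.
have dB := diam_le Bd; rewrite -poweR_EFin; apply: gt0_ler_poweR => //.
  rewrite in_itv /= leey andbT; have [x Bx] := proj1 (set0P _) B0.
  by apply: ereal_sup_ubound; exists x => //; exists x => //; rewrite mdistxx.
by rewrite in_itv /= leey andbT lee_fin.
Qed.

Lemma hausdorff_zero_intro (s : R) A :
  (forall e d : R, (0 < e)%R -> (0 < d)%R -> exists B : nat -> set T,
    [/\ A `<=` \bigcup_i B i, forall i, diam (B i) <= e%:E &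
        \sum_(0 <= i <oo) diam_pow s (B i) <= d%:E]) ->
  hausdorff_measure s A = 0.
Proof.
move=> H; have pre (e : R) : (0 < e)%R -> hausdorff_pre s e A = 0.
  move=> e0; apply/eqP; rewrite eq_le; apply/andP; split.
    apply/lee_addgt0Pr => d d0; rewrite add0e; have [B [AB Be Bd]] := H e d e0 d0.
    by apply: (le_trans _ Bd); apply: ereal_inf_lbound; exists B.
  apply: le_ereal_inf_tmp => _ [B [AB Be] <-].
  by apply: nneseries_ge0 => i _ _; exact: diam_pow_ge0.
apply/eqP; rewrite eq_le; apply/andP; split.
  by apply: ge_ereal_sup => _ [e /= e0 <-]; rewrite pre.
by apply: ereal_sup_ubound; exists 1%R; rewrite /= ?ltr01// pre.
Qed.

Lemma hausdorff_zero_elim (s : R) A (e d : R) : hausdorff_measure s A = 0 ->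
  (0 < e)%R -> (0 < d)%R -> exists B : nat -> set T,
  [/\ A `<=` \bigcup_i B i, forall i, diam (B i) <= e%:E &
      \sum_(0 <= i <oo) diam_pow s (B i) <= d%:E].
Proof.
move=> H e0 d0; have : hausdorff_pre s e A < d%:E.
  apply: (@le_lt_trans _ _ 0); last by rewrite lte_fin.
  by rewrite -H; apply: ereal_sup_ubound; exists e.
by move=> /ereal_inf_lt[_ [B [AB Be] <-] /ltW Bd]; exists B.
Qed.

Lemma diam_real B (e : R) x : B x -> diam B <= e%:E -> exists d : R,
  [/\ (0 <= d <= e)%R, forall y z, B y -> B z -> (mdist y z <= d)%R &
      forall s, diam_pow s B = (d `^ s)%:E].
Proof.
move=> Bx Be; have B0 : 0 <= diam B.
  by apply: ereal_sup_ubound; exists x => //; exists x => //; rewrite mdistxx.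
have Bfin : diam B \is a fin_num by rewrite ge0_fin_numE// (le_lt_trans Be)// ltry.
exists (fine (diam B)); split.
- by rewrite -!lee_fin fineK// B0.
- move=> y z By Bz; rewrite -lee_fin fineK//.
  by apply: ereal_sup_ubound; exists y => //; exists z.
move=> s; rewrite /diam_pow ifN; first by rewrite -poweR_EFin fineK.
by apply/set0P; exists x.
Qed.

End Hausdorff.

(** * Convergence of the series implies measure zero *)

Lemma sigma_ratio (R : realType) (W : euclidType R) (x : PGL W) : (1 < \dim {:W})%N ->
  sigma 2 x / sigma 1 x = expR (- alpha1 x).
Proof.
move=> n1; have [u [a [v [xs s1 s2]]]] := sigma_svd x.
have a1 : 0 < a`_1 := pgl_svd_gt0 xs n1; have a0 : 0 < a`_0 := pgl_svd_gt0 xs (ltnW n1).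
by rewrite /alpha1 s1 s2 expRN lnK ?posrE ?divr_gt0// invf_div.
Qed.

Lemma esum_scale (R : realType) (T : choiceType) (A : set T) (w : T -> R) (c : R) : 0 <= c ->
  (\esum_(x in A) (c * w x)%:E <= c%:E * \esum_(x in A) (w x)%:E)%E.
Proof.
move=> c0; apply: ge_ereal_sup => _ [X [finX XA] <-]; rewrite fsbig_finite// sumEFin.
rewrite -mulr_sumr EFinM lee_wpmul2l ?lee_fin//; apply: esum_ge; exists X => //.
by rewrite fsbig_finite// sumEFin.
Qed.

Lemma finite_bounded (R : realType) (T : eqType) (h : T -> R) (A : set T) : finite_set A ->
  exists t : R, forall x, A x -> h x <= t.
Proof.
move=> /finite_seqP[l ->]; elim: l => [|x l [t IH]]; first by exists 0.
exists (Num.max (h x) t) => y /=; rewrite inE => /orP[/eqP ->|/IH yt].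
  by rewrite le_max lexx.
by rewrite le_max yt orbT.
Qed.

Section Dimension.
Context {R : realType} {V : euclidType R} (f : {scalar V}) (Omega C : set (pspace V)).
Context (Gam : set (PGL V)) (b0 : pspace V).
Context (RCC : regular_convex_cocompact f Omega C Gam) (Cb0 : C b0).
Implicit Types (a b : PGL V).
Local Notation cone := (cone f Omega).
Local Notation ccone := (ccone f Omega).
Local Notation hilb := (hilbert f Omega).
Local Notation hle := (hle f Omega).
Local Notation aff := (aff f).
Local Notation orb a := (act_point a b0).
Local Notation D a := (hilbert f Omega b0 (act_point a b0)).
Local Notation bd := (bd Omega C).
Let Om := rcc_domain RCC.
Let CO p : C p -> Omega p. Proof. by have [_ _ [CO _ _ _ _] _ _] := RCC; exact: CO. Qed.
Let Oorb a : Gam a -> Omega (orb a). Proof. exact: (O_orb RCC Cb0). Qed.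
Context {W : euclidType R} (rho : PGL V -> PGL W).
Context (rhoM : forall a b, Gam a -> Gam b -> rho (a * b)%g = (rho a * rho b)%g).
Context (rhoI : forall a b, Gam a -> Gam b -> rho a = rho b -> a = b).
Context (Anos : projective_anosov (rho @` Gam)) (Ginf : infinite_set Gam).
Let n1 := infinite_target_dim RCC rhoI Ginf.
Context (xi : flag V -> flag W) (xi1 : pspace V -> pspace W).
Context (xiL : limit_map Gam rho xi) (xi1P : induced_map Gam xi xi1).
Context (NF : non_folding f Omega C Gam rho xi1 b0).
Local Notation al a := (alpha1 (rho a)).
Local Notation Lambda := (limit_set (rho @` Gam)).
Let LambdaE : Lambda = xi1 @` bd := limit_set_rho RCC Cb0 rhoM rhoI Anos Ginf xiL xi1P.
Let bdE : limit_set Gam = bd := limit_setE RCC Cb0 Ginf.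

Lemma poincareE (s : R) : poincare_series (rho @` Gam) s =
  (\esum_(a in Gam) (expR (- s * al a))%:E)%E.
Proof.
rewrite /poincare_series esum_image; last by move=> a b; rewrite !inE; exact: rhoI.
apply: eq_esum => a _; rewrite sigma_ratio// -expRM; congr (expR _)%:E; ring.
Qed.

Lemma al_finite (t : R) : finite_set [set a | Gam a /\ al a <= t].
Proof.
have [lam [A [lam0 gap]]] := rho_gap RCC Cb0 rhoM rhoI Anos.
apply: (sub_finite_set _ (finite_balls RCC Cb0 ((t + A) / lam))) => a [Ga at'].
by split=> //; rewrite ler_pdivlMr// mulrC; have := gap a Ga; move: at'; lra.
Qed.

Lemma Gam_index : exists iota : PGL V -> nat, {in Gam &, injective iota}.
Proof.
apply/pcard_injP; suff -> : Gam = \bigcup_(n in [set: nat]) [set a | Gam a /\ D a <= n%:R].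
  apply: bigcup_countable => // n _; apply: finite_set_countable.
  exact: (finite_balls RCC Cb0).
apply/seteqP; split=> [a Ga|a [n _ []//]]; exists (Num.truncn (D a)).+1 => //.
by split=> //; exact/ltW/truncnS_gt.
Qed.

(** Covers by the images of the sets of boundary points whose rays pass near a given
    orbit point; the non-folding property bounds their diameters. *)
Lemma hausdorff_upper (s : R) : 0 <= s -> (\esum_(a in Gam) (expR (- s * al a))%:E < +oo)%E ->
  hausdorff_measure s Lambda = 0%E.
Proof.
move=> s0 fin; have [r r0 rP] := coarse_ray RCC Cb0.
have r21 : 0 < 2 * r + 1 by rewrite ltr_pwDr// mulr_ge0.
have [K K1 KP] := NF r21 r0; have K0 : 0 < K by apply: lt_trans K1.
pose B a := xi1 @` [set x | bd x /\ exists z, [/\ C z, segment f `[0, 1[ b0 x z & hilb z (orb a) <= r]].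
have Bd a p q : Gam a -> B a p -> B a q -> mdist p q <= K * expR (- al a).
  move=> Ga [x [bx [z [Cz sz za]]] <-] [y [by' [z' [Cz' sz' za']]] <-].
  have := KP x z a; rewrite bdE => /(_ bx Cz sz Ga za)[_ sh].
  have : ball (xi1 x) (K * expR (- al a)) (xi1 y).
    apply: sh; exists y => //; split; first by rewrite bdE.
    exists z'; split=> //; first exact: CO.
    apply: (le_trans (hilb_triangle Om (CO Cz) (Oorb Ga) (CO Cz'))).
    by rewrite (hilb_sym Om (Oorb Ga) (CO Cz')); move: za za' r0; lra.
  by rewrite ballEmdist /= => /ltW.
apply: hausdorff_zero_intro => e d e0 d0.
have Ks : 0 < K `^ s by exact: powR_gt0.
have [X finX XP] := esum_tail (fun a => expR_ge0 _) fin (divr_gt0 d0 Ks).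
pose Y := X `|` [set a | Gam a /\ al a <= ln (K / e)].
have finY : finite_set Y by rewrite finite_setU; split=> //; exact: al_finite.
have [iota iinj] := Gam_index.
pose A := Gam `\` Y; pose BB n := \bigcup_(a in [set a | A a /\ iota a = n]) B a.
have small a : A a -> K * expR (- al a) <= e.
  move=> [Ga nY]; have Ke : 0 < K / e by rewrite divr_gt0.
  have : ln (K / e) < al a by rewrite ltNge; apply/negP => ?; apply: nY; right.
  move=> /ltW; rewrite -ler_expR lnK// => H.
  by rewrite expRN ler_pdivrMr ?expR_gt0// mulrC -ler_pdivrMr.
have BBd n p q : BB n p -> BB n q -> exists2 a, A a /\ iota a = n & mdist p q <= K * expR (- al a).
  move=> [a [Aa an] Bp] [b [Ab bn] Bq]; exists a => //.
  have ab : b = a by apply: iinj; rewrite ?inE ?an ?bn//; [case: Ab|case: Aa].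
  by apply: Bd => //; [case: Aa|rewrite -ab].
exists BB; split.
- rewrite LambdaE => _ [x bx <-]; have [z [beta [zP zh bh [z0 b0']]]] := rP x bx.
  have [t tP] := finite_bounded (fun a => D a) finY.
  pose i := (Num.truncn (t + 2 * r)).+1; have [Cz sz Gb zb] := zP i.
  have nY : ~ Y (beta i).
    move=> /tP; apply/negP; rewrite -ltNge.
    have := bh 0%N i (leq0n i); rewrite b0' invg1 mul1g subn0 ler_norml => /andP[+ _].
    have := truncnS_gt (t + 2 * r); rewrite -/i; lra.
  by exists (iota (beta i)) => //; exists (beta i) => //; exists x => //; split=> //; exists (z i).
- move=> n; apply: diam_le => p q Bp Bq; have [a [Aa _] pq] := BBd n p q Bp Bq.
  exact: le_trans pq (small a Aa).
have BB0 n : (0 <= diam_pow s (BB n))%E by exact: diam_pow_ge0.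
have iinjA : {in A &, injective iota}.
  by move=> a b; rewrite !inE => -[Ga _] [Gb _]; apply: iinj; rewrite inE.
have step1 a : A a -> (diam_pow s (BB (iota a)) <= (K `^ s * expR (- s * al a))%:E)%E.
  move=> Aa; have -> : K `^ s * expR (- s * al a) = (K * expR (- al a)) `^ s.
    rewrite powRM ?expR_ge0 ?(ltW K0)// -expRM; congr (_ * expR _); ring.
  apply: diam_pow_le => //; first by rewrite mulr_ge0 ?expR_ge0// ltW.
  move=> p q Bp Bq; have [b [Ab ba] pq] := BBd _ p q Bp Bq.
  by have <- : b = a by apply: iinjA; rewrite ?inE.
have step2 n : (forall a, A a -> iota a <> n) -> diam_pow s (BB n) = 0%E.
  move=> nA; rewrite /diam_pow ifT//; apply/eqP/seteqP; split=> // p [a [Aa an] _].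
  exact: nA Aa an.
apply: (le_trans (esum_indexed iinjA BB0 step1 step2)).
apply: (le_trans (esum_scale _ _ (ltW Ks))).
apply: (le_trans (lee_wpmul2l _ (XP Y _))); first by rewrite lee_fin ltW.
  by move=> a Xa; left.
by rewrite -EFinM lee_fin mulrC divfK// gt_eqF.
Qed.

End Dimension.

(** * Measure zero implies convergence of the series *)

Lemma sum_half_powers (R : realFieldType) (d : R) (N : nat) : 0 <= d ->
  \sum_(0 <= i < N) d * 2^-1 ^+ i.+1 <= d.
Proof.
move=> d0; suff -> : \sum_(0 <= i < N) d * 2^-1 ^+ i.+1 = d * (1 - 2^-1 ^+ N).
  by rewrite ler_piMr// gerBl exprn_ge0// invr_ge0.
elim: N => [|N IH]; first by rewrite big_nil expr0 subrr mulr0.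
by rewrite big_nat_recr //= IH !exprS; field.
Qed.

Lemma powR_invK (R : realType) (x s : R) : 0 <= x -> s != 0 -> (x `^ s^-1) `^ s = x.
Proof. by move=> x0 s0; rewrite -powRrM mulVf// powRr1. Qed.

Section LowerBound.
Context {R : realType} {V : euclidType R} (f : {scalar V}) (Omega C : set (pspace V)).
Context (Gam : set (PGL V)) (b0 : pspace V).
Context (RCC : regular_convex_cocompact f Omega C Gam) (Cb0 : C b0).
Implicit Types (a b : PGL V).
Local Notation cone := (cone f Omega).
Local Notation ccone := (ccone f Omega).
Local Notation hilb := (hilbert f Omega).
Local Notation hle := (hle f Omega).
Local Notation aff := (aff f).
Local Notation orb a := (act_point a b0).
Local Notation D a := (hilbert f Omega b0 (act_point a b0)).
Local Notation bd := (bd Omega C).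
Let Om := rcc_domain RCC.
Let CO p : C p -> Omega p. Proof. by have [_ _ [CO _ _ _ _] _ _] := RCC; exact: CO. Qed.
Let G1 : Gam 1%g. Proof. by have [] := rcc_subgroup RCC. Qed.
Let GM a b : Gam a -> Gam b -> Gam (a * b)%g.
Proof. by have [_ H _] := rcc_subgroup RCC; exact: H. Qed.
Let GV a : Gam a -> Gam a^-1%g. Proof. by have [_ _ H] := rcc_subgroup RCC; exact: H. Qed.
Let Oorb a : Gam a -> Omega (orb a). Proof. exact: (O_orb RCC Cb0). Qed.
Context {W : euclidType R} (rho : PGL V -> PGL W).
Context (rhoM : forall a b, Gam a -> Gam b -> rho (a * b)%g = (rho a * rho b)%g).
Context (rhoI : forall a b, Gam a -> Gam b -> rho a = rho b -> a = b).
Context (Anos : projective_anosov (rho @` Gam)) (Ginf : infinite_set Gam).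
Context (xi : flag V -> flag W) (xi1 : pspace V -> pspace W).
Context (xiL : limit_map Gam rho xi) (xi1P : induced_map Gam xi xi1).
Context (NF : non_folding f Omega C Gam rho xi1 b0).
Local Notation al a := (alpha1 (rho a)).
Local Notation Lambda := (limit_set (rho @` Gam)).
Let LambdaE : Lambda = xi1 @` bd := limit_set_rho RCC Cb0 rhoM rhoI Anos Ginf xiL xi1P.
Let bdE : limit_set Gam = bd := limit_setE RCC Cb0 Ginf.
Let xiI q q' : bd q -> bd q' -> xi1 q = xi1 q' -> q = q'.
Proof. exact: (xi1_inj RCC Cb0 rhoM rhoI Anos Ginf xiL xi1P). Qed.

(** The prefix [g] is the last point of the coarse ray to [x] at which the lower
    non-folding ball still has radius at least [t].  The points of the ball of radius
    [t] are then in the shadow of this point, so the elements seen near a ray to one of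
    them pass near [g b0]. *)
Lemma ball_prefix : exists L rho0 T T' : R, [/\ 0 < L, 0 < rho0,
  forall b, Gam b -> exists y, bd y /\
    exists z, [/\ C z, segment f `[0, 1[ b0 y z & hilb z (orb b) <= T'] & forall t x, bd x ->
  0 < t <= rho0 -> exists g, [/\ Gam g, expR (- al g) <= L * t &
  forall y b, Gam b -> bd y -> mdist (xi1 x) (xi1 y) < t -> D g + T <= D b ->
    (exists z, [/\ C z, segment f `[0, 1[ b0 y z & hilb z (orb b) <= T']) ->
    D (g^-1 * b)%g <= D b /\ al g + al (g^-1 * b)%g <= al b + L]].
Proof.
have [r r0 rP] := coarse_ray RCC Cb0; have [K K1 KP] := NF ltr01 r0.
have K0 : 0 < K by apply: lt_trans K1.
have [r1 r10 vis] := orbit_visible RCC Cb0 Ginf; pose rm := Num.max (r + 1) r1.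
have rm1 : r + 1 <= rm by rewrite le_max lexx.
have rm2 : r1 <= rm by rewrite le_max lexx orbT.
have [K1' al1] := anosov_aligned RCC Cb0 rhoM rhoI Anos Ginf (4 * rm).
have [K2 K20 st] := anosov_right RCC Cb0 rhoM rhoI Ginf (1 + 2 * r).
have [K3 K30 bl] := anosov_right RCC Cb0 rhoM rhoI Ginf (4 * rm).
have [lam [A [lam0 gap]]] := rho_gap RCC Cb0 rhoM rhoI Anos.
pose E := expR K2 * K; have E0 : 0 < E by rewrite mulr_gt0// expR_gt0.
(* below this radius the prefix found moves the base point by more than 4 rm *)
pose rho0 := E^-1 * expR (- (al 1%g + K3)).
exists (Num.max E K1'), rho0, (2 * rm), rm; split.
- by rewrite lt_max E0.
- by rewrite mulr_gt0 ?expR_gt0// invr_gt0.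
- move=> b Gb; have [y [z [by' Cz sz zb]]] := vis b Gb; exists y; split=> //.
  by exists z; split=> //; exact: le_trans zb rm2.
move=> t x bx /andP[t0 trho]; have [z [beta [zP zh bh [z0 b0']]]] := rP x bx.
have Gb i : Gam (beta i) by case: (zP i).
have [g [[i gE] tg gt Dg]] : exists g, [/\ exists i, g = beta i, t <= K^-1 * expR (- al g),
    expR (- al g) <= E * t & 4 * rm < D g].
  have [n0 n0P] : exists n, K^-1 * expR (- al (beta n)) < t.
    pose n := (Num.truncn ((A - ln (K * t)) / lam + 2 * r)).+1; exists n.
    have := bh 0%N n (leq0n n); rewrite b0' invg1 mul1g subn0 ler_norml => /andP[+ _].
    have := truncnS_gt ((A - ln (K * t)) / lam + 2 * r); rewrite -/n => h1 h2.
    have h3 : (A - ln (K * t)) / lam < D (beta n) by move: h1 h2; lra.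
    move: h3; rewrite ltr_pdivrMr// [_ * lam]mulrC => h3.
    rewrite ltr_pdivrMl// -[X in _ < X]lnK ?posrE ?mulr_gt0// ltr_expR.
    by have := gap _ (Gb n); move: h3; lra.
  have Pex : exists n, K^-1 * expR (- al (beta n)) < t by exists n0.
  case: (ex_minnP Pex) => -[|m] mP mmin.
    move: mP; rewrite b0' ltNge => /negP; case; apply: (le_trans trho).
    have -> : rho0 = K^-1 * (expR (- K2) * expR (- (al 1%g + K3))).
      by rewrite /rho0 /E invfM -(expRN K2) [_ * K^-1]mulrC -mulrA.
    by rewrite ler_pM2l ?invr_gt0// -expRD ler_expR; lra.
  have tm : t <= K^-1 * expR (- al (beta m)).
    by rewrite leNgt; apply/negP => /mmin; rewrite ltnn.
  have step : `|al (beta m.+1) - al (beta m)| <= K2.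
    have := st (beta m) ((beta m)^-1 * beta m.+1)%g (Gb m) (GM (GV (Gb m)) (Gb m.+1)).
    rewrite mulVKg; apply.
    by have := bh m m.+1 (leqnSn m); rewrite subSnn ler_norml => /andP[_]; lra.
  have gt : expR (- al (beta m)) < E * t.
    rewrite /E -mulrA -ltr_pdivrMl ?expR_gt0// -ltr_pdivrMl//; apply: le_lt_trans mP.
    rewrite ler_pM2l ?invr_gt0// -expRN -expRD ler_expR.
    by move: step; rewrite ler_norml => /andP[_]; lra.
  exists (beta m); split=> //; [by exists m|exact: ltW|].
  rewrite ltNge; apply/negP => Dm.
  have := bl 1%g (beta m) G1 (Gb m) Dm; rewrite mul1g ler_norml => /andP[_ alm].
  move: gt; apply/negP; rewrite -leNgt.
  apply: (le_trans (y := E * rho0)); first by rewrite ler_pM2l.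
  by rewrite /rho0 mulrA mulfV ?gt_eqF// mul1r ler_expR; lra.
have [Cz sz Gbi zb] := zP i; rewrite -gE in Gbi zb.
exists g; split=> //.
  by apply: (le_trans gt); rewrite ler_pM2r// le_max lexx.
move=> y b Gb' by' xyt Db [z' [Cz' sz' zb']].
have := KP x (z i) g; rewrite bdE => /(_ bx Cz sz Gbi zb)[sh _].
have [y' [+ [w [sw Ow zw]]] yy] : (xi1 @` shadow f Omega Gam 1 b0 (z i)) (xi1 y).
  apply: sh; split; last by exists y.
  by rewrite ballEmdist /=; exact: lt_le_trans xyt tg.
rewrite bdE => by''; have yE := xiI by'' by' yy; rewrite yE in sw.
have Cw : C w.
  have [cw [t' t'i wE]] := sw; apply: (segment_C RCC Cb0 (proj1 by') _ cw wE).
  by move: t'i; rewrite in_itv.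
have wg : hilb w (orb g) <= rm.
  have := hilb_triangle Om Ow (CO Cz) (Oorb Gbi); rewrite (hilb_sym Om Ow (CO Cz)).
  by move=> /le_trans; apply; apply: le_trans rm1; rewrite addrC lerD.
have := ray_aligned RCC Cb0 by' Cw Cz' sw sz' Gbi Gb' wg zb' Db => al4.
split; first by rewrite -(lerD2r (4 * rm)); apply: le_trans al4; rewrite addrC lerD2r ltW.
have Ggb := GM (GV Gbi) Gb'.
have := al1 g (g^-1 * b)%g Gbi Ggb; rewrite mulVKg => /(_ al4) H.
by apply: (le_trans H); rewrite lerD2l le_max lexx orbT.
Qed.

(** Each set of a cover is enlarged to a ball, to which [ball_prefix] applies; the radii
    [tau i] make the balls open while keeping the sum small. *)
Lemma hausdorff_lower (s : R) : 0 < s -> hausdorff_measure s Lambda = 0%E ->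
  (\esum_(a in Gam) (expR (- s * al a))%:E < +oo)%E.
Proof.
move=> s0 H0; apply: esum_lty.
have [L [rho0 [T [T' [L0 rho00 vis pre]]]]] := ball_prefix.
pose w a := expR (- s * al a).
(* the contribution of a ball of radius 2 max(d, t) is at most M (d^s + t^s) *)
pose M := expR (s * L) * L `^ s * 2 `^ s.
have M0 : 0 < M by rewrite !mulr_gt0 ?expR_gt0 ?powR_gt0.
pose del := Num.min (4 * M)^-1 ((rho0 / 2) `^ s).
have del0 : 0 < del by rewrite lt_min invr_gt0 mulr_gt0//= powR_gt0// divr_gt0.
have [B [LB Be Bd]] := hausdorff_zero_elim H0 (divr_gt0 rho00 (ltr0Sn R 1)) del0.
pose tau i := (del * 2^-1 ^+ i.+1) `^ s^-1.
have p20 i : 0 < (2^-1 : R) ^+ i.+1 by rewrite exprn_gt0// invr_gt0.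
have tau0 i : 0 < tau i by rewrite powR_gt0// mulr_gt0.
have taus i : tau i `^ s = del * 2^-1 ^+ i.+1.
  by rewrite powR_invK ?gt_eqF// mulr_ge0 ?(ltW del0)// ltW.
have tau_le i : tau i <= rho0 / 2.
  rewrite -[leRHS](@powRr1 _ (rho0 / 2)) ?divr_ge0 ?(ltW rho00)//.
  rewrite -[X in _ `^ X](mulfV (lt0r_neq0 s0)) powRrM ge0_ler_powR ?nnegrE ?powR_ge0 ?invr_ge0 ?(ltW s0)//.
    by rewrite mulr_ge0 ?(ltW del0)// ltW.
  apply: (le_trans (y := del)); last by rewrite ge_min lexx orbT.
  by rewrite ler_piMr ?(ltW del0)// exprn_ile1 ?invr_ge0// invf_le1// ler1n.
pose u i := fine (diam_pow s (B i)).
have Bfin i : diam_pow s (B i) \is a fin_num.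
  rewrite ge0_fin_numE ?diam_pow_ge0//; apply: (le_lt_trans _ (ltry del)).
  apply: (le_trans _ Bd); apply: (le_trans _ (nneseries_lim_ge i.+1 _)) => [|j _ _].
    by rewrite big_nat_recr//= leeDr// sume_ge0// => j _; exact: diam_pow_ge0.
  exact: diam_pow_ge0.
have usum N : \sum_(0 <= i < N) u i <= del.
  rewrite -lee_fin -sumEFin; apply: le_trans Bd.
  under eq_bigr do rewrite /u fineK//.
  by apply: nneseries_lim_ge => i _ _; exact: diam_pow_ge0.
have u0 i : 0 <= u i by rewrite fine_ge0// diam_pow_ge0.
have /choice[dat datP] i : exists dat : PGL V * R * set (pspace W),
    [/\ 0 <= dat.1.2 /\ dat.1.2 <= M * (u i + tau i `^ s),
        Lambda `&` B i `<=` dat.2,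
        forall p, dat.2 p -> exists2 e : R, 0 < e & forall q, mdist q p < e -> dat.2 q,
        dat.2 !=set0 -> Gam dat.1.1 &
        forall y b, Gam b -> bd y -> dat.2 (xi1 y) -> D dat.1.1 + T <= D b ->
          (exists z, [/\ C z, segment f `[0, 1[ b0 y z & hilb z (orb b) <= T']) ->
          D (dat.1.1^-1 * b)%g <= D b /\ w b <= dat.1.2 * w (dat.1.1^-1 * b)%g].
  have [[x [bx Bx]]|nB] := pselect (exists x, bd x /\ B i (xi1 x)); last first.
    exists (1%g, 0, set0); split=> //=.
      by split=> //; rewrite mulr_ge0 ?(ltW M0)// addr_ge0// powR_ge0.
    by rewrite LambdaE => p [[x bx <-] Bx]; apply: nB; exists x.
  have [d [/andP[d0 de] Bdd Bps]] := diam_real Bx (Be i).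
  pose t := 2 * Num.max d (tau i).
  have mx0 : 0 < Num.max d (tau i) by rewrite lt_max tau0 orbT.
  have t0 : 0 < t <= rho0.
    apply/andP; split; first by rewrite mulr_gt0.
    by rewrite /t [2 * _]mulrC -ler_pdivlMr// ge_max tau_le andbT.
  have [g [Gg gt gP]] := pre t x bx t0.
  exists (g, expR (s * L) * w g, [set p | mdist (xi1 x) p < t]); split=> //=.
  - split; first by rewrite mulr_ge0 ?expR_ge0.
    rewrite /M -!mulrA ler_pM2l ?expR_gt0//.
    have -> : w g = expR (- al g) `^ s by rewrite -expRM /w; congr expR; ring.
    apply: (le_trans (y := (L * t) `^ s)).
      by rewrite ge0_ler_powR ?nnegrE ?expR_ge0 ?(ltW s0)// mulr_ge0 ?(ltW L0)// mulr_ge0// ltW.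
    rewrite !powRM ?(ltW L0) ?(ltW mx0)//; last by rewrite mulr_ge0// ltW.
    rewrite ler_pM2l ?powR_gt0// ler_pM2l ?powR_gt0//.
    have -> : u i = d `^ s by rewrite /u Bps.
    by rewrite /Num.max; case: ifP => _; [rewrite lerDr|rewrite lerDl]; exact: powR_ge0.
  - move=> p [_ Bp]; apply: (le_lt_trans (Bdd _ _ Bx Bp)).
    have : d <= Num.max d (tau i) by rewrite le_max lexx.
    by rewrite /t; move: mx0; lra.
  - move=> p pt; exists (t - mdist (xi1 x) p); first by rewrite subr_gt0.
    move=> q qp; have tri := metric_triangle (xi1 x) p q.
    by rewrite [mdist p q]metric_sym in tri; move: tri qp; lra.
  - move=> y b Gb by' yt Db zz; have [Dle alle] := gP y b Gb by' yt Db zz.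
    split=> //; rewrite /w -!expRD ler_expR.
    have : s * (al g + al (g^-1 * b)%g) <= s * (al b + L) by rewrite ler_pM2l.
    by lra.
(* finitely many of the open sets cover the limit set *)
have [N NP] : exists N : nat, forall x, bd x -> exists2 i, (i < N)%N & (dat i).2 (xi1 x).
  apply: contrapT => H.
  have {}H N : exists x, bd x /\ forall i, (i < N)%N -> ~ (dat i).2 (xi1 x).
    apply: contrapT => H'; apply: H; exists N => x bx; apply: contrapT => H2.
    by apply: H'; exists x; split=> // i iN Ui; apply: H2; exists i.
  have [x xP] := choice H; have [phi phik [p px]] := pspace_bw (xi1 \o x).
  have Lp : Lambda p.
    apply: (limit_set_closed (rho_proper RCC Cb0 rhoM rhoI Anos) _ px) => k.
    by rewrite LambdaE; exists (x (phi k)) => //; case: (xP (phi k)).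
  have [i _ Bi] := LB p Lp; have [_ /(_ p (conj Lp Bi)) Up Uo _ _] := datP i.
  have [e e0 eP] := Uo p Up; have [k1 _ kP] := px e e0.
  pose k := maxn k1 i.+1.
  have [_ /(_ i)] := xP (phi k); apply; last by apply: eP; apply: kP; exact: leq_maxl.
  by apply: leq_trans (phik k); exact: leq_maxr.
have [T0 T0P] := finite_bounded (fun i => D (dat i).1.1 + T) (finite_II N).
apply: (counting_bound (D := fun a => D a) (I := index_iota 0 N) (gamma := fun i => (dat i).1.1)
  (c := fun i => (dat i).1.2) (M := T0)).
- by move=> a; exact: expR_ge0.
- by move=> i; have [[]] := datP i.
- apply: (le_trans (y := \sum_(0 <= i < N) M * (u i + tau i `^ s))).
    by apply: ler_sum => i _; have [[]] := datP i.
  rewrite -mulr_sumr big_split /=.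
  under [X in _ + X]eq_bigr do rewrite taus.
  apply: (le_trans (y := M * (del + del))).
    by rewrite ler_pM2l// lerD// sum_half_powers// ltW.
  have : M * del <= M * (4 * M)^-1 by rewrite ler_pM2l// ge_min lexx.
  have -> : M * (4 * M)^-1 = 4^-1 by field; rewrite gt_eqF.
  by rewrite mulrDr; lra.
- exact: (finite_balls RCC Cb0).
move=> b Gb TD; have [y [by' zP]] := vis b Gb; have [i iN Ui] := NP y by'.
have [_ _ _ /(_ (ex_intro _ _ Ui)) Gi iP] := datP i.
have DT : D (dat i).1.1 + T <= D b by apply: ltW; apply: le_lt_trans TD; exact: T0P.
have [Dle wle] := iP y b Gb by' Ui DT zP.
by exists i; split=> //; [rewrite mem_index_iota|exact: GM (GV Gi) Gb].
Qed.

End LowerBound.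

(** * The theorem *)

(** Each nonempty set has weight one when [s = 0]. *)
Lemma hausdorff_zero_nonempty (R : realType) (T : metricType R) (A : set T) :
  A !=set0 -> hausdorff_measure 0 A <> 0%E.
Proof.
move=> [x Ax] H; have h2 : 0 < 2^-1 :> R by rewrite invr_gt0.
have [B [AB Be Bd]] := hausdorff_zero_elim H ltr01 h2.
have [i _ Bi] := AB x Ax; have [d [_ _ /(_ 0) Bi1]] := diam_real Bi (Be i).
have : (1 <= (2^-1 : R)%:E)%E.
  apply: (le_trans _ Bd); apply: (le_trans _ (nneseries_lim_ge i.+1 _)) => [|j _ _].
    rewrite big_nat_recr//= Bi1 powRr0 leeDr// sume_ge0// => j _.
    exact: diam_pow_ge0.
  exact: diam_pow_ge0.
by rewrite lee_fin leNgt invf_lt1// ltr1n.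
Qed.

Lemma hausdorff_set0 (R : realType) (T : metricType R) (s : R) :
  hausdorff_measure s (set0 : set T) = 0%E.
Proof.
apply: hausdorff_zero_intro => e d e0 d0; exists (fun=> set0); split=> //.
  by move=> i; apply: diam_le.
rewrite eseries0 ?lee_fin ?(ltW d0)// => i _ _.
by rewrite /diam_pow eqxx.
Qed.

Lemma finite_limit_set (R : realType) (W : euclidType R) (Gam : set (PGL W)) :
  finite_set Gam -> limit_set Gam = set0.
Proof.
move=> fin; apply/seteqP; split=> // p [x [q [Gx xe _ _]]].
by have [N _ NP] := xe _ fin; case: (NP N (leqnn N)); exact: Gx.
Qed.

Lemma finite_poincare (R : realType) (W : euclidType R) (Gam : set (PGL W)) (s : R) :
  finite_set Gam -> (poincare_series Gam s < +oo)%E.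
Proof.
move=> /finite_seqP[l lE]; apply: esum_lty.
exists (\sum_(x <- l) (sigma 2 x / sigma 1 x) `^ s) => m um mG.
by apply: uniq_sum_le => // [x|x /mG]; [exact: powR_ge0|rewrite lE].
Qed.

Lemma dimension_from_zero_sets (R : realType) (W : euclidType R) (Gam : set (PGL W)) :
  (forall s : R, 0 <= s -> hausdorff_measure s (limit_set Gam) = 0%E <->
     (poincare_series Gam s < +oo)%E) ->
  hausdorff_dim (limit_set Gam) = critical_exponent Gam.
Proof.
move=> H; rewrite /hausdorff_dim /critical_exponent; congr (ereal_inf (_ @` _)).
by apply/seteqP; split=> s /= [s0 Hs]; split=> //; apply/(H s s0).
Qed.

Theorem theorem1p5 (R : realType) (d : nat) (Gamma : set (PGL 'cV[R]_d)) :
  non_folding_anosov Gamma ->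
  hausdorff_dim (limit_set Gamma) = critical_exponent Gamma.
Proof.
move=> [V [f [Om [C [Gam [b0 [rho [xi [xi1]]]]]]]]].
move=> [RCC Cb0 [[rhoM rhoI] Anos xiL xi1P] NF ->].
apply: dimension_from_zero_sets => s s0.
have [fin|Ginf] := pselect (finite_set Gam).
  have fin' := finite_image rho fin; rewrite finite_limit_set// hausdorff_set0.
  by split=> // _; exact: finite_poincare.
rewrite (poincareE RCC rhoI Ginf); split=> [H0|].
  move: s0; rewrite le_eqVlt => /orP[/eqP s0|s0].
    rewrite -s0 in H0; exfalso; apply: hausdorff_zero_nonempty H0.
    have [q [_ [bq _ _]]] := two_bd RCC Cb0 Ginf.
    rewrite (limit_set_rho RCC Cb0 rhoM rhoI Anos Ginf xiL xi1P).
    by exists (xi1 q); exists q.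
  exact: (hausdorff_lower RCC Cb0 rhoM rhoI Anos Ginf xiL xi1P NF s0 H0).
exact: (hausdorff_upper RCC Cb0 rhoM rhoI Anos Ginf xiL xi1P NF s0).
Qed.
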